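(* Let $\alpha\in\mathbb{R}$, $\alpha>1$, and let $Y_\alpha\subset\mathbb{R}^6$ be the compact coisotropic $4$-manifold $$Y_\alpha=\{\tfrac12 r_1^2+\tfrac{\alpha}{2}r_2^2=\tfrac14\}\cap\{\tfrac12 r_3^2=\tfrac12\}\subset(\mathbb{R}^6,\omega_0),$$ where $(r_i,\theta_i)$, $i=1,2,3$, are polar coordinates on the three factors of $\mathbb{R}^6=(\mathbb{R}^2)^3$ and $\omega_0=\sum_{i=1}^3 r_i\,dr_i\wedge d\theta_i$. Then the deformation problem of $Y_\alpha$ as a coisotropic submanifold is: (1) obstructed if $\alpha\in\mathbb{Q}$; (2) obstructed if $\alpha\notin\mathbb{Q}$ and $\alpha$ is a Liouville number; (3) unobstructed if $\alpha\notin\mathbb{Q}$ and $\alpha$ satisfies a diophantine condition.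
   Context: Coisotropic submanifolds. A submanifold $C$ of a symplectic manifold $(M,\omega)$ is coisotropic if $(T_xC)^\omega\subseteq T_xC$ for all $x\in C$, where $(\cdot)^\omega$ is the symplectic orthogonal. Then $\ker(\omega|_C)=(TC)^\omega$ is an integrable distribution of constant rank, tangent to the null foliation $\mathcal{F}$ of $C$. For $C=Y_\alpha$ (which is coisotropic in $(\mathbb{R}^6,\omega_0)$), $\mathcal{F}$ is the rank-$2$ foliation with $T\mathcal{F}$ spanned by $X_{H_\alpha}=\frac{\partial}{\partial\theta_1}+\alpha\frac{\partial}{\partial\theta_2}$ and $X_{H_3}=\frac{\partial}{\partial\theta_3}$. Foliation complex. $\Omega^k(\mathcal{F})$ denotes the smooth sections of $\Lambda^kT^*\mathcal{F}$ over $C$, and $d_{\mathcal{F}}:\Omega^k(\mathcal{F})\to\Omega^{k+1}(\mathcal{F})$ is the leafwise exterior derivative (given by the Cartan formula applied to vector fields tangent to $\mathcal{F}$). The coisotropic deformation equation. Fix a smooth distribution $G\subset TC$ with $TC=G\oplus T\mathcal{F}$. For $\Gamma\in\Omega^1(\mathcal{F})$ let $\widetilde\Gamma\in\Omega^1(C)$ be its extension by zero on $G$. A neighbourhood of $C$ in $M$ is symplectomorphic (Gotay) to a neighbourhood of the zero section of $\pi:T^*\mathcal{F}\to C$ with the symplectic form $\pi^*(\omega|_C)-d\theta_G$, where $\theta_G$ is the tautological $1$-form satisfying $\Gamma^*\theta_G=\widetilde\Gamma$ for every section $\Gamma$. The restriction of this form to the graph of $\Gamma$ pulls back to $\omega|_C-d\widetilde\Gamma$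 on $C$, and for small $\Gamma$ the graph is coisotropic if and only if this $2$-form has the same rank as $\omega|_C$. By a theorem of Oh and Park this condition is the Maurer–Cartan equation $\sum_{k\ge1}\frac1{k!}\mathfrak{l}_k(\Gamma,\dots,\Gamma)=0$ of an $L_\infty$-algebra on the shifted complex $\Omega^*[1](\mathcal{F})$, with $\mathfrak{l}_1=d_{\mathcal{F}}$ on $\Omega^1(\mathcal{F})$. This $L_\infty$-algebra is independent of $G$ up to isomorphism. For $C=Y_\alpha$ (dimension $4$, $\omega|_C$ of rank $2$) the equation is equivalent to $$(\omega|_C-d\widetilde\Gamma)\wedge(\omega|_C-d\widetilde\Gamma)=0,\qquad\text{with } \omega|_C=\omega_0|_{Y_\alpha}.\qquad( * )$$ The linear part of $( * )$ in $\Gamma$ is equivalent to $d_{\mathcal{F}}\Gamma=0$. Obstructedness. An infinitesimal deformation is a $\Gamma_1\in\Omega^1(\mathcal{F})$ with $d_{\mathcal{F}}\Gamma_1=0$. A (formal) full deformation extending $\Gamma_1$ is a formal power series $\Gamma_t=\sum_{i\ge1}\Gamma_it^i$, with $\Gamma_i\in\Omega^1(\mathcal{F})$ smooth and with the given $\Gamma_1$, such that $\Gamma_t$ satisfies the Maurer–Cartan equation (equivalently $( * )$) to every order in $t$. The deformation problem is unobstructed if every infinitesimal deformation extends to a formal full deformation, and obstructed otherwise. Arithmetic conditions. An irrational $\alpha$ is a Liouville number if there is a sequence of rationals $p_n/q_n\to\alpha$ ($p_n,q_n\in\mathbb{Z}$, $q_n\ge1$) such that for every $k\ge1$ there is a constant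 $\lambda(k)$ with $\left|\frac{p_n}{q_n}-\alpha\right|<\frac{\lambda(k)}{q_n^k}$ for all $n$. An irrational $\alpha$ satisfies a diophantine condition if it is not Liouville, i.e. if there exist $k\ge0$ and $c>0$ such that $\left|\frac pq-\alpha\right|>\frac{c}{q^k}$ for all integers $p$ and $q\ge1$. *)

(* Defs.v *)
From HB Require Import structures.
From mathcomp Require Import all_boot all_order all_algebra.
From mathcomp Require Import all_classical all_reals all_analysis.

Set Implicit Arguments.
Unset Strict Implicit.
Unset Printing Implicit Defensive.

Import Order.TTheory GRing.Theory Num.Theory.
Import numFieldNormedType.Exports.

Local Open Scope classical_set_scope.
Local Open Scope ring_scope.

Section Smooth.
Context {R : realType} {V W : normedModType R}.

(* Meaningful for [U] open: [differentiable] and ['D_v] look at a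
   neighbourhood of each point of [U]. *)
Fixpoint Ck_on (k : nat) (U : set V) (f : V -> W) : Prop :=
  match k with
  | 0%N => forall x, U x -> {for x, continuous f}
  | k'.+1 => (forall x, U x -> differentiable f x) /\
             (forall v : V, Ck_on k' U (fun x => 'D_v f x))
  end.

Definition smooth_on (U : set V) (f : V -> W) : Prop :=
  forall k, Ck_on k U f.

(* Smooth maps on an embedded submanifold [C] are represented by smooth maps
   on open neighbourhoods of [C] in the ambient space. *)
Definition smooth_near (C : set V) (f : V -> W) : Prop :=
  exists U : set V, [/\ open U, C `<=` U & smooth_on U f].

End Smooth.

(* A point of (R^2)^3 = R^6 is a 3 x 2 matrix; row [i] holds the cartesian
   coordinates (x_i, y_i) of the i-th factor, counted from 0. *)
Notation R6 R := 'M[R%type]_(3, 2).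

Section Coisotropic.
Context {R : realType}.
Implicit Types (C : set (R6 R)) (G : R6 R -> set (R6 R)) (x u v w : R6 R).

Definition radius x (i : 'I_3) : R :=
  Num.sqrt (x i 0 ^+ 2 + x i 1 ^+ 2).

(* r_i dr_i /\ dtheta_i = dx_i /\ dy_i. *)
Definition omega0 u v : R := \sum_(i < 3) (u i 0 * v i 1 - u i 1 * v i 0).

Definition tangent C x : set (R6 R) :=
  [set v | exists (I : set R) (c : R -> R6 R),
     [/\ open I, I 0, smooth_on I c & (forall t, I t -> C (c t))] /\
     (c 0 = x /\ 'D_1 c 0 = v)].

(* The kernel of the restriction of omega0 to T_x C, that is the tangent space
   of the null foliation F of C when C is coisotropic. *)
Definition null_tangent C x : set (R6 R) :=
  [set w | tangent C x w /\ forall v, tangent C x v -> omega0 w v = 0].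

(* A 1-form is given by its matrix of coefficients: row [i] of [a x] holds the
   coefficients of dx_i and dy_i at [x].  Elements of Omega^1(C) and of
   Omega^1(F) are represented by such 1-forms, smooth near C, of which only the
   restrictions to the spaces [tangent C x], resp. [null_tangent C x], for x in
   C, are relevant. *)
Definition ev (a : R6 R -> R6 R) x v : R :=
  \sum_(i < 3) \sum_(j < 2) a x i j * v i j.

(* d(sum_ij a_ij dx_ij)(u, v) = sum_ij (da_ij(u) v_ij - da_ij(v) u_ij). *)
Definition dext (a : R6 R -> R6 R) x u v : R :=
  ev ('D_u a) x v - ev ('D_v a) x u.

Definition wedge22 (b c : R6 R -> R6 R -> R) (v1 v2 v3 v4 : R6 R) : R :=
    b v1 v2 * c v3 v4 - b v1 v3 * c v2 v4 + b v1 v4 * c v2 v3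
  + b v2 v3 * c v1 v4 - b v2 v4 * c v1 v3 + b v3 v4 * c v1 v2.

Definition bracket (X Z : R6 R -> R6 R) x : R6 R :=
  'D_(X x) Z x - 'D_(Z x) X x.

Definition section_of C (D : R6 R -> set (R6 R)) (X : R6 R -> R6 R) : Prop :=
  smooth_near C X /\ forall x, C x -> D x (X x).

(* For X and Z tangent to F, this is the Cartan formula for (d_F a)(X, Z). *)
Definition dF (a : R6 R -> R6 R) (X Z : R6 R -> R6 R) x : R :=
  'D_(X x) (fun y => ev a y (Z y)) x - 'D_(Z x) (fun y => ev a y (X y)) x
  - ev a x (bracket X Z x).

Definition infinitesimal_deformation C (Gamma : R6 R -> R6 R) : Prop :=
  smooth_near C Gamma /\
  forall X Z, section_of C (null_tangent C) X ->
    section_of C (null_tangent C) Z ->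
    forall x, C x -> dF Gamma X Z x = 0.

(* Smoothness of the distribution G is the existence of a smooth section
   through every vector of G; the rank is constant by the splitting. *)
Definition smooth_complement C G : Prop :=
  forall x, C x ->
    [/\ G x 0 /\ (forall (k : R) u v, G x u -> G x v -> G x (k *: u + v)),
        G x `<=` tangent C x,
        (forall v, tangent C x v -> exists u w,
           [/\ G x u, null_tangent C x w & v = u + w]),
        (forall v, G x v -> null_tangent C x v -> v = 0)
      & (forall v, G x v -> exists X, section_of C G X /\ X x = v)].

Definition extension_by_zero C G (Gamma eta : R6 R -> R6 R) : Prop :=
  smooth_near C eta /\
  forall x, C x ->
    (forall v, null_tangent C x v -> ev eta x v = ev Gamma x v) /\
    (forall v, G x v -> ev eta x v = 0).

(* Coefficient of t^i in omega|_C - d(sum_(i >= 1) eta_i t^i). *)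
Definition deformed_coef (eta : nat -> R6 R -> R6 R) (i : nat) x u v : R :=
  if i is 0%N then omega0 u v else - dext (eta i) x u v.

(* The equation (omega|_C - d Gamma~_t) /\ (omega|_C - d Gamma~_t) = 0 on C,
   coefficient by coefficient in t, for Gamma_t = sum_(i >= 1) Gamma_i t^i;
   [Gamma 0] plays no role. *)
Definition formal_coisotropic C G (Gamma : nat -> R6 R -> R6 R) : Prop :=
  exists eta : nat -> R6 R -> R6 R,
    (forall i, (0 < i)%N -> extension_by_zero C G (Gamma i) (eta i)) /\
    forall (n : nat) x, C x ->
      forall v1 v2 v3 v4, tangent C x v1 -> tangent C x v2 ->
        tangent C x v3 -> tangent C x v4 ->
      \sum_(i < n.+1) wedge22 (deformed_coef eta i x)
        (deformed_coef eta (n - i)%N x) v1 v2 v3 v4 = 0.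

(* For a 4-dimensional coisotropic C on which omega0 has rank 2, so that the
   2-forms of rank at most 2 on C are those of square zero. *)
Definition unobstructed C G : Prop :=
  forall Gamma1, infinitesimal_deformation C Gamma1 ->
    exists Gamma : nat -> R6 R -> R6 R,
      [/\ Gamma 1%N = Gamma1,
          forall i, (0 < i)%N -> smooth_near C (Gamma i)
        & formal_coisotropic C G Gamma].

Definition obstructed C G : Prop := ~ unobstructed C G.

Definition Y (alpha : R) : set (R6 R) :=
  [set x | 2^-1 * radius x 0 ^+ 2 + alpha / 2 * radius x 1 ^+ 2 = 4^-1 /\
           2^-1 * radius x ord_max ^+ 2 = 2^-1].

End Coisotropic.

Section Arithmetic.
Context {R : realType}.

Definition liouville (a : R) : Prop :=
  irrational a /\
  exists (p : nat -> int) (q : nat -> nat),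
    [/\ (forall n, (1 <= q n)%N),
        (fun n => (p n)%:~R / (q n)%:R : R) @ \oo --> a
      & forall k : nat, (1 <= k)%N -> exists lambda : R,
          forall n, `| (p n)%:~R / (q n)%:R - a | < lambda / (q n)%:R ^+ k].

Definition diophantine (a : R) : Prop :=
  irrational a /\
  exists (k : nat) (c : R), 0 < c /\
    forall (p : int) (q : nat), (1 <= q)%N ->
      c / q%:R ^+ k < `| p%:~R / q%:R - a |.

End Arithmetic.

(* Main.v *)
(** Write omega restricted to Y as d lambda, and let X1 = d/dtheta_1 + alpha d/dtheta_2
    and d/dtheta_3 span the null foliation.

    Diophantine case.  The cohomological equation along X1 has smooth solutions up to
    torus-invariant terms: solve it over the first return to a circle by a Fourier
    series with small denominators.  Hence a closed Gamma_1 is cohomologous to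
    mu = f0 lambda + g1 dtheta_3 + dh with f0 and g1 invariant under the torus, and then
    d mu /\ d lambda = 0 and d mu /\ d mu = 0, so d (lambda - t mu) has rank 2 for all t.
    A formal isotopy, generated by fields in G solved for order by order, moves
    lambda - t mu to lambda minus a form vanishing on G, which is the required Gamma_t.

    Rational and Liouville cases.  The second-order equation, for Gamma_1 built from a
    function f with df/dtheta_3 = 0, implies after averaging over theta_3 that
    r_2^2 df/dtheta_1 - r_1^2 df/dtheta_2 has a bounded primitive along the flow of X1.
    Take for f superpositions of the functions cos and sin of P theta_1 - Q theta_2, whose
    frequency along the flow is delta = P - Q alpha.  If delta = 0 the primitive grows
    linearly.  If alpha is Liouville, choose delta_n tending rapidly to 0 and the coefficients
    - delta_n: the primitive is then at least of the order of Q_n at time pi / |delta_n|. *)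
Require Import Defs.
From HB Require Import structures.
From mathcomp Require Import all_boot all_order all_algebra.
From mathcomp Require Import all_classical all_reals all_analysis.
From mathcomp Require Import ring lra zify.
Set Implicit Arguments.
Unset Strict Implicit.
Unset Printing Implicit Defensive.

Import Order.TTheory GRing.Theory Num.Theory.
Import numFieldNormedType.Exports.

Local Open Scope classical_set_scope.
Local Open Scope ring_scope.

(** The fields of [frame] are global on Y, so a form on Y is a 4-tuple of functions, and [dfr], [pf]
    and [iprod] turn exterior calculus into identities between functions on [dom], a torus-invariant
    neighbourhood that retracts onto Y.

    The obstacle is G: the equation is stated for extensions that vanish on G, while the natural
    representative of Gamma_1 does not. On Y, two extensions of one leafwise form differ by i_W
    omega, with omega = d lambda. The identity L_W (beta /\ gamma) = divergence for closed 2-forms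
    ([pf_lie]) then serves both directions: integrated as a formal isotopy it brings a solution into
    the shape required by G, and at second order it removes G from the obstruction.

    The vanishing of d mu /\ d mu also needs f0 to be independent of theta_3. This holds because the
    theta_3-derivative of f0 is invariant under the torus and is the derivative along X1 of a
    globally defined function.

    In the Liouville case the primitives of the modes are, up to a constant, the nonnegative
    functions 1 - cos, so the modes cannot cancel and each of them alone bounds the sum from
    below. *)

Module SmoothMaps.

(** * Calculus of smooth maps between normed spaces *)

Section Differentiability.
Context {R : realType} {V W : normedModType R}.
Implicit Types (U : set V) (f g : V -> W).

Lemma is_diff_eps f x (df : {linear V -> W}) : continuous df ->
  (forall e : R, 0 < e -> exists2 d : R, 0 < d &
    forall h, `|h| < d -> `|f (x + h) - f x - df h| <= e * `|h|) ->
  differentiable f x /\ 'd f x = df :> (V -> W).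
Proof.
move=> cdf fe.
have fo : f \o shift x = cst (f x) + df +o_ 0 id.
  apply/eqaddoP => _/posnumP[e].
  have [d d0 fd] := fe e%:num (gt0 e).
  apply/nbhs_ballP; exists d => //= h; rewrite -ball_normE /= sub0r normrN => hd.
  have := fd _ hd; rewrite [x + h]addrC.
  by rewrite /= opprD addrA.
have dE := diff_unique cdf fo.
split=> //; apply/diff_locallyP; split; first by rewrite dE.
by rewrite dE.
Qed.

Lemma diff_eps f x : differentiable f x ->
  forall e : R, 0 < e -> exists2 d : R, 0 < d &
    forall h, `|h| < d -> `|f (x + h) - f x - 'd f x h| <= e * `|h|.
Proof.
move=> /diff_locallyP [_ /eqaddoP fo] e e0.
have /nbhs_ballP [/= d d0 fd] := fo e e0; exists d => // h hd.
have := fd h; rewrite -ball_normE /= sub0r normrN => /(_ hd).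
by rewrite /= opprD addrA [x + h]addrC.
Qed.

Lemma diff_near_eq {U f g x} : open U -> U x ->
  (forall y, U y -> f y = g y) -> differentiable f x -> differentiable g x.
Proof.
move=> oU Ux fg df.
suff [] : differentiable g x /\ 'd g x = 'd f x :> (V -> W) by [].
apply: is_diff_eps; first exact: diff_continuous.
move=> e e0; have [d d0 fd] := diff_eps df e0.
have /nbhs_ballP[r /= r0 rU] : nbhs x U by exact: open_nbhs_nbhs.
exists (Num.min d r); first by rewrite lt_min d0.
move=> h; rewrite lt_min => /andP[hd hr].
rewrite -!fg //; first exact: fd.
by apply: rU; rewrite -ball_normE /= opprD addNKr normrN.
Qed.

Lemma derive_near_eq {U f g x} v : open U -> U x ->
  (forall y, U y -> f y = g y) -> 'D_v f x = 'D_v g x.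
Proof.
move=> oU Ux fg; apply: near_eq_derive => //.
by near=> y; apply/fg; near: y; exact: open_nbhs_nbhs.
Unshelve. all: by end_near. Qed.

Lemma Ck_on_near_eq {k U f g} : open U -> (forall y, U y -> f y = g y) ->
  Ck_on k U f -> Ck_on k U g.
Proof.
move=> oU; elim: k f g => [|k IH] f g fg /=.
  move=> cf x Ux; rewrite /prop_for /continuous_at -(fg x Ux).
  apply: cvg_trans (cf x Ux); apply: near_eq_cvg.
  near=> y; apply/fg; near: y; exact: open_nbhs_nbhs.
move=> [df Df]; split=> [x Ux|v]; first exact: (diff_near_eq oU Ux fg (df x Ux)).
apply: (IH _ _ _ (Df v)) => y Uy; exact: (derive_near_eq v oU Uy fg).
Unshelve. all: by end_near. Qed.

Lemma Ck_onS k U f : Ck_on k.+1 U f -> Ck_on k U f.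
Proof.
elim: k f => [|k IH] f [df Df].
  by move=> x Ux; exact: differentiable_continuous (df x Ux).
by split=> // v; exact: IH.
Qed.

Lemma Ck_onW k U U' f : U' `<=` U -> Ck_on k U f -> Ck_on k U' f.
Proof.
move=> U'U; elim: k f => [|k IH] f /=; first by move=> h x Ux; exact: (h _ (U'U _ Ux)).
by move=> [df Df]; split=> [x Ux|v]; [exact: (df _ (U'U _ Ux)) | exact: IH].
Qed.

Lemma Ck_on_local k U f :
  (forall x, U x -> exists2 O : set V, O x & Ck_on k O f) -> Ck_on k U f.
Proof.
elim: k f => [|k IH] f /= h; first by move=> x /h [B Bx]; apply.
split=> [x /h [B Bx [dO _]]|v]; first exact: dO.
by apply: IH => x /h [B Bx [_ Df]]; exists B.
Qed.

Lemma smooth_onW U U' f : U' `<=` U -> smooth_on U f -> smooth_on U' f.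
Proof. by move=> U'U sf k; exact: Ck_onW (sf k). Qed.

Lemma smooth_on_near_eq U f g : open U -> (forall y, U y -> f y = g y) ->
  smooth_on U f -> smooth_on U g.
Proof. by move=> oU fg sf k; exact: (Ck_on_near_eq oU fg (sf k)). Qed.

Lemma smooth_on_local U f :
  (forall x, U x -> exists O : set V, [/\ open O, O x &
     exists2 g, (forall y, O y -> g y = f y) & smooth_on O g]) ->
  smooth_on U f.
Proof.
move=> h k; apply: Ck_on_local => x /h [B [oB Bx [g gf sg]]].
by exists B => //; exact: (Ck_on_near_eq oB gf (sg k)).
Qed.

Lemma smooth_on_diff U f x : smooth_on U f -> U x -> differentiable f x.
Proof. by move=> /(_ 1%N) [+ _]; apply. Qed.

Lemma smooth_on_cts U f x : smooth_on U f -> U x -> {for x, continuous f}.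
Proof. by move=> /(_ 0%N); apply. Qed.

Lemma smooth_on_eq U f g : f =1 g -> smooth_on U f -> smooth_on U g.
Proof. by move=> /funext ->. Qed.

Lemma smooth_on_D U f v : smooth_on U f -> smooth_on U (fun x => 'D_v f x).
Proof. by move=> sf k; have [_] := sf k.+1; apply. Qed.

Lemma smooth_onS U f : (forall x, U x -> differentiable f x) ->
  (forall v, smooth_on U (fun x => 'D_v f x)) -> smooth_on U f.
Proof.
move=> df Df [|k]; first by move=> x /df; exact: differentiable_continuous.
by split=> // v; exact: Df.
Qed.

Lemma derive_lin x v w (f : V -> W) (k : R) : differentiable f x ->
  'D_(k *: v + w) f x = k *: 'D_v f x + 'D_w f x.
Proof. by move=> df; rewrite !deriveE // linearP. Qed.

Lemma Ck_on_cst k U (a : W) : Ck_on k U (cst a).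
Proof.
elim: k a => [|k IH] a /=; first by move=> x _; exact: cst_continuous.
split=> [x _|v]; first exact: differentiable_cst.
have -> : (fun x => 'D_v (cst a) x) = cst 0 by apply/funext => x; rewrite derive_cst.
exact: IH.
Qed.

Lemma smooth_on_cst U (a : W) : smooth_on U (fun=> a).
Proof. by move=> k; exact: Ck_on_cst. Qed.

Lemma Ck_onD k U f g : open U -> Ck_on k U f -> Ck_on k U g ->
  Ck_on k U (fun x => f x + g x).
Proof.
move=> oU; elim: k f g => [|k IH] f g /=.
  by move=> cf cg x Ux; apply: continuousD; [exact: cf | exact: cg].
move=> [df Df] [dg Dg]; split=> [x Ux|v].
  by apply: differentiableD; [exact: df | exact: dg].
apply: (Ck_on_near_eq oU _ (IH _ _ (Df v) (Dg v))) => y Uy.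
by rewrite -deriveD //; exact: diff_derivable (df _ _) || exact: diff_derivable (dg _ _).
Qed.

Lemma Ck_onZ k U f (a : R) : open U -> Ck_on k U f ->
  Ck_on k U (fun x => a *: f x).
Proof.
move=> oU; elim: k f => [|k IH] f /=.
  by move=> cf x Ux; apply: continuousZl_tmp; exact: cf.
move=> [df Df]; split=> [x Ux|v].
  by apply: differentiableZ; exact: df.
apply: (Ck_on_near_eq oU _ (IH _ (Df v))) => y Uy.
by rewrite -deriveZ //; exact: diff_derivable (df _ _).
Qed.

Lemma smooth_onD U f g : open U -> smooth_on U f -> smooth_on U g ->
  smooth_on U (fun x => f x + g x).
Proof. by move=> oU sf sg k; exact: Ck_onD. Qed.

Lemma smooth_onZ U f (a : R) : open U -> smooth_on U f ->
  smooth_on U (fun x => a *: f x).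
Proof. by move=> oU sf k; exact: Ck_onZ. Qed.

Lemma smooth_onN U f : open U -> smooth_on U f -> smooth_on U (fun x => - f x).
Proof.
move=> oU sf; have -> : (fun x => - f x) = (fun x => (-1) *: f x).
  by apply/funext => x; rewrite scaleN1r.
exact: smooth_onZ.
Qed.

Lemma smooth_onB U f g : open U -> smooth_on U f -> smooth_on U g ->
  smooth_on U (fun x => f x - g x).
Proof. by move=> oU sf sg; apply: smooth_onD => //; exact: smooth_onN. Qed.

Lemma smooth_on_sum (I : Type) (s : seq I) (P : pred I) (F : I -> V -> W) U : open U ->
  (forall i, P i -> smooth_on U (F i)) -> smooth_on U (fun x => \sum_(i <- s | P i) F i x).
Proof.
move=> oU sF; elim: s => [|i s IH].
  by apply: (@smooth_on_eq _ (fun=> 0)) (smooth_on_cst _ _) => x; rewrite big_nil.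
case Pi : (P i); last first.
  by apply: smooth_on_eq IH => x; rewrite big_cons Pi.
apply: smooth_on_eq (smooth_onD oU (sF i Pi) IH) => x.
by rewrite big_cons Pi.
Qed.

Lemma smooth_on_lin U (f : {linear V -> W}) : continuous f -> smooth_on U f.
Proof.
move=> cf; apply: smooth_onS => [x _|v]; first exact: linear_differentiable.
have -> : (fun x => 'D_v f x) = (fun=> f v).
  by apply/funext => x; rewrite deriveE ?diff_lin //; exact: linear_differentiable.
exact: smooth_on_cst.
Qed.

End Differentiability.

Section ScalarCalculus.
Context {R : realType} {V : normedModType R}.
Implicit Types (U : set V) (f g h : V -> R).

Lemma deriveMf f g x v : differentiable f x -> differentiable g x ->
  'D_v (fun x => f x * g x) x = f x * 'D_v g x + g x * 'D_v f x.
Proof.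
move=> df dg; exact: (deriveM (diff_derivable df) (diff_derivable dg)).
Qed.

Lemma Ck_onM k U f g : open U -> Ck_on k U f -> Ck_on k U g ->
  Ck_on k U (fun x => f x * g x).
Proof.
move=> oU; elim: k f g => [|k IH] f g.
  by move=> cf cg x Ux; apply: continuousM; [exact: cf | exact: cg].
move=> sf sg; have [df Df] := sf; have [dg Dg] := sg; split=> [x Ux|v].
  by apply: differentiableM; [exact: df | exact: dg].
have := Ck_onD oU (IH _ _ (Ck_onS sf) (Dg v)) (IH _ _ (Ck_onS sg) (Df v)).
by apply: Ck_on_near_eq => // y Uy; rewrite deriveMf //; [exact: df | exact: dg].
Qed.

Lemma smooth_onM U f g : open U -> smooth_on U f -> smooth_on U g ->
  smooth_on U (fun x => f x * g x).
Proof. by move=> oU sf sg k; exact: Ck_onM. Qed.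

Lemma smooth_onX U f n : open U -> smooth_on U f -> smooth_on U (fun x => f x ^+ n).
Proof.
move=> oU sf; elim: n => [|n IH].
  exact: smooth_on_cst.
by apply: smooth_on_eq (smooth_onM oU sf IH) => x; rewrite exprS.
Qed.

(* An inverse (or a root) satisfies a polynomial differential equation
   D_v h = h^n * c * D_v f, hence is as smooth as f. *)
Lemma smooth_on_ode U f h n (c : R) : open U -> smooth_on U f ->
  (forall x, U x -> differentiable h x) ->
  (forall x v, U x -> 'D_v h x = c * (h x ^+ n * 'D_v f x)) ->
  smooth_on U h.
Proof.
move=> oU sf dh Dh; elim => [|k IH].
  by move=> x /dh; exact: differentiable_continuous.
split=> // v.
have hk m : Ck_on k U (fun x => h x ^+ m).
  elim: m => [|m IHm].
    exact: Ck_on_cst.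
  have -> : (fun x => h x ^+ m.+1) = (fun x => h x * h x ^+ m).
    by apply/funext => x; rewrite exprS.
  exact: Ck_onM.
have := Ck_onZ c oU (Ck_onM oU (hk n) (smooth_on_D v sf k)).
by apply: Ck_on_near_eq => // y Uy; rewrite Dh.
Qed.

Lemma smooth_onV U f : open U -> (forall x, U x -> f x != 0) ->
  smooth_on U f -> smooth_on U (fun x => (f x)^-1).
Proof.
move=> oU f0 sf.
have df x : U x -> differentiable f x by exact: smooth_on_diff.
apply: (@smooth_on_ode _ f _ 2 (-1)) => // [x Ux|x v Ux].
  by apply: differentiableV => //; [exact: df | exact: f0].
rewrite [LHS](deriveV (f0 _ Ux) (diff_derivable (df _ Ux))).
by rewrite mulN1r exprVn -scaleNr.
Qed.

End ScalarCalculus.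
End SmoothMaps.
Import SmoothMaps.

(** * Composition of smooth maps, matrix-valued maps, inverse square roots *)

Module SmoothComposition.
Section Composition.
Context {R : realType} {V V' : normedModType R}.

Lemma derive_comp (W : normedModType R) (g : V -> V') (f : V' -> W) x v :
  differentiable g x -> differentiable f (g x) ->
  'D_v (fun y => f (g y)) x = 'D_('D_v g x) f (g x).
Proof.
move=> dg df; rewrite !deriveE //; last exact: (differentiable_comp dg df).
by rewrite (diff_comp dg df).
Qed.

Lemma Ck_on_linl (W : normedModType R) k (U : set V) (L : {linear V' -> W}) (g : V -> V') : continuous L ->
  open U -> Ck_on k U g -> Ck_on k U (fun x => L (g x)).
Proof.
move=> cL oU; elim: k g => [|k IH] g.
  by move=> cg x Ux; apply: (continuous_comp (cg _ Ux)); exact: cL.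
move=> [dg Dg]; split=> [x Ux|v].
  apply: (differentiable_comp (dg _ Ux)); exact: linear_differentiable.
apply: (Ck_on_near_eq oU _ (IH _ (Dg v))) => y Uy.
have dL := linear_differentiable (g y) cL.
by rewrite (derive_comp _ (dg _ Uy) dL) (deriveE _ dL) diff_lin.
Qed.

Lemma smooth_on_linl (W : normedModType R) (U : set V) (L : {linear V' -> W}) (g : V -> V') : continuous L ->
  open U -> smooth_on U g -> smooth_on U (fun x => L (g x)).
Proof. by move=> cL oU sg k; exact: Ck_on_linl. Qed.

Lemma smooth_on_Zl (W : normedModType R) (U : set V) (f : V -> R) (a : W) : open U -> smooth_on U f ->
  smooth_on U (fun x => f x *: a).
Proof.
move=> oU + k; elim: k f => [|k IH] f sf.
  by move=> x Ux; apply: continuousZr_tmp; exact: smooth_on_cts Ux.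
split=> [x Ux|v].
  by apply: differentiableZl; exact: smooth_on_diff Ux.
apply: (Ck_on_near_eq oU _ (IH _ (smooth_on_D v sf))) => y Uy.
have df := smooth_on_diff sf Uy.
rewrite (deriveE _ (differentiableZl a df)) (deriveE _ df).
by have -> := diffZl a df.
Qed.

(** The chain rule differentiates [f] in a direction that varies with the point, whereas [Ck_on]
    speaks of constant directions only. Expanding the derivative of [g] over the fixed vectors [e i]
    makes it a finite sum of functions of the same shape, to which the induction on k applies. *)
Lemma smooth_on_comp (I : finType) (e : I -> V') (c : I -> V -> V -> R)
    (O : set V') (U : set V) (f : V' -> R) (g : V -> V') :
  open U -> (forall x, U x -> O (g x)) ->
  (forall v y, U y -> 'D_v g y = \sum_i c i v y *: e i) ->
  (forall i v, smooth_on U (c i v)) ->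
  smooth_on U g -> smooth_on O f -> smooth_on U (fun x => f (g x)).
Proof.
move=> oU gO gc sc sg + k; elim: k f => [|k IH] f sf.
  move=> x Ux; exact: (continuous_comp (smooth_on_cts sg Ux) (smooth_on_cts sf (gO _ Ux))).
have dg x (Ux : U x) := smooth_on_diff sg Ux.
have df x (Ux : U x) := smooth_on_diff sf (gO _ Ux).
split=> [x Ux|v].
  exact: (differentiable_comp (dg _ Ux) (df _ Ux)).
apply: (@Ck_on_near_eq _ _ _ _ _
    (fun x => \sum_i c i v x * 'D_(e i) f (g x))) => // [y Uy|].
  rewrite (derive_comp _ (dg _ Uy) (df _ Uy)) gc // (deriveE _ (df _ Uy)).
  rewrite linear_sum; apply: eq_bigr => i _.
  by rewrite linearZ deriveE //; exact: df.
have Dfk i : Ck_on k U (fun x => 'D_(e i) f (g x)).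
  exact: (IH _ (smooth_on_D (e i) sf)).
elim: (index_enum I) => [|i s IHs].
  rewrite (_ : (fun _ => _) = cst 0); first exact: Ck_on_cst.
  by apply/funext => y; rewrite big_nil.
apply: (Ck_on_near_eq oU _ (Ck_onD oU (Ck_onM oU (sc i v k) (Dfk i)) IHs)).
by move=> y Uy; rewrite big_cons.
Qed.

End Composition.

Section MatrixValued.
Context {R : realType} {V : normedModType R} {m n : nat}.
Implicit Types (U : set V) (M : V -> 'M[R]_(m, n)).

Lemma smooth_on_mx U M : open U ->
  (forall i j, smooth_on U (fun x => M x i j)) -> smooth_on U M.
Proof.
move=> oU sM.
apply: (@smooth_on_eq _ _ _ _ (fun x => \sum_i \sum_j M x i j *: delta_mx i j)).
  by move=> x; rewrite -matrix_sum_delta.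
apply: smooth_on_sum => // i _; apply: smooth_on_sum => // j _.
exact: smooth_on_Zl.
Qed.

Lemma smooth_on_entry U M i j : open U -> smooth_on U M ->
  smooth_on U (fun x => M x i j).
Proof.
move=> oU sM.
have @f : {linear 'M[R]_(m, n) -> R}.
  by exists (fun N : 'M[R]_(m, n) => N i j); do 2![eexists]; do ?[constructor];
     rewrite ?mxE// => ? *; rewrite ?mxE//; move=> ?; rewrite !mxE.
apply: (@smooth_on_linl _ _ _ _ _ f) => //; exact: coord_continuous.
Qed.

Lemma derive_entry M x v i j : differentiable M x ->
  ('D_v M x) i j = 'D_v (fun y => M y i j) x.
Proof. by move=> dM; rewrite (derive_mx (diff_derivable dM)) mxE. Qed.

Lemma smooth_on_compM (O : set 'M[R]_(m, n)) U (f : 'M[R]_(m, n) -> R) M :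
  open U -> (forall x, U x -> O (M x)) -> smooth_on U M -> smooth_on O f ->
  smooth_on U (fun x => f (M x)).
Proof.
move=> oU MO sM sf.
apply: (@smooth_on_comp _ _ _ _ (fun ij : 'I_m * 'I_n => delta_mx ij.1 ij.2)
  (fun ij v x => ('D_v M x) ij.1 ij.2) O U f M) => //.
  by move=> v y Uy; rewrite {1}[LHS]matrix_sum_delta pair_big.
by move=> i v; apply: smooth_on_entry => //; exact: smooth_on_D.
Qed.

Lemma smooth_on_compR (O : set R) U (f : R -> R) (g : V -> R) :
  open U -> (forall x, U x -> O (g x)) -> smooth_on U g -> smooth_on O f ->
  smooth_on U (fun x => f (g x)).
Proof.
move=> oU MO sg sf.
have Dg (v : V) y : U y -> 'D_v g y = \sum_(i < 1) 'D_v g y *: (1 : R).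
  by move=> Uy; rewrite big_ord1 [_ *: _]mulr1.
have sDg (i : 'I_1) v : smooth_on U (fun y => 'D_v g y) by exact: smooth_on_D.
exact: (smooth_on_comp oU MO Dg sDg sg sf).
Qed.

End MatrixValued.

Section MatrixDomain.
Context {R : realType} {m n : nat}.
Implicit Types (U : set 'M[R]_(m, n)) (f : 'M[R]_(m, n) -> R).

Lemma smooth_on_coord U i j : smooth_on U (fun x : 'M[R]_(m, n) => x i j).
Proof.
have @f : {linear 'M[R]_(m, n) -> R}.
  by exists (fun N : 'M[R]_(m, n) => N i j); do 2![eexists]; do ?[constructor];
     rewrite ?mxE// => ? *; rewrite ?mxE//; move=> ?; rewrite !mxE.
apply: (@smooth_on_lin _ _ _ _ f); exact: coord_continuous.
Qed.

Lemma derive_coord x v i j : 'D_v (fun x : 'M[R]_(m, n) => x i j) x = v i j.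
Proof.
rewrite -(@derive_entry _ _ _ _ id) ?derive_id //.
Qed.

Lemma derive_sum_coord f x v : differentiable f x ->
  'D_v f x = \sum_i \sum_j v i j * 'D_(delta_mx i j) f x.
Proof.
move=> df; rewrite deriveE // {1}[v]matrix_sum_delta linear_sum.
apply: eq_bigr => i _; rewrite linear_sum; apply: eq_bigr => j _.
by rewrite linearZ deriveE.
Qed.

End MatrixDomain.

Section SquareRoot.
Context {R : realType} {V : normedModType R}.

Lemma smooth_on_sqrtV (U : set V) (f : V -> R) : open U ->
  (forall x, U x -> 0 < f x) -> smooth_on U f ->
  smooth_on U (fun x => (Num.sqrt (f x))^-1).
Proof.
move=> oU f0 sf.
have df x (Ux : U x) := smooth_on_diff sf Ux.
have ds (y : R) : 0 < y -> is_derive y 1 Num.sqrt (2 * Num.sqrt y)^-1.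
  by move=> y0; exact: is_derive1_sqrt.
have h x v : U x -> differentiable (fun x => (Num.sqrt (f x))^-1) x /\
   'D_v (fun x => (Num.sqrt (f x))^-1) x =
    - 2^-1 * ((Num.sqrt (f x))^-1 ^+ 3 * 'D_v f x).
  move=> Ux; have s0 : Num.sqrt (f x) != 0 by rewrite sqrtr_eq0 -ltNge f0.
  have [dsx sx] := ds _ (f0 _ Ux).
  have dsf : differentiable Num.sqrt (f x) by apply/derivable1_diffP.
  have dsfx : differentiable (fun x => Num.sqrt (f x)) x.
    exact: (differentiable_comp (df _ Ux) dsf).
  split; first exact: differentiableV.
  have -> := @deriveV _ _ (fun x => Num.sqrt (f x)) x v s0 (diff_derivable dsfx).
  have -> := @derive_comp _ _ _ _ f Num.sqrt x v (df _ Ux) dsf.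
  have -> : 'D_('D_v f x) Num.sqrt (f x) = 'D_v f x * (2 * Num.sqrt (f x))^-1.
    rewrite -sx !(deriveE _ dsf) -[X in 'd _ _ X = _]mulr1.
    by rewrite [LHS]linearZ.
  by rewrite /GRing.scale /=; field.
apply: (@smooth_on_ode _ _ _ f _ 3 (- 2^-1)) => // x.
  by move=> /(h _ 0) [].
by move=> v /(h _ v) [].
Qed.

End SquareRoot.
End SmoothComposition.
Import SmoothComposition.

(** * Mean values along lines and the symmetry of second derivatives *)

Module SmoothLines.
Section LineCalculus.
Context {R : realType} {V : normedModType R}.
Implicit Types (U : set V) (f : V -> R).

Lemma is_derive_affine (x w : V) (t : R) :
  is_derive t (1 : R) (fun s : R => x + s *: w) w.
Proof.
have dw : differentiable (fun s : R => s *: w) t by exact: differentiableZl.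
apply: DeriveDef; first exact: derivableD (derivable_cst _ _ _) (diff_derivable dw).
have -> := @deriveD _ _ _ (cst x) (fun s : R => s *: w) t 1 (derivable_cst _ _ _) (diff_derivable dw).
rewrite derive_cst add0r (deriveE _ dw).
have -> := @diffZl _ _ _ (fun s : R => s) w t (ex_diff (is_diff_def := is_diff_id t)).
by rewrite (diff_val (is_diff_def := is_diff_id t)) scale1r.
Qed.

Lemma differentiable_affine (x w : V) (t : R) : differentiable (fun s : R => x + s *: w) t.
Proof. by apply/derivable1_diffP; have [] := is_derive_affine x w t. Qed.

Lemma is_derive_line f (x w : V) (t : R) : differentiable f (x + t *: w) ->
  is_derive t 1 (fun s : R => f (x + s *: w)) ('D_w f (x + t *: w)).
Proof.
move=> df; have dg := differentiable_affine x w t.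
apply: DeriveDef; first exact: diff_derivable (differentiable_comp dg df).
have -> := @derive_comp _ _ _ _ (fun s : R => x + s *: w) f t 1 dg df.
by rewrite (@derive_val _ _ _ _ _ _ _ (is_derive_affine x w t)).
Qed.

Lemma line_MVT f (x w : V) (h : R) : 0 < h ->
  (forall t, 0 <= t <= h -> differentiable f (x + t *: w)) ->
  exists2 t : R, 0 < t < h & f (x + h *: w) - f x = h * 'D_w f (x + t *: w).
Proof.
move=> h0 df.
have dl t : 0 <= t <= h ->
  is_derive t 1 (fun s : R => f (x + s *: w)) ('D_w f (x + t *: w)).
  by move=> th; apply: is_derive_line; exact: df.
have [t||t] := @MVT _ (fun s : R => f (x + s *: w)) (fun t => 'D_w f (x + t *: w)) 0 h h0.
- by rewrite in_itv /= => /andP[t0 th]; apply: dl; rewrite !ltW.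
- by apply: derivable_within_continuous => t; rewrite in_itv /= => /dl [].
- rewrite in_itv /= => th; rewrite scale0r addr0 subr0 => ->.
  by exists t => //; rewrite mulrC.
Qed.

(** The mean value theorem applied twice, to [f] and then to its derivative along h, gives the
    remainder with constant 1 in place of 1/2. *)
Lemma Taylor1 f (x h : V) U : smooth_on U f ->
  (forall t : R, 0 <= t <= 1 -> U (x + t *: h)) ->
  exists2 t : R, 0 <= t <= 1 & `|f (x + h) - f x - 'D_h f x| <=
     `|'D_h (fun y => 'D_h f y) (x + t *: h)|.
Proof.
move=> sf seg.
have [t /andP[t0 t1]] := @line_MVT f x h 1 ltr01
   (fun t ht => smooth_on_diff sf (seg t ht)).
rewrite scale1r mul1r => ->.
have [s hs|s /andP[s0 st] ->] := @line_MVT (fun y => 'D_h f y) x h t t0.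
  apply: (smooth_on_diff (smooth_on_D h sf)); apply: seg.
  by case/andP: hs => -> /= /le_trans; apply; exact: ltW.
exists s; first by rewrite (ltW s0) (ltW (lt_trans st t1)).
by rewrite normrM ger0_norm ?ler_piMl// ltW.
Qed.

Lemma mixed_difference f (x u v : V) U (h : R) : smooth_on U f -> 0 < h ->
  (forall s t : R, 0 <= s <= h -> 0 <= t <= h -> U (x + s *: u + t *: v)) ->
  exists s t : R, [/\ 0 <= s <= h, 0 <= t <= h &
    f (x + h *: u + h *: v) - f (x + h *: u) - (f (x + h *: v) - f x) =
    h * (h * 'D_v (fun y => 'D_u f y) (x + s *: u + t *: v))].
Proof.
move=> sf h0 sq.
have h00 : 0 <= (0 : R) <= h by rewrite lexx ltW.
have hh : 0 <= h <= h by rewrite lexx ltW.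
pose k y := f (y + h *: v).
pose g y := k y - f y.
have dshift y : differentiable (fun y : V => y + h *: v) y.
  by apply: differentiableD.
have dsf y : U (y + h *: v) -> differentiable k y.
  by move=> Uy; exact: (differentiable_comp (dshift y) (smooth_on_diff sf Uy)).
have U0 s : 0 <= s <= h -> U (x + s *: u).
  by move=> sh; rewrite -[_ + _]addr0 -(scale0r v); exact: sq.
have [s sh|s sh gE] := @line_MVT g x u h h0.
  apply: differentiableB; first by apply: dsf; exact: sq.
  by apply: (smooth_on_diff sf); exact: U0.
have sh' : 0 <= s <= h by case/andP: sh => s0 s1; rewrite !ltW.
have dk := dsf _ (sq _ _ sh' hh).
have df := smooth_on_diff sf (U0 _ sh').
have Dg : 'D_u g (x + s *: u) = 'D_u f (x + s *: u + h *: v) - 'D_u f (x + s *: u).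
  have -> := @deriveB _ _ _ k f _ u (diff_derivable dk) (diff_derivable df).
  have -> := @derive_comp _ _ _ _ (fun y => y + h *: v) f _ u (dshift _)
    (smooth_on_diff sf (sq _ _ sh' hh)).
  have -> // : 'D_u (fun y : V => y + h *: v) (x + s *: u) = u.
  have -> := @deriveD _ _ _ id (cst (h *: v)) (x + s *: u) u (@derivable_id _ _ _ _)
    (@derivable_cst _ _ _ _ _ _).
  by rewrite derive_id derive_cst addr0.
have [t th E2] := @line_MVT (fun y => 'D_u f y) (x + s *: u) v h h0 (fun t ht =>
  smooth_on_diff (smooth_on_D u sf) (sq s t sh' ht)).
exists s, t; split => //; first by case/andP: th => s0 s1; rewrite !ltW.
by rewrite -E2 -Dg -gE.
Qed.

(** Both mixed derivatives are limits of the same second difference divided by h^2: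
    [mixed_difference] evaluates it as either of them at a point near x, and continuity does the
    rest. *)
Lemma derive_sym f (x u v : V) U : open U -> U x -> smooth_on U f ->
  'D_v (fun y => 'D_u f y) x = 'D_u (fun y => 'D_v f y) x.
Proof.
move=> oU Ux sf.
have key : forall u v : V, forall e : R, 0 < e -> \forall h \near 0^'+,
  exists2 c, `|c - 'D_v (fun y => 'D_u f y) x| < e &
    f (x + h *: u + h *: v) - f (x + h *: u) - (f (x + h *: v) - f x) = h * (h * c).
  move=> {u v} u v e e0.
  have /cvgrPdist_lt /(_ _ e0) := smooth_on_cts (smooth_on_D v (smooth_on_D u sf)) Ux.
  move=> /nbhs_ballP[r /= r0 rD].
  have /nbhs_ballP[q /= q0 qU] : nbhs x U by exact: open_nbhs_nbhs.
  pose m := Num.min r q.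
  have m0 : 0 < m by rewrite lt_min r0.
  have K0 : 0 < `|u| + `|v| + 1 by rewrite ltr_wpDl// addr_ge0.
  near=> h.
  have h0 : 0 < h by near: h; exact: nbhs_right_gt.
  have hm : h * (`|u| + `|v| + 1) < m.
    rewrite -ltr_pdivlMr//; near: h; apply: nbhs_right_lt; exact: divr_gt0.
  have inb (s t : R) : 0 <= s <= h -> 0 <= t <= h -> `|x - (x + s *: u + t *: v)| < m.
    move=> /andP[s0 sh] /andP[t0 th]; rewrite -addrA opprD addNKr normrN.
    apply: le_lt_trans hm; rewrite (le_trans (ler_normD _ _))// !normrZ.
    rewrite !ger0_norm// !mulrDr mulr1.
    have := ler_wpM2r (normr_ge0 u) sh; have := ler_wpM2r (normr_ge0 v) th.
    lra.
  have [|s [t [sh th ->]]] := @mixed_difference f x u v U h sf h0.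
    move=> s t sh th; apply: qU; rewrite -ball_normE /=.
    by apply: lt_le_trans (inb _ _ sh th) _; rewrite ge_min lexx orbT.
  exists ('D_v (fun y => 'D_u f y) (x + s *: u + t *: v)) => //.
  rewrite distrC; apply: rD; rewrite -ball_normE /=.
  by apply: lt_le_trans (inb _ _ sh th) _; rewrite ge_min lexx.
have := key v u; have := key u v; clear key.
move: ('D_v (fun y => 'D_u f y) x) ('D_u (fun y => 'D_v f y) x) => a b keya keyb.
apply/eqP; rewrite -subr_eq0 -normr_le0; apply/ler_addgt0Pr => e e0.
have e20 : 0 < e / 2 by rewrite divr_gt0.
near (0 : R)^'+ => h.
have h0 : 0 < h by near: h; exact: nbhs_right_gt.
have [c cD cE] : exists2 c, `|c - a| < e / 2 &
    f (x + h *: u + h *: v) - f (x + h *: u) - (f (x + h *: v) - f x) = h * (h * c).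
  by near: h; exact: keya.
have [d dD dE] : exists2 c, `|c - b| < e / 2 &
    f (x + h *: v + h *: u) - f (x + h *: v) - (f (x + h *: u) - f x) = h * (h * c).
  by near: h; exact: keyb.
have cd : c = d.
  apply: (mulfI (lt0r_neq0 h0)); apply: (mulfI (lt0r_neq0 h0)).
  by rewrite -cE -dE (addrAC _ (h *: u)); ring.
rewrite add0r [e]splitr; apply: le_trans (_ : `|a - c| +
   `|d - b| <= _).
  by rewrite cd (le_trans _ (ler_normD _ _))// addrA subrK.
by apply: lerD; apply: ltW; rewrite // distrC.
Unshelve. all: by end_near. Qed.

End LineCalculus.
End SmoothLines.
Import SmoothLines.

(** * Differentiation under integrals and sums *)

Module Superposition.
Section LinearCombination.
Context {R : realType} {V : normedModType R}.

Lemma derive_lincomb (J : Type) (s : seq J) (k : J -> R) (g : J -> V -> R) x v :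
  (forall j, differentiable (g j) x) ->
  differentiable (fun y => \sum_(j <- s) k j * g j y) x /\
  'D_v (fun y => \sum_(j <- s) k j * g j y) x = \sum_(j <- s) k j * 'D_v (g j) x.
Proof.
move=> dg; elim: s => [|j s [IHd IHD]].
  rewrite big_nil (_ : (fun _ => _) = cst 0); last first.
    by apply/funext => y; rewrite big_nil.
  by split; [exact: differentiable_cst | rewrite derive_cst].
rewrite big_cons (_ : (fun _ => _) = (k j \*: g j) + (fun y => \sum_(j <- s) k j * g j y)).
  split; first by apply: differentiableD => //; exact: differentiableZ.
  rewrite deriveD ?IHD; [|exact: diff_derivable (differentiableZ _ (dg j))|exact: diff_derivable].
  by have -> := deriveZ (k j) (diff_derivable (dg j)).
by apply/funext => y; rewrite big_cons.
Qed.

End LinearCombination.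

Section Superposition.
Context {R : realType} {T : Type}.
Variables (D : set T) (b : T -> R) (P : set (T -> R)) (I : (T -> R) -> R) (B : R).

(* A positive functional, such as an integral or the sum of a series: it is
   linear on [P] and [I f] is controlled by the bound of [f] relatively to the
   weight [b] on [D]. *)
Definition bounded_functional : Prop :=
  [/\ forall t, 0 <= b t,
      forall k f g, P f -> P g -> P (fun t => k * f t + g t),
      forall k f g, P f -> P g -> I (fun t => k * f t + g t) = k * I f + I g
    & forall f c, 0 <= c -> P f -> (forall t, D t -> `|f t| <= c * b t) ->
        `|I f| <= c * B].

Hypothesis hI : bounded_functional.

Lemma bf_lin k f g : P f -> P g -> I (fun t => k * f t + g t) = k * I f + I g.
Proof. by have [_ _ h _] := hI; exact: h. Qed.

Lemma bf_dom k f g : P f -> P g -> P (fun t => k * f t + g t).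
Proof. by have [_ h _ _] := hI; exact: h. Qed.

Lemma bf_sub f g : P f -> P g -> P (fun t => f t - g t).
Proof.
move=> Pf Pg; have := bf_dom (-1) Pg Pf; congr P.
by apply/funext => t; rewrite mulN1r addrC.
Qed.

Lemma bf_B f g : P f -> P g -> I (fun t => f t - g t) = I f - I g.
Proof.
move=> Pf Pg; rewrite [RHS]addrC -mulN1r -bf_lin//; congr I.
by apply/funext => t; rewrite mulN1r addrC.
Qed.

Context {m n : nat}.
Implicit Types (F : 'M[R]_(m, n) -> T -> R) (x v : 'M[R]_(m, n)).
Variables (U : set 'M[R]_(m, n)) (K : set ('M[R]_(m, n) -> T -> R)).
Hypothesis (oU : open U).
Hypothesis Ksmooth : forall F, K F -> forall t, smooth_on U (F^~ t).
Hypothesis KP : forall F x, K F -> U x -> P (F x).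
Hypothesis Kb : forall F x, K F -> U x -> exists c : R,
  \forall y \near x, forall t, D t -> `|F y t| <= c * b t.
Hypothesis KD : forall F v, K F -> K (fun x t => 'D_v (F^~ t) x).

Let mx_norm_entry (h : 'M[R]_(m, n)) i j : `|h i j| <= `|h|.
Proof.
rewrite [leRHS]/Num.Def.normr/= mx_normrE.
by apply: le_trans (le_bigmax _ _ (i, j)).
Qed.

Let DI F x (h : 'M[R]_(m, n)) : R := I (fun t => 'D_h (F^~ t) x).

Let DI_lin F x : K F -> U x -> linear (DI F x).
Proof.
move=> KF Ux k u v; rewrite /DI -bf_lin; [|exact: (KP (KD _ KF) Ux)..].
by congr I; apply/funext => t; rewrite derive_lin//; exact: smooth_on_diff (Ksmooth _ _) Ux.
Qed.

(** The second derivative along h is quadratic in the entries of h, with the finitely many second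
    partial derivatives as coefficients; this makes the bound uniform in both h and t. *)
Let second_bound F x : K F -> U x -> exists2 c : R, 0 <= c &
  \forall y \near x, forall (h : 'M[R]_(m, n)) t, D t ->
   `|'D_h (fun z => 'D_h (F^~ t) z) y| <= (`|h| ^+ 2 * c) * b t.
Proof.
move=> KF Ux.
pose J := (('I_m * 'I_n) * ('I_m * 'I_n))%type.
pose d (ij : 'I_m * 'I_n) : 'M[R]_(m, n) := delta_mx ij.1 ij.2.
have hb (p : J) := Kb (KD (d p.1) (KD (d p.2) KF)) Ux.
pose c p := sval (cid (hb p)).
have cP p : \forall y \near x, forall t, D t ->
   `|'D_(d p.1) (fun z => 'D_(d p.2) (F^~ t) z) y| <= c p * b t.
  by rewrite /c; case: cid.
exists (\sum_p `|c p|); first exact: sumr_ge0.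
have cP' : \forall y \near x, forall p t, D t ->
   `|'D_(d p.1) (fun z => 'D_(d p.2) (F^~ t) z) y| <= c p * b t.
  exact: (@filter_forall _ _ (fun p => [set y | forall t, D t ->
   `|'D_(d p.1) (fun z => 'D_(d p.2) (F^~ t) z) y| <= c p * b t]) (nbhs x) _ cP).
near=> y => h t Dt.
have Uy : U y by near: y; exact: open_nbhs_nbhs.
have b0 : 0 <= b t by case: hI.
have sF := Ksmooth KF t.
have E1 z : U z -> 'D_h (F^~ t) z = \sum_p h p.1 p.2 * 'D_(d p) (F^~ t) z.
  by move=> Uz; rewrite derive_sum_coord ?pair_big//; exact: smooth_on_diff sF Uz.
rewrite (derive_near_eq h oU Uy E1).
have -> : 'D_h (fun z => \sum_p h p.1 p.2 * 'D_(d p) (F^~ t) z) y =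
   \sum_(p : J) h p.1.1 p.1.2 * h p.2.1 p.2.2 * 'D_(d p.1) (fun z => 'D_(d p.2) (F^~ t) z) y.
  have dq v q : differentiable (fun z => 'D_(d q) (F^~ t) z) y.
    by apply: (smooth_on_diff _ Uy); exact: smooth_on_D.
  have [dS ->] := @derive_lincomb _ _ _ (index_enum _) (fun p => h p.1 p.2) (fun p z => 'D_(d p) (F^~ t) z) y h (dq 0).
  under eq_bigr => q _ do rewrite (derive_sum_coord _ (dq 0 q)) pair_big /= mulr_sumr.
  rewrite exchange_big pair_big/=; apply: eq_bigr => p _.
  by rewrite mulrCA mulrA.
rewrite (le_trans (ler_norm_sum _ _ _))// mulr_sumr mulr_suml.
have cy : forall p t, D t -> `|'D_(d p.1) (fun z => 'D_(d p.2) (F^~ t) z) y| <= c p * b t.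
  by near: y.
apply: ler_sum => p _; rewrite !normrM expr2 -[leRHS]mulrA.
apply: ler_pM; rewrite ?mulr_ge0 ?ler_pM ?mx_norm_entry//.
by apply: (le_trans (cy p t Dt)); rewrite ler_wpM2r// ler_norm.
Unshelve. all: by end_near. Qed.

(** The Taylor remainder of each [F^~ t] is at most |h|^2 times a multiple of the weight b t,
    uniformly in t, and the positivity of [I] transports this bound to the remainder of [I (F y)].
    Since the class [K] is stable under derivation, iterating this yields smoothness. *)
Let superposition_diff F x : K F -> U x ->
  differentiable (fun y => I (F y)) x /\
  forall v, 'D_v (fun y => I (F y)) x = I (fun t => 'D_v (F^~ t) x).
Proof.
move=> KF Ux.
pose LM := GRing.isLinear.Build _ _ _ _ (DI F x) (DI_lin KF Ux).
pose L : {linear 'M[R]_(m, n) -> R} := HB.pack (DI F x) LM.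
have LE v : DI F x v = L v by [].
have cL : continuous L.
  have LS : L = (fun h => \sum_p L (delta_mx p.1 p.2) * h p.1 p.2) :> (_ -> _).
    apply/funext => h; rewrite {1}[h]matrix_sum_delta pair_big linear_sum.
    by apply: eq_bigr => p _; rewrite linearZ mulrC.
  rewrite LS => h; apply: differentiable_continuous.
  by apply: (derive_lincomb _ _ 0 _).1 => p; exact: differentiable_coord.
have [c c0 cF] := second_bound KF Ux.
have [dI dE] : differentiable (fun y => I (F y)) x /\ 'd (fun y => I (F y)) x = L :> (_ -> _).
  apply: is_diff_eps => // e e0.
  have /nbhs_ballP[r /= r0 rF] : \forall y \near x, U y /\
     forall (h : 'M[R]_(m, n)) t, D t ->
     `|'D_h (fun z => 'D_h (F^~ t) z) y| <= (`|h| ^+ 2 * c) * b t.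
    by apply: filterI => //; exact: open_nbhs_nbhs.
  have cB0 : 0 < c * `|B| + 1 by rewrite ltr_wpDl// mulr_ge0.
  exists (Num.min r (e / (c * `|B| + 1))); first by rewrite lt_min r0 divr_gt0.
  move=> h; rewrite lt_min => /andP[hr he].
  have seg (s : R) : 0 <= s <= 1 -> ball x r (x + s *: h).
    move=> /andP[s0 s1]; rewrite -ball_normE /= opprD addNKr normrN normrZ ger0_norm//.
    by apply: le_lt_trans hr; rewrite ler_piMl.
  have Uxh : U (x + h).
    by have [] := rF _ (seg 1 _); rewrite ?scale1r// ler01 lexx.
  have P12 := bf_sub (KP KF Uxh) (KP KF Ux).
  have P3 := KP (KD h KF) Ux.
  have -> : I (F (x + h)) - I (F x) - DI F x h =
      I (fun t => F (x + h) t - F x t - 'D_h (F^~ t) x).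
    by rewrite /DI (bf_B P12 P3) (bf_B (KP KF Uxh) (KP KF Ux)).
  have [_ _ _ hB] := hI; apply: le_trans (hB _ (`|h| ^+ 2 * c) _ _ _) _.
  - by rewrite mulr_ge0.
  - exact: (bf_sub P12 P3).
  - move=> t Dt.
    have [|s s01] := @Taylor1 _ _ (F^~ t) x h U (Ksmooth KF t).
      by move=> s s01; have [] := rF _ (seg s s01).
    by move=> /le_trans; apply; have [_] := rF _ (seg s s01); apply.
  - have heB : `|h| * (c * `|B| + 1) <= e by rewrite -ler_pdivlMr// ltW.
    rewrite expr2 -!mulrA [e * _]mulrC ler_wpM2l//; apply: le_trans heB.
    rewrite ler_wpM2l// ler_wpDr// ler_wpM2l//; exact: ler_norm.
by split => // v; rewrite deriveE // dE.
Qed.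

Lemma superposition_derive F x v : K F -> U x ->
  'D_v (fun y => I (F y)) x = I (fun t => 'D_v (F^~ t) x).
Proof. by move=> KF Ux; have [_] := superposition_diff KF Ux; apply. Qed.

Lemma superposition_smooth F : K F -> smooth_on U (fun y => I (F y)).
Proof.
move=> KF k; elim: k F KF => [|k IH] F KF.
  by move=> x Ux; apply: differentiable_continuous; have [] := superposition_diff KF Ux.
split=> [x Ux|v]; first by have [] := superposition_diff KF Ux.
apply: (Ck_on_near_eq oU _ (IH _ (KD v KF))) => y Uy.
by rewrite superposition_derive.
Qed.

End Superposition.
End Superposition.
Import Superposition.

(** * Integrals over a circle *)

Module CircleIntegrals.
Section Constancy.
Context {R : realType}.

Lemma derive0_cst (f : R -> R) (x y : R) :
  (forall t, Num.min x y <= t -> is_derive t 1 f 0) -> f x = f y.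
Proof.
wlog xy : x y / x <= y.
  move=> H; have [xy|yx] := orP (le_total x y); first exact: H.
  by move=> df; apply/esym/H => // t; rewrite minC; exact: df.
rewrite min_l// => df.
have [||c _] := @MVT_segment _ f (fun=> 0) x y xy.
- by move=> t; rewrite in_itv/= => /andP[xt _]; apply: df; exact: ltW.
- apply: derivable_within_continuous => t; rewrite in_itv/= => /andP[xt _].
  by have [] := df t xt.
by rewrite mul0r => /eqP; rewrite subr_eq0 => /eqP.
Qed.

End Constancy.

Section CircleIntegral.
Context {R : realType}.
Implicit Types (p q P : R -> R).

Lemma cont_mul p q : continuous p -> continuous q -> continuous (fun t => p t * q t).
Proof. by move=> cp cq t; apply: cvgM; [exact: cp | exact: cq]. Qed.

Lemma cont_add p q : continuous p -> continuous q -> continuous (fun t => p t + q t).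
Proof. by move=> cp cq t; apply: cvgD; [exact: cp | exact: cq]. Qed.

Lemma cont_scale k p : continuous p -> continuous (fun t => k * p t).
Proof. by move=> cp; apply: cont_mul => //; exact: cst_continuous. Qed.

Lemma cont_is_derive p (dp : R -> R) : (forall t : R, is_derive t 1 p (dp t)) -> continuous p.
Proof.
by move=> ip t; have [d _] := ip t; apply: differentiable_continuous; apply/derivable1_diffP.
Qed.

Definition cint p : R := \int[lebesgue_measure]_(t in `[0, 2 * pi]) p t.

Let T0 : 0 < 2 * pi :> R.
Proof. by rewrite mulr_gt0// pi_gt0. Qed.

Let cint_integrable p : continuous p ->
  lebesgue_measure.-integrable `[0, 2 * pi] (EFin \o p).
Proof.
move=> cp; apply: continuous_compact_integrable; first exact: segment_compact.
exact: continuous_subspaceT.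
Qed.

Lemma cint_lin k p q : continuous p -> continuous q ->
  cint (fun t => k * p t + q t) = k * cint p + cint q.
Proof.
move=> cp cq; have ckp := cont_scale (k:=k) cp.
rewrite /cint -RintegralZl//; last exact: cint_integrable.
by rewrite -RintegralD//; exact: cint_integrable.
Qed.

Lemma cint_cst (c : R) : cint (fun=> c) = c * (2 * pi).
Proof.
have mE := @lebesgue_measure_itv R `[0, 2 * pi]; rewrite /= lte_fin T0 oppr0 adde0 in mE.
by rewrite /cint Rintegral_cst//; congr (_ * _); exact: (congr1 fine mE).
Qed.

Lemma cint_bound p c : continuous p -> 0 <= c ->
  (forall t, 0 <= t <= 2 * pi -> `|p t| <= c) -> `|cint p| <= c * (2 * pi).
Proof.
move=> cp c0 pc; have cnp : continuous (fun t => `|p t|).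
  move=> t; apply: (@continuous_comp _ _ _ p Num.norm); first exact: cp.
  exact: norm_continuous.
apply: (le_trans (le_normr_Rintegral _ (cint_integrable cp))) => //.
have -> : c * (2 * pi) = \int[lebesgue_measure]_(t in `[0, 2 * pi]) (cst c) t.
  exact/esym/cint_cst.
apply: le_Rintegral => //.
- exact: cint_integrable.
- by apply: cint_integrable; exact: cst_continuous.
Qed.

Lemma cint_FTC P p : continuous p ->
  (forall t, 0 <= t <= 2 * pi -> is_derive t 1 P (p t)) -> cint p = P (2 * pi) - P 0.
Proof.
move=> cp dP.
have cP t : 0 <= t <= 2 * pi -> {for t, continuous P}.
  by move=> /dP [dPt _]; apply: differentiable_continuous; apply/derivable1_diffP.
rewrite /cint /Rintegral (@continuous_FTC2 _ p P 0 (2 * pi) T0)//.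
- exact: continuous_subspaceT.
- split.
  + by move=> t; rewrite in_itv/= => /andP[t0 t1]; have [] := dP t; rewrite // !ltW.
  + by apply: cvg_at_right_filter; apply: cP; rewrite lexx ltW.
  + by apply: cvg_at_left_filter; apply: cP; rewrite lexx ltW.
- move=> t; rewrite in_itv/= => /andP[t0 t1]; rewrite derive1E.
  by have [|_ ->] := dP t; rewrite // !ltW.
Qed.

Lemma cint_functional : bounded_functional [set t : R | 0 <= t <= 2 * pi] (fun=> 1)
  [set p : R -> R | continuous p] cint (2 * pi).
Proof.
split => //.
- by move=> k p q cp cq; exact: (cont_add (cont_scale (k:=k) cp) cq).
- exact: cint_lin.
- by move=> p c c0 cp h; apply: cint_bound => // t /h; rewrite mulr1.
Qed.

Lemma cint_parts p q (dp dq : R -> R) : continuous dp -> continuous dq ->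
  (forall t : R, is_derive t 1 p (dp t)) -> (forall t : R, is_derive t 1 q (dq t)) ->
  cint (fun t => p t * dq t) =
  p (2 * pi) * q (2 * pi) - p 0 * q 0 - cint (fun t => dp t * q t).
Proof.
move=> cdp cdq ip iq.
have c1 := cont_mul (cont_is_derive ip) cdq.
have c2 := cont_mul cdp (cont_is_derive iq).
apply/eqP; rewrite eq_sym subr_eq eq_sym -[cint _ in eqbLHS]mul1r -cint_lin//; apply/eqP.
apply: (@cint_FTC (fun t => p t * q t)).
  exact: (cont_add (cont_scale (k:=1) c1) c2).
move=> t _; rewrite mul1r mulrC addrC.
have := is_deriveM (ip t) (iq t); rewrite /GRing.scale/= => H.
by apply: is_derive_eq; rewrite addrC mulrC (mulrC (dp t)).
Qed.

(** With a primitive P of the periodic function p, the increment of P over a period has derivative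
    zero, hence is the same from 0 and from tau. *)
Lemma cint_shift p tau : continuous p -> (forall t, p (t + 2 * pi) = p t) ->
  cint (fun t => p (t + tau)) = cint p.
Proof.
move=> cp per.
(* A base point to the left of both 0 and tau, so that P is differentiable wherever it is used. *)
pose a : R := - `|tau| - 1.
pose P x := \int[lebesgue_measure]_(t in `[a, x]) p t.
have dP x : a < x -> is_derive x 1 P (p x).
  move=> ax; have ip : lebesgue_measure.-integrable `[a, x + 1] (EFin \o p).
    apply: continuous_compact_integrable; first exact: segment_compact.
    exact: continuous_subspaceT.
  have x1 : x < x + 1 by rewrite ltrDl.
  have [dPx E] := continuous_FTC1_closed x1 ip ax (cp x).
  by rewrite derive1E in E; exact: (DeriveDef dPx E).
clearbody P.
have dPs s x : a < x + s -> is_derive x 1 (fun x => P (x + s)) (p (x + s)).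
  move=> axs; have ds : is_derive x 1 (fun x => x + s) 1.
    by rewrite -[X in is_derive _ _ _ X]addr0; exact: is_deriveD.
  by have := @is_derive1_comp _ P (fun x => x + s) x _ _ (dP _ axs) ds; rewrite mulr1.
have a0 : a < 0 by rewrite /a; have := normr_ge0 tau; lra.
have at0 : a < tau by rewrite /a; have := ler_norm (- tau); rewrite normrN; lra.
have cpt : continuous (fun t => p (t + tau)).
  move=> t; apply: (@continuous_comp _ _ _ (fun t => t + tau) p); last exact: cp.
  by apply: cvgD; [exact: cvg_id | exact: cvg_cst].
have -> : cint (fun t => p (t + tau)) = P (2 * pi + tau) - P (0 + tau).
  apply: (@cint_FTC (fun x => P (x + tau)) _ cpt) => t /andP[t0 _].
  by apply: dPs; rewrite ltr_wpDl.
have -> : cint p = P (2 * pi) - P 0.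
  by apply: (@cint_FTC P _ cp) => t /andP[t0 _]; exact: dP (lt_le_trans a0 t0).
pose c x := P (x + 2 * pi) - P x.
have dc x : a < x -> is_derive x 1 c 0.
  move=> ax; rewrite -(subrr (p x)) -{1}per; apply: is_deriveB; last exact: dP.
  by apply: dPs; rewrite ltr_wpDr// ltW.
suff : c tau = c 0 by rewrite /c !add0r [tau + _]addrC.
apply: derive0_cst => x tx; apply: dc; apply: lt_le_trans tx.
by rewrite lt_min at0.
Qed.

End CircleIntegral.
End CircleIntegrals.
Import CircleIntegrals.

(** * The torus acting on R^6 and its generators *)

Module TorusAction.
Section Plane.
Context {R : realType}.
Implicit Types (x y v : R6 R) (k th : 'I_3 -> R).

Definition pair_mx (p q : 'I_3 -> R) : R6 R := \matrix_(i, j) (if j == 0 then p i else q i).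

Lemma pair_mx0 p q i : pair_mx p q i 0 = p i. Proof. by rewrite mxE. Qed.
Lemma pair_mx1 p q i : pair_mx p q i 1 = q i. Proof. by rewrite mxE. Qed.

Lemma R6P x y : (forall i, x i 0 = y i 0) -> (forall i, x i 1 = y i 1) -> x = y.
Proof.
move=> h0 h1; apply/matrixP => i j.
have [->|j0] := eqVneq j 0; first exact: h0.
have -> : j = 1 by apply/val_inj; case: j j0 => -[|[|]].
exact: h1.
Qed.

Definition three (a b c : R) (l : 'I_3) : R :=
  match val l with 0%N => a | 1%N => b | _ => c end.

Lemma three0 a b c : three a b c 0 = a. Proof. by []. Qed.
Lemma three1 a b c : three a b c 1 = b. Proof. by []. Qed.
Lemma three2 a b c : three a b c ord_max = c. Proof. by []. Qed.
Definition threeE := (three0, three1, three2).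

Lemma I3P (P : 'I_3 -> Prop) : P 0 -> P 1 -> P ord_max -> forall i, P i.
Proof.
move=> h0 h1 h2 -[[|[|[|//]]] hl]; [set i := Ordinal _ | set i := Ordinal _ | set i := Ordinal _].
- by have -> : i = 0 by exact/val_inj.
- by have -> : i = 1 by exact/val_inj.
- by have -> : i = ord_max by exact/val_inj.
Qed.

Definition torus th x := pair_mx (fun i => x i 0 * cos (th i) - x i 1 * sin (th i))
  (fun i => x i 0 * sin (th i) + x i 1 * cos (th i)).

Definition torus_gen k x := pair_mx (fun i => - (k i * x i 1)) (fun i => k i * x i 0).

Definition sq x (i : 'I_3) : R := x i 0 ^+ 2 + x i 1 ^+ 2.

Lemma sq_ge0 x i : 0 <= sq x i.
Proof. by rewrite addr_ge0// sqr_ge0. Qed.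

Lemma sq_eq0 x i : (sq x i == 0) = (x i 0 == 0) && (x i 1 == 0).
Proof. by rewrite paddr_eq0 ?sqr_ge0// !sqrf_eq0. Qed.

Lemma torus_lin th : linear (torus th).
Proof. by move=> a x y; apply: R6P => i; rewrite !mxE/=; ring. Qed.

Lemma torus_gen_lin k : linear (torus_gen k).
Proof. by move=> a x y; apply: R6P => i; rewrite !mxE/=; ring. Qed.

Lemma sq_torus th x i : sq (torus th x) i = sq x i.
Proof.
rewrite /sq !mxE/=.
have /(congr1 (fun c => (x i 0 ^+ 2 + x i 1 ^+ 2) * c)) := cos2Dsin2 (th i).
by rewrite mulr1 => <-; ring.
Qed.

Lemma torusD th th' x : torus th (torus th' x) = torus (fun i => th i + th' i) x.
Proof. by apply: R6P => i; rewrite !mxE/= cosD sinD; ring. Qed.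

Lemma torusC th th' x : torus th (torus th' x) = torus th' (torus th x).
Proof. by rewrite !torusD; congr torus; apply/funext => i; rewrite addrC. Qed.

Lemma torus0 x : torus (fun=> 0) x = x.
Proof. by apply: R6P => i; rewrite !mxE/= cos0 sin0; ring. Qed.

Lemma torus_torus_gen th k x : torus th (torus_gen k x) = torus_gen k (torus th x).
Proof. by apply: R6P => i; rewrite !mxE/=; ring. Qed.

Lemma torus_2pi (e : 'I_3 -> bool) x : torus (fun i => 2 * pi * (e i)%:R) x = x.
Proof.
apply: R6P => i; rewrite !mxE/=; case: (e i); rewrite ?mulr0 ?cos0 ?sin0 ?mulr1;
  rewrite ?mulr_natl ?cos2pi ?sin2pi; ring.
Qed.

Lemma sq_cont i : continuous (fun x => sq x i).
Proof.
move=> x; apply: (@smooth_on_cts _ _ _ setT _ x _ I).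
by apply: smooth_onD; [exact: openT | |]; apply: smooth_onX; [exact: openT | exact: smooth_on_coord
  | exact: openT | exact: smooth_on_coord].
Qed.

Lemma cvg_fsum (V : normedModType R) (n : nat) (T : Type) (F : set_system T)
    (f : 'I_n -> T -> V) (l : 'I_n -> V) : Filter F ->
  (forall i, f i @ F --> l i) -> (fun t => \sum_i f i t) @ F --> \sum_i l i.
Proof.
move=> FF fl; elim: (index_enum _) => [|i s IH].
  rewrite big_nil (_ : (fun _ => _) = cst 0); first exact: cvg_cst.
  by apply/funext => t; rewrite big_nil.
rewrite big_cons (_ : (fun _ => _) = (fun t => f i t + \sum_(j <- s) f j t)).
  by apply: cvgD.
by apply/funext => t; rewrite big_cons.
Qed.

Lemma cvg_pair_mx (T : Type) (F : set_system T) (f : T -> R6 R) (l : R6 R) : Filter F ->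
  (forall i, (fun t => f t i 0) @ F --> l i 0) ->
  (forall i, (fun t => f t i 1) @ F --> l i 1) -> f @ F --> l.
Proof.
move=> FF h0 h1.
have fE (y : R6 R) : y = \sum_i (y i 0 *: delta_mx i 0 + y i 1 *: delta_mx i 1).
  have l01 : lift ord0 ord0 = 1 :> 'I_2 by exact/val_inj.
  rewrite {1}[y]matrix_sum_delta; apply: eq_bigr => i _.
  by rewrite big_ord_recl big_ord1 l01.
rewrite (_ : f = fun t => \sum_i (f t i 0 *: delta_mx i 0 + f t i 1 *: delta_mx i 1)).
  rewrite [X in _ --> X]fE; apply: cvg_fsum => i.
  by apply: cvgD; apply: cvgZr_tmp.
by apply/funext => t; rewrite -fE.
Qed.

Lemma torus_cont2 k (s0 : R) x0 :
  (fun p : R * R6 R => torus (fun i => p.1 * k i) p.2) @ nbhs (s0, x0) -->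
  torus (fun i => s0 * k i) x0.
Proof.
have hc i j : (fun p : R * R6 R => p.2 i j) @ nbhs (s0, x0) --> x0 i j.
  apply: (@cvg_comp _ _ _ snd (fun y : R6 R => y i j) _ (nbhs x0)); first exact: cvg_snd.
  exact: coord_continuous.
have ha i : (fun p : R * R6 R => p.1 * k i) @ nbhs (s0, x0) --> s0 * k i.
  by apply: cvgM; [exact: cvg_fst | exact: cvg_cst].
have hcos i : (fun p : R * R6 R => cos (p.1 * k i)) @ nbhs (s0, x0) --> cos (s0 * k i).
  by apply: (cvg_comp _ _ (ha i)); exact: continuous_cos.
have hsin i : (fun p : R * R6 R => sin (p.1 * k i)) @ nbhs (s0, x0) --> sin (s0 * k i).
  by apply: (cvg_comp _ _ (ha i)); exact: continuous_sin.
apply: cvg_pair_mx => i; rewrite /torus.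
  rewrite pair_mx0 (_ : (fun _ => _) = (fun p : R * R6 R => p.2 i 0 * cos (p.1 * k i) - p.2 i 1 * sin (p.1 * k i))).
    by apply: cvgB; apply: cvgM.
  by apply/funext => p; rewrite pair_mx0.
rewrite pair_mx1 (_ : (fun _ => _) = (fun p : R * R6 R => p.2 i 0 * sin (p.1 * k i) + p.2 i 1 * cos (p.1 * k i))).
  by apply: cvgD; apply: cvgM.
by apply/funext => p; rewrite pair_mx1.
Qed.

Lemma lin_field_smooth (L : R6 R -> R6 R) (U : set (R6 R)) : open U -> linear L -> smooth_on U L.
Proof.
move=> oU lL.
pose LM := GRing.isLinear.Build _ _ _ _ L lL.
pose L' : {linear R6 R -> R6 R} := HB.pack L LM.
apply: smooth_on_mx => // i j.
apply: (@smooth_on_eq _ _ _ _ (fun x => \sum_p x p.1 p.2 *: (L' (delta_mx p.1 p.2) i j))).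
  move=> x; rewrite -[L]/(L' : _ -> _) [in RHS](matrix_sum_delta x) pair_big linear_sum summxE.
  by apply: eq_bigr => p _; rewrite linearZ mxE.
by apply: smooth_on_sum => // p _; apply: smooth_on_Zl => //; exact: smooth_on_coord.
Qed.

Lemma derive_lin_field (L : R6 R -> R6 R) x v : linear L -> 'D_v L x = L v.
Proof.
move=> lL; have sL := lin_field_smooth openT lL.
pose LM := GRing.isLinear.Build _ _ _ _ L lL.
pose L' : {linear R6 R -> R6 R} := HB.pack L LM.
have := @smooth_on_cts _ _ _ _ _ 0 sL I.
move=> c0; rewrite deriveE; last exact: smooth_on_diff sL I.
have -> : 'd L x = 'd L' x by [].
rewrite diff_lin//.
by move=> y; apply: (@smooth_on_cts _ _ _ setT).
Qed.

End Plane.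
End TorusAction.
Import TorusAction.

(** * Averages along circle orbits near Y *)

Module TorusAverage.
Section Averaging.
Context {R : realType}.
Variable alpha : R.
Hypothesis alpha_gt0 : 0 < alpha.
Implicit Types (x y v : R6 R) (k : 'I_3 -> R) (F : R6 R -> R).

Definition Nf x : R := sq x 0 + alpha * sq x 1.

(** An open neighbourhood of Y on which [rho] retracts onto Y. Functions are kept on it, rather than
    on Y, so that derivatives in all directions of R^6 make sense; it is invariant under the torus,
    so that orbits and averages stay inside. *)
Definition dom : set (R6 R) := [set x | 0 < Nf x /\ 0 < sq x ord_max].

Lemma Nf_smooth (U : set (R6 R)) : open U -> smooth_on U Nf.
Proof.
have sqs i (V : set (R6 R)) : open V -> smooth_on V (sq^~ i).
  by move=> oV; apply: smooth_onD => //; apply: smooth_onX => //; exact: smooth_on_coord.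
move=> oU; apply: smooth_onD; [by []| exact: sqs|].
by apply: smooth_onM; [by [] | exact: smooth_on_cst | exact: sqs].
Qed.

Lemma dom_open : open dom.
Proof.
have -> : dom = Nf @^-1` [set t | 0 < t] `&` (fun x => sq x ord_max) @^-1` [set t | 0 < t] by [].
apply: openI.
  apply: open_comp; last exact: open_gt.
  by move=> x _; apply: (@smooth_on_cts _ _ _ setT _ x _ I); apply: Nf_smooth; exact: openT.
apply: open_comp; last exact: open_gt.
by move=> x _; exact: sq_cont.
Qed.

Lemma dom_torus th x : dom (torus th x) <-> dom x.
Proof. by rewrite /dom /= /Nf !sq_torus. Qed.

Local Notation orb k s x := (torus (fun i => s * k i) x).

Lemma orb_is_derive k (s : R) x : is_derive s (1 : R) (fun s : R => orb k s x) (torus_gen k (orb k s x)).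
Proof.
have e0 i : is_derive s (1 : R) (fun s => orb k s x i 0) (torus_gen k (orb k s x) i 0).
  rewrite (_ : (fun _ => _) = (fun s => x i 0 * cos (s * k i) - x i 1 * sin (s * k i))); last first.
    by apply/funext => t; rewrite mxE.
  rewrite /torus_gen /torus !mxE /=.
  apply: is_derive_eq; rewrite /GRing.scale /=; ring.
have e1 i : is_derive s (1 : R) (fun s => orb k s x i 1) (torus_gen k (orb k s x) i 1).
  rewrite (_ : (fun _ => _) = (fun s => x i 0 * sin (s * k i) + x i 1 * cos (s * k i))); last first.
    by apply/funext => t; rewrite mxE.
  rewrite /torus_gen /torus !mxE /=.
  apply: is_derive_eq; rewrite /GRing.scale /=; ring.
have j01 (j : 'I_2) : j = 0 \/ j = 1.
  by case: j => -[|[|//]] j; [left|right]; exact/val_inj.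
have d : derivable (fun s : R => orb k s x) s (1 : R).
  apply/derivable_mxP => i j.
  by have [->|->] := j01 j; [have [] := e0 i | have [] := e1 i].
apply: DeriveDef => //; rewrite derive_mx//; apply/matrixP => i j; rewrite mxE.
by have [->|->] := j01 j; [have [_] := e0 i | have [_] := e1 i].
Qed.

Lemma orb_differentiable k (s : R) x : differentiable (fun s : R => orb k s x) s.
Proof. by apply/derivable1_diffP; have [] := orb_is_derive k s x. Qed.

Lemma orbit_is_derive k (s : R) x F : differentiable F (orb k s x) ->
  is_derive s (1 : R) (fun s => F (orb k s x)) ('D_(torus_gen k (orb k s x)) F (orb k s x)).
Proof.
move=> dF; have dc := orb_differentiable k s x.
apply: DeriveDef; first exact: diff_derivable (differentiable_comp dc dF).
have -> := @derive_comp _ _ _ _ (fun s : R => orb k s x) F s 1 dc dF.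
by have [_ ->] := orb_is_derive k s x.
Qed.

Lemma orbit_cont k x F : smooth_on dom F -> dom x -> continuous (fun s : R => F (orb k s x)).
Proof.
move=> sF dx s; apply: differentiable_continuous.
apply: (differentiable_comp (orb_differentiable k s x)).
by apply: smooth_on_diff sF _; apply/dom_torus.
Qed.

(** Joint continuity gives the bound near each pair (s, x); compactness of the interval of
    parameters s yields a single neighbourhood of x. *)
Lemma orbit_bounded k x F : smooth_on dom F -> dom x ->
  exists c : R, \forall y \near x, forall s : R, 0 <= s <= 2 * pi -> `|F (orb k s y)| <= c.
Proof.
move=> sF dx.
have cont2 (s0 : R) : {for (s0, x), continuous (fun p : R * R6 R => F (orb k p.1 p.2))}.
  have cF : {for orb k s0 x, continuous F}.
    by apply: smooth_on_cts sF _; apply/dom_torus.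
  exact: (@continuous_comp _ _ _ (fun p : R * R6 R => orb k p.1 p.2) F (s0, x)
    (torus_cont2 (k := k) (s0 := s0) (x0 := x)) cF).
have [M [_ HM]] : bounded_set [set F (orb k s x) | s in `[(0 : R), 2 * pi]].
  apply: compact_bounded; apply: continuous_compact; last exact: segment_compact.
  by apply: continuous_subspaceT; exact: orbit_cont.
have /compact_near_coveringP cov := @segment_compact R 0 (2 * pi).
have h : \forall y \near x, `[(0 : R), 2 * pi] `<=` (fun s => `|F (orb k s y)| < `|F (orb k s x)| + 1).
  apply: (cov _ (nbhs x) (fun y s => `|F (orb k s y)| < `|F (orb k s x)| + 1) _) => s0 _.
  have e2 : 0 < (2^-1 : R) by [].
  have /cvgrPdist_lt /(_ _ e2) n1 := cont2 s0.
  have /cvgrPdist_lt /(_ _ e2) n2 := @orbit_cont k x F sF dx s0.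
  apply: filterS (filterI n1 (cvg_fst n2)) => -[s y] /= [h1 h2].
  rewrite distrC in h1.
  have h3 := ler_normD (F (orb k s y) - F (orb k s x)) (F (orb k s x)).
  have h4 := ler_normD (F (orb k s y) - F (orb k s0 x)) (F (orb k s0 x) - F (orb k s x)).
  rewrite subrK in h3; rewrite addrA subrK in h4.
  apply: (le_lt_trans h3); rewrite addrC ltrD2l; apply: (le_lt_trans h4).
  by rewrite (_ : 1 = 2^-1 + 2^-1 :> R) ?ltrD//; field.
exists (M + 1 + 1).
near=> y => s s02.
have sI : `[(0 : R), 2 * pi]%classic s by rewrite /= in_itv.
have hy : `[(0 : R), 2 * pi] `<=` (fun s => `|F (orb k s y)| < `|F (orb k s x)| + 1).
  by near: y.
apply: (le_trans (ltW (hy _ sI))); rewrite lerD2r.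
by apply: (HM (M + 1)); [rewrite ltrDl | exists s].
Unshelve. all: by end_near. Qed.

(** The smallest class that contains the integrands K s F(orbit) and is closed under derivation: a
    derivative along v moves v along the orbit, and the entries of the rotated vector are continuous
    functions of s that are absorbed in K. *)
Inductive orbit_family k : (R6 R -> R -> R) -> Prop :=
| orbit_family0 : orbit_family k (fun _ _ => 0)
| orbit_familyD (K : R -> R) F (H : R6 R -> R -> R) : continuous K -> smooth_on dom F ->
    orbit_family k H -> orbit_family k (fun x s => K s * F (orb k s x) + H x s).

Definition orbit_class k : set (R6 R -> R -> R) :=
  [set H | exists2 H', orbit_family k H' & forall x s, dom x -> H x s = H' x s].

Lemma orbit_term_smooth k s F : smooth_on dom F -> smooth_on dom (fun x => F (orb k s x)).
Proof.
move=> sF; apply: (@smooth_on_compM _ _ _ _ dom) => //; first exact: dom_open.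
  by move=> x dx; apply/dom_torus.
by apply: lin_field_smooth; [exact: dom_open | exact: torus_lin].
Qed.

Lemma orbit_term_derive k s F x v : smooth_on dom F -> dom x ->
  'D_v (fun x => F (orb k s x)) x = 'D_(orb k s v) F (orb k s x).
Proof.
move=> sF dx.
have sr : smooth_on setT (fun y : R6 R => orb k s y).
  by apply: lin_field_smooth; [exact: openT | exact: torus_lin].
have -> := @derive_comp _ _ _ _ (fun y => orb k s y) F x v (smooth_on_diff sr I) _; last first.
  by apply: smooth_on_diff sF _; apply/dom_torus.
by rewrite derive_lin_field//; exact: torus_lin.
Qed.

Lemma orbit_family_smooth k H : orbit_family k H -> forall s, smooth_on dom (H^~ s).
Proof.
elim=> [s|K F H' cK sF _ IH s]; first exact: smooth_on_cst.
apply: smooth_onD; [exact: dom_open| |exact: IH].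
by apply: smooth_onM; [exact: dom_open|exact: smooth_on_cst|exact: orbit_term_smooth].
Qed.

Lemma orbit_family_add k H1 H2 : orbit_family k H1 -> orbit_family k H2 ->
  orbit_family k (fun x s => H1 x s + H2 x s).
Proof.
move=> oH1 oH2; elim: oH1 => [|K F H' cK sF _ IH].
  by have := oH2; congr orbit_family; apply/funext => x; apply/funext => s; rewrite add0r.
have := orbit_familyD cK sF IH; congr orbit_family.
by apply/funext => x; apply/funext => s; rewrite addrA.
Qed.

Lemma orbit_family_D k v H : orbit_family k H -> orbit_class k (fun x s => 'D_v (H^~ s) x).
Proof.
elim=> [|K F H' cK sF oH' [H'' oH'' H''E]].
  by exists (fun _ _ => 0); [exact: orbit_family0 | move=> x s _; rewrite derive_cst].
have term : orbit_family k (fun x s => \sum_(p : 'I_3 * 'I_2)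
    K s * orb k s v p.1 p.2 * 'D_(delta_mx p.1 p.2) F (orb k s x)).
  elim: (index_enum _) => [|p r IH].
    have := orbit_family0 k; congr orbit_family.
    by apply/funext => x; apply/funext => s; rewrite big_nil.
  have cp : continuous (fun s => K s * orb k s v p.1 p.2).
    apply: cont_mul => // s.
    apply: (@cvg_comp _ _ _ (fun s : R => orb k s v) (fun y : R6 R => y p.1 p.2)).
      exact: differentiable_continuous (orb_differentiable k s v).
    exact: coord_continuous.
  have := orbit_familyD cp (smooth_on_D (delta_mx p.1 p.2) sF) IH.
  congr orbit_family.
  by apply/funext => x; apply/funext => s; rewrite big_cons.
exists (fun x s => \sum_(p : 'I_3 * 'I_2)
    K s * orb k s v p.1 p.2 * 'D_(delta_mx p.1 p.2) F (orb k s x) + H'' x s).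
  exact: orbit_family_add.
move=> x s dx; rewrite -H''E//.
have st := smooth_on_diff (orbit_term_smooth k s sF) dx.
have sH := smooth_on_diff (orbit_family_smooth oH' s) dx.
have -> := @deriveD _ _ _ (fun x => K s * F (orb k s x)) (H'^~ s) x v
  (diff_derivable (differentiableZ (K s) st)) (diff_derivable sH).
congr (_ + _).
have -> := @deriveZ _ _ _ (fun x => F (orb k s x)) (K s) x v (diff_derivable st).
rewrite orbit_term_derive// derive_sum_coord; last first.
  by apply: smooth_on_diff sF _; apply/dom_torus.
rewrite pair_big [LHS]mulr_sumr.
by apply: eq_bigr => p _; rewrite mulrA.
Qed.

Lemma orbit_class_D k v H : orbit_class k H -> orbit_class k (fun x s => 'D_v (H^~ s) x).
Proof.
move=> [H' oH' HE]; have [H'' oH'' H''E] := orbit_family_D v oH'.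
exists H'' => // x s dx; rewrite -H''E//.
by apply: (derive_near_eq v dom_open dx) => y dy; exact: HE.
Qed.

Lemma orbit_family_cont k H x : orbit_family k H -> dom x -> continuous (H x).
Proof.
move=> oH dx; elim: oH => [|K F H' cK sF _ IH]; first exact: cst_continuous.
by apply: cont_add => //; apply: cont_mul => //; exact: orbit_cont.
Qed.

Lemma orbit_family_bounded k H x : orbit_family k H -> dom x ->
  exists c : R, \forall y \near x, forall s : R, 0 <= s <= 2 * pi -> `|H y s| <= c.
Proof.
move=> oH dx; elim: oH => [|K F H' cK sF _ [c' IH]].
  by exists 0; near=> y => s _; rewrite normr0.
have [c hc] := orbit_bounded k sF dx.
have [M [_ HM]] : bounded_set [set K s | s in `[(0 : R), 2 * pi]].
  apply: compact_bounded; apply: continuous_compact; last exact: segment_compact.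
  exact: continuous_subspaceT.
exists ((M + 1) * c + c'); near=> y => s hs.
have Fy : forall s : R, 0 <= s <= 2 * pi -> `|F (orb k s y)| <= c by near: y.
have Hy : forall s : R, 0 <= s <= 2 * pi -> `|H' y s| <= c' by near: y.
rewrite (le_trans (ler_normD _ _))// lerD ?Hy// normrM ler_pM ?Fy//.
by apply: (HM (M + 1)); [rewrite ltrDl | exists s => //=; rewrite in_itv].
Unshelve. all: by end_near. Qed.

Definition avg k (K : R -> R) F x := cint (fun s => K s * F (orb k s x)).

Let avg_class k (K : R -> R) F : continuous K -> smooth_on dom F ->
  orbit_class k (fun x s => K s * F (orb k s x)).
Proof.
move=> cK sF; exists (fun x s => K s * F (orb k s x) + 0).
  exact: (orbit_familyD cK sF (orbit_family0 k)).
by move=> x s _; rewrite addr0.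
Qed.

Let class_smooth k H : orbit_class k H -> forall s, smooth_on dom (H^~ s).
Proof.
move=> [H' oH' HE] s; apply: (smooth_on_near_eq dom_open (f := H'^~ s)).
  by move=> y dy; rewrite HE.
exact: (orbit_family_smooth oH' s).
Qed.

Let class_cont k H x : orbit_class k H -> dom x -> [set p : R -> R | continuous p] (H x).
Proof.
move=> [H' oH' HE] dx /=.
rewrite (_ : H x = H' x); first exact: orbit_family_cont oH' dx.
by apply/funext => s; rewrite HE.
Qed.

Let class_bounded k H x : orbit_class k H -> dom x -> exists c : R,
  \forall y \near x, forall s, [set t : R | 0 <= t <= 2 * pi] s -> `|H y s| <= c * 1.
Proof.
move=> [H' oH' HE] dx; have [c hc] := orbit_family_bounded oH' dx.
have dn : \forall y \near x, dom y by apply: open_nbhs_nbhs; split => //; exact: dom_open.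
exists c; apply: filterS2 dn hc => y dy hy s hs.
by rewrite mulr1 HE// hy.
Qed.

Lemma avg_smooth k (K : R -> R) F : continuous K -> smooth_on dom F ->
  smooth_on dom (avg k K F).
Proof.
move=> cK sF.
exact: (superposition_smooth (@cint_functional R) dom_open
  (@class_smooth k) (@class_cont k) (@class_bounded k) (fun H v => @orbit_class_D k v H)
  (avg_class k cK sF)).
Qed.

Lemma avg_derive k (K : R -> R) F x v : continuous K -> smooth_on dom F -> dom x ->
  'D_v (avg k K F) x = cint (fun s => K s * 'D_(orb k s v) F (orb k s x)).
Proof.
move=> cK sF dx.
have -> := superposition_derive (@cint_functional R) dom_open
  (@class_smooth k) (@class_cont k) (@class_bounded k) (fun H v => @orbit_class_D k v H)
  v (avg_class k cK sF) dx.
congr cint; apply/funext => s.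
have st := smooth_on_diff (orbit_term_smooth k s sF) dx.
have -> := @deriveZ _ _ _ (fun x => F (orb k s x)) (K s) x v (diff_derivable st).
by rewrite orbit_term_derive.
Qed.

Definition lie (L : R6 R -> R6 R) F x : R := 'D_(L x) F x.

Lemma lie_smooth (L : R6 R -> R6 R) F (U : set (R6 R)) : open U -> linear L ->
  smooth_on U F -> smooth_on U (lie L F).
Proof.
move=> oU lL sF.
apply: (@smooth_on_near_eq _ _ _ _ (fun x => \sum_i \sum_j L x i j * 'D_(delta_mx i j) F x)) => //.
  by move=> x Ux; rewrite /lie derive_sum_coord//; exact: smooth_on_diff sF Ux.
apply: smooth_on_sum => // i _; apply: smooth_on_sum => // j _.
apply: smooth_onM => //; last exact: smooth_on_D.
by apply: smooth_on_entry => //; exact: lin_field_smooth.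
Qed.

Lemma avg_lie k (K : R -> R) F (L : R6 R -> R6 R) x : continuous K -> smooth_on dom F ->
  dom x -> (forall s y, orb k s (L y) = L (orb k s y)) ->
  lie L (avg k K F) x = avg k K (lie L F) x.
Proof.
move=> cK sF dx LC; rewrite /lie (avg_derive _ _ cK sF dx).
by congr cint; apply/funext => s; rewrite LC.
Qed.

Lemma avg_comm k l (K : R -> R) F x : avg k K F (torus l x) = avg k K (fun y => F (torus l y)) x.
Proof.
by rewrite /avg; congr cint; apply/funext => s; rewrite torusC.
Qed.

Lemma avg_cint_lie k F x : smooth_on dom F -> dom x ->
  avg k (fun=> 1) (lie (torus_gen k) F) x = F (orb k (2 * pi) x) - F x.
Proof.
move=> sF dx.
have -> : F x = F (orb k 0 x).
  by rewrite -{1}[x]torus0; congr F; congr torus; apply/funext => i; rewrite mul0r.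
have sl : smooth_on dom (lie (torus_gen k) F).
  by apply: lie_smooth => //; [exact: dom_open | exact: torus_gen_lin].
have c1 : continuous (fun s : R => 1 * lie (torus_gen k) F (orb k s x)).
  by apply: cont_mul; [exact: cst_continuous | exact: orbit_cont].
apply: (@cint_FTC _ (fun s => F (orb k s x)) _ c1).
move=> t _; rewrite mul1r; apply: orbit_is_derive.
by apply: smooth_on_diff sF _; apply/dom_torus.
Qed.

End Averaging.
End TorusAverage.
Import TorusAverage.

(** * Derivatives along linear fields, and the brackets of the frame *)

Module LieDerivatives.
Section LieDerivative.
Context {R : realType}.
Implicit Types (x v : R6 R) (f g : R6 R -> R) (L M : R6 R -> R6 R) (U : set (R6 R)).

Lemma derive_lie M f x v U : open U -> U x -> linear M -> smooth_on U f ->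
  'D_v (lie M f) x = 'D_(M v) f x + 'D_v (fun y => 'D_(M x) f y) x.
Proof.
move=> oU Ux lM sf.
have sM := lin_field_smooth oU lM.
have E1 w y : U y -> 'D_w f y = \sum_(p : 'I_3 * 'I_2) w p.1 p.2 * 'D_(delta_mx p.1 p.2) f y.
  by move=> Uy; rewrite derive_sum_coord ?pair_big//; exact: smooth_on_diff sf Uy.
have dp p : differentiable (fun y => 'D_(delta_mx p.1 p.2) f y) x.
  by apply: (smooth_on_diff (smooth_on_D _ sf) Ux).
have dM p : differentiable (fun y => M y p.1 p.2) x.
  by apply: (smooth_on_diff _ Ux); apply: smooth_on_entry.
rewrite (derive_near_eq v oU Ux (fun y Uy => E1 (M y) y Uy)).
rewrite (derive_near_eq v oU Ux (fun y Uy => E1 (M x) y Uy)).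
have [_ ->] := @derive_lincomb _ _ _ (index_enum _) (fun p : 'I_3 * 'I_2 => M x p.1 p.2)
   (fun p y => 'D_(delta_mx p.1 p.2) f y) x v dp.
have [_] := @derive_lincomb _ _ _ (index_enum _) (fun p : 'I_3 * 'I_2 => 1)
   (fun p y => M y p.1 p.2 * 'D_(delta_mx p.1 p.2) f y) x v
   (fun p => differentiableM (dM p) (dp p)).
rewrite (_ : (fun y => \sum_p 1 * _) = (fun y => \sum_p M y p.1 p.2 * 'D_(delta_mx p.1 p.2) f y)); last first.
  by apply/funext => y; apply: eq_bigr => p _; rewrite mul1r.
move=> ->; rewrite (E1 (M v) x Ux) -big_split; apply: eq_bigr => p _ /=.
rewrite mul1r (deriveMf v (dM p) (dp p)) addrC; congr (_ + _).
rewrite -(derive_entry (M := M) v p.1 p.2) ?derive_lin_field// 1?mulrC//.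
exact: smooth_on_diff sM Ux.
Qed.

(** The pure second derivatives cancel by symmetry; what remains comes from differentiating one
    linear field along the other, that is from their bracket. *)
Lemma lie_comm L M f x U : open U -> U x -> linear L -> linear M -> smooth_on U f ->
  lie L (lie M f) x - lie M (lie L f) x = 'D_(M (L x) - L (M x)) f x.
Proof.
move=> oU Ux lL lM sf; have df := smooth_on_diff sf Ux.
rewrite {1}/lie (derive_lie _ oU Ux lM sf) {1}/lie (derive_lie _ oU Ux lL sf).
rewrite (derive_sym (L x) (M x) oU Ux sf).
have -> : M (L x) - L (M x) = -1 *: L (M x) + M (L x) by rewrite scaleN1r addrC.
by rewrite (derive_lin _ _ _ df) scaleN1r; ring.
Qed.

Lemma lieD L f g x : differentiable f x -> differentiable g x ->
  lie L (fun y => f y + g y) x = lie L f x + lie L g x.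
Proof. by move=> df dg; rewrite /lie (deriveD (diff_derivable df) (diff_derivable dg)). Qed.

Lemma lieB L f g x : differentiable f x -> differentiable g x ->
  lie L (fun y => f y - g y) x = lie L f x - lie L g x.
Proof. by move=> df dg; rewrite /lie (deriveB (diff_derivable df) (diff_derivable dg)). Qed.

Lemma lieM L f g x : differentiable f x -> differentiable g x ->
  lie L (fun y => f y * g y) x = f x * lie L g x + g x * lie L f x.
Proof. exact: deriveMf. Qed.

Lemma lieZ L (k : R) f x : differentiable f x ->
  lie L (fun y => k * f y) x = k * lie L f x.
Proof. by move=> df; exact: (deriveZ k (diff_derivable df)). Qed.

Lemma lie_near_eq L f g x U : open U -> U x -> (forall y, U y -> f y = g y) ->
  lie L f x = lie L g x.
Proof. by move=> oU Ux; exact: derive_near_eq. Qed.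

End LieDerivative.

Section FrameCalculus.
Context {R : realType}.
Variable alpha : R.
Implicit Types (x v : R6 R) (b c W : nat -> R6 R -> R).

(* Left-invariant fields of S^3 x S^1 (in the coordinates that turn the
   ellipsoid into a sphere): for z = (z1, z2, z3) in C^3 they are (i z1, i z2, 0),
   (- alpha conj z2, conj z1, 0), its product by i, and (0, 0, i z3).
   Indices run from 1 to 4. *)
Definition frame (i : nat) x : R6 R :=
  match i with
  | 1%N => torus_gen (three 1 1 0) x
  | 2%N => pair_mx (three (- (alpha * x 1 0)) (x 0 0) 0) (three (alpha * x 1 1) (- x 0 1) 0)
  | 3%N => pair_mx (three (- (alpha * x 1 1)) (x 0 1) 0) (three (- (alpha * x 1 0)) (x 0 0) 0)
  | _ => torus_gen (three 0 0 1) x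
  end.

Lemma frame_lin i : linear (frame i).
Proof.
case: i => [|[|[|[|i]]]] a x y; try exact: torus_gen_lin.
  by apply: R6P; apply: I3P; rewrite /frame /torus_gen !(mxE, pair_mx0, pair_mx1, threeE) /=; ring.
by apply: R6P; apply: I3P; rewrite /frame /torus_gen !(mxE, pair_mx0, pair_mx1, threeE) /=; ring.
Qed.

(** The value of the 1-form b on the bracket of [frame i] and [frame j]; the constants are those of
    [frame_bracket]. *)
Definition structure (i j : nat) b x : R :=
  match i, j with
  | 1%N, 2%N => - 2 * b 3%N x
  | 2%N, 1%N => 2 * b 3%N x
  | 1%N, 3%N => 2 * b 2%N x
  | 3%N, 1%N => - 2 * b 2%N x
  | 2%N, 3%N => - 2 * alpha * b 1%N x
  | 3%N, 2%N => 2 * alpha * b 1%N x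
  | _, _ => 0
  end.

Lemma frame_bracket i j x : (0 < i <= 4)%N -> (0 < j <= 4)%N ->
  frame j (frame i x) - frame i (frame j x) =
  match i, j with
  | 1%N, 2%N => - 2 *: frame 3 x
  | 2%N, 1%N => 2 *: frame 3 x
  | 1%N, 3%N => 2 *: frame 2 x
  | 3%N, 1%N => - 2 *: frame 2 x
  | 2%N, 3%N => (- 2 * alpha) *: frame 1 x
  | 3%N, 2%N => (2 * alpha) *: frame 1 x
  | _, _ => 0
  end.
Proof.
case: i => [|[|[|[|[|//]]]]] //; case: j => [|[|[|[|[|//]]]]] // _ _;
  apply: R6P; apply: I3P; rewrite /frame /torus_gen !(mxE, pair_mx0, pair_mx1, threeE) /=; ring.
Qed.

End FrameCalculus.
End LieDerivatives.
Import LieDerivatives.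

(** * Exterior calculus in the frame *)

Module FrameForms.
Ltac smooth := repeat match goal with
  | |- smooth_on _ (fun x => @?f x - @?g x) => apply: (@smooth_onB _ _ _ _ f g); [by []| |]
  | |- smooth_on _ (fun x => @?f x + @?g x) => apply: (@smooth_onD _ _ _ _ f g); [by []| |]
  | |- smooth_on _ (fun x => @?f x * @?g x) => apply: (@smooth_onM _ _ _ f g); [by []| |]
  | |- smooth_on _ (fun x => - @?f x) => apply: (@smooth_onN _ _ _ _ f); [by []|]
  | |- smooth_on _ (fun _ => ?c) => exact: smooth_on_cst
  end.

Ltac generalize_at x := repeat match goal with
  | |- context [lie ?L ?f x] => generalize (lie L f x); intro
  | |- context [?b ?k x] => is_var b; generalize (b k x); intro
  end.

Section ExteriorCalculus.
Context {R : realType}.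
Variable alpha : R.
Implicit Types (x v : R6 R) (b c W : nat -> R6 R -> R) (B C : nat -> nat -> R).

Local Notation D i f x := (lie (frame alpha i) f x).

(* [b i] stands for the value of a 1-form on [frame i]; [dfr b i j] for the value
   of its exterior derivative on [frame i] and [frame j]. *)
Definition dfr b (i j : nat) x : R := D i (b j) x - D j (b i) x - structure alpha i j b x.

(** The value of the 4-form B /\ C on the frame, that is the polarized Pfaffian, written with the
    entries above the diagonal. *)
Definition pf B C : R :=
  B 1%N 2%N * C 3%N 4%N - B 1%N 3%N * C 2%N 4%N + B 1%N 4%N * C 2%N 3%N + B 2%N 3%N * C 1%N 4%N - B 2%N 4%N * C 1%N 3%N + B 3%N 4%N * C 1%N 2%N.

Definition iprod W (B : nat -> nat -> R6 R -> R) (j : nat) x : R :=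
  W 1%N x * B 1%N j x + W 2%N x * B 2%N j x + W 3%N x * B 3%N j x + W 4%N x * B 4%N j x.

Definition dfr_at b x i j := dfr b i j x.

Definition smooth_coef (U : set (R6 R)) b := forall i, smooth_on U (b i).

Variable U : set (R6 R).
Hypothesis oU : open U.

Lemma dfr_smooth b i j : smooth_coef U b -> smooth_on U (dfr b i j).
Proof.
move=> sb.
have sl k f : smooth_on U f -> smooth_on U (lie (frame alpha k) f).
  by move=> sf; apply: lie_smooth => //; exact: frame_lin.
apply: smooth_onB => //; first by apply: smooth_onB => //; apply: sl.
have sc k (a : R) : smooth_on U (fun x => a * b k x).
  by apply: smooth_onM => //; exact: smooth_on_cst.
by case: i => [|[|[|[|i]]]]; case: j => [|[|[|[|j]]]]; rewrite /structure;
  try exact: smooth_on_cst; exact: sc.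
Qed.

Lemma iprod_smooth W (B : nat -> nat -> R6 R -> R) j : smooth_coef U W ->
  (forall i, smooth_on U (B i j)) -> smooth_on U (iprod W B j).
Proof. by move=> sW sB; rewrite /iprod; smooth; exact: sW || exact: sB. Qed.

Lemma pf_smooth b c : smooth_coef U b -> smooth_coef U c ->
  smooth_on U (fun x => pf (dfr_at b x) (dfr_at c x)).
Proof.
move=> sb sc; rewrite /pf /dfr_at.
by smooth; exact: dfr_smooth.
Qed.

Lemma dfr_anti b i j x : (0 < i <= 4)%N -> (0 < j <= 4)%N -> dfr b i j x = - dfr b j i x.
Proof.
by case: i => [|[|[|[|[|//]]]]] //; case: j => [|[|[|[|[|//]]]]] // _ _; rewrite /dfr /structure; ring.
Qed.

Lemma frame_comm i j f x : (0 < i <= 4)%N -> (0 < j <= 4)%N -> smooth_on U f -> U x ->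
  D i (lie (frame alpha j) f) x - D j (lie (frame alpha i) f) x =
  structure alpha i j (fun k => lie (frame alpha k) f) x.
Proof.
move=> hi hj sf Ux; rewrite (lie_comm oU Ux (@frame_lin R alpha i) (@frame_lin R alpha j) sf).
rewrite (frame_bracket alpha x hi hj).
have df := smooth_on_diff sf Ux.
have Z (k : R) w : 'D_(k *: w) f x = k * 'D_w f x.
  by rewrite -[k *: w]addr0 (derive_lin _ _ _ df) derive0 addr0.
by case: i hi => [|[|[|[|[|//]]]]] // _; case: j hj => [|[|[|[|[|//]]]]] // _;
  rewrite /structure /lie ?derive0 ?Z.
Qed.

Section Leibniz.
Variables (b : nat -> R6 R -> R) (x : R6 R).
Hypotheses (sb : smooth_coef U b) (Ux : U x).

Let sl k f : smooth_on U f -> smooth_on U (lie (frame alpha k) f).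
Proof. by move=> sf; apply: lie_smooth => //; exact: frame_lin. Qed.

Let Ddfr k i j : D k (dfr b i j) x = D k (lie (frame alpha i) (b j)) x
  - D k (lie (frame alpha j) (b i)) x - D k (structure alpha i j b) x.
Proof.
have d1 l m : differentiable (lie (frame alpha l) (b m)) x.
  by apply: smooth_on_diff (sl l (sb m)) Ux.
have ds : differentiable (structure alpha i j b) x.
  apply: (@smooth_on_diff _ _ _ U _ _ _ Ux).
  have sc l (a : R) : smooth_on U (fun x => a * b l x).
    by apply: smooth_onM => //; exact: smooth_on_cst.
  by case: i => [|[|[|[|i']]]]; case: j => [|[|[|[|j']]]]; rewrite /structure;
  try exact: smooth_on_cst; exact: sc.
by rewrite (lieB _ (differentiableB (d1 i j) (d1 j i)) ds) (lieB _ (d1 i j) (d1 j i)).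
Qed.

Let Dstr k l (a : R) : D k (fun y => a * b l y) x = a * D k (b l) x.
Proof. by rewrite lieZ//; exact: smooth_on_diff (sb l) Ux. Qed.

Let D0 k : D k (fun=> 0) x = 0.
Proof. by rewrite /lie derive_cst. Qed.

(** This and the next three lemmas are the components of d (d b) = 0: the commutators of second
    derivatives are replaced by structure terms through [frame_comm], and the rest cancels. *)
Lemma dfr_closed123 : D 1 (dfr b 2%N 3%N) x = D 2 (dfr b 1%N 3%N) x - D 3 (dfr b 1%N 2%N) x.
Proof.
have := frame_comm (i := 1) (j := 2) isT isT (sb 3%N) Ux.
have := frame_comm (i := 1) (j := 3) isT isT (sb 2%N) Ux.
have := frame_comm (i := 2) (j := 3) isT isT (sb 1%N) Ux.
by rewrite !Ddfr /structure !Dstr; generalize_at x; lra.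
Qed.

Lemma dfr_closed124 : D 1 (dfr b 2%N 4%N) x = D 2 (dfr b 1%N 4%N) x - D 4 (dfr b 1%N 2%N) x - 2 * dfr b 3%N 4%N x.
Proof.
have := frame_comm (i := 1) (j := 2) isT isT (sb 4%N) Ux.
have := frame_comm (i := 1) (j := 4) isT isT (sb 2%N) Ux.
have := frame_comm (i := 2) (j := 4) isT isT (sb 1%N) Ux.
by rewrite !Ddfr /dfr /structure !Dstr !D0; generalize_at x; lra.
Qed.

Lemma dfr_closed134 : D 1 (dfr b 3%N 4%N) x = D 3 (dfr b 1%N 4%N) x - D 4 (dfr b 1%N 3%N) x + 2 * dfr b 2%N 4%N x.
Proof.
have := frame_comm (i := 1) (j := 3) isT isT (sb 4%N) Ux.
have := frame_comm (i := 1) (j := 4) isT isT (sb 3%N) Ux.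
have := frame_comm (i := 3) (j := 4) isT isT (sb 1%N) Ux.
by rewrite !Ddfr /dfr /structure !Dstr !D0; generalize_at x; lra.
Qed.

Lemma dfr_closed234 : D 2 (dfr b 3%N 4%N) x = D 3 (dfr b 2%N 4%N) x - D 4 (dfr b 2%N 3%N) x
  - 2 * alpha * dfr b 1%N 4%N x.
Proof.
have := frame_comm (i := 2) (j := 3) isT isT (sb 4%N) Ux.
have := frame_comm (i := 2) (j := 4) isT isT (sb 3%N) Ux.
have := frame_comm (i := 3) (j := 4) isT isT (sb 2%N) Ux.
by rewrite !Ddfr /dfr /structure !Dstr !D0; generalize_at x => h1 h2 h3; nra.
Qed.

End Leibniz.

(* The Lie derivative along [W] of the product of two closed 2-forms:
   L_W (beta /\ gamma) = d (i_W beta) /\ gamma + beta /\ d (i_W gamma)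
   is the divergence of the 4-form times W. *)
Lemma pf_lie b c W x : smooth_coef U b -> smooth_coef U c -> smooth_coef U W -> U x ->
  pf (dfr_at (iprod W (dfr b)) x) (dfr_at c x) + pf (dfr_at b x) (dfr_at (iprod W (dfr c)) x) =
  D 1 (fun y => W 1%N y * pf (dfr_at b y) (dfr_at c y)) x +
  D 2 (fun y => W 2%N y * pf (dfr_at b y) (dfr_at c y)) x +
  D 3 (fun y => W 3%N y * pf (dfr_at b y) (dfr_at c y)) x +
  D 4 (fun y => W 4%N y * pf (dfr_at b y) (dfr_at c y)) x.
Proof.
move=> sb sc sW Ux.
have dd e i j : smooth_coef U e -> differentiable (dfr e i j) x.
  by move=> se; apply: smooth_on_diff (dfr_smooth i j se) Ux.
have dW i : differentiable (W i) x by exact: smooth_on_diff (sW i) Ux.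
have dM e i l m : smooth_coef U e -> differentiable (fun y => W i y * dfr e l m y) x.
  by move=> se; exact: differentiableM (dW i) (dd e l m se).
have DM k e i l m : smooth_coef U e -> D k (fun y => W i y * dfr e l m y) x =
    W i x * D k (dfr e l m) x + dfr e l m x * D k (W i) x.
  by move=> se; rewrite (lieM _ (dW i) (dd e l m se)).
have anti e i j y : (0 < i <= 4)%N -> (0 < j <= 4)%N -> dfr e i j y = - dfr e j i y.
  by move=> hi hj; exact: dfr_anti.
have diag e i y : (0 < i <= 4)%N -> dfr e i i y = 0.
  by case: i => [|[|[|[|[|//]]]]] // _; rewrite /dfr /structure; ring.
have io1 e : iprod W (dfr e) 1%N = (fun y => - (W 2%N y * dfr e 1%N 2%N y) - W 3%N y * dfr e 1%N 3%N y - W 4%N y * dfr e 1%N 4%N y).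
  by apply/funext => y; rewrite /iprod (anti e 2%N 1%N)// (anti e 3%N 1%N)// (anti e 4%N 1%N)// diag//; ring.
have io2 e : iprod W (dfr e) 2%N = (fun y => W 1%N y * dfr e 1%N 2%N y - W 3%N y * dfr e 2%N 3%N y - W 4%N y * dfr e 2%N 4%N y).
  by apply/funext => y; rewrite /iprod (anti e 3%N 2%N)// (anti e 4%N 2%N)// diag//; ring.
have io3 e : iprod W (dfr e) 3%N = (fun y => W 1%N y * dfr e 1%N 3%N y + W 2%N y * dfr e 2%N 3%N y - W 4%N y * dfr e 3%N 4%N y).
  by apply/funext => y; rewrite /iprod (anti e 4%N 3%N)// diag//; ring.
have io4 e : iprod W (dfr e) 4%N = (fun y => W 1%N y * dfr e 1%N 4%N y + W 2%N y * dfr e 2%N 4%N y + W 3%N y * dfr e 3%N 4%N y).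
  by apply/funext => y; rewrite /iprod diag//; ring.
have Di1 k e : smooth_coef U e -> D k (iprod W (dfr e) 1%N) x =
   - D k (fun y => W 2%N y * dfr e 1%N 2%N y) x - D k (fun y => W 3%N y * dfr e 1%N 3%N y) x
   - D k (fun y => W 4%N y * dfr e 1%N 4%N y) x.
  move=> se; rewrite io1; have h i l m := dM e i l m se.
  rewrite (lieB _ (differentiableB (differentiableN (h 2%N 1%N 2%N)) (h 3%N 1%N 3%N)) (h 4%N 1%N 4%N)).
  rewrite (lieB _ (differentiableN (h 2%N 1%N 2%N)) (h 3%N 1%N 3%N)).
  by rewrite {1}/lie (deriveN (diff_derivable (h 2%N 1%N 2%N))).
have Di2 k e : smooth_coef U e -> D k (iprod W (dfr e) 2%N) x =
   D k (fun y => W 1%N y * dfr e 1%N 2%N y) x - D k (fun y => W 3%N y * dfr e 2%N 3%N y) x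
   - D k (fun y => W 4%N y * dfr e 2%N 4%N y) x.
  move=> se; rewrite io2; have h i l m := dM e i l m se.
  rewrite (lieB _ (differentiableB (h 1%N 1%N 2%N) (h 3%N 2%N 3%N)) (h 4%N 2%N 4%N)).
  by rewrite (lieB _ (h 1%N 1%N 2%N) (h 3%N 2%N 3%N)).
have Di3 k e : smooth_coef U e -> D k (iprod W (dfr e) 3%N) x =
   D k (fun y => W 1%N y * dfr e 1%N 3%N y) x + D k (fun y => W 2%N y * dfr e 2%N 3%N y) x
   - D k (fun y => W 4%N y * dfr e 3%N 4%N y) x.
  move=> se; rewrite io3; have h i l m := dM e i l m se.
  rewrite (lieB _ (differentiableD (h 1%N 1%N 3%N) (h 2%N 2%N 3%N)) (h 4%N 3%N 4%N)).
  by rewrite (lieD _ (h 1%N 1%N 3%N) (h 2%N 2%N 3%N)).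
have Di4 k e : smooth_coef U e -> D k (iprod W (dfr e) 4%N) x =
   D k (fun y => W 1%N y * dfr e 1%N 4%N y) x + D k (fun y => W 2%N y * dfr e 2%N 4%N y) x
   + D k (fun y => W 3%N y * dfr e 3%N 4%N y) x.
  move=> se; rewrite io4; have h i l m := dM e i l m se.
  rewrite (lieD _ (differentiableD (h 1%N 1%N 4%N) (h 2%N 2%N 4%N)) (h 3%N 3%N 4%N)).
  by rewrite (lieD _ (h 1%N 1%N 4%N) (h 2%N 2%N 4%N)).
have dp l m l' m' : differentiable (fun y => dfr b l m y * dfr c l' m' y) x.
  exact: differentiableM (dd b l m sb) (dd c l' m' sc).
have Dp k l m l' m' : D k (fun y => dfr b l m y * dfr c l' m' y) x =
   dfr b l m x * D k (dfr c l' m') x + dfr c l' m' x * D k (dfr b l m) x.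
  by rewrite (lieM _ (dd b l m sb) (dd c l' m' sc)).
have d2 := differentiableB (dp 1%N 2%N 3%N 4%N) (dp 1%N 3%N 2%N 4%N).
have d3 := differentiableD d2 (dp 1%N 4%N 2%N 3%N).
have d4 := differentiableD d3 (dp 2%N 3%N 1%N 4%N).
have d5 := differentiableB d4 (dp 2%N 4%N 1%N 3%N).
have Dpf k i : D k (fun y => W i y * pf (dfr_at b y) (dfr_at c y)) x =
   W i x * (D k (fun y => dfr b 1%N 2%N y * dfr c 3%N 4%N y) x - D k (fun y => dfr b 1%N 3%N y * dfr c 2%N 4%N y) x
   + D k (fun y => dfr b 1%N 4%N y * dfr c 2%N 3%N y) x + D k (fun y => dfr b 2%N 3%N y * dfr c 1%N 4%N y) x
   - D k (fun y => dfr b 2%N 4%N y * dfr c 1%N 3%N y) x + D k (fun y => dfr b 3%N 4%N y * dfr c 1%N 2%N y) x)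
   + pf (dfr_at b x) (dfr_at c x) * D k (W i) x.
  rewrite (lieM _ (dW i) (smooth_on_diff (pf_smooth sb sc) Ux)) /pf /dfr_at.
  by rewrite (lieD _ d5 (dp 3%N 4%N 1%N 2%N)) (lieB _ d4 (dp 2%N 4%N 1%N 3%N)) (lieD _ d3 (dp 2%N 3%N 1%N 4%N))
     (lieD _ d2 (dp 1%N 4%N 2%N 3%N)) (lieB _ (dp 1%N 2%N 3%N 4%N) (dp 1%N 3%N 2%N 4%N)).
have unf e i j : dfr (iprod W (dfr e)) i j x = D i (iprod W (dfr e) j) x
   - D j (iprod W (dfr e) i) x - structure alpha i j (iprod W (dfr e)) x by [].
have e12 := unf _ 1%N 2%N; have e13 := unf _ 1%N 3%N; have e14 := unf _ 1%N 4%N.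
have e23 := unf _ 2%N 3%N; have e24 := unf _ 2%N 4%N; have e34 := unf _ 3%N 4%N.
have i1 e : iprod W (dfr e) 1%N x = _ := congr1 (@^~ x) (io1 e).
have i2 e : iprod W (dfr e) 2%N x = _ := congr1 (@^~ x) (io2 e).
have i3 e : iprod W (dfr e) 3%N x = _ := congr1 (@^~ x) (io3 e).
move: (Dpf 1 1)%N (Dpf 2 2)%N (Dpf 3 3)%N (Dpf 4 4)%N.
move: (e12 b) (e13 b) (e14 b) (e23 b) (e24 b) (e34 b) (e12 c) (e13 c) (e14 c) (e23 c) (e24 c) (e34 c).
move: (i1 b) (i2 b) (i3 b) (i1 c) (i2 c) (i3 c).
move: (Di1 2 b sb)%N (Di1 3 b sb)%N (Di1 4 b sb)%N (Di1 2 c sc)%N (Di1 3 c sc)%N (Di1 4 c sc)%N.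
move: (Di2 1 b sb)%N (Di2 3 b sb)%N (Di2 4 b sb)%N (Di2 1 c sc)%N (Di2 3 c sc)%N (Di2 4 c sc)%N.
move: (Di3 1 b sb)%N (Di3 2 b sb)%N (Di3 4 b sb)%N (Di3 1 c sc)%N (Di3 2 c sc)%N (Di3 4 c sc)%N.
move: (Di4 1 b sb)%N (Di4 2 b sb)%N (Di4 3 b sb)%N (Di4 1 c sc)%N (Di4 2 c sc)%N (Di4 3 c sc)%N.
move: (dfr_closed123 sb Ux) (dfr_closed124 sb Ux) (dfr_closed134 sb Ux) (dfr_closed234 sb Ux).
move: (dfr_closed123 sc Ux) (dfr_closed124 sc Ux) (dfr_closed134 sc Ux) (dfr_closed234 sc Ux).
rewrite /structure /pf /dfr_at.
(* Each product rule is recorded as an equation on a fresh variable. After all derivatives are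
   generalized and the equations substituted, only a polynomial identity is left. *)
repeat match goal with
  | |- context [lie (frame alpha ?k) (fun y => W ?i y * dfr b ?l ?m y) x] =>
    generalize (DM k b i l m sb);
    generalize (lie (frame alpha k) (fun y => W i y * dfr b l m y) x); intro
  | |- context [lie (frame alpha ?k) (fun y => W ?i y * dfr c ?l ?m y) x] =>
    generalize (DM k c i l m sc);
    generalize (lie (frame alpha k) (fun y => W i y * dfr c l m y) x); intro
  | |- context [lie (frame alpha ?k) (fun y => dfr b ?l ?m y * dfr c ?l' ?m' y) x] =>
    generalize (Dp k l m l' m');
    generalize (lie (frame alpha k) (fun y => dfr b l m y * dfr c l' m' y) x); intro
  end.
clear -oU.
repeat match goal with
  | |- context [lie ?L ?f x] => generalize (lie L f x); intro
  | |- context [dfr ?e ?i ?j x] => generalize (dfr e i j x); intro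
  | |- context [iprod ?e ?i ?j x] => generalize (iprod e i j x); intro
  | |- context [W ?k x] => generalize (W k x); intro
  end.
clear; intros; subst.
ring.
Qed.

End ExteriorCalculus.
End FrameForms.
Import FrameForms.

(** * The submanifold Y, its retraction and its tangent spaces *)

Module EllipsoidGeometry.
Section Geometry.
Context {R : realType}.
Variable alpha : R.
Hypothesis alpha_gt0 : 0 < alpha.
Implicit Types (x y u v w : R6 R).

Local Notation frame := (frame alpha).
Local Notation Nf := (Nf alpha).
Local Notation dom := (dom alpha).

Lemma sum3 (V : nmodType) (F : 'I_3 -> V) : \sum_i F i = F 0 + F 1 + F ord_max.
Proof.
rewrite !big_ord_recl big_ord0 addr0 addrA; congr (_ + F _ + F _); exact/val_inj.
Qed.

Lemma sum2 (V : nmodType) (F : 'I_2 -> V) : \sum_j F j = F 0 + F 1.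
Proof. by rewrite big_ord_recl big_ord1; congr (_ + F _); exact/val_inj. Qed.

Definition dt x v (i : 'I_3) : R := x i 0 * v i 0 + x i 1 * v i 1.
Definition cr x v (i : 'I_3) : R := x i 0 * v i 1 - x i 1 * v i 0.

Lemma omega0E u v : omega0 u v = cr u v 0 + cr u v 1 + cr u v ord_max.
Proof. by rewrite /omega0 sum3. Qed.

Lemma radius_sq x i : Defs.radius x i ^+ 2 = sq x i.
Proof. by rewrite /Defs.radius sqr_sqrtr// sq_ge0. Qed.

Lemma YE x : Y alpha x <-> Nf x = 2^-1 /\ sq x ord_max = 1.
Proof.
rewrite /Y /= !radius_sq /TorusAverage.Nf; split=> -[h1 h2]; split; move: h1 h2.
- by move=> h1 _; lra.
- by move=> _ h2; lra.
- by move=> h1 _; lra.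
- by move=> _ h2; lra.
Qed.

Lemma Y_dom x : Y alpha x -> dom x.
Proof. by move=> /YE [h1 h2]; split; rewrite ?h1 ?h2. Qed.

Lemma sq_derive x v i : differentiable (sq^~ i) x /\ 'D_v (sq^~ i) x = 2 * dt x v i.
Proof.
have dc j : differentiable (fun y : R6 R => y i j) x by exact: differentiable_coord.
have dX j := differentiableM (dc j) (dc j).
split; first exact: differentiableD (dX 0) (dX 1).
have -> := deriveD (diff_derivable (dX 0)) (diff_derivable (dX 1)) (v := v).
have DX j : 'D_v ((fun y : R6 R => y i j) * (fun y : R6 R => y i j)) x = 2 * x i j * v i j.
  have -> := @deriveMf _ _ (fun y : R6 R => y i j) (fun y : R6 R => y i j) x v (dc j) (dc j).
  by rewrite derive_coord; ring.
by rewrite !DX /dt; ring.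
Qed.

Lemma Nf_derive x v : differentiable Nf x /\ 'D_v Nf x = 2 * (dt x v 0 + alpha * dt x v 1).
Proof.
have [d0 D0] := sq_derive x v 0; have [d1 D1] := sq_derive x v 1.
have d1' := differentiableZ alpha d1.
split; first exact: differentiableD d0 d1'.
have -> := deriveD (diff_derivable d0) (diff_derivable d1') (v := v).
have -> := deriveZ alpha (diff_derivable d1) (v := v).
by rewrite D0 D1 /GRing.scale/=; ring.
Qed.

(** The retraction onto Y that rescales the first two factors together, since [Nf] is 1/2 on Y, and
    the third one to the unit circle. It commutes with the torus. *)
Definition rho x : R6 R :=
  let s := three (Num.sqrt (2 * Nf x))^-1 (Num.sqrt (2 * Nf x))^-1 (Num.sqrt (sq x ord_max))^-1 in
  pair_mx (fun i => s i * x i 0) (fun i => s i * x i 1).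

Lemma rho_smooth : smooth_on dom rho.
Proof.
have oU : open dom by exact: dom_open.
have s1 : smooth_on dom (fun x => (Num.sqrt (2 * Nf x))^-1).
  apply: smooth_on_sqrtV => //.
    by move=> x [Nx _]; rewrite mulr_gt0.
  by apply: smooth_onM => //; [exact: smooth_on_cst | exact: Nf_smooth].
have s2 : smooth_on dom (fun x => (Num.sqrt (sq x ord_max))^-1).
  apply: smooth_on_sqrtV => //; first by move=> x [].
  by apply: smooth_onD => //; apply: smooth_onX => //; exact: smooth_on_coord.
apply: smooth_on_mx => // i j.
have [->|->] : j = 0 \/ j = 1.
- by case: j => -[|[|//]] hj; [left|right]; exact/val_inj.
- apply: (@smooth_on_eq _ _ _ _ (fun x => three (Num.sqrt (2 * Nf x))^-1 (Num.sqrt (2 * Nf x))^-1 (Num.sqrt (sq x ord_max))^-1 i * x i 0)).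
    by move=> x; rewrite pair_mx0.
  by apply: smooth_onM => //; [move: i; apply: I3P | exact: smooth_on_coord].
- apply: (@smooth_on_eq _ _ _ _ (fun x => three (Num.sqrt (2 * Nf x))^-1 (Num.sqrt (2 * Nf x))^-1 (Num.sqrt (sq x ord_max))^-1 i * x i 1)).
    by move=> x; rewrite pair_mx1.
  by apply: smooth_onM => //; [move: i; apply: I3P | exact: smooth_on_coord].
Qed.

Lemma rho_Y x : dom x -> Y alpha (rho x).
Proof.
move=> [N0 s0]; apply/YE.
have sqr i : sq (rho x) i = (three (Num.sqrt (2 * Nf x))^-1 (Num.sqrt (2 * Nf x))^-1 (Num.sqrt (sq x ord_max))^-1 i) ^+ 2 * sq x i.
  by rewrite /sq /rho pair_mx0 pair_mx1; ring.
have V (t : R) : 0 < t -> (Num.sqrt t)^-1 ^+ 2 = t^-1.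
  by move=> t0; rewrite exprVn sqr_sqrtr// ltW.
rewrite /TorusAverage.Nf !sqr !threeE !V ?mulr_gt0//; split; last by rewrite mulVf// lt0r_neq0.
rewrite mulrCA -mulrDr -/(Nf x); field.
by rewrite lt0r_neq0.
Qed.

Lemma rho_id x : Y alpha x -> rho x = x.
Proof.
move=> /YE [h1 h2]; rewrite /rho h1 h2 divff// sqrtr1 invr1.
apply: R6P => i; rewrite !mxE/= (_ : three 1 1 1 i = 1) ?mul1r//; by move: i; apply: I3P.
Qed.

Definition tangential x v : Prop := dt x v 0 + alpha * dt x v 1 = 0 /\ dt x v ord_max = 0.

Lemma tangent_derive0 f x v : tangent (Y alpha) x v -> differentiable f x ->
  (forall y, Y alpha y -> f y = 0) -> 'D_v f x = 0 :> R.
Proof.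
move=> [I [c [[oI I0 sc cY] [c0 <-]]]] df fY.
have dc := smooth_on_diff sc I0; rewrite -c0 in df *.
have <- := @derive_comp _ _ _ _ c f 0 1 dc df.
have fc t : I t -> f (c t) = cst 0 t by move=> It; rewrite fY//; exact: cY.
have -> := @derive_near_eq _ _ _ I (fun t : R => f (c t)) (cst 0) 0 1 oI I0 fc.
by rewrite derive_cst.
Qed.

Lemma rho_derive x v : Y alpha x -> tangential x v -> 'D_v rho x = v.
Proof.
move=> Yx [t1 t2]; have dx := Y_dom Yx; have /YE [Nx qx] := Yx.
have dr : differentiable rho x by exact: smooth_on_diff rho_smooth dx.
(* the scaling factors are functions of Nf and sq, stationary along v *)
have key (phi : R -> R) (f : R6 R -> R) i j : smooth_on [set t : R | 0 < t] phi -> 0 < f x ->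
    differentiable f x -> 'D_v f x = 0 -> phi (f x) = 1 ->
    'D_v (fun y => phi (f y) * y i j) x = v i j.
  move=> sp f0 df Df p1.
  have dp : differentiable phi (f x) by exact: smooth_on_diff sp f0.
  have -> := @deriveMf _ _ (fun y => phi (f y)) (fun y : R6 R => y i j) x v
    (differentiable_comp df dp) (differentiable_coord _ _ _).
  have -> := @derive_comp _ _ _ _ f phi x v df dp.
  by rewrite Df derive0 mulr0 addr0 derive_coord p1 mul1r.
have opos : open [set t : R | 0 < t] by exact: open_gt.
have sp1 : smooth_on [set t : R | 0 < t] (fun t => (Num.sqrt t)^-1).
  apply: smooth_on_sqrtV => //.
  by apply: (@smooth_on_lin _ _ _ _ idfun) => t; exact: cvg_id.
have sp2 : smooth_on [set t : R | 0 < t] (fun t => (Num.sqrt (2 * t))^-1).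
  apply: smooth_on_sqrtV => //; first by move=> t /= t0; rewrite mulr_gt0.
  apply: smooth_onM => //; first exact: smooth_on_cst.
  by apply: (@smooth_on_lin _ _ _ _ idfun) => t; exact: cvg_id.
have [dN DN] := Nf_derive x v; rewrite t1 mulr0 in DN.
have [dq Dq] := sq_derive x v ord_max; rewrite t2 mulr0 in Dq.
have p2 : (Num.sqrt (2 * Nf x))^-1 = 1 by rewrite Nx divff// sqrtr1 invr1.
have p1 : (Num.sqrt (sq x ord_max))^-1 = 1 by rewrite qx sqrtr1 invr1.
have kN j i : 'D_v (fun y => (Num.sqrt (2 * Nf y))^-1 * y i j) x = v i j.
  by apply: (key (fun t => (Num.sqrt (2 * t))^-1) Nf) => //; rewrite Nx.
have kq j i : 'D_v (fun y => (Num.sqrt (sq y ord_max))^-1 * y i j) x = v i j.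
  by apply: (key (fun t => (Num.sqrt t)^-1) (sq^~ ord_max)) => //; rewrite qx.
have e0 i : (fun y => rho y i 0) = (fun y => three (Num.sqrt (2 * Nf y))^-1 (Num.sqrt (2 * Nf y))^-1 (Num.sqrt (sq y ord_max))^-1 i * y i 0).
  by apply/funext => y; rewrite pair_mx0.
have e1 i : (fun y => rho y i 1) = (fun y => three (Num.sqrt (2 * Nf y))^-1 (Num.sqrt (2 * Nf y))^-1 (Num.sqrt (sq y ord_max))^-1 i * y i 1).
  by apply/funext => y; rewrite pair_mx1.
apply: R6P; apply: I3P; rewrite (derive_entry _ _ _ dr).
- by rewrite e0; exact: (kN 0 0).
- by rewrite e0; exact: (kN 0 1).
- by rewrite e0; exact: (kq 0 ord_max).
- by rewrite e1; exact: (kN 1 0).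
- by rewrite e1; exact: (kN 1 1).
- by rewrite e1; exact: (kq 1 ord_max).
Qed.

(** One direction differentiates the two equations of Y along a curve. For the other, the straight
    line through x with velocity v is projected by [rho], whose derivative fixes tangential
    vectors. *)
Lemma tangentP x v : Y alpha x -> tangent (Y alpha) x v <-> tangential x v.
Proof.
move=> Yx; split.
- move=> tv; have [dq Dq] := sq_derive x v ord_max.
  have [dN DN] := Nf_derive x v.
  have NB : 'D_v (fun y => Nf y - 2^-1) x = 'D_v Nf x.
    by rewrite (deriveB (diff_derivable dN) (derivable_cst _ _ _)) derive_cst subr0.
  have qB : 'D_v (fun y => sq y ord_max - 1) x = 'D_v (sq^~ ord_max) x.
    by rewrite (deriveB (diff_derivable dq) (derivable_cst _ _ _)) derive_cst subr0.
  have h1 : 'D_v (fun y => Nf y - 2^-1) x = 0.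
    apply: tangent_derive0 tv _ _; first by apply: differentiableB.
    by move=> y /YE [-> _]; rewrite subrr.
  have h2 : 'D_v (fun y => sq y ord_max - 1) x = 0.
    apply: tangent_derive0 tv _ _; first by apply: differentiableB.
    by move=> y /YE [_ ->]; rewrite subrr.
  by split; [rewrite NB DN in h1 | rewrite qB Dq in h2]; lra.
- move=> tv; pose c (t : R) := x + t *: v.
  have cc : smooth_on setT c.
    apply: smooth_onD; [exact: openT|exact: smooth_on_cst|].
    apply: (@smooth_on_Zl _ _ _ setT (fun t : R => t)); first exact: openT.
    by apply: (@smooth_on_lin _ _ _ _ idfun) => t; exact: cvg_id.
  have c0 : c 0 = x by rewrite /c scale0r addr0.
  have oI : open (c @^-1` dom).
    by apply: open_comp; [move=> t _; exact: (smooth_on_cts cc I) | exact: dom_open].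
  have sr := rho_smooth.
  exists (c @^-1` dom), (fun t => rho (c t)); split; split.
  + exact: oI.
  + by rewrite /= c0; exact: Y_dom.
  + apply: smooth_on_mx => // i j.
    apply: (@smooth_on_compM _ _ _ _ dom _ (fun y => rho y i j) c) => //.
      exact: smooth_onW (@subsetT _ _) cc.
    by apply: smooth_on_entry => //; exact: dom_open.
  + by move=> t; exact: rho_Y.
  + by rewrite c0 rho_id.
  + have dr : differentiable rho (c 0) by rewrite c0; exact: smooth_on_diff sr (Y_dom Yx).
    have -> := @derive_comp _ _ _ _ c rho 0 1 (differentiable_affine x v 0) dr.
    by have [_ ->] := is_derive_affine x v 0; rewrite c0; exact: rho_derive.
Qed.

End Geometry.
End EllipsoidGeometry.
Import EllipsoidGeometry.

(** * The dual coframe and the null foliation *)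

Module Coframes.
Section Coframe.
Context {R : realType}.
Variable alpha : R.
Hypothesis alpha_gt0 : 0 < alpha.
Implicit Types (x y u v w : R6 R) (i j : nat).

Local Notation frame := (frame alpha).
Local Notation Nf := (Nf alpha).
Local Notation dom := (dom alpha).
Local Notation tangential := (tangential alpha).

(** The frame is orthogonal for the metric |v_1|^2 + alpha |v_2|^2 + |v_3|^2, with squared norms Nf,
    alpha Nf, alpha Nf and |z_3|^2. Its dual coframe is therefore the frame itself, multiplied by
    the metric and divided by these norms. *)
Definition weight i x : 'I_3 -> R :=
  match i with
  | 1%N => three (Nf x)^-1 (alpha / Nf x) 0
  | 2%N | 3%N => three (alpha * Nf x)^-1 (Nf x)^-1 0
  | _ => three 0 0 (sq x ord_max)^-1
  end.

Definition coframe i x : R6 R :=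
  pair_mx (fun l => weight i x l * frame i x l 0) (fun l => weight i x l * frame i x l 1).

Definition pairing (a v : R6 R) : R := \sum_(l < 3) \sum_(j < 2) a l j * v l j.

Definition fcomp i x v : R := pairing (coframe i x) v.

Lemma pairing_linr (a : R6 R) (k : R) u v : pairing a (k *: u + v) = k * pairing a u + pairing a v.
Proof. by rewrite /pairing !sum3 !sum2 !mxE; ring. Qed.

Lemma pairing_linl (a b : R6 R) (k : R) v : pairing (k *: a + b) v = k * pairing a v + pairing b v.
Proof. by rewrite /pairing !sum3 !sum2 !mxE; ring. Qed.

Lemma comp_lin i x (k : R) u v : fcomp i x (k *: u + v) = k * fcomp i x u + fcomp i x v.
Proof. exact: pairing_linr. Qed.

Lemma compE i x v : fcomp i x v =
  weight i x 0 * (frame i x 0 0 * v 0 0 + frame i x 0 1 * v 0 1) +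
  weight i x 1 * (frame i x 1 0 * v 1 0 + frame i x 1 1 * v 1 1) +
  weight i x ord_max * (frame i x ord_max 0 * v ord_max 0 + frame i x ord_max 1 * v ord_max 1).
Proof. by rewrite /fcomp /pairing /coframe sum3 !sum2 !pair_mx0 !pair_mx1; ring. Qed.

Lemma comp1E x v : fcomp 1 x v = (cr x v 0 + alpha * cr x v 1) / Nf x.
Proof. by rewrite compE /weight /frame /torus_gen /cr !(pair_mx0, pair_mx1, threeE); ring. Qed.

Lemma comp2E x v : 0 < Nf x -> fcomp 2 x v =
  (- x 1 0 * v 0 0 + x 1 1 * v 0 1 + x 0 0 * v 1 0 - x 0 1 * v 1 1) / Nf x.
Proof.
move=> N0; rewrite compE /weight /frame /torus_gen !(pair_mx0, pair_mx1, threeE); field.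
by rewrite !lt0r_neq0.
Qed.

Lemma comp3E x v : 0 < Nf x -> fcomp 3 x v =
  (- x 1 1 * v 0 0 - x 1 0 * v 0 1 + x 0 1 * v 1 0 + x 0 0 * v 1 1) / Nf x.
Proof.
move=> N0; rewrite compE /weight /frame /torus_gen !(pair_mx0, pair_mx1, threeE); field.
by rewrite !lt0r_neq0.
Qed.

Lemma comp4E x v : fcomp 4 x v = cr x v ord_max / sq x ord_max.
Proof. by rewrite compE /weight /frame /torus_gen /cr !(pair_mx0, pair_mx1, threeE); ring. Qed.

Lemma comp_frame i j x : (0 < i <= 4)%N -> (0 < j <= 4)%N -> dom x ->
  fcomp i x (frame j x) = (i == j)%:R.
Proof.
move=> hi hj [N0 q0]; have Nn0 := lt0r_neq0 N0; have qn0 := lt0r_neq0 q0.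
case: i hi => [|[|[|[|[|//]]]]] // _; rewrite ?comp1E ?comp2E// ?comp3E// ?comp4E;
 case: j hj => [|[|[|[|[|//]]]]] // _;
 rewrite /cr /frame /torus_gen !(pair_mx0, pair_mx1, threeE) /=; 
 move: Nn0 qn0; rewrite /TorusAverage.Nf /sq => Nn0 qn0; field; by [].
Qed.

(** [row12] and [row3] are the radial fields transverse to the two equations of Y; they complete the
    frame to a basis of R^6. *)
Definition row12 x : R6 R := pair_mx (three (x 0 0) (x 1 0) 0) (three (x 0 1) (x 1 1) 0).
Definition row3 x : R6 R := pair_mx (three 0 0 (x ord_max 0)) (three 0 0 (x ord_max 1)).

Lemma frame_decomp x v : dom x ->
  v = fcomp 1 x v *: frame 1 x + fcomp 2 x v *: frame 2 x + fcomp 3 x v *: frame 3 x +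
      fcomp 4 x v *: frame 4 x + ((dt x v 0 + alpha * dt x v 1) / Nf x) *: row12 x +
      (dt x v ord_max / sq x ord_max) *: row3 x.
Proof.
move=> [N0 q0]; have Nn0 := lt0r_neq0 N0; have qn0 := lt0r_neq0 q0.
rewrite comp1E comp2E// comp3E// comp4E /cr /dt.
apply: R6P; apply: I3P; rewrite /frame /torus_gen /row12 /row3 !(mxE, pair_mx0, pair_mx1, threeE) /=;
 move: Nn0 qn0; rewrite /TorusAverage.Nf /sq => Nn0 qn0; field; by rewrite ?Nn0 ?qn0.
Qed.

Lemma tangential_decomp x v : dom x -> tangential x v ->
  v = fcomp 1 x v *: frame 1 x + fcomp 2 x v *: frame 2 x + fcomp 3 x v *: frame 3 x +
      fcomp 4 x v *: frame 4 x.
Proof.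
move=> dx [t1 t2]; rewrite {1}(frame_decomp v dx) t1 t2 !mul0r !scale0r !addr0//.
Qed.

Lemma frame_tangential i x : tangential x (frame i x).
Proof.
case: i => [|[|[|[|i]]]]; rewrite /EllipsoidGeometry.tangential /dt /frame /torus_gen !(pair_mx0, pair_mx1, threeE); split; ring.
Qed.

Definition X1 x : R6 R := torus_gen (three 1 alpha 0) x.

Lemma X1_tangential x : tangential x (X1 x).
Proof. by rewrite /EllipsoidGeometry.tangential /dt /X1 /torus_gen !(pair_mx0, pair_mx1, threeE); split; ring. Qed.

Lemma X1_lin : linear X1. Proof. exact: torus_gen_lin. Qed.

Definition xi i x : R := fcomp i x (X1 x).

Lemma X1_decomp x : dom x ->
  X1 x = xi 1 x *: frame 1 x + xi 2 x *: frame 2 x + xi 3 x *: frame 3 x.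
Proof.
move=> dx; rewrite {1}(tangential_decomp dx (X1_tangential x)).
have -> : fcomp 4 x (X1 x) = 0.
  by rewrite comp4E /cr /X1 /torus_gen !(pair_mx0, pair_mx1, threeE); ring.
by rewrite scale0r addr0.
Qed.

Definition ww x : R := sq x 0 + alpha ^+ 2 * sq x 1.

Lemma ww_gt0 x : dom x -> 0 < ww x.
Proof.
move=> [N0 _]; move: N0; rewrite /ww /TorusAverage.Nf.
have := sq_ge0 x 0; have := sq_ge0 x 1; move: (sq x 0) (sq x 1) => a b.
rewrite le0r => /orP[/eqP -> _|b0 a0 _]; first by rewrite !mulr0 !addr0.
by rewrite ltr_wpDl// mulr_gt0// exprn_gt0.
Qed.

Lemma xi1E x : xi 1 x = ww x / Nf x.
Proof.
by rewrite /xi comp1E /cr /X1 /torus_gen !(pair_mx0, pair_mx1, threeE) /ww /sq; congr (_ / _); ring.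
Qed.

Lemma omega_frame23 x : omega0 (frame 2 x) (frame 3 x) = ww x.
Proof.
by rewrite omega0E /cr /frame !(pair_mx0, pair_mx1, threeE) /ww /sq; ring.
Qed.

Lemma omega_X1 x v : omega0 (X1 x) v = - (dt x v 0 + alpha * dt x v 1).
Proof. by rewrite omega0E /cr /dt /X1 /torus_gen !(pair_mx0, pair_mx1, threeE); ring. Qed.

Lemma omega_frame4 x v : omega0 (frame 4 x) v = - dt x v ord_max.
Proof. by rewrite omega0E /cr /dt /frame /torus_gen !(pair_mx0, pair_mx1, threeE); ring. Qed.

Lemma omega_lin (k : R) u u' v : omega0 (k *: u + u') v = k * omega0 u v + omega0 u' v.
Proof. by rewrite !omega0E /cr !mxE; ring. Qed.

Lemma omega_anti u v : omega0 u v = - omega0 v u.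
Proof. by rewrite !omega0E /cr; ring. Qed.

Lemma tangential_lin x (k : R) u v : tangential x u -> tangential x v -> tangential x (k *: u + v).
Proof.
rewrite /EllipsoidGeometry.tangential /dt => -[a1 a2] [b1 b2]; split; rewrite !mxE.
  have -> : forall p q r s p' q' r' s' a b a' b' : R,
    a * (k * p + p') + b * (k * q + q') + alpha * (a' * (k * r + r') + b' * (k * s + s')) =
    k * (a * p + b * q + alpha * (a' * r + b' * s)) + (a * p' + b * q' + alpha * (a' * r' + b' * s')).
    by move=> *; ring.
  by rewrite a1 b1 mulr0 addr0.
have -> : forall p q p' q' a b : R,
    a * (k * p + p') + b * (k * q + q') = k * (a * p + b * q) + (a * p' + b * q').
  by move=> *; ring.
by rewrite a2 b2 mulr0 addr0.
Qed.

(** Both generators pair with tangent vectors through the differentials of the two equations of Y,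
    hence to zero. Conversely, subtracting a multiple of X1 removes the component of w on [frame 1],
    and the components on [frame 2] and [frame 3] then vanish because omega0 pairs these two fields
    to [ww], which is positive. *)
Lemma null_tangentP x w : Y alpha x ->
  null_tangent (Y alpha) x w <-> exists a b : R, w = a *: X1 x + b *: frame 4 x.
Proof.
move=> Yx; have dx := Y_dom Yx; split; last first.
  move=> [a [b ->]]; split.
    apply/(@tangentP R alpha _ _ Yx); apply: tangential_lin; first exact: X1_tangential.
    rewrite -[_ *: _]addr0; apply: tangential_lin; first exact: frame_tangential.
    by split; rewrite /dt !mxE; ring.
  move=> v /(@tangentP R alpha _ _ Yx) [t1 t2].
  rewrite omega_lin omega_X1 t1 oppr0 mulr0 add0r -[_ *: _]addr0 omega_lin omega_frame4 t2.
  by rewrite omega0E /cr !mxE; ring.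
move=> [/(@tangentP R alpha _ _ Yx) tw ow].
have x1n0 : xi 1 x != 0.
  by rewrite xi1E mulf_neq0 ?invr_eq0 ?lt0r_neq0 ?ww_gt0//; case: dx.
pose a := fcomp 1 x w / xi 1 x.
exists a, (fcomp 4 x w).
pose w' := - a *: X1 x + w.
have tw' : tangential x w' by apply: tangential_lin => //; exact: X1_tangential.
have w1 : fcomp 1 x w' = 0.
  by rewrite comp_lin -/(xi 1 x) mulNr divfK// addNr.
have w4 : fcomp 4 x w' = fcomp 4 x w.
  rewrite comp_lin (_ : fcomp 4 x (X1 x) = 0) ?mulr0 ?add0r//.
  by rewrite comp4E /cr /X1 /torus_gen !(pair_mx0, pair_mx1, threeE); ring.
have w'E := tangential_decomp dx tw'.
rewrite w1 w4 scale0r add0r in w'E.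
have ow' v : tangential x v -> omega0 w' v = 0.
  move=> tv; rewrite omega_lin ow; last exact/(@tangentP R alpha _ _ Yx).
  by case: tv => t1 t2; rewrite omega_X1 t1 oppr0 mulr0 addr0.
have h v : tangential x v -> fcomp 2 x w' * omega0 (frame 2 x) v + fcomp 3 x w' * omega0 (frame 3 x) v = 0.
  move=> tv; have := ow' v tv; rewrite {1}w'E -addrA !omega_lin.
  rewrite -[_ *: frame 4 x]addr0 omega_lin omega_frame4 (tv.2).
  have -> : omega0 0 v = 0 by rewrite omega0E /cr !mxE; ring.
  by rewrite oppr0 mulr0 !addr0.
have wn0 := lt0r_neq0 (ww_gt0 dx).
have c2 : fcomp 2 x w' = 0.
  have := h _ (frame_tangential 3 x); rewrite omega_frame23.
  rewrite (_ : omega0 (frame 3 x) (frame 3 x) = 0); last by rewrite omega0E /cr; ring.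
  by rewrite mulr0 addr0 => /eqP; rewrite mulf_eq0 (negbTE wn0) orbF => /eqP.
have c3 : fcomp 3 x w' = 0.
  have := h _ (frame_tangential 2 x); rewrite c2 mul0r add0r omega_anti omega_frame23.
  by move=> /eqP; rewrite mulrN oppr_eq0 mulf_eq0 (negbTE wn0) orbF => /eqP.
rewrite c2 c3 !scale0r !add0r in w'E.
by rewrite -w'E addrA scaleNr subrr add0r.
Qed.

Lemma xi_smooth i (U : set (R6 R)) : open U -> U `<=` dom -> (0 < i <= 3)%N -> smooth_on U (xi i).
Proof.
move=> oU Ud hi.
have N0 x : U x -> Nf x != 0 by move=> /Ud [N0 _]; exact: lt0r_neq0.
have sN : smooth_on U (fun x => (Nf x)^-1) by apply: smooth_onV => //; exact: Nf_smooth.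
have sc l (j : 'I_2) : smooth_on U (fun x : R6 R => x l j) by exact: smooth_on_coord.
case: i hi => [|[|[|[|//]]]] // _.
- apply: (@smooth_on_near_eq _ _ _ _ (fun x => ((x 0 0 * x 0 0 + x 0 1 * x 0 1) + alpha * alpha * (x 1 0 * x 1 0 + x 1 1 * x 1 1)) * (Nf x)^-1)) => //; last by smooth => //; exact: sc.
  by move=> x _; rewrite xi1E /ww /sq; congr (_ * _); ring.
- apply: (@smooth_on_near_eq _ _ _ _ (fun x => ((1 - alpha) * (x 1 0 * x 0 1 + x 1 1 * x 0 0)) * (Nf x)^-1)) => //; last by smooth => //; exact: sc.
  move=> x /Ud [h _]; rewrite /xi comp2E// /X1 /torus_gen !(pair_mx0, pair_mx1, threeE); congr (_ * _); ring.
- apply: (@smooth_on_near_eq _ _ _ _ (fun x => ((1 - alpha) * (x 1 1 * x 0 1 - x 1 0 * x 0 0)) * (Nf x)^-1)) => //; last by smooth => //; exact: sc.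
  move=> x /Ud [h _]; rewrite /xi comp3E// /X1 /torus_gen !(pair_mx0, pair_mx1, threeE); congr (_ * _); ring.
Qed.

End Coframe.
End Coframes.
Import Coframes.

(** * Ambient 1-forms and their components in the frame *)

Module DifferentialForms.
Section Forms.
Context {R : realType}.
Variable alpha : R.
Hypothesis alpha_gt0 : 0 < alpha.
Implicit Types (x y u v w : R6 R) (i j : nat) (eta X Z : R6 R -> R6 R) (O : set (R6 R)).

Local Notation frame := (frame alpha).
Local Notation dom := (dom alpha).
Local Notation dfr := (dfr alpha).
Local Notation coframe := (coframe alpha).

Lemma evE eta x v : ev eta x v = pairing (eta x) v. Proof. by []. Qed.

Lemma ev_derive eta Z x v : differentiable eta x -> differentiable Z x ->
  'D_v (fun y => ev eta y (Z y)) x = ev ('D_v eta) x (Z x) + ev eta x ('D_v Z x).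
Proof.
move=> de dZ.
have entry (M : R6 R -> R6 R) l k : differentiable M x -> differentiable (fun y => M y l k) x.
  by move=> dM; exact: (differentiable_comp dM (differentiable_coord _ _ _)).
have E : (fun y => ev eta y (Z y)) =
  (fun y => \sum_(p : 'I_3 * 'I_2) 1 * (eta y p.1 p.2 * Z y p.1 p.2)).
  apply/funext => y; rewrite /ev pair_big; apply: eq_bigr => p _; by rewrite mul1r.
have [_] := @derive_lincomb _ _ _ (index_enum _) (fun p : 'I_3 * 'I_2 => 1 : R)
  (fun p y => eta y p.1 p.2 * Z y p.1 p.2) x v
  (fun p => differentiableM (entry eta p.1 p.2 de) (entry Z p.1 p.2 dZ)).
rewrite E => ->.
have E2 : \sum_(p : 'I_3 * 'I_2) 1 * 'D_v (fun y => eta y p.1 p.2 * Z y p.1 p.2) x =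
  \sum_(p : 'I_3 * 'I_2) (('D_v eta) x p.1 p.2 * Z x p.1 p.2 + eta x p.1 p.2 * 'D_v Z x p.1 p.2).
  apply: eq_bigr => p _; rewrite mul1r (deriveMf v (entry eta p.1 p.2 de) (entry Z p.1 p.2 dZ)).
  by rewrite (derive_entry v p.1 p.2 de) (derive_entry v p.1 p.2 dZ) addrC mulrC.
by rewrite E2 big_split /ev !pair_big.
Qed.

Lemma dF_dext eta X Z x : differentiable eta x -> differentiable X x -> differentiable Z x ->
  dF eta X Z x = dext eta x (X x) (Z x).
Proof.
move=> de dX dZ; rewrite /dF (ev_derive _ de dX) (ev_derive _ de dZ) /dext /bracket.
have -> : ev eta x ('D_(X x) Z x - 'D_(Z x) X x) =
    ev eta x ('D_(X x) Z x) - ev eta x ('D_(Z x) X x).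
  by rewrite !evE addrC -scaleN1r pairing_linr mulN1r addrC.
move: (ev ('D_(X x) eta) x (Z x)) (ev eta x ('D_(X x) Z x))
  (ev ('D_(Z x) eta) x (X x)) (ev eta x ('D_(Z x) X x)) => a b c d.
ring.
Qed.

Definition coef eta i x : R := ev eta x (frame i x).

Lemma coef_smooth O eta : open O -> smooth_on O eta -> smooth_coef O (coef eta).
Proof.
move=> oO se i.
apply: (@smooth_on_eq _ _ _ _ (fun y => \sum_l \sum_k eta y l k * frame i y l k)) => //.
apply: smooth_on_sum => // l _; apply: smooth_on_sum => // k _.
apply: smooth_onM => //; apply: smooth_on_entry => //.
by apply: lin_field_smooth => //; exact: frame_lin.
Qed.

Lemma dext_frame eta i j x : differentiable eta x -> (0 < i <= 4)%N -> (0 < j <= 4)%N ->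
  dext eta x (frame i x) (frame j x) = dfr (coef eta) i j x.
Proof.
move=> de hi hj.
have df k : differentiable (frame k) x.
  apply: (@smooth_on_diff _ _ _ setT _ _ _ I).
  by apply: lin_field_smooth; [exact: openT | exact: frame_lin].
have L k l : lie (frame k) (coef eta l) x =
   ev ('D_(frame k x) eta) x (frame l x) + ev eta x (frame l (frame k x)).
  rewrite /lie (ev_derive _ de (df l)) derive_lin_field//; exact: frame_lin.
rewrite /FrameForms.dfr !L /dext.
have := frame_bracket alpha x hi hj => /(congr1 (pairing (eta x))).
have -> : frame j (frame i x) - frame i (frame j x) = -1 *: frame i (frame j x) + frame j (frame i x).
  by rewrite scaleN1r addrC.
rewrite pairing_linr -!evE => h.
have -> : structure alpha i j (coef eta) x = -1 * ev eta x (frame i (frame j x)) + ev eta x (frame j (frame i x)).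
  rewrite h; clear h L df de.
  have p0 : pairing (eta x) 0 = 0 by rewrite /pairing !sum3 !sum2 !mxE; ring.
  have pZ (k : R) v : pairing (eta x) (k *: v) = k * pairing (eta x) v.
    by rewrite -[k *: v]addr0 pairing_linr p0 addr0.
  by move: hi hj; case: i => [|[|[|[|[|//]]]]] // _; case: j => [|[|[|[|[|//]]]]] // _;
    rewrite /structure ?evE ?p0 ?pZ.
move: (ev ('D_(frame i x) eta) x (frame j x)) (ev ('D_(frame j x) eta) x (frame i x))
  (ev eta x (frame j (frame i x))) (ev eta x (frame i (frame j x))) => a b c d.
ring.
Qed.

Definition form (b : nat -> R6 R -> R) x : R6 R :=
  b 1%N x *: coframe 1 x + b 2%N x *: coframe 2 x + b 3%N x *: coframe 3 x + b 4%N x *: coframe 4 x.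

Lemma ev_form b x v : ev (form b) x v = b 1%N x * fcomp alpha 1 x v + b 2%N x * fcomp alpha 2 x v
  + b 3%N x * fcomp alpha 3 x v + b 4%N x * fcomp alpha 4 x v.
Proof.
rewrite evE /form -[_ *: coframe 4 x]addr0 -!addrA !pairing_linl /fcomp.
have -> : pairing 0 v = 0 by rewrite /pairing !sum3 !sum2 !mxE; ring.
by rewrite addr0.
Qed.

Lemma coef_form b i x : dom x -> (0 < i <= 4)%N -> coef (form b) i x = b i x.
Proof.
move=> dx hi; rewrite /coef ev_form !comp_frame//.
by move: hi; case: i => [|[|[|[|[|//]]]]] // _; rewrite /=; ring.
Qed.

Lemma coframe_smooth i : smooth_on dom (coframe i).
Proof.
have oU : open dom by exact: dom_open.
have sN : smooth_on dom (fun x => (Nf alpha x)^-1).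
  by apply: smooth_onV; [by [] | by move=> x [h _]; exact: lt0r_neq0 | exact: Nf_smooth].
have sq3 : smooth_on dom (fun x => (sq x ord_max)^-1).
  apply: smooth_onV => //; first by move=> x [_ h]; exact: lt0r_neq0.
  by apply: smooth_onD => //; apply: smooth_onX => //; exact: smooth_on_coord.
have sw l : smooth_on dom (fun x => weight alpha i x l).
  case: i => [|[|[|[|i]]]]; move: l; apply: I3P; rewrite /weight /three /=;
  try exact: smooth_on_cst; try exact: sN; try exact: sq3.
  - by apply: smooth_onM => //; exact: smooth_on_cst.
  - apply: (@smooth_on_eq _ _ _ _ (fun x => alpha^-1 * (Nf alpha x)^-1)).
      by move=> x; rewrite invfM.
    by apply: smooth_onM => //; exact: smooth_on_cst.
  - apply: (@smooth_on_eq _ _ _ _ (fun x => alpha^-1 * (Nf alpha x)^-1)).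
      by move=> x; rewrite invfM.
    by apply: smooth_onM => //; exact: smooth_on_cst.
have sf l k : smooth_on dom (fun x => frame i x l k).
  by apply: smooth_on_entry => //; apply: lin_field_smooth => //; exact: frame_lin.
apply: smooth_on_mx => // l k.
have [->|->] : k = 0 \/ k = 1.
- by case: k => -[|[|//]] hk; [left|right]; exact/val_inj.
- apply: (@smooth_on_eq _ _ _ _ (fun x => weight alpha i x l * frame i x l 0)).
    by move=> x; rewrite pair_mx0.
  exact: smooth_onM.
- apply: (@smooth_on_eq _ _ _ _ (fun x => weight alpha i x l * frame i x l 1)).
    by move=> x; rewrite pair_mx1.
  exact: smooth_onM.
Qed.

Lemma form_smooth O b : open O -> O `<=` dom -> smooth_coef O b -> smooth_on O (form b).
Proof.
move=> oO Od sb.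
have oU : open dom by exact: dom_open.
have s i : smooth_on O (fun x => b i x *: coframe i x).
  apply: smooth_on_mx => // l k.
  apply: (@smooth_on_eq _ _ _ _ (fun x => b i x * coframe i x l k)).
    by move=> x; rewrite [RHS]mxE.
  apply: smooth_onM => //; apply: smooth_on_entry => //.
  by apply: smooth_onW Od _; exact: coframe_smooth.
by do 3 apply: smooth_onD => //.
Qed.

Definition bialt (B : R6 R -> R6 R -> R) : Prop :=
  (forall (k : R) u u' v, B (k *: u + u') v = k * B u v + B u' v) /\
  (forall u v, B u v = - B v u).

Lemma omega_bialt : bialt (@omega0 R).
Proof. by split; [exact: omega_lin | exact: omega_anti]. Qed.

Lemma dext_bialt eta x : differentiable eta x -> bialt (dext eta x).
Proof.
move=> de; split=> [k u u' v|u v]; last by rewrite /dext; ring.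
have h1 : ev ('D_(k *: u + u') eta) x v = k * ev ('D_u eta) x v + ev ('D_u' eta) x v.
  by rewrite !evE (derive_lin _ _ _ de) pairing_linl.
have h2 : ev ('D_v eta) x (k *: u + u') = k * ev ('D_v eta) x u + ev ('D_v eta) x u'.
  exact: pairing_linr.
have e (p q a b c d : R) : p = k * a + b -> q = k * c + d -> p - q = k * (a - c) + (b - d).
  by move=> -> ->; ring.
exact: e h1 h2.
Qed.

Lemma bialtN B : bialt B -> bialt (fun u v => - B u v).
Proof. by move=> [h1 h2]; split=> *; rewrite ?h1 1?h2; ring. Qed.

Lemma bialt_expand B x v (c1 c2 c3 c4 : R) : bialt B ->
  B (c1 *: frame 1 x + c2 *: frame 2 x + c3 *: frame 3 x + c4 *: frame 4 x) v =
  c1 * B (frame 1 x) v + c2 * B (frame 2 x) v + c3 * B (frame 3 x) v + c4 * B (frame 4 x) v.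
Proof.
move=> [h1 h2].
have B0 : B 0 v = 0 by have := h1 (-1) 0 0 v; rewrite scaler0 addr0; lra.
by rewrite -[c4 *: _]addr0 -!addrA !h1 B0 addr0.
Qed.

(** Alternating 4-forms on a 4-dimensional space are proportional. The factor d is chosen before B
    and C, so that one d serves all terms of the deformation equation. *)
Lemma wedge_det x v1 v2 v3 v4 : dom x ->
  tangential alpha x v1 -> tangential alpha x v2 ->
  tangential alpha x v3 -> tangential alpha x v4 ->
  exists d : R, forall B C, bialt B -> bialt C ->
    wedge22 B C v1 v2 v3 v4 = d * pf (fun i j => B (frame i x) (frame j x)) (fun i j => C (frame i x) (frame j x)).
Proof.
move=> dx /(tangential_decomp alpha_gt0 dx) -> /(tangential_decomp alpha_gt0 dx) ->.
move=> /(tangential_decomp alpha_gt0 dx) -> /(tangential_decomp alpha_gt0 dx) ->.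
move: (fcomp alpha 1 x v1) (fcomp alpha 2 x v1) (fcomp alpha 3 x v1) (fcomp alpha 4 x v1) => a1 a2 a3 a4.
move: (fcomp alpha 1 x v2) (fcomp alpha 2 x v2) (fcomp alpha 3 x v2) (fcomp alpha 4 x v2) => b1 b2 b3 b4.
move: (fcomp alpha 1 x v3) (fcomp alpha 2 x v3) (fcomp alpha 3 x v3) (fcomp alpha 4 x v3) => c1 c2 c3 c4.
move: (fcomp alpha 1 x v4) (fcomp alpha 2 x v4) (fcomp alpha 3 x v4) (fcomp alpha 4 x v4) => d1 d2 d3 d4.
pose m12 (p1 p2 q1 q2 : R) := p1 * q2 - p2 * q1.
(* The determinant of the four vectors in the frame, by Laplace expansion along the first two
   rows. *)
exists (m12 a1 a2 b1 b2 * m12 c3 c4 d3 d4 - m12 a1 a3 b1 b3 * m12 c2 c4 d2 d4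
  + m12 a1 a4 b1 b4 * m12 c2 c3 d2 d3 + m12 a2 a3 b2 b3 * m12 c1 c4 d1 d4
  - m12 a2 a4 b2 b4 * m12 c1 c3 d1 d3 + m12 a3 a4 b3 b4 * m12 c1 c2 d1 d2) => B C aB aC.
have ex D (e1 e2 e3 e4 f1 f2 f3 f4 : R) : bialt D ->
  D (e1 *: frame 1 x + e2 *: frame 2 x + e3 *: frame 3 x + e4 *: frame 4 x)
    (f1 *: frame 1 x + f2 *: frame 2 x + f3 *: frame 3 x + f4 *: frame 4 x) =
  m12 e1 e2 f1 f2 * D (frame 1 x) (frame 2 x) + m12 e1 e3 f1 f3 * D (frame 1 x) (frame 3 x) +
  m12 e1 e4 f1 f4 * D (frame 1 x) (frame 4 x) + m12 e2 e3 f2 f3 * D (frame 2 x) (frame 3 x) +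
  m12 e2 e4 f2 f4 * D (frame 2 x) (frame 4 x) + m12 e3 e4 f3 f4 * D (frame 3 x) (frame 4 x).
  move=> aD; rewrite bialt_expand// !(aD.2 _ (_ + _)) !bialt_expand//.
  have d0 u : D u u = 0 by have := aD.2 u u; lra.
  rewrite !d0 (aD.2 (frame 2 x) (frame 1 x)) (aD.2 (frame 3 x) (frame 1 x)) (aD.2 (frame 4 x) (frame 1 x)).
  rewrite (aD.2 (frame 3 x) (frame 2 x)) (aD.2 (frame 4 x) (frame 2 x)) (aD.2 (frame 4 x) (frame 3 x)) /m12.
  by ring.
rewrite /wedge22 !(ex B)// !(ex C)// /pf /m12.
clear - R.
move: (B (frame 1 x) (frame 2 x)) (B (frame 1 x) (frame 3 x)) (B (frame 1 x) (frame 4 x))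
  (B (frame 2 x) (frame 3 x)) (B (frame 2 x) (frame 4 x)) (B (frame 3 x) (frame 4 x)).
move: (C (frame 1 x) (frame 2 x)) (C (frame 1 x) (frame 3 x)) (C (frame 1 x) (frame 4 x))
  (C (frame 2 x) (frame 3 x)) (C (frame 2 x) (frame 4 x)) (C (frame 3 x) (frame 4 x)).
by move=> *; ring.
Qed.

(** The form (r_1^2 d theta_1 + r_2^2 d theta_2) / 2. The third factor is left out: its area form
    vanishes on vectors tangent to Y, so d of this form is omega0 there. *)
Definition lamf x : R6 R :=
  pair_mx (three (- (x 0 1) / 2) (- (x 1 1) / 2) 0) (three (x 0 0 / 2) (x 1 0 / 2) 0).

Lemma lamf_lin : linear lamf.
Proof.
by move=> a x y; apply: R6P; apply: I3P; rewrite /lamf !(mxE, pair_mx0, pair_mx1, threeE) /=; ring.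
Qed.

Lemma dlamf i j x : (0 < i <= 4)%N -> (0 < j <= 4)%N ->
  dfr (coef lamf) i j x = omega0 (frame i x) (frame j x).
Proof.
move=> hi hj.
have dl : differentiable lamf x.
  apply: (@smooth_on_diff _ _ _ setT _ _ _ I).
  by apply: lin_field_smooth; [exact: openT | exact: lamf_lin].
have D v : 'D_v lamf x = lamf v by rewrite derive_lin_field//; exact: lamf_lin.
rewrite -(dext_frame dl hi hj) /dext /ev !sum3 !sum2 !D.
rewrite omega0E (_ : cr (frame i x) (frame j x) ord_max = 0).
  by rewrite /lamf /cr !(pair_mx0, pair_mx1, threeE); field.
by move: hi hj; case: i => [|[|[|[|[|//]]]]] // _; case: j => [|[|[|[|[|//]]]]] // _;
  rewrite /cr /frame /torus_gen !(pair_mx0, pair_mx1, threeE); ring.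
Qed.

End Forms.
End DifferentialForms.
Import DifferentialForms.

(** * Formal power series of forms and their transport *)

Module GaugeRecursion.
Section StrongRecursion.

(** Iterating [Phi] from a constant sequence fixes the value at n after n + 1 steps, since this
    value depends on earlier ones only. *)
Lemma strong_recursion (T : Type) (d : T) (Phi : (nat -> T) -> nat -> T) :
  (forall n s s', (forall k, (k < n)%N -> s k = s' k) -> Phi s n = Phi s' n) ->
  exists f, forall n, f n = Phi f n.
Proof.
move=> ext; pose it m := iter m Phi (fun=> d).
have st n : forall m, (n < m)%N -> it m n = it n.+1 n.
  elim/ltn_ind: n => n IH [//|m] nm.
  apply: ext => k kn; rewrite ltnS in nm.
  exact: (etrans (IH k kn m (leq_trans kn nm)) (esym (IH k kn n kn))).
exists (fun n => it n.+1 n) => n.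
by apply: ext => k kn; exact: st.
Qed.

(** Both sides sum over the triples of indices with total n; this is the associativity of the Cauchy
    product. *)
Lemma sum_triangle (V : zmodType) n (H : nat -> nat -> nat -> V) :
  \sum_(i < n.+1) \sum_(j < i.+1) H j (i - j)%N (n - i)%N =
  \sum_(j < n.+1) \sum_(k < (n - j).+1) H j k (n - j - k)%N.
Proof.
elim: n H => [|n IH] H; first by rewrite !big_ord1.
rewrite [RHS]big_ord_recl /=.
under [X in _ = _ + X]eq_bigr => j _ do rewrite /bump leq0n add1n subSS.
rewrite -(IH (fun j => H j.+1)).
rewrite (eq_bigr (fun i : 'I_n.+2 => H 0%N i (n.+1 - i)%N +
   \sum_(j < i) H j.+1 (i - j.+1)%N (n.+1 - i)%N)); last first.
  by move=> i _; rewrite big_ord_recl /= subn0.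
rewrite big_split /= subn0; congr (_ + _).
rewrite big_ord_recl /= big_ord0 add0r.
apply: eq_bigr => i _; rewrite /bump leq0n add1n subSS.
by apply: eq_bigr => j _; rewrite subSS.
Qed.

End StrongRecursion.

Section Convolution.
Context {R : realType}.
Variable alpha : R.
Implicit Types (x : R6 R) (a b c e f W : nat -> nat -> R6 R -> R) (U : set (R6 R)).

Local Notation frame := (frame alpha).
Local Notation dfr := (dfr alpha).
Local Notation dfr_at := (dfr_at alpha).

Definition pfd (b c : nat -> R6 R -> R) x : R := pf (dfr_at b x) (dfr_at c x).

(** The coefficient of t^n in d a_t /\ d b_t, for the series a_t and b_t with coefficients [a i] and
    [b i]. *)
Definition conv a b n x : R := \sum_(i < n.+1) pfd (a i) (b (n - i)%N) x.

(** No structure term appears, because the brackets of the frame have no trace. *)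
Definition divergence (W : nat -> R6 R -> R) (q : R6 R -> R) x : R :=
  lie (frame 1) (fun y => W 1%N y * q y) x + lie (frame 2) (fun y => W 2%N y * q y) x +
  lie (frame 3) (fun y => W 3%N y * q y) x + lie (frame 4) (fun y => W 4%N y * q y) x.

Lemma dfr_lincomb (I : Type) (s : seq I) (k : I -> R) (b : I -> nat -> R6 R -> R) i j x :
  (forall l m, differentiable (b l m) x) ->
  dfr (fun m y => \sum_(l <- s) k l * b l m y) i j x = \sum_(l <- s) k l * dfr (b l) i j x.
Proof.
move=> db; rewrite /FrameForms.dfr.
have L m n : lie (frame m) (fun y => \sum_(l <- s) k l * b l n y) x = \sum_(l <- s) k l * lie (frame m) (b l n) x.
  by have [_] := @derive_lincomb _ _ _ s k (fun l => b l n) x (frame m x) (fun l => db l n).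
rewrite !L -!sumrN -!big_split /=.
have -> : structure alpha i j (fun m y => \sum_(l <- s) k l * b l m y) x =
   \sum_(l <- s) k l * structure alpha i j (b l) x.
  have S (c : R) m : c * (\sum_(l <- s) k l * b l m x) = \sum_(l <- s) k l * (c * b l m x).
    by rewrite mulr_sumr; apply: eq_bigr => l _; rewrite mulrCA.
  have S0 : 0 = \sum_(l <- s) k l * 0 :> R by rewrite big1// => l _; rewrite mulr0.
  by case: i => [|[|[|[|i]]]]; case: j => [|[|[|[|j]]]]; rewrite /structure ?S//.
by rewrite -sumrN -big_split; apply: eq_bigr => l _ /=; ring.
Qed.

Lemma dfr_near_eq (b c : nat -> R6 R -> R) U i j x : open U -> U x ->
  (forall m y, (0 < m <= 4)%N -> U y -> b m y = c m y) -> (0 < i <= 4)%N -> (0 < j <= 4)%N ->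
  dfr b i j x = dfr c i j x.
Proof.
move=> oU Ux bc hi hj; rewrite /FrameForms.dfr.
rewrite (lie_near_eq (frame i) oU Ux (fun y => bc j y hj)) (lie_near_eq (frame j) oU Ux (fun y => bc i y hi)).
congr (_ - _ - _).
by move: hi hj; case: i => [|[|[|[|[|//]]]]] // _; case: j => [|[|[|[|[|//]]]]] // _; rewrite /structure ?bc.
Qed.

Lemma pf_sym B C : pf B C = pf C B :> R.
Proof. by rewrite /pf; ring. Qed.

Lemma pfdC (b c : nat -> R6 R -> R) x : pfd b c x = pfd c b x. Proof. exact: pf_sym. Qed.

Lemma pfd_linl (I : Type) (s : seq I) (k : I -> R) (b : nat -> R6 R -> R) (c : I -> nat -> R6 R -> R) (d : nat -> R6 R -> R) x :
  (forall i j, (0 < i <= 4)%N -> (0 < j <= 4)%N -> dfr b i j x = \sum_(l <- s) k l * dfr (c l) i j x) ->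
  pfd b d x = \sum_(l <- s) k l * pfd (c l) d x.
Proof.
move=> h; rewrite /pfd /pf /FrameForms.dfr_at !h//.
elim: s {h} => [|l s IH]; first by rewrite !big_nil; ring.
rewrite !big_cons -{}IH; move: (k l) => kl.
repeat match goal with
  | |- context [dfr ?e ?i ?j x] => generalize (dfr e i j x); intro
  | |- context [\sum_(l <- s) ?F] => generalize (\sum_(l <- s) F); intro
  end; ring.
Qed.

Variable U : set (R6 R).
Hypothesis oU : open U.

(** In terms of series: if d a' = d (i_W d a) + d e and d b' = d (i_W d b) + d f, then the
    derivative of d a /\ d b is the divergence of W times this 4-form, by [pf_lie], plus the source
    terms d e /\ d b and d a /\ d f. *)
Lemma conv_step a b e f W n x : U x ->
  (forall m, smooth_coef U (a m)) -> (forall m, smooth_coef U (b m)) ->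
  (forall m, smooth_coef U (e m)) -> (forall m, smooth_coef U (f m)) ->
  (forall m, smooth_coef U (W m)) ->
  (forall m i j, (0 < i <= 4)%N -> (0 < j <= 4)%N ->
     m.+1%:R * dfr (a m.+1) i j x =
     \sum_(k < m.+1) dfr (iprod (W k) (dfr (a (m - k)%N))) i j x + dfr (e m) i j x) ->
  (forall m i j, (0 < i <= 4)%N -> (0 < j <= 4)%N ->
     m.+1%:R * dfr (b m.+1) i j x =
     \sum_(k < m.+1) dfr (iprod (W k) (dfr (b (m - k)%N))) i j x + dfr (f m) i j x) ->
  n.+1%:R * conv a b n.+1 x =
  \sum_(k < n.+1) divergence (W k) (conv a b (n - k)%N) x + conv e b n x + conv a f n x.
Proof.
move=> Ux sa sb se sf sW ha hb.
have stepl (g : nat -> nat -> R6 R -> R) (r : nat -> nat -> R6 R -> R) (c : nat -> R6 R -> R) m :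
  (forall i j, (0 < i <= 4)%N -> (0 < j <= 4)%N ->
     m.+1%:R * dfr (g m.+1) i j x =
     \sum_(k < m.+1) dfr (iprod (W k) (dfr (g (m - k)%N))) i j x + dfr (r m) i j x) ->
  m.+1%:R * pfd (g m.+1) c x = \sum_(k < m.+1) pfd (iprod (W k) (dfr (g (m - k)%N))) c x + pfd (r m) c x.
  move=> h.
  (* The index [None] carries the source, which makes the recursion a single linear combination for
     [pfd_linl]. *)
  have -> : pfd (g m.+1) c x = \sum_(l <- rcons [seq Some k | k <- enum 'I_m.+1] None) m.+1%:R^-1 *
     pfd (if l is Some k then iprod (W k) (dfr (g (m - k)%N)) else r m) c x.
    apply: pfd_linl => i j hi hj.
    rewrite -mulr_sumr -cats1 big_cat big_seq1 big_map big_enum /= -h//.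
    by rewrite mulKf// pnatr_eq0.
  by rewrite -mulr_sumr mulVKf ?pnatr_eq0// -cats1 big_cat big_seq1 big_map big_enum.
(* The Leibniz rule for series: n + 1 is split as i + (n + 1 - i) in front of the i-th term. *)
have E1 : n.+1%:R * conv a b n.+1 x =
   \sum_(i < n.+1) i.+1%:R * pfd (a i.+1) (b (n - i)%N) x +
   \sum_(i < n.+1) (n - i).+1%:R * pfd (a i) (b (n - i).+1) x.
  rewrite mulr_sumr (eq_bigr (fun i : 'I_n.+2 => i%:R * pfd (a i) (b (n.+1 - i)%N) x +
     (n.+1 - i)%:R * pfd (a i) (b (n.+1 - i)%N) x)); last first.
    by move=> i _; rewrite -mulrDl -natrD subnKC// -ltnS.
  rewrite big_split /=; congr (_ + _).
    rewrite big_ord_recl /= mul0r add0r; apply: eq_bigr => i _.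
    by rewrite /bump leq0n add1n subSS.
  rewrite big_ord_recr /= subnn mul0r addr0; apply: eq_bigr => i _.
  by rewrite subSn// -ltnS.
have EA : \sum_(i < n.+1) i.+1%:R * pfd (a i.+1) (b (n - i)%N) x =
   \sum_(j < n.+1) \sum_(k < (n - j).+1) pfd (iprod (W j) (dfr (a k))) (b (n - j - k)%N) x + conv e b n x.
  rewrite -(sum_triangle n (fun j k l => pfd (iprod (W j) (dfr (a k))) (b l) x)) -big_split /=.
  by apply: eq_bigr => i _; rewrite (stepl a e)// => *; exact: ha.
have EB : \sum_(i < n.+1) (n - i).+1%:R * pfd (a i) (b (n - i).+1) x =
   \sum_(j < n.+1) \sum_(k < (n - j).+1) pfd (a (n - j - k)%N) (iprod (W j) (dfr (b k))) x + conv a f n x.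
  rewrite -(sum_triangle n (fun j k l => pfd (a l) (iprod (W j) (dfr (b k))) x)).
  rewrite (reindex_inj rev_ord_inj) [conv a f n x](reindex_inj rev_ord_inj) /= -big_split /=.
  apply: eq_bigr => i _; rewrite subSS subKn; last by rewrite -ltnS.
  rewrite pfdC (stepl b f); last by move=> *; exact: hb.
  by rewrite pfdC; congr (_ + _); apply: eq_bigr => j _; rewrite pfdC.
rewrite E1 EA EB addrACA addrA; congr (_ + _ + _).
rewrite -big_split; apply: eq_bigr => j _ /=.
set m := (n - j)%N.
have -> : \sum_(k < m.+1) pfd (a (m - k)%N) (iprod (W j) (dfr (b k))) x =
   \sum_(k < m.+1) pfd (a k) (iprod (W j) (dfr (b (m - k)%N))) x.
  rewrite (reindex_inj rev_ord_inj) /=; apply: eq_bigr => k _.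
  by rewrite subSS subKn// -ltnS.
rewrite -big_split /=.
have PL k := pf_lie alpha oU (sa k) (sb (m - k)%N) (sW j) Ux.
under eq_bigr => k _ do rewrite {1 2}/pfd (PL k).
have dp k : differentiable (pfd (a k) (b (m - k)%N)) x.
  by apply: smooth_on_diff (pf_smooth alpha oU (sa k) (sb (m - k)%N)) Ux.
have dw i : differentiable (W j i) x by exact: smooth_on_diff (sW j i) Ux.
have L i : lie (frame i) (fun y => W j i y * conv a b m y) x =
   \sum_(k < m.+1) lie (frame i) (fun y => W j i y * pfd (a k) (b (m - k)%N) y) x.
  have [_ h] := @derive_lincomb _ _ _ (index_enum _) (fun=> 1) (fun (k : 'I_m.+1) y => W j i y * pfd (a k) (b (m - k)%N) y)
    x (frame i x) (fun k => differentiableM (dw i) (dp k)).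
  rewrite /lie (_ : (fun y => W j i y * conv a b m y) =
    (fun y => \sum_(k < m.+1) 1 * (W j i y * pfd (a k) (b (m - k)%N) y))).
    by rewrite h; apply: eq_bigr => k _; rewrite mul1r.
  by apply/funext => y; rewrite /conv mulr_sumr; apply: eq_bigr => k _; rewrite mul1r.
by rewrite /divergence !L -!big_split.
Qed.

End Convolution.
End GaugeRecursion.
Import GaugeRecursion.

(** * A frame of the complement G *)

Module Complement.
Section ComplementFrame.
Context {R : realType}.
Variable alpha : R.
Hypothesis alpha_gt0 : 0 < alpha.
Variable G : R6 R -> set (R6 R).
Hypothesis hG : smooth_complement (Y alpha) G.
Implicit Types (x y u v w : R6 R) (i j : nat).

Local Notation frame := (frame alpha).
Local Notation dom := (dom alpha).
Local Notation X1 := (X1 alpha).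
Local Notation xi := (xi alpha).
Local Notation fcomp := (fcomp alpha).

(** [frame j] corrected along the null directions. With suitable p and q, the fields for j = 2 and 3
    span G. *)
Definition Ehat (p q : nat -> R6 R -> R) j x : R6 R :=
  frame j x + p j x *: X1 x + q j x *: frame 4 x.

Lemma G_lin x (k : R) u v : Y alpha x -> G x u -> G x v -> G x (k *: u + v).
Proof. by move=> Yx; have [[_ h] _ _ _ _] := hG Yx; exact: h. Qed.

Lemma G_null0 x (a b : R) : Y alpha x -> G x (a *: X1 x + b *: frame 4 x) -> a = 0 /\ b = 0.
Proof.
move=> Yx Gx; have [_ _ _ h _] := hG Yx; have dx := Y_dom Yx.
have e0 : a *: X1 x + b *: frame 4 x = 0.
  by apply: h => //; apply/(null_tangentP alpha_gt0) => //; exists a, b.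
have c0 i : fcomp i x 0 = 0.
  have := comp_lin alpha i x (-1) 0 0; rewrite scaler0 addr0; lra.
have X14 : fcomp 4 x (X1 x) = 0.
  by rewrite comp4E /cr /Coframes.X1 /torus_gen !(pair_mx0, pair_mx1, threeE); ring.
have f4 i : fcomp i x (b *: frame 4 x) = b * fcomp i x (frame 4 x).
  by rewrite -[b *: _]addr0 comp_lin c0 addr0.
have := congr1 (fcomp 1 x) e0; have := congr1 (fcomp 4 x) e0.
rewrite !comp_lin !c0 !f4 X14 !comp_frame//= mulr0 add0r mulr1 => -> .
rewrite mul0r addr0 => /eqP; rewrite mulf_eq0 => /orP[/eqP //|].
rewrite -/(xi 1 x) xi1E mulf_eq0 invr_eq0 (gt_eqF (ww_gt0 alpha_gt0 dx)) /=.
by case: dx => h1 _; rewrite (gt_eqF h1).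
Qed.

Lemma G_frame_pointwise x j : Y alpha x -> exists ab : R * R,
  G x (frame j x + ab.1 *: X1 x + ab.2 *: frame 4 x).
Proof.
move=> Yx; have [_ _ h _ _] := hG Yx.
have tf : tangent (Y alpha) x (frame j x).
  by apply/tangentP => //; exact: frame_tangential.
have [u [w [Gu /(null_tangentP alpha_gt0 _ Yx)[a [b ->]] E]]] := h _ tf.
exists (- a, - b) => /=.
by rewrite E !scaleNr -addrA -opprD addrK.
Qed.

Lemma comp_smooth i (Z : R6 R -> R6 R) (O : set (R6 R)) : open O -> O `<=` dom -> smooth_on O Z ->
  smooth_on O (fun x => fcomp i x (Z x)).
Proof.
move=> oO Od sZ; rewrite /Coframes.fcomp /pairing.
apply: smooth_on_sum => // l _; apply: smooth_on_sum => // k _.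
apply: smooth_onM => //; apply: smooth_on_entry => //.
by apply: smooth_onW Od _; exact: coframe_smooth.
Qed.

(* coefficients of a field on X1, frame 2, frame 3 and frame 4 *)
Let z1 (Z : R6 R -> R6 R) y := fcomp 1 y (Z y) / xi 1 y.
Let z2 (Z : R6 R -> R6 R) y := fcomp 2 y (Z y) - xi 2 y * z1 Z y.
Let z3 (Z : R6 R -> R6 R) y := fcomp 3 y (Z y) - xi 3 y * z1 Z y.
Let z4 (Z : R6 R -> R6 R) y := fcomp 4 y (Z y).

Let xi1_neq0 x : dom x -> xi 1 x != 0.
Proof.
move=> dx; rewrite xi1E mulf_neq0 ?invr_eq0 ?lt0r_neq0 ?ww_gt0//; by case: dx.
Qed.

Let z_smooth (Z : R6 R -> R6 R) (O : set (R6 R)) : open O -> O `<=` dom -> smooth_on O Z ->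
  [/\ smooth_on O (z1 Z), smooth_on O (z2 Z), smooth_on O (z3 Z) & smooth_on O (z4 Z)].
Proof.
move=> oO Od sZ; have sc i := comp_smooth i oO Od sZ.
have sx i : (0 < i <= 3)%N -> smooth_on O (xi i) by move=> hi; exact: xi_smooth.
have s1 : smooth_on O (z1 Z).
  apply: smooth_onM => //; apply: smooth_onV => //; last exact: sx.
  by move=> x /Od; exact: xi1_neq0.
split => //; first by apply: smooth_onB => //; apply: smooth_onM => //; exact: sx.
  by apply: smooth_onB => //; apply: smooth_onM => //; exact: sx.
exact: (sc 4%N).
Qed.

Let z_decomp (Z : R6 R -> R6 R) y : dom y -> tangential alpha y (Z y) ->
  Z y = z1 Z y *: X1 y + z2 Z y *: frame 2 y + z3 Z y *: frame 3 y + z4 Z y *: frame 4 y.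
Proof.
move=> dy tZ; have e : fcomp 1 y (Z y) = z1 Z y * xi 1 y by rewrite divfK// xi1_neq0.
rewrite {1}(tangential_decomp alpha_gt0 dy tZ) e (X1_decomp alpha_gt0 dy) /z2 /z3 /z4.
move: (z1 Z y) (fcomp _ _ _) (fcomp _ _ _) (fcomp _ _ _) => a b c d.
by apply/matrixP => l k; rewrite !mxE; ring.
Qed.

Let z_val x0 j (a b : R) : dom x0 -> (1 < j < 4)%N -> forall Z : R6 R -> R6 R,
  Z x0 = frame j x0 + a *: X1 x0 + b *: frame 4 x0 -> z2 Z x0 = (j == 2)%:R /\ z3 Z x0 = (j == 3)%:R.
Proof.
move=> d0 hj Z e.
have c0 i : fcomp i x0 0 = 0.
  have := comp_lin alpha i x0 (-1) 0 0; rewrite scaler0 addr0; lra.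
have cl i (k : R) u : fcomp i x0 (k *: u) = k * fcomp i x0 u.
  by rewrite -[k *: u]addr0 comp_lin c0 addr0.
have cd i u v : fcomp i x0 (u + v) = fcomp i x0 u + fcomp i x0 v.
  by rewrite -[u]scale1r comp_lin mul1r scale1r.
have hj4 : (0 < j <= 4)%N by case/andP: hj; case: j {e} => [|[|[|[|]]]].
have E1 : z1 Z x0 = a.
  rewrite /z1 e !cd !cl !comp_frame// -/(xi 1 x0).
  move: hj; case: j {e hj4} => [|[|[|[|]]]]//= _; 
    by rewrite mulr0 addr0 add0r mulfK// xi1_neq0.
rewrite /z2 /z3 E1 e !cd !cl !comp_frame// -/(xi 2 x0) -/(xi 3 x0).
by move: hj; case: j {e hj4} => [|[|[|[|]]]]//= _; split; ring.
Qed.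

Lemma Gsub x (u v : R6 R) (k : R) : Y alpha x -> G x u -> G x v -> G x (u - k *: v).
Proof.
by move=> Yx Gu Gv; rewrite -[u - _]addrC -scaleNr; exact: G_lin.
Qed.

Let z_rel x (P Q : nat -> R) (Z : R6 R -> R6 R) : Y alpha x -> G x (Z x) ->
  (forall j, G x (frame j x + P j *: X1 x + Q j *: frame 4 x)) ->
  z1 Z x = z2 Z x * P 2%N + z3 Z x * P 3%N /\ z4 Z x = z2 Z x * Q 2%N + z3 Z x * Q 3%N.
Proof.
move=> Yx GZ GE; have dx := Y_dom Yx.
have [_ Gt _ _ _] := hG Yx.
have tZ : tangential alpha x (Z x) by apply/tangentP => //; exact: Gt.
have D := z_decomp dx tZ.
have := Gsub (z3 Z x) Yx (Gsub (z2 Z x) Yx GZ (GE 2%N)) (GE 3%N).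
rewrite {1}D; set v := (X in G x X).
have -> : v = (z1 Z x - z2 Z x * P 2%N - z3 Z x * P 3%N) *: X1 x
  + (z4 Z x - z2 Z x * Q 2%N - z3 Z x * Q 3%N) *: frame 4 x.
  by apply/matrixP => l k; rewrite /v !mxE; ring.
by move=> /(G_null0 Yx)[h1 h2]; split; lra.
Qed.

(** G meets the null directions in 0, so the coefficients are determined on Y pointwise. Smoothness
    is local, by Cramer's rule in terms of two smooth sections of G; composing with [rho] then
    extends the coefficients from Y to [dom]. *)
Lemma G_frame_exists : exists p q : nat -> R6 R -> R,
  [/\ forall j, (j == 2)%N || (j == 3)%N -> smooth_on dom (p j),
      forall j, (j == 2)%N || (j == 3)%N -> smooth_on dom (q j)
    & forall x, Y alpha x -> G x (Ehat p q 2 x) /\ G x (Ehat p q 3 x)].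
Proof.
pose ab j x : R * R := match pselect (Y alpha x) with
  | left Yx => sval (cid (G_frame_pointwise j Yx)) | right _ => (0, 0) end.
have abP j x : Y alpha x -> G x (frame j x + (ab j x).1 *: X1 x + (ab j x).2 *: frame 4 x).
  move=> Yx; rewrite /ab; case: pselect => // Yx'.
  by case: cid.
pose P j x := (ab j x).1; pose Q j x := (ab j x).2.
(* near every point of Y the coefficients are rational in those of two sections *)
have local x0 : Y alpha x0 -> exists O : set (R6 R), [/\ open O, O x0, O `<=` dom &
   forall j, (j == 2)%N || (j == 3)%N -> exists f g : R6 R -> R,
     [/\ smooth_on O f, smooth_on O g & forall y, Y alpha y -> O y -> P j y = f y /\ Q j y = g y]].
  move=> Y0; have d0 := Y_dom Y0.
  have [_ _ _ _ sec] := hG Y0.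
  have [Z2 [[[U2 [oU2 YU2 s2]] G2] e2]] := sec _ (abP 2%N x0 Y0).
  have [Z3 [[[U3 [oU3 YU3 s3]] G3] e3]] := sec _ (abP 3%N x0 Y0).
  have od : open dom by exact: dom_open.
  pose O1 := U2 `&` U3 `&` dom.
  have oO1 : open O1 by apply: openI => //; exact: openI.
  have O1d : O1 `<=` dom by move=> y [].
  have s2' : smooth_on O1 Z2 by apply: smooth_onW s2 => y [[]].
  have s3' : smooth_on O1 Z3 by apply: smooth_onW s3 => y [[]].
  have [t1 t2 t3 t4] := z_smooth oO1 O1d s2'.
  have [u1 u2 u3 u4] := z_smooth oO1 O1d s3'.
  (* The determinant of the two sections modulo the null directions. It is 1 at x0, because there
     the sections are [frame 2] and [frame 3] up to null vectors. *)
  pose det y := z2 Z2 y * z3 Z3 y - z3 Z2 y * z2 Z3 y.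
  have sdet : smooth_on O1 det by apply: smooth_onB => //; apply: smooth_onM.
  pose O := O1 `&` det @^-1` [set t | t != 0].
  have v2 := z_val d0 (isT : (1 < 2 < 4)%N) e2.
  have v3 := z_val d0 (isT : (1 < 3 < 4)%N) e3.
  have oO : open O.
    rewrite openE => y [y1 y2]; apply: filterI; first exact: open_nbhs_nbhs.
    have cd : {for y, continuous det} by exact: (smooth_on_cts sdet y1).
    apply: cd; apply: open_nbhs_nbhs; split => //; exact: (@open_neq _ _ 0).
  have sO (f : R6 R -> R) : smooth_on O1 f -> smooth_on O f by apply: smooth_onW => y [].
  have sV : smooth_on O (fun y => (det y)^-1).
    by apply: smooth_onV => //; [move=> y []|exact: sO].
  exists O; split => //.
  - split; last by rewrite /O/= /det v2.1 v2.2 v3.1 v3.2 /= mulr1 mulr0 subr0 oner_eq0.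
    by split => //; split; [exact: YU2|exact: YU3].
  - by move=> y [[]].
  have rel y : Y alpha y -> O y ->
    [/\ P 2%N y = (z1 Z2 y * z3 Z3 y - z3 Z2 y * z1 Z3 y) * (det y)^-1,
        P 3%N y = (z2 Z2 y * z1 Z3 y - z2 Z3 y * z1 Z2 y) * (det y)^-1,
        Q 2%N y = (z4 Z2 y * z3 Z3 y - z3 Z2 y * z4 Z3 y) * (det y)^-1
      & Q 3%N y = (z2 Z2 y * z4 Z3 y - z2 Z3 y * z4 Z2 y) * (det y)^-1].
    move=> Yy [_ /= dy].
    have [r1 r2] := z_rel Yy (G2 _ Yy) (fun j => abP j _ Yy).
    have [r3 r4] := z_rel Yy (G3 _ Yy) (fun j => abP j _ Yy).
    rewrite r1 r2 r3 r4 -/(P 2%N y) -/(P 3%N y) -/(Q 2%N y) -/(Q 3%N y).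
    by split; apply: (mulIf dy); rewrite mulfVK// /det; ring.
  have sm (f g h k : R6 R -> R) : smooth_on O1 f -> smooth_on O1 g -> smooth_on O1 h -> smooth_on O1 k ->
    smooth_on O (fun y => (f y * g y - h y * k y) * (det y)^-1).
    move=> sf sg sh sk; apply: smooth_onM => //.
    by apply: sO; apply: smooth_onB => //; apply: smooth_onM.
  move=> j /orP[]/eqP->.
  - exists (fun y => (z1 Z2 y * z3 Z3 y - z3 Z2 y * z1 Z3 y) * (det y)^-1),
      (fun y => (z4 Z2 y * z3 Z3 y - z3 Z2 y * z4 Z3 y) * (det y)^-1).
    by split; [exact: sm|exact: sm|move=> y Yy Oy; have [? _ ? _] := rel _ Yy Oy].
  - exists (fun y => (z2 Z2 y * z1 Z3 y - z2 Z3 y * z1 Z2 y) * (det y)^-1),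
      (fun y => (z2 Z2 y * z4 Z3 y - z2 Z3 y * z4 Z2 y) * (det y)^-1).
    by split; [exact: sm|exact: sm|move=> y Yy Oy; have [_ ? _ ?] := rel _ Yy Oy].
have od : open dom by exact: dom_open.
have sr : smooth_on dom (rho alpha) := @rho_smooth _ alpha.
have smr (F : R6 R -> R) : (forall x0, Y alpha x0 -> exists O : set (R6 R), [/\ open O, O x0, O `<=` dom &
    exists f : R6 R -> R, smooth_on O f /\ forall y, Y alpha y -> O y -> F y = f y]) ->
  smooth_on dom (fun x => F (rho alpha x)).
  move=> h; apply: smooth_on_local => // x dx.
  have [B0 [oO Ox Od [f [sf ef]]]] := h _ (rho_Y dx).
  pose B := [set y | dom y /\ B0 (rho alpha y)].
  have oB : open B.
    rewrite openE => y [dy Oy]; apply: filterI; first exact: open_nbhs_nbhs.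
    by apply: (smooth_on_cts sr dy); exact: open_nbhs_nbhs.
  exists B; split => //.
  exists (fun y => f (rho alpha y)).
    by move=> y [dy Oy]; rewrite ef//; exact: rho_Y.
  apply: (@smooth_on_compM _ _ _ _ B0) => //; first by move=> y [].
  by apply: smooth_onW sr => y [].
exists (fun j x => P j (rho alpha x)), (fun j x => Q j (rho alpha x)); split.
- move=> j hj; apply: smr => x0 Yx0.
  have [B0 [oO Ox Od h]] := local _ Yx0; exists B0; split => //.
  by have [f [g [sf sg e]]] := h j hj; exists f; split => // y Yy Oy; have [] := e _ Yy Oy.
- move=> j hj; apply: smr => x0 Yx0.
  have [B0 [oO Ox Od h]] := local _ Yx0; exists B0; split => //.
  by have [f [g [sf sg e]]] := h j hj; exists g; split => // y Yy Oy; have [] := e _ Yy Oy.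
- by move=> x Yx; rewrite /Ehat !rho_id//; split; exact: abP.
Qed.

(** Subtracting from v the combination with the same components on [frame 2] and [frame 3] leaves a
    null vector of G, that is 0. *)
Lemma G_span (p q : nat -> R6 R -> R) x v : Y alpha x -> G x (Ehat p q 2 x) -> G x (Ehat p q 3 x) ->
  G x v -> exists c2 c3 : R, v = c2 *: Ehat p q 2 x + c3 *: Ehat p q 3 x.
Proof.
move=> Yx G2 G3 Gv; have dx := Y_dom Yx; have [_ Gt _ _ _] := hG Yx.
have tZ : tangential alpha x v by apply/tangentP => //; exact: Gt.
have D := @z_decomp (fun=> v) _ dx tZ.
exists (z2 (fun=> v) x), (z3 (fun=> v) x); apply/eqP; rewrite -subr_eq0; apply/eqP.
have [_ _ _ h _] := hG Yx; apply: h => //.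
  by rewrite opprD addrA -scaleNr -scalerN scalerN -scaleNr; 
     rewrite !scaleNr; apply: Gsub => //; exact: Gsub.
apply/(null_tangentP alpha_gt0) => //.
exists (z1 (fun=> v) x - z2 (fun=> v) x * p 2%N x - z3 (fun=> v) x * p 3%N x),
  (z4 (fun=> v) x - z2 (fun=> v) x * q 2%N x - z3 (fun=> v) x * q 3%N x).
rewrite {1}D /Ehat; apply/matrixP => l k; rewrite !mxE; ring.
Qed.

End ComplementFrame.
End Complement.
Import Complement.

(** * Solving i_W omega = r on G *)

Module GaugeStep.
Section Gauge.
Context {R : realType}.
Variable alpha : R.
Hypothesis alpha_gt0 : 0 < alpha.
Implicit Types (x y u v w : R6 R) (i j : nat).

Local Notation frame := (frame alpha).
Local Notation dom := (dom alpha).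
Local Notation X1 := (X1 alpha).
Local Notation xi := (xi alpha).
Local Notation ww := (ww alpha).
Local Notation fcomp := (fcomp alpha).
Local Notation dfr := (dfr alpha).
Local Notation form := (form alpha).
Local Notation conv := (conv alpha).
Local Notation lam := (coef alpha lamf).

Lemma lam_smooth (U : set (R6 R)) : open U -> smooth_coef U lam.
Proof. by move=> oU; apply: coef_smooth => //; apply: lin_field_smooth => //; exact: lamf_lin. Qed.

(** X1 and [frame 4] lie in the kernel of d lambda. On the first three fields d lambda is thus t
    times the contraction of the volume by X1, and pairing [frame 2] with [frame 3] gives t. *)
Lemma dlam_eq x : dom x -> exists t : R,
  [/\ dfr lam 1 2 x = xi 3 x * t, dfr lam 1 3 x = - xi 2 x * t, dfr lam 2 3 x = xi 1 x * t,
      xi 1 x * t = ww x & forall i, (0 < i <= 4)%N -> dfr lam i 4 x = 0].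
Proof.
move=> dx; have w0 := ww_gt0 alpha_gt0 dx.
have N0 : Nf alpha x != 0 by case: dx => h _; rewrite gt_eqF.
have x0 : xi 1 x != 0 by rewrite xi1E mulf_neq0 ?invr_eq0// gt_eqF.
have kX v : tangential alpha x v -> omega0 (X1 x) v = 0 by move=> [h _]; rewrite omega_X1 h oppr0.
have e v : omega0 (X1 x) v = xi 1 x * omega0 (frame 1 x) v + xi 2 x * omega0 (frame 2 x) v
    + xi 3 x * omega0 (frame 3 x) v.
  rewrite (X1_decomp alpha_gt0 dx) -[xi 3 x *: _]addr0 -!addrA !omega_lin.
  have -> : omega0 0 v = 0 by rewrite omega0E /cr !mxE; ring.
  by rewrite addr0.
have d v : omega0 v v = 0 by have := omega_anti v v; lra.
have h2 := kX _ (frame_tangential alpha 2 x); have h3 := kX _ (frame_tangential alpha 3 x).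
rewrite !e in h2 h3; rewrite d in h2; rewrite d in h3.
rewrite !dlamf//.
have h23 := omega_frame23 alpha x; have a32 := omega_anti (frame 3 x) (frame 2 x).
exists (ww x / xi 1 x); split => //.
- by apply: (mulfI x0); rewrite mulrCA (mulrC (ww x)) mulVKf//; rewrite a32 h23 in h2; lra.
- by apply: (mulfI x0); rewrite mulrCA (mulrC (ww x)) mulVKf//; rewrite h23 in h3; lra.
- by rewrite mulrC divfK// h23.
- by rewrite mulrC divfK.
- move=> i hi; rewrite dlamf// omega_anti omega_frame4.
  by have [_ ->] := frame_tangential alpha i x; rewrite oppr0 oppr0.
Qed.

Variables p q : nat -> R6 R -> R.
Hypothesis smp : forall j, (j == 2)%N || (j == 3)%N -> smooth_on dom (p j).
Hypothesis smq : forall j, (j == 2)%N || (j == 3)%N -> smooth_on dom (q j).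

Definition Ecoef j i x : R := match i with
  | 1%N => (1 == j)%N%:R + p j x * xi 1 x
  | 2%N => (2 == j)%N%:R + p j x * xi 2 x
  | 3%N => (3 == j)%N%:R + p j x * xi 3 x
  | 4%N => q j x
  | _ => 0 end.

Definition Epair (r : nat -> R6 R -> R) j x : R :=
  r 1%N x * Ecoef j 1 x + r 2%N x * Ecoef j 2 x + r 3%N x * Ecoef j 3 x + r 4%N x * Ecoef j 4 x.

(* the section W of span (Ehat 2, Ehat 3) such that i_W omega and r agree there *)
Definition solve (r : nat -> R6 R -> R) i x : R :=
  Epair r 3 x / ww x * Ecoef 2 i x - Epair r 2 x / ww x * Ecoef 3 i x.

Lemma Ecoef_smooth j i : (j == 2)%N || (j == 3)%N -> smooth_on dom (Ecoef j i).
Proof.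
move=> hj; have od : open dom by exact: dom_open.
have s k : (0 < k <= 3)%N -> smooth_on dom (fun x => (k == j)%N%:R + p j x * xi k x).
  move=> hk; apply: smooth_onD => //; first exact: smooth_on_cst.
  by apply: smooth_onM => //; [exact: smp|exact: xi_smooth].
case: i => [|[|[|[|[|i]]]]]; [exact: smooth_on_cst|exact: s|exact: s|exact: s|exact: smq|exact: smooth_on_cst].
Qed.

Lemma sq_smooth (U : set (R6 R)) k : open U -> smooth_on U (fun x : R6 R => sq x k).
Proof. by move=> oU; apply: smooth_onD => //; apply: smooth_onX => //; exact: smooth_on_coord. Qed.

Lemma ww_smooth (U : set (R6 R)) : open U -> smooth_on U ww.
Proof.
move=> oU; apply: smooth_onD => //; first exact: sq_smooth.
by apply: smooth_onM => //; [exact: smooth_on_cst|exact: sq_smooth].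
Qed.

Lemma solve_smooth (r : nat -> R6 R -> R) : smooth_coef dom r -> smooth_coef dom (solve r).
Proof.
move=> sr i; have od : open dom by exact: dom_open.
have sv j : (j == 2)%N || (j == 3)%N -> smooth_on dom (fun x => Epair r j x / ww x).
  move=> hj; apply: smooth_onM => //.
    by do ![apply: smooth_onD => //]; apply: smooth_onM => //; exact: sr || exact: Ecoef_smooth.
  by apply: smooth_onV => //; [move=> x dx; rewrite gt_eqF// ww_gt0|exact: ww_smooth].
by apply: smooth_onB => //; apply: smooth_onM => //; exact: sv || exact: Ecoef_smooth.
Qed.

(** The null corrections do not change omega, so [Ehat] 2 and 3 pair to [ww] as [frame 2] and
    [frame 3] do; [solve] inverts this nondegenerate pairing. *)
Lemma solveP (r : nat -> R6 R -> R) x j : dom x -> (j == 2)%N || (j == 3)%N ->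
  Epair (iprod (solve r) (dfr lam)) j x = Epair r j x.
Proof.
move=> dx hj; have [t [e12 e13 e23 et e4]] := dlam_eq dx.
have w0 := ww_gt0 alpha_gt0 dx.
have d0 i : (0 < i <= 4)%N -> dfr lam i i x = 0 by move=> hi; have := dfr_anti alpha lam x hi hi; lra.
have an i k : (0 < i <= 4)%N -> (0 < k <= 4)%N -> dfr lam i k x = - dfr lam k i x by exact: dfr_anti.
rewrite {1}/Epair /iprod !d0// (an 2 1)%N// (an 3 1)%N// (an 3 2)%N// (an 4 1)%N// (an 4 2)%N// (an 4 3)%N//.
rewrite e12 e13 e23 !e4// /solve -et /Ecoef.
have x1 : xi 1 x * t != 0 by rewrite et gt_eqF.
have [x10 t0] : xi 1 x != 0 /\ t != 0 by move: x1; rewrite mulf_eq0 negb_or => /andP[].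
case/orP: hj => /eqP-> /=; rewrite ?mulr0n ?mulr1n.
all: move: (Epair r 3 x) (Epair r 2 x) (p 2%N x) (p 3%N x) (q 2%N x) (q 3%N x) (xi 1 x) (xi 2 x) (xi 3 x) x10 t0.
all: by move=> *; field; apply/andP.
Qed.

(** X1 and [frame 4] are in the kernel of omega. Adding i_W omega to a form therefore leaves its
    values on the leaves unchanged. *)
Lemma solve_null (r : nat -> R6 R -> R) x : dom x ->
  iprod (solve r) (dfr lam) 1 x * xi 1 x + iprod (solve r) (dfr lam) 2 x * xi 2 x 
  + iprod (solve r) (dfr lam) 3 x * xi 3 x = 0 /\ iprod (solve r) (dfr lam) 4 x = 0.
Proof.
move=> dx; have [t [e12 e13 e23 et e4]] := dlam_eq dx.
have d0 i : (0 < i <= 4)%N -> dfr lam i i x = 0 by move=> hi; have := dfr_anti alpha lam x hi hi; lra.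
have an i k : (0 < i <= 4)%N -> (0 < k <= 4)%N -> dfr lam i k x = - dfr lam k i x by exact: dfr_anti.
rewrite /iprod !d0// (an 2 1)%N// (an 3 1)%N// (an 3 2)%N// (an 4 1)%N// (an 4 2)%N// (an 4 3)%N//.
rewrite e12 e13 e23 !e4//.
move: (solve r 1 x) (solve r 2 x) (solve r 3 x) (solve r 4 x) => a b c d; split; ring.
Qed.

End Gauge.
End GaugeStep.
Import GaugeStep.

(** * The formal isotopy *)

Module GaugeSolution.
Section GaugeTheorem.
Context {R : realType}.
Variable alpha : R.
Hypothesis alpha_gt0 : 0 < alpha.
Implicit Types (x y u v w : R6 R) (i j : nat).

Local Notation frame := (frame alpha).
Local Notation dom := (dom alpha).
Local Notation X1 := (X1 alpha).
Local Notation xi := (xi alpha).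
Local Notation ww := (ww alpha).
Local Notation fcomp := (fcomp alpha).
Local Notation dfr := (dfr alpha).
Local Notation form := (form alpha).
Local Notation conv := (GaugeRecursion.conv alpha).
Local Notation lam := (coef alpha lamf).
Local Notation comps := (nat -> R6 R -> R).

Variables p q : comps.
Local Notation solve := (solve alpha p q).
Local Notation Epair := (Epair alpha p q).

(** The Taylor coefficients of the system a' = i_W d a - mu, mu' = i_W d mu, that is of the
    pullbacks of lambda - t mu0 and mu0 by the flow of W, up to exact terms. The field W_n is chosen
    so that the coefficient a_(n+1) vanishes on G. *)
Lemma gauge_sequences (mu0 : comps) : exists a mu W : nat -> comps,
  [/\ a 0%N = lam, mu 0%N = mu0,
   forall n, a n.+1 = fun i y => n.+1%:R^-1 * (\sum_(k < n.+1) iprod (W k) (dfr (a (n - k)%N)) i y - mu n i y),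
   forall n, mu n.+1 = fun i y => n.+1%:R^-1 * \sum_(k < n.+1) iprod (W k) (dfr (mu (n - k)%N)) i y
   & forall n, W n = solve (fun i y => mu n i y - \sum_(k < n) iprod (W k) (dfr (a (n - k)%N)) i y)].
Proof.
pose an (s : nat -> comps * comps * comps) n : comps := if n is m.+1 then
  fun i y => m.+1%:R^-1 * (\sum_(k < m.+1) iprod (s k).2 (dfr (s (m - k)%N).1.1) i y - (s m).1.2 i y)
  else lam.
pose mn (s : nat -> comps * comps * comps) n : comps := if n is m.+1 then
  fun i y => m.+1%:R^-1 * \sum_(k < m.+1) iprod (s k).2 (dfr (s (m - k)%N).1.2) i y
  else mu0.
(* The term k = 0 contains a_n, which is produced at the same stage n; it must be read from
   [an s n], since [s n] is not yet available to the recursion. *)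
pose Wn s n : comps := solve (fun i y => mn s n i y -
  \sum_(k < n) iprod (s k).2 (dfr (if k == 0 :> nat then an s n else (s (n - k)%N).1.1)) i y).
have ex n s s' : (forall k, (k < n)%N -> s k = s' k) -> (an s n, mn s n, Wn s n) = (an s' n, mn s' n, Wn s' n).
  move=> h.
  have ea : an s n = an s' n.
    case: n h => [|n] h; first by [].
    apply/funext => i; apply/funext => y; rewrite /= (h _ (ltnSn n)); congr (_ * (_ - _)).
    by apply: eq_bigr => k _; rewrite (h _ (ltn_ord k)) (h _ (leq_ltn_trans (leq_subr k n) (ltnSn n))).
  have em : mn s n = mn s' n.
    case: n h {ea} => [|n] h; first by [].
    apply/funext => i; apply/funext => y; rewrite /=; congr (_ * _).
    by apply: eq_bigr => k _; rewrite (h _ (ltn_ord k)) (h _ (leq_ltn_trans (leq_subr k n) (ltnSn n))).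
  rewrite ea em /Wn; congr (_, _, solve _); rewrite em; apply/funext => i; apply/funext => y.
  congr (_ - _); apply: eq_bigr => k _; rewrite (h _ (ltn_ord k)) ea.
  case: eqP => [_|/eqP k0]; first by [].
  have kn : (n - k < n)%N by rewrite ltn_subrL lt0n k0 (leq_ltn_trans _ (ltn_ord k)).
  by rewrite (h _ kn).
have [f fE] := @strong_recursion _ (lam, mu0, lam) (fun s n => (an s n, mn s n, Wn s n)) ex.
exists (fun n => (f n).1.1), (fun n => (f n).1.2), (fun n => (f n).2); split.
- by rewrite fE.
- by rewrite fE.
- by move=> n; rewrite fE.
- by move=> n; rewrite fE.
- move=> n; rewrite {1}fE /= /Wn; congr (solve _); apply/funext => i; apply/funext => y.
  have -> : (f n).1.2 = mn f n by rewrite fE.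
  congr (_ - _); apply: eq_bigr => k _.
  case: eqP => [k0|_]; last by [].
  have -> : (f (n - k)%N).1.1 = an f n by rewrite k0 subn0 fE.
  by [].
Qed.

Hypothesis smp : forall j, (j == 2)%N || (j == 3)%N -> smooth_on dom (p j).
Hypothesis smq : forall j, (j == 2)%N || (j == 3)%N -> smooth_on dom (q j).

Variable mu0 : comps.
Hypothesis smu0 : smooth_coef dom mu0.

(** The fields of the frame are tangent to Y, so the divergence on Y of W times f sees only the
    values of f on Y. *)
Lemma divergence0 (W : comps) (f : R6 R -> R) x : smooth_coef dom W -> smooth_on dom f ->
  (forall y, Y alpha y -> f y = 0) -> Y alpha x -> divergence alpha W f x = 0.
Proof.
move=> sW sf f0 Yx; have dx := Y_dom Yx; have od : open dom by exact: dom_open.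
have l i : lie (frame i) (fun y => W i y * f y) x = 0.
  apply: (@tangent_derive0 _ alpha _ x (frame i x)); first by apply/tangentP => //; exact: frame_tangential.
    by apply: (@smooth_on_diff _ _ _ dom) => //; apply: smooth_onM => //; exact: sW.
  by move=> y Yy; rewrite f0// mulr0.
by rewrite /divergence !l !addr0.
Qed.

Lemma conv_smooth (a b : nat -> comps) n : (forall m, smooth_coef dom (a m)) ->
  (forall m, smooth_coef dom (b m)) -> smooth_on dom (conv a b n).
Proof.
move=> sa sb; apply: smooth_on_sum => // [|k _]; first exact: dom_open.
by apply: pf_smooth => //; exact: dom_open.
Qed.

Lemma dfr_step (V : nat -> comps) (r : comps) m i j x :
  (forall k l, differentiable (V k l) x) -> (forall l, differentiable (r l) x) ->
  m.+1%:R * dfr (fun l y => m.+1%:R^-1 * (\sum_(k < m.+1) V k l y + r l y)) i j x =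
  \sum_(k < m.+1) dfr (V k) i j x + dfr r i j x.
Proof.
move=> dV dr; pose s : seq (option 'I_m.+1) := rcons [seq Some k | k <- enum 'I_m.+1] None.
pose b (l : option 'I_m.+1) : comps := if l is Some k then V k else r.
have -> : (fun l y => m.+1%:R^-1 * (\sum_(k < m.+1) V k l y + r l y)) =
    (fun l y => \sum_(o <- s) m.+1%:R^-1 * b o l y).
  apply/funext => l; apply/funext => y.
  by rewrite -mulr_sumr /s -cats1 big_cat big_seq1 big_map big_enum.
rewrite dfr_lincomb; last by move=> [k|] l; [exact: dV|exact: dr].
by rewrite -mulr_sumr mulVKf ?pnatr_eq0// /s -cats1 big_cat big_seq1 big_map big_enum.
Qed.

(** The products d mu /\ d mu, d a /\ d mu and d a /\ d a satisfy transport equations along W. In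
    this order, the sources of each are products already known to vanish on Y, and all three vanish
    at t = 0. *)
Lemma gauge_solution :
  (forall x, Y alpha x -> pfd alpha lam mu0 x = 0) ->
  (forall x, Y alpha x -> pfd alpha mu0 mu0 x = 0) ->
  exists a : nat -> comps,
  [/\ a 0%N = lam, forall n, smooth_coef dom (a n),
      forall n x, Y alpha x -> conv a a n x = 0,
      forall x j n, dom x -> (j == 2)%N || (j == 3)%N -> Epair (a n.+1) j x = 0
    & forall x, dom x -> a 1%N 4%N x = - mu0 4%N x /\
       a 1%N 1%N x * xi 1 x + a 1%N 2%N x * xi 2 x + a 1%N 3%N x * xi 3 x =
       - (mu0 1%N x * xi 1 x + mu0 2%N x * xi 2 x + mu0 3%N x * xi 3 x)].
Proof.
move=> lm mm; have [a [mu [W [a0 m0 aS mS WS]]]] := gauge_sequences mu0.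
have od : open dom by exact: dom_open.
have si (V : comps) (b : comps) i : smooth_coef dom V -> smooth_coef dom b ->
    smooth_on dom (iprod V (dfr b) i).
  by move=> sV sb; apply: iprod_smooth => // l; exact: dfr_smooth.
have sm n : smooth_coef dom (a n) /\ smooth_coef dom (mu n) /\ smooth_coef dom (W n).
  elim/ltn_ind: n => n IH.
  have sa : smooth_coef dom (a n).
    case: n IH => [_|n IH]; first by rewrite a0; exact: lam_smooth.
    have [san [smn sWn]] := IH n (ltnSn n).
    move=> i; rewrite aS; apply: smooth_onM => //; first exact: smooth_on_cst.
    apply: smooth_onB => //.
    apply: smooth_on_sum => // k _; apply: si.
      by have [_ [_]] := IH k (ltn_ord k).
    by have [] := IH (n - k)%N (leq_ltn_trans (leq_subr _ _) (ltnSn n)).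
  have smn : smooth_coef dom (mu n).
    case: n IH {sa} => [_|n IH]; first by rewrite m0.
    move=> i; rewrite mS; apply: smooth_onM => //; first exact: smooth_on_cst.
    apply: smooth_on_sum => // k _; apply: si.
      by have [_ [_]] := IH k (ltn_ord k).
    by have [_ []] := IH (n - k)%N (leq_ltn_trans (leq_subr _ _) (ltnSn n)).
  split => //; split => //; rewrite WS; apply: solve_smooth => // i.
  apply: smooth_onB => //.
  apply: smooth_on_sum => // k _; apply: si; first by have [_ [_]] := IH k (ltn_ord k).
  case: (posnP k) => [k0|k0]; first by rewrite k0 subn0.
  by have [] // := IH (n - k)%N; rewrite ltn_subrL k0 (leq_ltn_trans _ (ltn_ord k)).
have sa n : smooth_coef dom (a n) by have [] := sm n.
have smu n : smooth_coef dom (mu n) by have [_ []] := sm n.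
have sW n : smooth_coef dom (W n) by have [_ []] := sm n.
pose z : nat -> comps := fun _ _ _ => 0.
have sz n : smooth_coef dom (z n) by move=> i; exact: smooth_on_cst.
pose Nmu : nat -> comps := fun n i y => - mu n i y.
have sNm n : smooth_coef dom (Nmu n) by move=> i; apply: smooth_onN => //; exact: smu.
have dz n i j x : dfr (z n) i j x = 0.
  have l k : lie (frame k) (fun=> 0 : R) x = 0 by rewrite /lie derive_cst.
  rewrite /FrameForms.dfr /z !l; move: i j => [|[|[|[|i]]]] [|[|[|[|j]]]]; rewrite /structure; ring.
have c0 b n x : conv z b n x = 0.
  by rewrite /GaugeRecursion.conv big1// => i _; rewrite /pfd /pf /dfr_at !dz; ring.
have c0' b n x : conv b z n x = 0.
  by rewrite /GaugeRecursion.conv big1// => i _; rewrite pfdC /pfd /pf /dfr_at !dz; ring.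
have diff0 (f : R6 R -> R) x : smooth_on dom f -> dom x -> differentiable f x by exact: smooth_on_diff.
have ha x : dom x -> forall m i j, (0 < i <= 4)%N -> (0 < j <= 4)%N ->
     m.+1%:R * dfr (a m.+1) i j x =
     \sum_(k < m.+1) dfr (iprod (W k) (dfr (a (m - k)%N))) i j x + dfr (Nmu m) i j x.
  move=> dx m i j _ _; rewrite aS; apply: (@dfr_step (fun k => iprod (W k) (dfr (a (m - k)%N))) (Nmu m)).
    by move=> k l; apply: diff0 => //; exact: si.
  by move=> l; apply: diff0 => //; exact: sNm.
have hm x : dom x -> forall m i j, (0 < i <= 4)%N -> (0 < j <= 4)%N ->
     m.+1%:R * dfr (mu m.+1) i j x =
     \sum_(k < m.+1) dfr (iprod (W k) (dfr (mu (m - k)%N))) i j x + dfr (z m) i j x.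
  move=> dx m i j _ _.
  have -> : mu m.+1 = fun l y => m.+1%:R^-1 * (\sum_(k < m.+1) iprod (W k) (dfr (mu (m - k)%N)) l y + z m l y).
    by rewrite mS; apply/funext => l; apply/funext => y; rewrite addr0.
  apply: (@dfr_step (fun k => iprod (W k) (dfr (mu (m - k)%N))) (z m)).
  - by move=> k l; apply: diff0 => //; exact: si.
  - by move=> l; apply: diff0 => //; exact: sz.
have N m b x : dom x -> smooth_coef dom b -> pfd alpha (Nmu m) b x = - pfd alpha (mu m) b x.
  move=> dx sb; rewrite (@pfd_linl _ alpha unit [:: tt] (fun=> -1) (Nmu m) (fun=> mu m) b x).
    by rewrite big_seq1 mulN1r.
  move=> i j _ _; have -> : Nmu m = fun l y => \sum_(k <- [:: tt]) -1 * mu m l y.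
    by apply/funext => l; apply/funext => y; rewrite big_seq1 mulN1r.
  by apply: (@dfr_lincomb _ alpha unit [:: tt] (fun=> -1) (fun=> mu m)) => _ l; apply: diff0 => //; exact: smu.
(* A transport equation without source propagates the zero initial value, order by order. *)
have vanish (C : nat -> R6 R -> R) : (forall n, smooth_on dom (C n)) ->
   (forall x, Y alpha x -> C 0%N x = 0) ->
   (forall n x, Y alpha x -> n.+1%:R * C n.+1 x = \sum_(k < n.+1) divergence alpha (W k) (C (n - k)%N) x) ->
   forall n x, Y alpha x -> C n x = 0.
  move=> sC C0 CS; elim/ltn_ind => -[_ //|n IH] x Yx.
  apply/eqP; rewrite -(mulrI_eq0 _ (@mulfI _ n.+1%:R _)) ?pnatr_eq0// CS//.
  apply/eqP; apply: big1 => k _; apply: divergence0 => //.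
  by apply: IH; rewrite ltnS leq_subr.
have Smm : forall n x, Y alpha x -> conv mu mu n x = 0.
  apply: vanish => [n|x Yx|n x Yx]; first exact: conv_smooth.
    by rewrite /GaugeRecursion.conv big_ord1 m0 mm.
  have dx := Y_dom Yx.
  by rewrite (@conv_step _ alpha dom od mu mu z z W)// ?c0 ?c0' ?addr0//; exact: hm.
have Sam : forall n x, Y alpha x -> conv a mu n x = 0.
  apply: vanish => [n|x Yx|n x Yx]; first exact: conv_smooth.
    by rewrite /GaugeRecursion.conv big_ord1 m0 a0 lm.
  have dx := Y_dom Yx.
  rewrite (@conv_step _ alpha dom od a mu Nmu z W)// ?c0'; [|exact: ha|exact: hm].
  rewrite addr0 [X in _ + X](_ : _ = 0) ?addr0//.
  have := Smm n x Yx; rewrite /GaugeRecursion.conv => e; apply/eqP; rewrite -oppr_eq0 -{}[X in _ == X]e -sumrN.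
  by apply/eqP; apply: eq_bigr => k _; rewrite N// opprK.
have Saa : forall n x, Y alpha x -> conv a a n x = 0.
  apply: vanish => [n|x Yx|n x Yx]; first exact: conv_smooth.
    have dx := Y_dom Yx.
    rewrite /GaugeRecursion.conv big_ord1 a0 /pfd /pf /dfr_at; have [t [_ _ _ _ e4]] := dlam_eq alpha_gt0 dx.
    by rewrite !e4//; ring.
  have dx := Y_dom Yx.
  rewrite (@conv_step _ alpha dom od a a Nmu Nmu W)//; [|exact: ha|exact: ha].
  have e1 : conv Nmu a n x = 0.
    rewrite -oppr0 -(Sam n x Yx) /GaugeRecursion.conv -sumrN (reindex_inj rev_ord_inj).
    apply: eq_bigr => k _ /=; rewrite N// subSS subKn; last by rewrite -ltnS.
    by rewrite pfdC.
  have e2 : conv a Nmu n x = 0.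
    rewrite -oppr0 -(Sam n x Yx) /GaugeRecursion.conv -sumrN.
    by apply: eq_bigr => k _ /=; rewrite pfdC N// pfdC.
  by rewrite e1 e2 !addr0.
exists a; split => //.
- move=> x j n dx hj.
  (* As a_0 is lambda, the last term of the recursion is i_(W_n) omega and all others form -r; [W n]
     was defined to match r on G. *)
  pose r i y := mu n i y - \sum_(k < n) iprod (W k) (dfr (a (n - k)%N)) i y.
  have aE i y : a n.+1 i y = n.+1%:R^-1 * (iprod (W n) (dfr lam) i y - r i y).
    by rewrite aS big_ord_recr /= subnn a0 /r; congr (_ * _); ring.
  have := @solveP _ _ alpha_gt0 p q r x j dx hj; rewrite -WS => E.
  transitivity (n.+1%:R^-1 * (Epair (iprod (W n) (dfr lam)) j x - Epair r j x)).
    rewrite {1}/GaugeStep.Epair !aE /GaugeStep.Epair.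
    move: (iprod _ _ 1%N x) (iprod _ _ 2%N x) (iprod _ _ 3%N x) (iprod _ _ 4%N x) => b1 b2 b3 b4.
    by move: (r 1%N x) (r 2%N x) (r 3%N x) (r 4%N x) => r1 r2 r3 r4; ring.
  by rewrite E subrr mulr0.
- move=> x dx.
  have a1 i : a 1%N i x = iprod (W 0%N) (dfr lam) i x - mu0 i x.
    by rewrite aS big_ord1 /= a0 m0 invr1 mul1r.
  have [n1 n2] := @solve_null _ _ alpha_gt0 p q 
    (fun i y => mu 0%N i y - \sum_(k < 0) iprod (W k) (dfr (a (0 - k)%N)) i y) x dx.
  rewrite -(WS 0%N) in n1 n2; rewrite !a1 n2 sub0r; split; first by [].
  move: n1; move: (iprod _ _ 1%N x) (iprod _ _ 2%N x) (iprod _ _ 3%N x) => b1 b2 b3.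
  move: (mu0 1%N x) (mu0 2%N x) (mu0 3%N x) (xi 1 x) (xi 2 x) (xi 3 x) => *; lra.
Qed.

End GaugeTheorem.
End GaugeSolution.
Import GaugeSolution.

(** * From a good representative to a deformation with extensions vanishing on G *)

Module GaugeExtension.
Section Extension.
Context {R : realType}.
Variable alpha : R.
Hypothesis alpha_gt0 : 0 < alpha.
Variable G : R6 R -> set (R6 R).
Hypothesis hG : smooth_complement (Y alpha) G.
Implicit Types (x y u v w : R6 R) (i j : nat).

Local Notation frame := (frame alpha).
Local Notation dom := (dom alpha).
Local Notation X1 := (X1 alpha).
Local Notation xi := (xi alpha).
Local Notation fcomp := (fcomp alpha).
Local Notation dfr := (dfr alpha).
Local Notation form := (form alpha).
Local Notation lam := (coef alpha lamf).

Lemma comp_lin2 i x (c d : R) u v : fcomp i x (c *: u + d *: v) = c * fcomp i x u + d * fcomp i x v.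
Proof.
rewrite comp_lin -[d *: v]addr0 comp_lin.
by have := comp_lin alpha i x (-1) 0 0; rewrite scaler0 addr0 => h; congr (_ + _); lra.
Qed.

Lemma comp4_X1 x : fcomp 4 x (X1 x) = 0.
Proof. by rewrite comp4E /cr /Coframes.X1 /torus_gen !(pair_mx0, pair_mx1, threeE); ring. Qed.

Lemma comp_Ehat (p q : nat -> R6 R -> R) j i x : dom x -> (j == 2)%N || (j == 3)%N -> (0 < i <= 4)%N ->
  fcomp i x (Ehat alpha p q j x) = Ecoef alpha p q j i x.
Proof.
move=> dx hj hi.
have hj4 : (0 < j <= 4)%N by case/orP: hj => /eqP->.
have E : Ehat alpha p q j x = p j x *: X1 x + (q j x *: frame 4 x + frame j x).
  by rewrite /Ehat -addrA addrC -addrA.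
rewrite E !comp_lin !comp_frame//.
by move: hi; case: i => [|[|[|[|[|]]]]] //= _; rewrite ?comp4_X1 -/(xi _ x); case/orP: hj => /eqP->/=; ring.
Qed.

(** The extensions are minus the coefficients of the transported form a_t: they vanish on G by
    construction, the first one restricts to Gamma1 on the leaves, and d a_t keeps square zero. *)
Lemma extends (Gamma1 : R6 R -> R6 R) (mu0 : nat -> R6 R -> R) : smooth_near (Y alpha) Gamma1 ->
  smooth_coef dom mu0 ->
  (forall x v, Y alpha x -> null_tangent (Y alpha) x v -> ev (form mu0) x v = ev Gamma1 x v) ->
  (forall x, Y alpha x -> pfd alpha lam mu0 x = 0) ->
  (forall x, Y alpha x -> pfd alpha mu0 mu0 x = 0) ->
  exists Gamma : nat -> R6 R -> R6 R,
      [/\ Gamma 1%N = Gamma1,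
          forall i, (0 < i)%N -> smooth_near (Y alpha) (Gamma i)
        & formal_coisotropic (Y alpha) G Gamma].
Proof.
move=> sG smu hmu lm mm; have od : open dom by exact: dom_open.
have [p [q [smp smq GE]]] := G_frame_exists alpha_gt0 hG.
have [a [a0 sa aa aE a1]] := gauge_solution alpha_gt0 smp smq smu lm mm.
pose b n : nat -> R6 R -> R := fun i y => - a n i y.
have sb n : smooth_coef dom (b n) by move=> i; apply: smooth_onN => //; exact: sa.
pose eta n := form (b n).
have se n : smooth_on dom (eta n) by exact: form_smooth.
have sne n : smooth_near (Y alpha) (eta n) by exists dom; split => // x /Y_dom.
(* [eta 1] agrees with [Gamma1] on null vectors only, whereas the first coefficient has to be
   [Gamma1] itself. *)
exists (fun n => if n is 1%N then Gamma1 else eta n); split => //.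
  by case=> [|[|i]].
exists eta; split.
  move=> i i0; split => // x Yx; have dx := Y_dom Yx.
  have evN n v : ev (eta n) x v = - (a n 1%N x * fcomp 1 x v + a n 2%N x * fcomp 2 x v
     + a n 3%N x * fcomp 3 x v + a n 4%N x * fcomp 4 x v).
    by rewrite ev_form /b; ring.
  split.
    case: i i0 => [//|[|//]] _ v nv.
    rewrite -hmu//; have [c [d ->]] := (null_tangentP alpha_gt0 _ Yx).1 nv.
    have [h4 h1] := a1 x dx.
    rewrite evN ev_form !comp_lin2 comp4_X1 !comp_frame//= -/(xi 1 x) -/(xi 2 x) -/(xi 3 x).
    move: h4 h1; move: (a 1%N 1%N x) (a 1%N 2%N x) (a 1%N 3%N x) (a 1%N 4%N x) => a11 a12 a13 a14.
    move: (mu0 1%N x) (mu0 2%N x) (mu0 3%N x) (mu0 4%N x) (xi 1 x) (xi 2 x) (xi 3 x) => m1 m2 m3 m4 x1 x2 x3 h4 h1.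
    transitivity (- c * (a11 * x1 + a12 * x2 + a13 * x3) - d * a14); first by ring.
    by rewrite h1 h4; ring.
  case: i i0 => // i _ v Gv; have [G2 G3] := GE x Yx.
  have [c2 [c3 ->]] := G_span alpha_gt0 hG Yx G2 G3 Gv.
  rewrite evN.
  have e2 := aE x 2%N i dx isT; have e3 := aE x 3%N i dx isT.
  rewrite !comp_lin2 !comp_Ehat//.
  move: e2 e3; rewrite /Epair; move: (Ecoef _ _ _) => F.
  move: (a i.+1 1%N x) (a i.+1 2%N x) (a i.+1 3%N x) (a i.+1 4%N x) => b1 b2 b3 b4 e2 e3.
  transitivity (- c2 * (b1 * F 2%N 1%N x + b2 * F 2%N 2%N x + b3 * F 2%N 3%N x + b4 * F 2%N 4%N x)
    - c3 * (b1 * F 3%N 1%N x + b2 * F 3%N 2%N x + b3 * F 3%N 3%N x + b4 * F 3%N 4%N x)); first by ring.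
  by rewrite e2 e3; ring.
move=> n x Yx v1 v2 v3 v4 t1 t2 t3 t4; have dx := Y_dom Yx.
have [d hd] := wedge_det alpha_gt0 dx ((tangentP _ Yx).1 t1) ((tangentP _ Yx).1 t2) ((tangentP _ Yx).1 t3) ((tangentP _ Yx).1 t4).
have de i : differentiable (eta i) x by exact: smooth_on_diff (se i) dx.
have ba i : bialt (deformed_coef eta i x).
  case: i => [|i]; first exact: omega_bialt.
  by apply: bialtN; exact: dext_bialt.
have fr i k l : (0 < k <= 4)%N -> (0 < l <= 4)%N -> deformed_coef eta i x (frame k x) (frame l x) = dfr (a i) k l x.
  move=> hk hl; case: i => [|i] /=; first by rewrite a0 dlamf.
  rewrite dext_frame//.
  rewrite (@dfr_near_eq _ alpha (coef alpha (eta i.+1)) (b i.+1) dom k l x od dx)//; last first.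
    by move=> m y hm dy; exact: coef_form.
  have -> : b i.+1 = fun m y => \sum_(o <- [:: tt]) -1 * a i.+1 m y.
    by apply/funext => m; apply/funext => y; rewrite big_seq1 mulN1r.
  rewrite dfr_lincomb; first by rewrite big_seq1 mulN1r opprK.
  by move=> _ m; exact: smooth_on_diff (sa i.+1 m) dx.
rewrite (eq_bigr (fun i : 'I_n.+1 => d * pfd alpha (a i) (a (n - i)%N) x)); last first.
  by move=> i _; rewrite hd// /pfd /pf /dfr_at !fr.
rewrite -mulr_sumr; have := aa n x Yx; rewrite /GaugeRecursion.conv => ->; by rewrite mulr0.
Qed.

End Extension.
End GaugeExtension.
Import GaugeExtension.

(** * Limits with rate 1/n *)

Module Approximations.
Section Approximation.
Context {R : realType}.
Implicit Types (a b : R) (c d : nat -> R).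

Lemma nat_above a : exists n : nat, a < n%:R.
Proof. by exists (Num.bound `|a|); exact: le_lt_trans (ler_norm a) (archi_boundP (normr_ge0 a)). Qed.

(** Convergence at the rate 1/n, which all series below have. The rate is stable under linear
    combinations and under integration against a fixed continuous function. *)
Definition approx a c := exists B, forall n, `|a - c n| <= B / n.+1%:R.

Lemma approx_uniq a b c : approx a c -> approx b c -> a = b.
Proof.
move=> [B hB] [D hD]; apply/eqP; rewrite -subr_eq0 -normr_le0.
apply/ler_addgt0Pl => e e0; rewrite addr0.
have [n hn] : exists n : nat, (B + D) / e < n%:R.
  exact: nat_above.
have : `|a - b| <= (B + D) / n.+1%:R.
  rewrite (_ : a - b = (a - c n) - (b - c n)); last by ring.
  by rewrite mulrDl (le_trans (ler_normB _ _))// lerD.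
move=> /le_trans; apply; rewrite ler_pdivrMr// mulrC -ler_pdivrMr//.
by rewrite (le_trans (ltW hn))// ler_nat.
Qed.

Lemma approx_lin (k : R) a b c d : approx a c -> approx b d ->
  approx (k * a + b) (fun n => k * c n + d n).
Proof.
move=> [B hB] [D hD]; exists (`|k| * B + D) => n.
rewrite (_ : _ - _ = k * (a - c n) + (b - d n)); last by ring.
rewrite (le_trans (ler_normD _ _))// mulrDl lerD// normrM -mulrA ler_wpM2l//.
Qed.

Lemma approx_eq a c d : c =1 d -> approx a c -> approx a d.
Proof. by move=> /funext ->. Qed.

(** The majorants 1/((k+1)(k+2)) telescope, so the tail after n terms is at most A/(n+1), uniformly
    in s. *)
Lemma unif_series (u : nat -> R -> R) A : (forall k, continuous (u k)) ->
  (forall k s, `|u k s| <= A / (k.+1%:R * k.+2%:R)) ->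
  exists U, continuous U /\ forall n s, `|U s - \sum_(k < n) u k s| <= A / n.+1%:R.
Proof.
move=> cu hu.
have A0 : 0 <= A.
  by have := le_trans (normr_ge0 _) (hu 0%N 0); rewrite pmulr_lge0// invr_gt0.
have tele m n : \sum_(n <= k < n + m) A / (k.+1%:R * k.+2%:R) = A / n.+1%:R - A / (n + m).+1%:R.
  elim: m => [|m IH]; first by rewrite addn0 big_geq// subrr.
  rewrite addnS big_nat_recr/= ?leq_addr// IH.
  have h1 : (n + m).+1%:R != 0 :> R by rewrite pnatr_eq0.
  have h2 : (n + m).+2%:R != 0 :> R by rewrite pnatr_eq0.
  have h3 : n.+1%:R != 0 :> R by rewrite pnatr_eq0.
  have e : (n + m).+2%:R = (n + m).+1%:R + 1 :> R by rewrite -natr1.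
  rewrite e in h2 *; move: h1 h2 h3; move: ((n + m).+1%:R : R) (n.+1%:R : R) => a b h1 h2 h3.
  by field; rewrite h1 h2 h3.
have b0 k : 0 <= A / (k.+1%:R * k.+2%:R) by rewrite mulr_ge0// invr_ge0 mulr_ge0.
have cb : cvgn (series (fun k : nat => A / (k.+1%:R * k.+2%:R))).
  apply: nondecreasing_is_cvgn; first exact: nondecreasing_series.
  exists A => _ [n _ <-]; rewrite /series/= -[n]add0n tele/= divr1 gerBl.
  by rewrite mulr_ge0// invr_ge0.
have cs s : cvgn (series (fun k => u k s)).
  apply: normed_cvg; by apply: series_le_cvg cb => // k; [exact: normr_ge0 | exact: hu].
pose U s := limn (series (fun k => u k s)).
have UE n s : `|U s - \sum_(k < n) u k s| <= A / n.+1%:R.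
  have cl : (fun m => series (fun k => u k s) m - \sum_(k < n) u k s) @ \oo --> U s - \sum_(k < n) u k s.
    by apply: cvgB; [exact: cs | exact: cvg_cst].
  have cn : (fun m => `|series (fun k => u k s) m - \sum_(k < n) u k s|) @ \oo --> `|U s - \sum_(k < n) u k s|.
    exact: cvg_norm.
  rewrite -(cvg_lim (@Rhausdorff R) cn).
  apply: limr_le; first by apply/cvg_ex; exists (`|U s - \sum_(k < n) u k s|).
  exists n => // m /= nm; rewrite /series /= -(big_mkord xpredT (fun k => u k s)) sub_series_geq//.
  rewrite (le_trans (ler_norm_sum _ _ _))//.
  rewrite (le_trans (ler_sum _ (fun k _ => hu k s)))// -{1}(subnKC nm) tele gerBl.
  by rewrite mulr_ge0// invr_ge0.
exists U; split => // s; apply/cvgrPdist_lt => e e0.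
have [n hn] : exists n : nat, 3 * A / e < n%:R.
  exact: nat_above.
have hA : A / n.+1%:R < e / 3.
  have : 3 * A / e < n.+1%:R by rewrite (lt_trans hn)// ltr_nat.
  by rewrite ltr_pdivrMr// => h; rewrite ltr_pdivrMr//; lra.
have cS : {for s, continuous (fun t => \sum_(k < n) u k t)}.
  by apply: cvg_fsum => i; exact: cu.
have e3 : 0 < e / 3 by rewrite divr_gt0.
have /cvgrPdist_lt/(_ _ e3) := cS; apply: filterS => t ht.
rewrite (_ : U s - U t = (U s - \sum_(k < n) u k s) + (\sum_(k < n) u k s - \sum_(k < n) u k t) - (U t - \sum_(k < n) u k t)); last by ring.
have h1 := le_lt_trans (UE n s) hA; have h2 := le_lt_trans (UE n t) hA.
apply: (le_lt_trans (ler_normB _ _)); apply: (le_lt_trans (lerD (ler_normD _ _) (lexx _))).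
lra.
Qed.

Lemma cint_unif (U : R -> R) (c : nat -> R -> R) (p : R -> R) A : continuous U -> (forall n, continuous (c n)) ->
  continuous p -> (forall n s, `|U s - c n s| <= A / n.+1%:R) ->
  approx (cint (fun s => U s * p s)) (fun n => cint (fun s => c n s * p s)).
Proof.
move=> cU cc cp h.
have cnp : {within `[0, 2 * pi], continuous (fun t => `|p t|)}.
  by apply: continuous_subspaceT => t; apply: cvg_norm; exact: cp.
have pi0 : 0 <= 2 * pi :> R by rewrite mulr_ge0// pi_ge0.
have [m _ hm] := EVT_max pi0 cnp.
exists (A * `|p m| * (2 * pi)) => n.
have A0 : 0 <= A / n.+1%:R by exact: le_trans (normr_ge0 _) (h n 0).
have -> : cint (fun s => U s * p s) - cint (fun s => c n s * p s) =
  cint (fun s => (U s - c n s) * p s).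
  rewrite addrC -mulN1r -cint_lin; [|exact: cont_mul|exact: cont_mul].
  by congr cint; apply/funext => s; ring.
rewrite (_ : _ / _ = A / n.+1%:R * `|p m| * (2 * pi)); last by ring.
apply: cint_bound.
- apply: cont_mul => //; apply: cont_add => // s; exact: (cvgN (cc n s)).
- by rewrite mulr_ge0.
- move=> t ht; rewrite normrM ler_pM//; apply: hm; by rewrite in_itv.
Qed.

End Approximation.
End Approximations.
Import Approximations.

(** * The cosine series of a parabola *)

Module CosineSums.
Section CosineSeries.
Context {R : realType}.
Implicit Types (s t : R).

Lemma is_derive_affine_arg (f : R -> R) (a b s d : R) : is_derive (a * s + b) 1 f d ->
  is_derive s 1 (fun t : R => f (a * t + b)) (a * d).
Proof.
move=> df.
have da : is_derive s 1 (fun t : R => a * t + b) a.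
  rewrite (_ : (fun t : R => a * t + b) = (fun t : R => b + t *: (a : R^o))); first exact: is_derive_affine.
  by apply/funext => t; rewrite /GRing.scale/= addrC mulrC.
have := @is_derive1_comp _ f (fun t : R => a * t + b) s _ _ df da.
by rewrite mulrC.
Qed.

Lemma is_derive_sin_arg (a s : R) : is_derive s 1 (fun t : R => sin (a * t)) (a * cos (a * s)).
Proof.
have := @is_derive_affine_arg sin a 0 s (cos (a * s + 0)) (is_derive_sin _).
by rewrite addr0 (_ : (fun t : R => sin (a * t + 0)) = (fun t => sin (a * t)))//; apply/funext => t; rewrite addr0.
Qed.

Lemma is_derive_cos_arg (a s : R) : is_derive s 1 (fun t : R => cos (a * t)) (a * - sin (a * s)).
Proof.
have := @is_derive_affine_arg cos a 0 s (- sin (a * s + 0)) (is_derive_cos _).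
by rewrite addr0 (_ : (fun t : R => cos (a * t + 0)) = (fun t => cos (a * t)))//; apply/funext => t; rewrite addr0.
Qed.

Lemma is_derive_sum (n : nat) (f df : nat -> R -> R) s : (forall k, is_derive s 1 (f k) (df k s)) ->
  is_derive s 1 (fun t : R => \sum_(k < n) f k t) (\sum_(k < n) df k s).
Proof.
move=> h; elim: n => [|n IH].
  rewrite big_ord0 (_ : (fun t : R => _) = cst 0); first exact: is_derive_cst.
  by apply/funext => t; rewrite big_ord0.
rewrite big_ord_recr /= (_ : (fun t : R => _) = (fun t => \sum_(k < n) f k t + f n t)).
  exact: is_deriveD.
by apply/funext => t; rewrite big_ord_recr.
Qed.

Lemma MVT_bound (f df : R -> R) (a b c : R) : a <= b ->
  (forall s, a <= s <= b -> is_derive s 1 f (df s)) ->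
  (forall s, a <= s <= b -> `|df s| <= c) -> `|f b - f a| <= c * (b - a).
Proof.
move=> ab hd hc.
have [||t] := @MVT_segment _ f df a b ab.
- by move=> s; rewrite in_itv/= => /andP[h1 h2]; apply: hd; rewrite !ltW.
- apply: derivable_within_continuous => s; rewrite in_itv/= => h.
  by have [] := hd s h.
rewrite in_itv/= => ht ->; rewrite normrM (ger0_norm (_ : 0 <= b - a)) ?subr_ge0//.
by rewrite ler_wpM2r ?subr_ge0// hc.
Qed.

Definition csum n s : R := \sum_(k < n) k.+1%:R ^- 2 * cos (k.+1%:R * s).
Definition ssum n s : R := \sum_(k < n) k.+1%:R^-1 * sin (k.+1%:R * s).
Definition dsum n s : R := \sum_(k < n) cos (k.+1%:R * s).

Lemma csum_derive n s : is_derive s 1 (csum n) (- ssum n s).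
Proof.
have := @is_derive_sum n (fun k t => k.+1%:R ^- 2 * cos (k.+1%:R * t)) (fun k t => - (k.+1%:R^-1 * sin (k.+1%:R * t))) s.
rewrite /ssum sumrN; apply => k.
have h := @is_deriveZ _ _ _ _ (k.+1%:R ^- 2) s 1 _ (is_derive_cos_arg k.+1%:R s).
apply: is_derive_eq h _.
rewrite /GRing.scale/=; have : k.+1%:R != 0 :> R by rewrite pnatr_eq0.
by move: (k.+1%:R : R) (sin _) => a b a0; field.
Qed.

Lemma ssum_derive n s : is_derive s 1 (ssum n) (dsum n s).
Proof.
have := @is_derive_sum n (fun k t => k.+1%:R^-1 * sin (k.+1%:R * t)) (fun k t => cos (k.+1%:R * t)) s.
apply => k.
have h := @is_deriveZ _ _ _ _ (k.+1%:R^-1) s 1 _ (is_derive_sin_arg k.+1%:R s).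
apply: is_derive_eq h _.
rewrite /GRing.scale/=; have : k.+1%:R != 0 :> R by rewrite pnatr_eq0.
by move: (k.+1%:R : R) (cos _) => a b a0; field.
Qed.

Lemma dirichlet n s : 2 * sin (2^-1 * s) * dsum n s = sin ((n%:R + 2^-1) * s) - sin (2^-1 * s).
Proof.
elim: n => [|n IH]; first by rewrite /dsum big_ord0 mulr0 add0r subrr.
rewrite /dsum big_ord_recr /= mulrDr -/(dsum n s) IH.
have -> : (n.+1%:R + 2^-1) * s = n.+1%:R * s + 2^-1 * s by ring.
have -> : (n%:R + 2^-1) * s = n.+1%:R * s - 2^-1 * s by rewrite -[n.+1]addn1 natrD; field.
by rewrite sinB sinD; ring.
Qed.

Lemma sin_natpi (k : nat) : sin (k%:R * pi) = 0 :> R.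
Proof.
elim: k => [|k IH]; first by rewrite mul0r sin0.
by rewrite -natr1 mulrDl mul1r sinDpi IH oppr0.
Qed.

Lemma ssum_pi n : ssum n pi = 0.
Proof. by rewrite /ssum big1// => k _; rewrite sin_natpi mulr0. Qed.

(** The derivative of [csum] is minus the partial sum of the sawtooth series, which is within O(1/n)
    of (pi - s)/2 uniformly on [t, pi], away from its jump at 0. Integrating from t to pi yields the
    parabola. *)
Lemma csum_near (t : R) : 0 < t <= pi -> exists B, forall n : nat,
  `|csum n t - csum n pi - (t - pi) ^+ 2 / 4| <= B / n.+1%:R.
Proof.
move=> /andP[t0 tpi]; set d := sin (2^-1 * t).
have pi0 := @pi_gt0 R.
have d0 : 0 < d by apply: sin_gt0_pi; apply/andP; split; lra.
have ds s : t <= s <= pi -> d <= sin (2^-1 * s).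
  move=> /andP[h1 h2]; have [->//|ne] := eqVneq s t.
  have lt : t < s by rewrite lt_neqAle eq_sym ne.
  by rewrite ltW// ltr_sin ?in_itv/=; [lra|apply/andP; split; lra|apply/andP; split; lra].
have d1 : d <= 1 by exact: sin_le1.
have key n s : t <= s <= pi -> `|ssum n s + (s - pi) / 2| <= 2 * pi / d ^+ 2 / n.+1%:R.
  move=> hs; have /andP[ts spi] := hs.
  set m : R := n%:R + 2^-1.
  have m0 : 0 < m by rewrite /m ltr_wpDl.
  (* By the Dirichlet kernel, the first two terms have derivative sin(m r) / (2 sin(r/2)). The third
     term, an integration by parts, cancels it up to O(1/m); it vanishes at pi because m is a
     half-integer. *)
  pose Phi (r : R) := ssum n r + (r - pi) / 2 + cos (m * r) * (2 * m * sin (2^-1 * r))^-1.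
  pose dPhi (r : R) := - (cos (m * r) * cos (2^-1 * r) / (4 * m * sin (2^-1 * r) ^+ 2)).
  have sr r : s <= r <= pi -> d <= sin (2^-1 * r).
    by move=> /andP[h1 h2]; apply: ds; rewrite h2 (le_trans ts).
  have hd r : s <= r <= pi -> is_derive r 1 Phi (dPhi r).
    move=> hr; have s0 : 0 < sin (2^-1 * r) by exact: lt_le_trans d0 (sr r hr).
    have e0 : 2 * m * sin (2^-1 * r) != 0 by rewrite !mulf_neq0// gt_eqF.
    have D1 : is_derive r 1 (fun r : R => 2 * m * sin (2^-1 * r)) (2 * m * (2^-1 * cos (2^-1 * r))).
      exact: (@is_deriveZ _ _ _ (fun r : R => sin (2^-1 * r)) (2 * m) r 1 _ (is_derive_sin_arg 2^-1 r)).
    have D2 := @is_deriveV _ (fun r : R => 2 * m * sin (2^-1 * r)) r _ 1 e0 D1.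
    have D3 := @is_deriveM _ _ (fun r : R => cos (m * r)) _ r 1 _ _ (is_derive_cos_arg m r) D2.
    have D4 : is_derive r 1 (fun r : R => (r - pi) / 2) 2^-1.
      have := @is_derive_affine_arg id 2^-1 (- pi / 2) r 1 (is_derive_id _ _).
      rewrite mulr1 (_ : (fun t => _) = (fun r : R => (r - pi) / 2))//.
      by apply/funext => y /=; ring.
    have D := is_deriveD (is_deriveD (ssum_derive n r) D4) D3.
    apply: is_derive_eq D _.
    have dir := dirichlet n r.
    have ds' : dsum n r = sin (m * r) / (2 * sin (2^-1 * r)) - 2^-1.
      have s2 : 2 * sin (2^-1 * r) != 0 by rewrite mulf_neq0// gt_eqF.
      by apply: (mulfI s2); rewrite dir mulrBr mulrCA mulfV// mulr1 mulrAC mulfV// mul1r.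
    rewrite ds' /dPhi /GRing.scale /=.
    have := lt0r_neq0 s0; have := lt0r_neq0 m0.
    move: (sin (2^-1 * r)) (cos (2^-1 * r)) (cos (m * r)) (sin (m * r)) => a b c e a0 m0'.
    by field; apply/andP.
  have hb r : s <= r <= pi -> `|dPhi r| <= (4 * m * d ^+ 2)^-1.
    move=> hr; have sd := sr r hr; have s0 := lt_le_trans d0 sd.
    rewrite normrN normrM normfV (ger0_norm (_ : 0 <= 4 * m * _)); last by rewrite !mulr_ge0 ?sqr_ge0// ltW.
    rewrite -[leRHS]mul1r ler_pM//; first by rewrite invr_ge0 !mulr_ge0 ?sqr_ge0// ltW.
      by rewrite normrM mulr_ile1// ?cos_max.
    rewrite lef_pV2 ?posrE ?mulr_gt0 ?exprn_gt0//.
    by rewrite ler_wpM2l ?mulr_ge0 ?(ltW m0)// lerXn2r ?nnegrE// ltW.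
  have := MVT_bound spi hd hb.
  have cm : cos (m * pi) = 0.
    have -> : m * pi = n%:R * pi + pi / 2 by rewrite /m; ring.
    by rewrite cosDpihalf sin_natpi oppr0.
  have -> : Phi pi = 0 by rewrite /Phi ssum_pi cm subrr !mul0r !addr0.
  rewrite sub0r normrN => hPhi.
  have -> : ssum n s + (s - pi) / 2 = Phi s - cos (m * s) * (2 * m * sin (2^-1 * s))^-1.
    by rewrite /Phi addrK.
  apply: (le_trans (ler_normB _ _)).
  have hc : `|cos (m * s) / (2 * m * sin (2^-1 * s))| <= (2 * m * d)^-1.
    have sd := ds s hs; have s0 := lt_le_trans d0 sd.
    rewrite normrM normfV (ger0_norm (_ : 0 <= 2 * m * _)); last by rewrite !mulr_ge0// ltW.
    rewrite -[leRHS]mul1r ler_pM ?cos_max//; first by rewrite invr_ge0 !mulr_ge0// ltW.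
    rewrite lef_pV2 ?posrE ?mulr_gt0//.
    by rewrite ler_wpM2l// mulr_ge0// ltW.
  apply: (le_trans (lerD hPhi hc)).
  have n0 : 0 < n.+1%:R :> R by [].
  have hm : n.+1%:R <= 2 * m by rewrite /m -natr1 -[n%:R]/(n%:R : R); have : 0 <= n%:R :> R by []; lra.
  have d20 : 0 < d ^+ 2 by rewrite exprn_gt0.
  have dn0 := lt0r_neq0 d20; have nn0 := lt0r_neq0 n0.
  have e1 : (4 * m * d ^+ 2)^-1 * (pi - s) <= (d ^+ 2 * n.+1%:R)^-1 * pi.
    rewrite ler_pM ?subr_ge0 ?invr_ge0 ?mulr_ge0 ?(ltW m0) ?(ltW d20) ?(ltW d0)//; last by lra.
    rewrite lef_pV2 ?posrE ?mulr_gt0// mulrC ler_wpM2r ?(ltW d20)//; lra.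
  have e2 : (2 * m * d)^-1 <= (d ^+ 2 * n.+1%:R)^-1.
    rewrite lef_pV2 ?posrE ?mulr_gt0// mulrC ler_pM// ?(ltW d20)//.
    by rewrite expr2 ler_piMl// ltW.
  have pi2 := @pi_ge2 R.
  apply: (le_trans (lerD e1 e2)).
  rewrite (_ : 2 * pi / d ^+ 2 / n.+1%:R = (d ^+ 2 * n.+1%:R)^-1 * (2 * pi)).
    rewrite -[X in _ + X]mulr1 -mulrDr ler_wpM2l ?invr_ge0 ?mulr_ge0 ?(ltW d20) ?(ltW d0)//; lra.
  by rewrite [in RHS]invfM; move: ((d ^+ 2)^-1) (n.+1%:R^-1) => u v; ring.
exists (2 * pi / d ^+ 2 * pi) => n.
pose Psi (r : R) := csum n r - (r - pi) ^+ 2 / 4.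
have hd r : t <= r <= pi -> is_derive r 1 Psi (- (ssum n r + (r - pi) / 2)).
  move=> _.
  have D1 : is_derive r 1 (fun r : R => r - pi) 1.
    have := @is_derive_affine_arg id 1 (- pi) r 1 (is_derive_id _ _).
    by rewrite mulr1 (_ : (fun t => _) = (fun r : R => r - pi))//; apply/funext => y /=; ring.
  have D2 := is_deriveM D1 D1.
  have D3 := @is_deriveZ _ _ _ _ 4^-1 r 1 _ D2.
  have D := is_deriveB (csum_derive n r) D3.
  rewrite (_ : Psi = csum n - (4^-1 *: ((fun r : R => r - pi) * (fun r : R => r - pi)))).
    by apply: is_derive_eq D _; rewrite /GRing.scale /=; field.
  by apply/funext => y; rewrite /Psi expr2 mulrC.
have := MVT_bound tpi hd (fun r hr => le_trans _ (key n r hr)).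
move=> h.
have e : csum n t - csum n pi - (t - pi) ^+ 2 / 4 = - (Psi pi - Psi t) by rewrite /Psi; field.
rewrite e normrN; apply: (le_trans (h _)); first by move=> r; rewrite normrN.
rewrite mulrAC ler_wpM2r ?invr_ge0// ler_wpM2l ?gerBl ?(ltW t0)//.
by rewrite mulr_ge0 ?invr_ge0 ?exprn_ge0 ?mulr_ge0// ltW.
Qed.

End CosineSeries.
End CosineSums.
Import CosineSums.

(** * Fourier inversion at one point *)

Module Fourier.
Section FourierInversion.
Context {R : realType}.
Implicit Types (s t : R).

Lemma cos_arg_cont (a : R) : continuous (fun s => cos (a * s)).
Proof. by apply: cont_is_derive => t; exact: is_derive_cos_arg. Qed.

Lemma sin_arg_cont (a : R) : continuous (fun s => sin (a * s)).
Proof. by apply: cont_is_derive => t; exact: is_derive_sin_arg. Qed.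

Lemma inv_sq_le (k : nat) : k.+1%:R ^- 2 <= 2 / (k.+1%:R * k.+2%:R) :> R.
Proof.
have e : 2 / (k.+1%:R * k.+2%:R) = (k.+1%:R * (k.+2%:R / 2))^-1 :> R.
  by rewrite mulrA [in RHS]invfM invrK mulrC.
rewrite e lef_pV2 ?posrE ?mulr_gt0// expr2 ler_wpM2l//.
by rewrite ler_pdivrMr// -natrM ler_nat; lia.
Qed.

(** [csum_near] covers (0, pi]. The endpoint 0 follows by continuity, the other half by the symmetry
    s -> 2 pi - s. *)
Lemma csum_limit : exists C : R -> R, [/\ continuous C,
  forall s, 0 <= s <= 2 * pi -> C s = (s - pi) ^+ 2 / 4 + C pi
  & forall n s, `|C s - csum n s| <= 2 / n.+1%:R].
Proof.
have [|k s|C [cC hC]] := @unif_series _ (fun k s => k.+1%:R ^- 2 * cos (k.+1%:R * s) : R) 2.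
- by move=> k; apply: cont_scale; exact: cos_arg_cont.
- rewrite normrM ger0_norm ?invr_ge0 ?exprn_ge0//; apply: le_trans (inv_sq_le k).
  by rewrite ler_piMr ?cos_max// invr_ge0 exprn_ge0.
have pi0 := @pi_gt0 R.
exists C; split => //.
have apx s : approx (C s) (fun n => csum n s) by exists 2 => n; exact: hC.
have h1 s : 0 < s <= pi -> C s = (s - pi) ^+ 2 / 4 + C pi.
  move=> hs; have [B hB] := csum_near hs.
  have a1 := approx_lin (-1) (apx pi) (apx s).
  have a2 : approx ((s - pi) ^+ 2 / 4) (fun n => -1 * csum n pi + csum n s).
    exists B => n; rewrite distrC; apply: le_trans (hB n).
    by rewrite le_eqVlt; apply/orP; left; apply/eqP; congr `|_|; ring.
  have := approx_uniq a1 a2; lra.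
have sym s : C (2 * pi - s) = C s.
  apply: (approx_uniq (apx _)); apply: approx_eq (apx s) => n.
  apply: eq_bigr => k _; congr (_ * _).
  have -> : k.+1%:R * (2 * pi - s) = - (k.+1%:R * s) + k.+1%:R * (2 * pi) by ring.
  rewrite cosD; have -> : sin (k.+1%:R * (2 * pi)) = 0 :> R by rewrite mulrA -natrM sin_natpi.
  have -> : cos (k.+1%:R * (2 * pi)) = 1 :> R.
    have -> : k.+1%:R * (2 * pi) = (k.+1%:R * pi) *+ 2 :> R by rewrite -mulr_natl; ring.
    by rewrite cos_mulr2n cos2sin2 sin_natpi expr0n subr0 mulr2n addrK.
  by rewrite cosN; ring.
have h0 : C 0 = (0 - pi) ^+ 2 / 4 + C pi.
  pose g s := C s - ((s - pi) ^+ 2 / 4 + C pi).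
  have cg : continuous g.
    move=> s; apply: cvgB; first exact: cC.
    apply: cvgD; last exact: cvg_cst.
    by apply: cvgMl; apply: cvgM; apply: cvgB; [exact: cvg_id|exact: cvg_cst|exact: cvg_id|exact: cvg_cst].
  suff : g 0 = 0 by rewrite /g; lra.
  apply/eqP; rewrite -normr_le0; apply/ler_addgt0Pl => e e0; rewrite addr0.
  have /cvgrPdist_lt/(_ e e0) /nbhs_ballP[d /= d0 hd] := cg 0.
  pose s := Num.min (d / 2) pi.
  have s0 : 0 < s by rewrite /s lt_min pi0 divr_gt0.
  have := hd s; rewrite /ball/= sub0r normrN gtr0_norm// => /(_ _).
  have -> : g s = 0 by rewrite /g h1 ?subrr// s0 /s ge_min lexx orbT.
  rewrite subr0 => h; apply/ltW/h.
  by rewrite /s gt_min ltr_pdivrMr// mulr_natr mulr2n ltrDl d0.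
move=> s /andP[s0 s2]; have [sp|sp] := leP s pi.
  by move: s0; rewrite le_eqVlt => /orP[/eqP<-//|s0]; apply: h1; rewrite s0.
rewrite -sym; have -> : (s - pi) ^+ 2 = (2 * pi - s - pi) ^+ 2 by ring.
move: s2; rewrite le_eqVlt => /orP[/eqP<-|s2]; first by rewrite subrr h0.
by apply: h1; apply/andP; split; lra.
Qed.

Lemma cint_scale (a : R) (p : R -> R) : continuous p -> cint (fun t => a * p t) = a * cint p.
Proof.
move=> cp; have c0 : continuous (fun _ : R => 0 : R) by exact: cst_continuous.
have := cint_lin a cp c0; rewrite cint_cst mul0r addr0 => <-.
by congr cint; apply/funext => t; rewrite addr0.
Qed.

Lemma cint_sum n (u : nat -> R -> R) (p : R -> R) : (forall k, continuous (u k)) -> continuous p ->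
  cint (fun s => (\sum_(k < n) u k s) * p s) = \sum_(k < n) cint (fun s => u k s * p s).
Proof.
move=> cu cp; elim: n => [|n IH].
  rewrite big_ord0 (_ : (fun s => _) = fun=> 0); first by rewrite cint_cst mul0r.
  by apply/funext => s; rewrite big_ord0 mul0r.
rewrite big_ord_recr /= -IH (_ : (fun s => _) = fun s => 1 * ((\sum_(k < n) u k s) * p s) + u n s * p s).
  rewrite cint_lin ?mul1r//; last exact: cont_mul.
  apply: cont_mul => // s; apply: cvg_fsum => i; exact: cu.
by apply/funext => s; rewrite big_ord_recr /=; ring.
Qed.

(** The sum is the integral of p'' against the periodic parabola C. Two integrations by parts leave
    the mean of p and, from the jump of C' at the ends, the value p(0). Only cosines and the point 0
    occur; other points are reached by moving along the orbit. *)
Lemma fourier_inversion (p0 p1 p2 : R -> R) : continuous p2 ->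
  (forall t : R, is_derive t 1 p0 (p1 t)) -> (forall t : R, is_derive t 1 p1 (p2 t)) ->
  p0 (2 * pi) = p0 0 -> p1 (2 * pi) = p1 0 ->
  approx (2^-1 * cint p0 - pi * p0 0)
    (fun n => \sum_(k < n) k.+1%:R ^- 2 * cint (fun s => cos (k.+1%:R * s) * p2 s)).
Proof.
move=> c2 d0 d1 e0 e1; have [C [cC hC aC]] := csum_limit.
have c1 := cont_is_derive d1; have c0 := cont_is_derive d0.
have cs n : continuous (@csum R n) by apply: cont_is_derive => t; exact: csum_derive.
have := cint_unif cC cs c2 aC.
pose b (s : R) := (s - pi) ^+ 2 / 4 + C pi.
have dl (k c : R) s : is_derive s 1 (fun r : R => k * (r - c)) k.
  have := @is_derive_affine_arg _ id k (- (k * c)) s 1 (is_derive_id _ _).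
  by rewrite mulr1 (_ : (fun t => _) = (fun r : R => k * (r - c)))//; apply/funext => y /=; ring.
have db (t : R) : is_derive t 1 b (2^-1 * (t - pi)).
  have D2 := is_deriveM (dl 1 pi t) (dl 1 pi t).
  have D3 := @is_deriveZ _ _ _ _ 4^-1 t 1 _ D2.
  have D := is_deriveD D3 (@is_derive_cst _ _ _ (C pi) t 1).
  rewrite (_ : b = (4^-1 *: ((fun r : R => 1 * (r - pi)) * (fun r : R => 1 * (r - pi)))) + cst (C pi)).
    by apply: is_derive_eq D _; rewrite /GRing.scale /=; field.
  apply/funext => y; rewrite /b.
  by change ((y - pi) ^+ 2 / 4 + C pi = 4^-1 * ((1 * (y - pi)) * (1 * (y - pi))) + C pi); field.
have cb := cont_is_derive db.
have cdb : continuous (fun t => 2^-1 * (t - pi)) by apply: cont_is_derive => t; exact: dl.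
have -> : cint (fun s => C s * p2 s) = cint (fun s => b s * p2 s).
  have cm : continuous (fun s => C s * p2 s) by exact: cont_mul.
  have cm' : continuous (fun s => b s * p2 s) by exact: cont_mul.
  apply/eqP; rewrite -subr_eq0 -normr_le0 addrC -mulN1r -cint_lin//.
  rewrite -[leRHS](mul0r (2 * pi)); apply: cint_bound => //.
    by apply: cont_add => //; exact: cont_scale.
  by move=> t ht; rewrite (hC _ ht) /b mulN1r addNr normr0.
rewrite (cint_parts _ _ db d1)//.
rewrite (@cint_parts _ (fun t => 2^-1 * (t - pi)) p0 (fun=> 2^-1) p1)//; last exact: cst_continuous.
have -> : cint (fun t => 2^-1 * p0 t) = 2^-1 * cint p0.
  exact: cint_scale.
rewrite e0 e1 (_ : _ - _ - _ = 2^-1 * cint p0 - pi * p0 0); last by rewrite /b; field.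
apply: approx_eq => n.
have -> : cint (fun s => csum n s * p2 s) = \sum_(k < n) cint (fun s => k.+1%:R ^- 2 * cos (k.+1%:R * s) * p2 s).
  apply: (@cint_sum n (fun k s => k.+1%:R ^- 2 * cos (k.+1%:R * s)) p2 _ c2) => k.
  by apply: cont_scale; exact: cos_arg_cont.
apply: eq_bigr => k _.
have cc : continuous (fun s => cos (k.+1%:R * s) * p2 s) by apply: cont_mul => //; exact: cos_arg_cont.
by rewrite -(cint_scale _ cc); congr cint; apply/funext => t; rewrite mulrA.
Qed.

Lemma cos_moment (k : nat) (p0 p1 p2 : R -> R) : continuous p2 ->
  (forall t : R, is_derive t 1 p0 (p1 t)) -> (forall t : R, is_derive t 1 p1 (p2 t)) ->
  p0 (2 * pi) = p0 0 -> p1 (2 * pi) = p1 0 ->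
  cint (fun s => cos (k%:R * s) * p2 s) = - k%:R ^+ 2 * cint (fun s => cos (k%:R * s) * p0 s).
Proof.
move=> c2 d0 d1 e0 e1; have c1 := cont_is_derive d1; have c0 := cont_is_derive d0.
have dc (t : R) := is_derive_cos_arg k%:R t; have ds (t : R) := is_derive_sin_arg k%:R t.
have cS : continuous (fun t : R => k%:R * - sin (k%:R * t)).
  by move=> t; apply: cvgMr; apply: cvgN; exact: sin_arg_cont.
have cC : continuous (fun t : R => k%:R * cos (k%:R * t)) by apply: cont_scale; exact: cos_arg_cont.
have s2 : sin (k%:R * (2 * pi)) = 0 :> R by rewrite mulrA -natrM sin_natpi.
have c21 : cos (k%:R * (2 * pi)) = 1 :> R.
  have -> : k%:R * (2 * pi) = (k%:R * pi) *+ 2 :> R by rewrite -mulr_natl; ring.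
  by rewrite cos_mulr2n cos2sin2 sin_natpi expr0n subr0 mulr2n addrK.
rewrite (cint_parts cS c2 dc d1) c21 mulr0 cos0 e1 subrr sub0r.
have -> : (fun t => k%:R * - sin (k%:R * t) * p1 t) = (fun t => - k%:R * (sin (k%:R * t) * p1 t)).
  by apply/funext => t; ring.
rewrite cint_scale; last by apply: cont_mul => //; exact: sin_arg_cont.
rewrite (cint_parts cC c1 ds d0) s2 mulr0 sin0 !mul0r subrr sub0r.
have -> : (fun t => k%:R * cos (k%:R * t) * p0 t) = (fun t => k%:R * (cos (k%:R * t) * p0 t)).
  by apply/funext => t; ring.
rewrite cint_scale; last by apply: cont_mul => //; exact: cos_arg_cont.
ring.
Qed.

End FourierInversion.
End Fourier.
Import Fourier.

(** * Lower bounds for the small denominators *)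

Module Denominators.
Section SmallDivisors.
Context {R : realType}.
Implicit Types (x y : R).

(** With z = y/2 at most pi/4, cos is at least 1/2 on [0, z], because cos(2 r) >= 0 there. The mean
    value theorem gives sin z >= z/2, and sin y = 2 sin z cos z. *)
Lemma sin_lower y : 0 <= y <= pi / 2 -> y / 4 <= sin y.
Proof.
move=> /andP[y0 y2]; have pi0 := @pi_gt0 R.
have ch (r : R) : 0 <= r <= pi / 4 -> 2^-1 <= cos r.
  move=> /andP[r0 r4]; have c0 : 0 <= cos r by apply: cos_ge0_pihalf; apply/andP; split; lra.
  have c2 : 0 <= cos (r *+ 2) by apply: cos_ge0_pihalf; rewrite (mulr2n r); apply/andP; split; lra.
  move: c2; rewrite cos_mulr2n (mulr2n (cos r ^+ 2)); move: (cos r) c0 => c c0 c2.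
  by rewrite leNgt; apply/negP => c1; nra.
set z := y / 2.
have z0 : 0 <= z by rewrite /z; lra.
have sz : z / 2 <= sin z.
  have [|c] := @MVT_segment _ sin cos 0 z z0 (fun r _ => is_derive_sin r).
    by apply: continuous_subspaceT => r; exact: continuous_sin.
  rewrite in_itv/= => /andP[h1 h2]; rewrite sin0 !subr0 => ->.
  have : 2^-1 <= cos c by apply: ch; apply/andP; split => //; rewrite (le_trans h2)// /z; lra.
  by move=> h; nra.
have cz : 2^-1 <= cos z by apply: ch; apply/andP; split => //; rewrite /z; lra.
have -> : sin y = sin (z *+ 2) by congr sin; rewrite (mulr2n z) /z; field.
rewrite sin_mulr2n (mulr2n (cos z * sin z)); have -> : y = 2 * z by rewrite /z; field.
by nra.
Qed.

Lemma norm_sinDint y (p : int) : `|sin (y + p%:~R * pi)| = `|sin y|.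
Proof.
have nat (w : R) (n : nat) : `|sin (w + n%:R * pi)| = `|sin w|.
  rewrite sinD sin_natpi mulr0 addr0 normrM.
  by have /eqP := @sin_natpi R n; rewrite -norm_cos_eq1 => /eqP->; rewrite mulr1.
case: p => n; first exact: nat.
by rewrite -(nat _ n.+1) NegzE intrN mulNr subrK.
Qed.

Lemma sin_dist x (p : int) : `|x - p%:~R| <= 2^-1 -> `|x - p%:~R| / 2 <= `|sin (x * pi)|.
Proof.
move=> h; have pi2 := @pi_ge2 R.
have -> : x * pi = (x - p%:~R) * pi + p%:~R * pi by ring.
rewrite norm_sinDint; set d := x - p%:~R in h *.
have -> : `|sin (d * pi)| = `|sin (`|d| * pi)|.
  by have [d0|d0] := ger0P d => //; rewrite mulNr sinN normrN.
have d0 := normr_ge0 d; move: (`|d|) d0 h => e e0 h.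
apply: le_trans (ler_norm _); apply: le_trans (sin_lower _); first by nra.
by apply/andP; split; nra.
Qed.

(** The condition with exponent m gives |sin| >= c/(2 q^m), so the power 2(m+1) leaves at least q^2
    to make the weights summable. It is even because it counts the derivatives traded against cosine
    coefficients in [ders_moment]. *)
Lemma diophantine_weights (alpha : R) : diophantine alpha ->
  exists (m : nat) (A : R), forall k : nat, sin (k.+1%:R * (pi * alpha)) != 0 /\
   `|(k.+1%:R ^+ (2 * m.+1) * sin (k.+1%:R * (pi * alpha)))^-1| <= A / (k.+1%:R * k.+2%:R).
Proof.
move=> [_ [m [c [c0 h]]]]; exists m, (4 / c) => k.
set q : R := k.+1%:R; have q0 : 0 < q by rewrite /q.
(* The integer nearest to q alpha. *)
pose p := Num.floor (q * alpha + 2^-1).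
have pd : `|q * alpha - p%:~R| <= 2^-1.
  have f1 : p%:~R <= q * alpha + 2^-1 by exact: floor_le_tmp.
  have f2 : q * alpha + 2^-1 < p%:~R + 1 by have := floorD1_gt (q * alpha + 2^-1); rewrite intrD.
  by rewrite ler_norml; apply/andP; split; lra.
have hl : c / q ^+ m < `|q * alpha - p%:~R|.
  have := h p k.+1 isT; rewrite -/q => h1.
  have -> : q * alpha - p%:~R = - (q * (p%:~R / q - alpha)) by field; rewrite gt_eqF.
  rewrite normrN normrM (gtr0_norm q0); apply: lt_le_trans h1 _.
  by rewrite ler_peMl// /q ler1n.
have hs := sin_dist pd.
have e : q * alpha * pi = q * (pi * alpha) by ring.
rewrite e in hs.
have cq : 0 < c / q ^+ m by rewrite divr_gt0 ?exprn_gt0.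
have sl : c / q ^+ m / 2 <= `|sin (q * (pi * alpha))|.
  by apply: le_trans hs; rewrite ler_wpM2r// ltW.
split.
  rewrite -normr_gt0; apply: lt_le_trans sl; by rewrite divr_gt0.
rewrite normfV normrM (ger0_norm (exprn_ge0 _ (ltW q0))).
have e1 : q ^+ (2 * m.+1) = q ^+ m * q ^+ 2 * q ^+ m.
  by rewrite -!exprD; congr (_ ^+ _); lia.
apply: (@le_trans _ _ ((q ^+ 2 * (c / 2))^-1)).
  rewrite lef_pV2 ?posrE; last first.
  - by rewrite mulr_gt0 ?exprn_gt0 ?divr_gt0.
  - by rewrite mulr_gt0 ?exprn_gt0// (lt_le_trans _ sl)// divr_gt0.
  apply: (@le_trans _ _ (q ^+ (2 * m.+1) * (c / q ^+ m / 2))); last first.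
    by rewrite ler_wpM2l// exprn_ge0// ltW.
  rewrite e1 (_ : _ * (c / q ^+ m / 2) = q ^+ m * (q ^+ 2 * (c / 2))); last first.
    by field; rewrite expf_neq0// gt_eqF.
  by rewrite ler_peMl ?mulr_ge0 ?exprn_ge0 ?(ltW q0) ?(ltW c0)// exprn_ege1// /q ler1n.
rewrite invfM invf_div; apply: (@le_trans _ _ (2 / (q * k.+2%:R) * (2 / c))).
  by rewrite ler_wpM2r ?divr_ge0 ?(ltW c0)//; exact: inv_sq_le.
by rewrite le_eqVlt; apply/orP; left; apply/eqP; rewrite mulrAC; congr (_ / _); ring.
Qed.

End SmallDivisors.
End Denominators.
Import Denominators.

(** * The cohomological equation along X1 *)

Module Cohomological.
Section CohomologicalEquation.
Context {R : realType}.
Variable alpha : R.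
Hypothesis alpha_gt0 : 0 < alpha.
Implicit Types (x y : R6 R) (F g : R6 R -> R).

Local Notation dom := (dom alpha).
Local Notation orb k s x := (torus (fun i => s * k i) x).
Local Notation e1 := (three (1 : R) 0 0).
Local Notation e2 := (three (0 : R) 1 0).
Local Notation k1 := (three 1 alpha 0).
Local Notation R2 := (torus_gen e2).
Local Notation lie1 F x := (lie (torus_gen e1) F x).
Local Notation lie2 F x := (lie R2 F x).
Local Notation lieX F x := (lie (torus_gen k1) F x).

Lemma dom_orb k (s : R) x : dom x -> dom (orb k s x).
Proof. by move=> dx; apply/dom_torus. Qed.

Lemma orbD k (s t : R) x : orb k s (orb k t x) = orb k (s + t) x.
Proof. by rewrite torusD; congr torus; apply/funext => i; rewrite mulrDl. Qed.

Lemma orb0 k x : orb k 0 x = x.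
Proof. by rewrite -[RHS]torus0; congr torus; apply/funext => i; rewrite mul0r. Qed.

Lemma orb_comm k l (s t : R) x : orb k s (orb l t x) = orb l t (orb k s x).
Proof. exact: torusC. Qed.

Lemma orb_gen k l (s : R) y : orb k s (torus_gen l y) = torus_gen l (orb k s y).
Proof. exact: torus_torus_gen. Qed.

Lemma orb_period (b : 'I_3 -> bool) x : orb (fun i => (b i)%:R) (2 * pi) x = x.
Proof. exact: torus_2pi. Qed.

Lemma e1_period (s : R) x : orb e1 (s + 2 * pi) x = orb e1 s x.
Proof.
rewrite -orbD; congr torus; rewrite -[RHS](orb_period (fun i => i == 0)); congr torus.
by apply/funext; apply: I3P.
Qed.

Lemma e1_2pi x : orb e1 (2 * pi) x = x.
Proof. by have := e1_period 0 x; rewrite add0r orb0. Qed.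

Lemma e2_period (s : R) x : orb e2 (s + 2 * pi) x = orb e2 s x.
Proof.
rewrite -orbD; congr torus; rewrite -[RHS](orb_period (fun i => i == 1)); congr torus.
by apply/funext; apply: I3P.
Qed.

Lemma orbit_lie_derive k (s : R) x F : smooth_on dom F -> dom x ->
  is_derive s 1 (fun s : R => F (orb k s x)) (lie (torus_gen k) F (orb k s x)).
Proof. by move=> sF dx; apply: orbit_is_derive; apply: (smooth_on_diff sF); exact: dom_orb. Qed.

Lemma invariant_lie0 k F x : smooth_on dom F -> dom x -> (forall s : R, F (orb k s x) = F x) ->
  lie (torus_gen k) F x = 0.
Proof.
move=> sF dx h; have := orbit_lie_derive k 0 sF dx; rewrite orb0 => d.
have -> : lie (torus_gen k) F x = 'D_1 (fun s : R => F (orb k s x)) 0 by rewrite (@derive_val _ _ _ _ _ _ _ d).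
by rewrite (_ : (fun s : R => _) = cst (F x)) ?derive_cst//; apply/funext => s; rewrite h.
Qed.

Lemma lie0_invariant k F x (s : R) : smooth_on dom F -> dom x ->
  (forall y, dom y -> lie (torus_gen k) F y = 0) -> F (orb k s x) = F x.
Proof.
move=> sF dx h; rewrite -[in RHS](orb0 k x).
apply: (@derive0_cst _ (fun s : R => F (orb k s x)) s 0) => t _.
by rewrite -(h (orb k t x)); [exact: orbit_lie_derive|exact: dom_orb].
Qed.

Lemma lieX_split F x : differentiable F x -> lieX F x = lie1 F x + alpha * lie2 F x.
Proof.
move=> dF; rewrite /lie.
have -> : torus_gen k1 x = alpha *: R2 x + torus_gen e1 x.
  by apply: R6P; apply: I3P; rewrite /torus_gen !(mxE, pair_mx0, pair_mx1, threeE) /=; ring.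
by rewrite derive_lin// addrC.
Qed.

Definition ders g j := iter j (fun F x => lie2 F x) g.

Lemma ders_smooth g j : smooth_on dom g -> smooth_on dom (ders g j).
Proof.
move=> sg; elim: j => //= j IH; apply: lie_smooth => //; first exact: dom_open.
exact: torus_gen_lin.
Qed.

Lemma ders_derive g j x (s : R) : smooth_on dom g -> dom x ->
  is_derive s 1 (fun s : R => ders g j (orb e2 s x)) (ders g j.+1 (orb e2 s x)).
Proof. by move=> sg dx; apply: orbit_lie_derive => //; exact: ders_smooth. Qed.

Lemma ders_moment g m x (k : nat) : smooth_on dom g -> dom x ->
  cint (fun s => cos (k%:R * s) * ders g (2 * m.+1) (orb e2 s x)) =
  (- k%:R ^+ 2) ^+ m * cint (fun s => cos (k%:R * s) * ders g 2 (orb e2 s x)).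
Proof.
move=> sg dx; elim: m => [|m IH]; first by rewrite mul1r.
have per j : ders g j (orb e2 (2 * pi) x) = ders g j (orb e2 0 x).
  by rewrite -[2 * pi]add0r e2_period.
rewrite exprS -mulrA -IH (_ : (2 * m.+2 = (2 * m.+1).+2)%N); last by lia.
apply: (@cos_moment _ k (fun s => ders g (2 * m.+1) (orb e2 s x)) (fun s => ders g (2 * m.+1).+1 (orb e2 s x))).
- exact: (orbit_cont (ders_smooth _ sg) dx).
- by move=> t; exact: ders_derive.
- by move=> t; exact: ders_derive.
- exact: per.
- exact: per.
Qed.

Hypothesis dioph : diophantine alpha.

Local Notation S x := (orb e2 (2 * pi * alpha) x).

(** [T g] integrates the derivative of order 2(m+1) of g along theta_2 against the kernel K with
    coefficients 1/(k^(2m+2) sin(pi k alpha)). The difference of K under the rotation has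
    coefficients proportional to k^(-2m-2) cos(k s): the small denominators cancel, the derivatives
    remove the power, and Fourier inversion returns g minus its mean. *)
Lemma difference_operator : exists T : (R6 R -> R) -> R6 R -> R, forall g, smooth_on dom g ->
  [/\ smooth_on dom (T g),
      forall x, dom x -> T g (S x) - T g x = g x - (2 * pi)^-1 * avg e2 (fun=> 1) g x
    & (forall x, dom x -> g (S x) = g x) -> forall x, dom x -> T g (S x) = T g x].
Proof.
have [m [A hA]] := diophantine_weights dioph.
pose th k : R := k.+1%:R * (pi * alpha).
pose w k : R := (k.+1%:R ^+ (2 * m.+1) * sin (th k))^-1.
have cu k (b : R) : continuous (fun s : R => w k * sin (k.+1%:R * s + b)).
  apply: cont_scale; apply: (@cont_is_derive _ _ (fun t => k.+1%:R * cos (k.+1%:R * t + b))) => t.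
  by apply: is_derive_affine_arg; exact: is_derive_sin.
have [|k s|K [cK hK]] := @unif_series _ (fun k s => w k * sin (k.+1%:R * s + th k)) A.
- by move=> k; exact: cu.
- rewrite normrM; have [_ h] := hA k; apply: le_trans h.
  by rewrite ler_piMr// sin_max.
(* The sign comes from the factor (-k^2)^m of [ders_moment]. *)
pose kap : R := (-1) ^+ m / (2 * pi).
exists (fun g x => kap * avg e2 K (ders g (2 * m.+1)) x) => g sg.
have od : open dom by exact: dom_open.
have sD := ders_smooth (2 * m.+1) sg.
split.
- by apply: smooth_onM => //; [exact: smooth_on_cst | exact: avg_smooth].
- move=> x dx; have dS : dom (S x) by exact: dom_orb.
  pose p s := ders g (2 * m.+1) (orb e2 s x).
  have cp : continuous p by exact: (orbit_cont sD dx).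
  have pP s : p (s + 2 * pi) = p s by rewrite /p e2_period.
  pose Kn n (s : R) := \sum_(k < n) w k * sin (k.+1%:R * s + th k).
  have cKn n : continuous (Kn n) by move=> s; apply: cvg_fsum => i; exact: cu.
  (* The kernel after the rotation angle 2 pi alpha is moved from the function to it. Its phase is
     the opposite of that of [Kn], so the difference of the two is a cosine times sin(th k). *)
  pose Kt n (s : R) := \sum_(k < n) w k * sin (k.+1%:R * s - th k).
  have cKt n : continuous (Kt n) by move=> s; apply: cvg_fsum => i; exact: cu.
  pose ps s := p (s + 2 * pi * alpha).
  have psE s : ps s = ders g (2 * m.+1) (orb e2 s (S x)) by rewrite /ps /p orbD.
  have cps : continuous ps by rewrite (funext psE); exact: (orbit_cont sD dS).
  have KnE n s : Kt n (s + 2 * pi * alpha) = Kn n s.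
    by apply: eq_bigr => k _; congr (_ * sin _); rewrite /th; ring.
  have per n s : Kt n (s + 2 * pi) * p (s + 2 * pi) = Kt n s * p s.
    rewrite pP; congr (_ * _); apply: eq_bigr => k _; congr (_ * _).
    have -> : k.+1%:R * (s + 2 * pi) - th k = k.+1%:R * s - th k + (2 * k.+1)%N%:R * pi.
      by rewrite natrM; ring.
    rewrite sinD sin_natpi mulr0 addr0 (_ : cos _ = 1) ?mulr1//.
    have -> : (2 * k.+1)%N%:R * pi = (k.+1%:R * pi) *+ 2 :> R by rewrite -(mulr_natl (_ * pi)) natrM; ring.
    by rewrite cos_mulr2n cos2sin2 sin_natpi expr0n subr0 (mulr2n 1) addrK.
  have sh n : cint (fun s => Kn n s * ps s) = cint (fun s => Kt n s * p s).
    rewrite -(@cint_shift _ (fun s => Kt n s * p s) (2 * pi * alpha))//; last exact: cont_mul.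
    by congr cint; apply/funext => s; rewrite KnE.
  have a1 := cint_unif cK cKn cps hK; have a2 := cint_unif cK cKn cp hK.
  have a3 := approx_lin (-1) a2 a1.
  have d0 t := ders_derive 0 t sg dx; have d1 t := ders_derive 1 t sg dx.
  have perD j : ders g j (orb e2 (2 * pi) x) = ders g j (orb e2 0 x).
    by rewrite -[2 * pi]add0r e2_period.
  have c2 : continuous (fun s : R => ders g 2 (orb e2 s x)) := orbit_cont (ders_smooth 2 sg) dx.
  have z0 : continuous (fun _ : R => 0 : R) by exact: cst_continuous.
  have a4 := fourier_inversion c2 d0 d1 (perD 0%N) (perD 1%N).
  have a40 : approx (0 : R) (fun=> 0) by exists 0 => n; rewrite subrr normr0 mul0r.
  have a5 := approx_lin (- 2 * (-1) ^+ m) a4 a40.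
  have E : -1 * cint (fun s => K s * p s) + cint (fun s => K s * ps s) =
     - 2 * (-1) ^+ m * (2^-1 * cint (fun s => g (orb e2 s x)) - pi * g x) + 0.
    rewrite -{2}(orb0 e2 x); apply: approx_uniq a3 _; apply: approx_eq a5 => n.
    rewrite addr0 sh -(cint_lin (-1) (cont_mul (cKn n) cp) (cont_mul (cKt n) cp)).
    have -> : (fun t => -1 * (Kn n t * p t) + Kt n t * p t) =
        (fun t => (\sum_(k < n) - 2 * k.+1%:R ^- (2 * m.+1) * cos (k.+1%:R * t)) * p t).
      apply/funext => t; rewrite mulrA -mulrDl; congr (_ * _).
      rewrite mulr_sumr -big_split; apply: eq_bigr => k _ /=; have [s0 _] := hA k.
      rewrite sinB sinD /w -/(th k) in s0 *; have q0 : k.+1%:R ^+ (2 * m.+1) != 0 :> R by rewrite expf_neq0 ?pnatr_eq0.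
      move: q0 s0; move: (k.+1%:R ^+ (2 * m.+1)) (sin (th k)) (cos (th k)) (sin (_ * t)) (cos (_ * t)) => a b c d e a0 b0.
      by field; apply/andP.
    rewrite (@cint_sum _ n (fun k t => - 2 / k.+1%:R ^+ (2 * m.+1) * cos (k.+1%:R * t)) p)//; last first.
      by move=> k; apply: cont_scale; exact: cos_arg_cont.
    rewrite mulr_sumr; apply: eq_bigr => k _.
    have cc : continuous (fun s : R => cos (k.+1%:R * s) * p s) by apply: cont_mul => //; exact: cos_arg_cont.
    have -> : cint (fun s => - 2 * k.+1%:R ^- (2 * m.+1) * cos (k.+1%:R * s) * p s) =
       - 2 * k.+1%:R ^- (2 * m.+1) * cint (fun s => cos (k.+1%:R * s) * p s).
      by rewrite -cint_scale//; congr cint; apply/funext => t; rewrite mulrA.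
    rewrite /p ders_moment// (exprNn (k.+1%:R ^+ 2)) -exprM mulnS exprD.
    have q0 : k.+1%:R != 0 :> R by rewrite pnatr_eq0.
    have q1 : k.+1%:R ^+ (2 * m) != 0 :> R by rewrite expf_neq0.
    move: q0 q1; move: (k.+1%:R : R) (k.+1%:R ^+ (2 * m)) ((-1) ^+ m) (cint _) => d c b a hd hc.
    by field; apply/andP.
  rewrite /avg; under [X in kap * cint X - _]funext => s do rewrite -psE.
  have -> : cint (fun s => 1 * g (orb e2 s x)) = cint (fun s => g (orb e2 s x)).
    by congr cint; apply/funext => s; rewrite mul1r.
  move: E; rewrite /kap; move: (cint _) (cint _) (cint _) => w' v u; rewrite addr0 => E.
  have -> : (-1) ^+ m / (2 * pi) * v - (-1) ^+ m / (2 * pi) * u = (-1) ^+ m / (2 * pi) * (-1 * u + v) by ring.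
  have m2 : (-1) ^+ m * (-1) ^+ m = 1 :> R by rewrite -exprD addnn -mul2n exprM sqrrN expr1n expr1n.
  have pi0 : pi != 0 :> R by rewrite gt_eqF// pi_gt0.
  rewrite E; move: ((-1) ^+ m : R) m2 (pi : R) pi0 => e m2 q q0.
  transitivity ((e * e) * (- 2 / (2 * q) * (2^-1 * w' - q * g x))); first by field.
  by rewrite m2; field.
- move=> gS x dx; congr (_ * cint _); apply/funext => s; congr (_ * _).
  have: forall t : R, ders g (2 * m.+1) (orb e2 t (S x)) = ders g (2 * m.+1) (orb e2 t x).
    elim: (2 * m.+1)%N => [|j IH] t; first by rewrite /ders/= orb_comm gS//; exact: dom_orb.
    have dS : dom (S x) by exact: dom_orb.
    have d1 := ders_derive j t sg dS; have d2 := ders_derive j t sg dx.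
    rewrite -(@derive_val _ _ _ _ _ _ _ d1) -(@derive_val _ _ _ _ _ _ _ d2).
    by congr ('D_1 _ t); apply/funext => r; exact: IH.
  by apply.
Qed.

Local Notation A1 F := (avg e1 (fun=> 1) F).
Local Notation A2 F := (avg e2 (fun=> 1) F).

Lemma avg_invariant k F x (t : R) : (forall (s : R) x, orb k (s + 2 * pi) x = orb k s x) ->
  smooth_on dom F -> dom x -> avg k (fun=> 1) F (orb k t x) = avg k (fun=> 1) F x.
Proof.
move=> per sF dx; rewrite /avg.
rewrite -[RHS](@cint_shift _ _ t).
- by congr cint; apply/funext => s; rewrite orbD.
- by apply: cont_scale; exact: (orbit_cont sF dx).
- by move=> s; rewrite per.
Qed.

Lemma lie2_avg F x : smooth_on dom F -> dom x -> lie2 (A2 F) x = 0.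
Proof.
move=> sF dx; have cc : continuous (fun _ : R => 1 : R) by exact: cst_continuous.
by apply: invariant_lie0 => // [|s]; [exact: avg_smooth|exact: avg_invariant e2_period _ _].
Qed.

Lemma lie1_avg F x : smooth_on dom F -> dom x -> lie1 (A1 F) x = 0.
Proof.
move=> sF dx; have cc : continuous (fun _ : R => 1 : R) by exact: cst_continuous.
by apply: invariant_lie0 => // [|s]; [exact: avg_smooth|exact: avg_invariant e1_period _ _].
Qed.

(* a smooth function invariant under the irrational rotation S is the average
   of itself, by applying the difference operator to it *)
Lemma rotation_invariant g x : smooth_on dom g -> (forall y, dom y -> g (S y) = g y) -> dom x ->
  lie2 g x = 0.
Proof.
move=> sg gS dx; have [T hT] := difference_operator.
have [_ h1 h2] := hT g sg; have od : open dom by exact: dom_open.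
have cc : continuous (fun _ : R => 1 : R) by exact: cst_continuous.
have e y : dom y -> g y = (2 * pi)^-1 * A2 g y.
  by move=> dy; have := h1 y dy; rewrite h2// subrr => e; apply/eqP; rewrite -subr_eq0 -e.
have sA : smooth_on dom (A2 g) by exact: avg_smooth.
have dA := smooth_on_diff sA dx.
by rewrite (lie_near_eq R2 od dx e) (lieZ R2 _ dA) (lie2_avg sg dx) mulr0.
Qed.

Lemma flow_period x : orb k1 (2 * pi) x = S x.
Proof.
have -> : orb k1 (2 * pi) x = orb e1 (2 * pi) (S x).
  by rewrite torusD; congr torus; apply/funext; apply: I3P; rewrite !threeE; ring.
exact: e1_2pi.
Qed.

Lemma flow_invariant g x : smooth_on dom g -> (forall y, dom y -> lieX g y = 0) -> dom x ->
  lie1 g x = 0 /\ lie2 g x = 0.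
Proof.
move=> sg gX dx.
have l2 : lie2 g x = 0.
  by apply: rotation_invariant => // y dy; rewrite -flow_period; exact: lie0_invariant.
by have := gX x dx; rewrite (lieX_split (smooth_on_diff sg dx)) l2 mulr0 addr0.
Qed.

(** The average u of g over theta_1 and theta_2 is invariant, so X1 u = 0; on the other hand X1 u is
    c times (2 pi)^2, because c is invariant. *)
Lemma flow_growth g c x : smooth_on dom g -> smooth_on dom c -> (forall y, dom y -> lieX g y = c y) ->
  (forall y, dom y -> lie1 c y = 0) -> (forall y, dom y -> lie2 c y = 0) -> dom x -> c x = 0.
Proof.
move=> sg sc gX c1 c2 dx; have od : open dom by exact: dom_open.
have cc : continuous (fun _ : R => 1 : R) by exact: cst_continuous.
have pi0 : 2 * pi != 0 :> R by rewrite mulf_neq0// gt_eqF// pi_gt0.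
pose u := A1 (A2 g).
have s2 : smooth_on dom (A2 g) by exact: avg_smooth.
have su : smooth_on dom u by exact: avg_smooth.
have avc k F y : (forall s : R, F (orb k s y) = F y) -> avg k (fun=> 1) F y = F y * (2 * pi).
  move=> h; rewrite /avg -cint_cst; congr cint; apply/funext => s; by rewrite h mul1r.
have E2 y : dom y -> lieX (A2 g) y = c y * (2 * pi).
  move=> dy; rewrite (avg_lie _ sg dy)//; last by move=> s z; exact: orb_gen.
  rewrite -(avc e2 c y); last by move=> s; apply: (lie0_invariant _ sc dy c2).
  congr cint; apply/funext => s; congr (_ * _); apply: gX; exact: dom_orb.
have E1 : lieX u x = c x * (2 * pi) * (2 * pi).
  rewrite (avg_lie _ s2 dx)//; last by move=> s z; exact: orb_gen.
  rewrite -(avc e1 (fun y => c y * (2 * pi)) x).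
    congr cint; apply/funext => s; congr (_ * _); apply: E2; exact: dom_orb.
  by move=> s; rewrite (lie0_invariant _ sc dx c1).
have : lieX u x = 0.
  rewrite lieX_split; last exact: (smooth_on_diff su).
  have a1 : lie1 u x = 0 := lie1_avg s2 dx.
  have a2 : lie2 u x = 0.
    apply: (invariant_lie0 su dx) => s.
    rewrite /u avg_comm; congr cint; apply/funext => t; congr (_ * _).
    exact: (avg_invariant _ e2_period sg (dom_orb e1 t dx)).
  by rewrite a1 a2 mulr0 addr0.
by rewrite E1 => E; apply: (mulIf pi0); apply: (mulIf pi0); rewrite E !mul0r.
Qed.

(** The equation is solved first for the return map S to a circle, which reduces the error to a
    function D of zero theta_2-derivative; the remaining equation along theta_1 is elementary. *)
Lemma cohomological_equation F : smooth_on dom F -> exists h f0 : R6 R -> R,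
  [/\ smooth_on dom h, smooth_on dom f0,
      forall x, dom x -> lieX h x = F x - f0 x,
      forall x, dom x -> lie1 f0 x = 0 & forall x, dom x -> lie2 f0 x = 0].
Proof.
move=> sF; have od : open dom by exact: dom_open.
have cc : continuous (fun _ : R => 1 : R) by exact: cst_continuous.
have [T hT] := difference_operator.
(* The integral of F over the return time 2 pi, by which a primitive increases under S. [H]
   increases by P minus its mean. *)
pose P := avg k1 (fun=> 1) F.
have sP : smooth_on dom P by exact: avg_smooth.
have [sH hH _] := hT P sP; pose H := T P.
have lX (E : R6 R -> R) : smooth_on dom E -> smooth_on dom (fun x => lieX E x).
  by move=> sE; apply: lie_smooth => //; exact: torus_gen_lin.
pose D x := lieX H x - F x.
have sD : smooth_on dom D by apply: smooth_onB => //; exact: lX.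
have df (E : R6 R -> R) x : smooth_on dom E -> dom x -> differentiable E x by exact: smooth_on_diff.
have lS (E : R6 R -> R) x : smooth_on dom E -> dom x -> lieX E (S x) = lieX (fun y => E (S y)) x.
  by move=> sE dx; rewrite /lie -orb_gen -(orbit_term_derive _ _ _ sE dx).
have sS (E : R6 R -> R) : smooth_on dom E -> smooth_on dom (fun y => E (S y)).
  by move=> sE; exact: orbit_term_smooth.
have XP x : dom x -> lieX P x = F (S x) - F x.
  move=> dx; rewrite (avg_lie _ sF dx)//; last by move=> s z; exact: orb_gen.
  by rewrite (avg_cint_lie _ sF dx) flow_period.
have sA2P : smooth_on dom (A2 P) by exact: avg_smooth.
(* Along X1 the increment of H has the derivative of P, that is F o S - F; the mean of P does not
   contribute, since a rotation does not change the integral over the theta_2 circle. *)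
have DS x : dom x -> D (S x) = D x.
  move=> dx; apply/eqP; rewrite -subr_eq0; apply/eqP.
  have e1' : lieX (fun y => H (S y) - H y) x = lieX H (S x) - lieX H x.
    by rewrite (lieB _ (df _ _ (sS _ sH) dx) (df _ _ sH dx)) (lS _ _ sH dx).
  have e2' : lieX (fun y => H (S y) - H y) x = lieX P x - (2 * pi)^-1 * lieX (A2 P) x.
    have sZ : smooth_on dom (fun y => (2 * pi)^-1 * A2 P y).
      by apply: smooth_onM => //; exact: smooth_on_cst.
    by rewrite (lie_near_eq (torus_gen k1) od dx hH) (lieB _ (df _ _ sP dx) (df _ _ sZ dx)) (lieZ _ _ (df _ _ sA2P dx)).
  have e3' : lieX (A2 P) x = 0.
    rewrite (avg_lie _ sP dx)//; last by move=> s z; exact: orb_gen.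
    have -> : avg e2 (fun=> 1) (lie (torus_gen k1) P) x =
       -1 * cint (fun s : R => F (orb e2 s x)) + cint (fun s : R => F (orb e2 (s + 2 * pi * alpha) x)).
      have cF : continuous (fun s : R => F (orb e2 s x)) by exact: (orbit_cont sF dx).
      have cF' : continuous (fun s : R => F (orb e2 (s + 2 * pi * alpha) x)).
        have dS : dom (S x) := dom_orb e2 (2 * pi * alpha) dx.
        have cS : continuous (fun s : R => F (orb e2 s (S x))) := orbit_cont sF dS.
        rewrite (_ : (fun s : R => _) = (fun s : R => F (orb e2 s (S x)))); first by exact: cS.
        by apply/funext => s; rewrite orbD.
      rewrite -cint_lin//; congr cint; apply/funext => s.
      by rewrite XP; [rewrite orbD (addrC (2 * pi * alpha)); ring|exact: dom_orb].
    rewrite (@cint_shift _ (fun s : R => F (orb e2 s x)) (2 * pi * alpha)); first by ring.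
      exact: (orbit_cont sF dx).
    by move=> s; rewrite e2_period.
  rewrite /D; rewrite e1' e3' mulr0 subr0 XP// in e2'; lra.
have D2 x : dom x -> lie2 D x = 0 by move=> dx; exact: rotation_invariant.
(* A sawtooth: integrating by parts, its jump returns D and its slope subtracts the mean. *)
pose K (s : R) := (2 * pi)^-1 * (s - pi).
have pi0 : 2 * pi != 0 :> R by rewrite mulf_neq0// gt_eqF// pi_gt0.
have dK (s : R) : is_derive s 1 K (2 * pi)^-1.
  have := @is_derive_affine_arg _ id (2 * pi)^-1 (- ((2 * pi)^-1 * pi)) s 1 (is_derive_id _ _).
  by rewrite mulr1 (_ : (fun t => _) = K)//; apply/funext => y /=; rewrite /K mulrBr.
have cK : continuous K by apply: cont_is_derive dK.
pose k := avg e1 K D; have sk : smooth_on dom k by exact: avg_smooth.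
have Xk x : dom x -> lieX k x = D x - (2 * pi)^-1 * A1 D x.
  move=> dx; rewrite (avg_lie _ sD dx)//; last by move=> s z; exact: orb_gen.
  have -> : avg e1 K (lie (torus_gen k1) D) x = cint (fun s => K s * lie1 D (orb e1 s x)).
    congr cint; apply/funext => s; congr (_ * _); have ds : dom (orb e1 s x) by exact: dom_orb.
    by rewrite (lieX_split (df _ _ sD ds)) (D2 _ ds) mulr0 addr0.
  have s1D : smooth_on dom (lie (torus_gen e1) D) by apply: lie_smooth => //; exact: torus_gen_lin.
  have cst1 : continuous (fun _ : R => (2 * pi)^-1 : R) by exact: cst_continuous.
  rewrite (@cint_parts _ K (fun s : R => D (orb e1 s x)) (fun=> (2 * pi)^-1)
    (fun s : R => lie1 D (orb e1 s x)) cst1 (orbit_cont s1D dx) dK (fun s => orbit_lie_derive e1 s sD dx)).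
  rewrite e1_2pi orb0 cint_scale; last exact: (orbit_cont sD dx).
  have -> : cint (fun s : R => D (orb e1 s x)) = A1 D x.
    by congr cint; apply/funext => s; rewrite mul1r.
  have p0 : (pi : R) != 0 by rewrite gt_eqF// pi_gt0.
  rewrite /K; move: (pi : R) p0 (A1 D x) (D x) => q q0 a d.
  by field.
exists (fun x => H x - k x), (fun x => - (2 * pi)^-1 * A1 D x).
have sA1 : smooth_on dom (A1 D) by exact: avg_smooth.
split.
- exact: smooth_onB.
- by apply: smooth_onM => //; exact: smooth_on_cst.
- by move=> x dx; rewrite (lieB _ (df _ _ sH dx) (df _ _ sk dx)) (Xk x dx) /D; ring.
- by move=> x dx; rewrite (lieZ _ _ (df _ _ sA1 dx)) (lie1_avg sD dx) mulr0.
- move=> x dx; rewrite (lieZ _ _ (df _ _ sA1 dx)).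
  have -> : lie2 (A1 D) x = 0; last by rewrite mulr0.
  apply: (invariant_lie0 sA1 dx) => s; rewrite avg_comm; congr cint; apply/funext => t; congr (_ * _).
  exact: (lie0_invariant _ sD (dom_orb e1 t dx) D2).
Qed.

End CohomologicalEquation.
End Cohomological.
Import Cohomological.

(** * Pullback by the retraction, and invariant functions *)

Module ContactSplitting.
Section Unobstructed.
Context {R : realType}.
Variable alpha : R.
Hypothesis alpha_gt1 : 1 < alpha.
Let alpha_gt0 : 0 < alpha := lt_trans ltr01 alpha_gt1.
Implicit Types (x y u v w : R6 R).

Local Notation frame := (frame alpha).
Local Notation dom := (dom alpha).
Local Notation X1 := (X1 alpha).
Local Notation xi := (xi alpha).
Local Notation fcomp := (fcomp alpha).
Local Notation dfr := (dfr alpha).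
Local Notation form := (form alpha).
Local Notation lam := (coef alpha lamf).
Local Notation orb k s x := (torus (fun i => s * k i) x).
Local Notation L i f x := (lie (frame i) f x).
Local Notation R1 := (torus_gen (three (1 : R) 0 0)).
Local Notation R2 := (torus_gen (three (0 : R) 1 0)).

Lemma rho_torus th x : rho alpha (torus th x) = torus th (rho alpha x).
Proof.
have NE : Nf alpha (torus th x) = Nf alpha x by rewrite /Nf !sq_torus.
by apply: R6P => i; rewrite /rho NE sq_torus /torus !(pair_mx0, pair_mx1); ring.
Qed.

(** [rho] commutes with the torus, so replacing a function near Y by its pullback to [dom] commutes
    with the derivatives along torus fields. *)
Lemma rho_pullback (U : set (R6 R)) (g : R6 R -> R) : open U -> Y alpha `<=` U -> smooth_on U g ->
  smooth_on dom (fun x => g (rho alpha x)) /\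
  forall k x, dom x -> lie (torus_gen k) (fun y => g (rho alpha y)) x = lie (torus_gen k) g (rho alpha x).
Proof.
move=> oU YU sg; have od : open dom by exact: dom_open.
have sgr : smooth_on dom (fun x => g (rho alpha x)).
  by apply: (smooth_on_compM od _ (@rho_smooth _ alpha) sg) => x dx; apply: YU; exact: rho_Y.
split; first by [].
move=> k x dx.
have d1 := orbit_lie_derive k 0 sgr dx; rewrite orb0 in d1.
have dg : differentiable g (orb k 0 (rho alpha x)).
  by rewrite orb0; apply: (smooth_on_diff sg); apply: YU; exact: rho_Y.
have d2 := orbit_is_derive dg.
rewrite -[LHS](@derive_val _ _ _ _ _ _ _ d1).
have -> : (fun s : R => g (rho alpha (orb k s x))) = (fun s : R => g (orb k s (rho alpha x))).
  by apply/funext => s; rewrite rho_torus.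
by rewrite (@derive_val _ _ _ _ _ _ _ d2) orb0.
Qed.

Lemma dirlin (f : R6 R -> R) x (k : R) u v : differentiable f x ->
  'D_(k *: u + v) f x = k * 'D_u f x + 'D_v f x.
Proof. by move=> df; exact: derive_lin. Qed.

Lemma dir0 (f : R6 R -> R) x : differentiable f x -> 'D_0 f x = 0.
Proof. by move=> df; have := dirlin (-1) 0 0 df; rewrite scaler0 addr0; lra. Qed.

Lemma lie_X1 (f : R6 R -> R) x : dom x -> differentiable f x ->
  lie X1 f x = xi 1 x * L 1 f x + xi 2 x * L 2 f x + xi 3 x * L 3 f x.
Proof.
move=> dx df; rewrite /lie (X1_decomp alpha_gt0 dx) -addrA -[xi 3 x *: _]addr0.
by rewrite !(dirlin _ _ _ df) (dir0 df) addr0 addrA.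
Qed.

Lemma lie_frame1 (f : R6 R -> R) x : differentiable f x -> L 1 f x = lie R1 f x + lie R2 f x.
Proof.
move=> df; rewrite /lie.
have -> : frame 1 x = 1 *: R1 x + R2 x.
  by apply: R6P; apply: I3P; rewrite /LieDerivatives.frame /torus_gen !(mxE, pair_mx0, pair_mx1, threeE) /=; ring.
by rewrite (dirlin _ _ _ df) mul1r.
Qed.

(** Up to the nonzero factor (1 - alpha) / Nf, the pair (xi 2, xi 3) consists of the real and
    imaginary parts of a unit multiple of z_1 z_2. *)
Lemma xi23 x : dom x -> xi 2 x = 0 -> xi 3 x = 0 -> sq x 0 = 0 \/ sq x 1 = 0.
Proof.
move=> dx; have N0 : 0 < Nf alpha x by case: dx.
rewrite /Coframes.xi comp2E// comp3E// /Coframes.X1 /torus_gen !(pair_mx0, pair_mx1, threeE).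
move=> /eqP; rewrite mulf_eq0 invr_eq0 (gt_eqF N0) orbF => /eqP h2.
move=> /eqP; rewrite mulf_eq0 invr_eq0 (gt_eqF N0) orbF => /eqP h3.
have a1 : 1 - alpha != 0 by rewrite subr_eq0 eq_sym gt_eqF.
have e2 : x 1 0 * x 0 1 + x 1 1 * x 0 0 = 0.
  by apply: (mulfI a1); rewrite mulr0 -[RHS]h2; ring.
have e3 : x 1 1 * x 0 1 - x 1 0 * x 0 0 = 0.
  by apply: (mulfI a1); rewrite mulr0 -[RHS]h3; ring.
have : sq x 0 * sq x 1 = 0.
  rewrite /sq (_ : _ * _ = (x 1 0 * x 0 1 + x 1 1 * x 0 0) ^+ 2 + (x 1 1 * x 0 1 - x 1 0 * x 0 0) ^+ 2).
    by rewrite e2 e3 expr0n addr0.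
  by ring.
by move=> /eqP; rewrite mulf_eq0 => /orP[]/eqP; [left|right].
Qed.

(* where z_k = 0 every tangent vector of the k-th plane has the form R_k v, and
   differentiating R_k f = 0 in the direction v gives the claim *)
Lemma invariant_axis (k : 'I_3 -> R) (f : R6 R -> R) x v : smooth_on dom f -> dom x ->
  (forall y, dom y -> lie (torus_gen k) f y = 0) -> torus_gen k x = 0 ->
  torus_gen k (torus_gen k v) = - v -> 'D_v f x = 0.
Proof.
move=> sf dx f0 kx kv; have od : open dom by exact: dom_open.
have lk := @torus_gen_lin _ k.
have df : differentiable f x by exact: smooth_on_diff sf dx.
have := derive_lie (torus_gen k v) od dx lk sf.
have -> : 'D_(torus_gen k v) (lie (torus_gen k) f) x = 0.
  by rewrite (derive_near_eq _ od dx f0) derive_cst.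
rewrite kv kx.
have sDf : smooth_on dom (fun y => 'D_0 f y) by exact: smooth_on_D.
have -> : 'D_(torus_gen k v) (fun y => 'D_0 f y) x = 0.
  have e y : dom y -> 'D_0 f y = 0.
    move=> dy; have dfy : differentiable f y by exact: smooth_on_diff sf dy.
    exact: dir0.
  by rewrite (derive_near_eq _ od dx e) derive_cst.
rewrite addr0 -scaleN1r -[_ *: v]addr0 (dirlin _ _ _ df) (dir0 df); lra.
Qed.

(** Invariance under theta_1 and theta_2 gives the linear relation xi 2 L_2 + xi 3 L_3 = 0 for both
    functions, so their derivatives are proportional. Where xi 2 and xi 3 both vanish, x lies on an
    axis and [invariant_axis] makes the derivatives of f vanish. *)
Lemma invariant_minor (f g : R6 R -> R) x : smooth_on dom f -> smooth_on dom g -> dom x ->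
  (forall y, dom y -> lie R1 f y = 0) -> (forall y, dom y -> lie R2 f y = 0) ->
  (forall y, dom y -> lie R1 g y = 0) -> (forall y, dom y -> lie R2 g y = 0) ->
  L 2 f x * L 3 g x - L 3 f x * L 2 g x = 0.
Proof.
move=> sf sg dx f1 f2 g1 g2.
have X0 h : smooth_on dom h -> (forall y, dom y -> lie R1 h y = 0) -> (forall y, dom y -> lie R2 h y = 0) ->
    xi 2 x * L 2 h x + xi 3 x * L 3 h x = 0.
  move=> sh h1 h2; have dh : differentiable h x by exact: smooth_on_diff sh dx.
  have := lie_X1 dx dh; rewrite (lie_frame1 dh) (h1 x dx) (h2 x dx).
  have -> : lie X1 h x = lie R1 h x + alpha * lie R2 h x by exact: lieX_split.
  by rewrite (h1 x dx) (h2 x dx); lra.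
have ef := X0 f sf f1 f2; have eg := X0 g sg g1 g2.
have [x2|x2] := eqVneq (xi 2 x) 0; last first.
  apply: (mulfI x2); rewrite mulr0; move: ef eg.
  move: (xi 2 x) (xi 3 x) (L 2 f x) (L 3 f x) (L 2 g x) (L 3 g x) => a b c d e h ef eg.
  transitivity ((a * c + b * d) * h - (a * e + b * h) * d); first by ring.
  by rewrite ef eg; ring.
have [x3|x3] := eqVneq (xi 3 x) 0; last first.
  apply: (mulfI x3); rewrite mulr0; move: ef eg.
  move: (xi 2 x) (xi 3 x) (L 2 f x) (L 3 f x) (L 2 g x) (L 3 g x) => a b c d e h ef eg.
  transitivity ((a * e + b * h) * c - (a * c + b * d) * e); first by ring.
  by rewrite ef eg; ring.
suff [h2 h3] : L 2 f x = 0 /\ L 3 f x = 0 by rewrite h2 h3 !mul0r subrr.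
have [z|z] := xi23 dx x2 x3; move/eqP: z; rewrite sq_eq0 => /andP[/eqP z0 /eqP z1].
- split; apply: (@invariant_axis (three 1 0 0)) => //; apply: R6P; apply: I3P;
    rewrite /LieDerivatives.frame /torus_gen !(mxE, pair_mx0, pair_mx1, threeE) /= ?z0 ?z1; ring.
- split; apply: (@invariant_axis (three 0 1 0)) => //; apply: R6P; apply: I3P;
    rewrite /LieDerivatives.frame /torus_gen !(mxE, pair_mx0, pair_mx1, threeE) /= ?z0 ?z1; ring.
Qed.

End Unobstructed.
End ContactSplitting.
Import ContactSplitting.

(** * The diophantine case *)

Module DiophantineCase.
Section Diophantine.
Context {R : realType}.
Variable alpha : R.
Hypothesis alpha_gt1 : 1 < alpha.
Let alpha_gt0 : 0 < alpha := lt_trans ltr01 alpha_gt1.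
Implicit Types (x y u v w : R6 R).

Local Notation frame := (frame alpha).
Local Notation dom := (dom alpha).
Local Notation X1 := (X1 alpha).
Local Notation xi := (xi alpha).
Local Notation fcomp := (fcomp alpha).
Local Notation dfr := (dfr alpha).
Local Notation form := (form alpha).
Local Notation lam := (coef alpha lamf).
Local Notation L i f x := (lie (frame i) f x).
Local Notation R1 := (torus_gen (three (1 : R) 0 0)).
Local Notation R2 := (torus_gen (three (0 : R) 1 0)).

Lemma lam4 x : lam 4%N x = 0.
Proof. 
by rewrite /coef /ev sum3 !sum2 /lamf /LieDerivatives.frame /torus_gen !(pair_mx0, pair_mx1, threeE); ring.
Qed.

Lemma lam_X1 x : ev lamf x (X1 x) = Nf alpha x / 2.
Proof.
by rewrite /ev sum3 !sum2 /lamf /Coframes.X1 /torus_gen !(pair_mx0, pair_mx1, threeE) /Nf /sq; field.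
Qed.

Lemma lam_xi x : dom x -> xi 1 x * lam 1%N x + xi 2 x * lam 2%N x + xi 3 x * lam 3%N x = Nf alpha x / 2.
Proof.
move=> dx; rewrite -lam_X1 evE (X1_decomp alpha_gt0 dx) -[xi 3 x *: _]addr0 -!addrA.
rewrite !pairing_linr (_ : pairing _ 0 = 0) ?addr0//.
by rewrite /pairing !sum3 !sum2 !mxE; ring.
Qed.

(* f0 times the contact form plus g1 times d theta_3 plus dh *)
Definition solved_form (f0 g1 h : R6 R -> R) (i : nat) x : R :=
  4 * f0 x * lam i x + (i == 4%N)%:R * g1 x + L i h x.

Lemma dfr_solved f0 g1 h i j x : smooth_on dom f0 -> smooth_on dom g1 -> smooth_on dom h -> dom x ->
  (0 < i <= 4)%N -> (0 < j <= 4)%N ->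
  dfr (solved_form f0 g1 h) i j x =
  4 * (L i f0 x * lam j x - L j f0 x * lam i x + f0 x * dfr lam i j x)
  + ((j == 4%N)%:R * L i g1 x - (i == 4%N)%:R * L j g1 x).
Proof.
move=> sf sg sh dx hi hj; have od : open dom by exact: dom_open.
have slam := lam_smooth alpha od.
have df (f : R6 R -> R) : smooth_on dom f -> differentiable f x by move=> s; exact: smooth_on_diff s dx.
have E k l : L k (solved_form f0 g1 h l) x = 4 * (f0 x * L k (lam l) x + lam l x * L k f0 x)
    + (l == 4%N)%:R * L k g1 x + L k (fun y => L l h y) x.
  have s1 : smooth_on dom (fun y => 4 * f0 y) by apply: smooth_onM => //; exact: smooth_on_cst.
  have s2 : smooth_on dom (fun y => 4 * f0 y * lam l y) by apply: smooth_onM => //; exact: slam.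
  have s3 : smooth_on dom (fun y => (l == 4%N)%:R * g1 y) by apply: smooth_onM => //; exact: smooth_on_cst.
  have s4 : smooth_on dom (fun y => 4 * f0 y * lam l y + (l == 4%N)%:R * g1 y) by exact: smooth_onD.
  have s5 : smooth_on dom (fun y => L l h y) by apply: lie_smooth => //; exact: frame_lin.
  rewrite /solved_form (lieD _ (df _ s4) (df _ s5)) (lieD _ (df _ s2) (df _ s3)).
  rewrite (lieM _ (df _ s1) (df _ (slam l))) (lieZ _ _ (df _ sf)) (lieZ _ _ (df _ sg)).
  by congr (_ + _ + _); move: (L k (lam l) x) (L k f0 x) => a b; ring.
have C := frame_comm alpha od hi hj sh dx.
have ST : structure alpha i j (solved_form f0 g1 h) x =
   4 * f0 x * structure alpha i j lam x + structure alpha i j (fun k y => L k h y) x.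
  by move: hi hj; case: i {C} => [|[|[|[|[|i]]]]] // _; case: j => [|[|[|[|[|j]]]]] // _;
    rewrite /structure /solved_form /=; ring.
rewrite {1}/FrameForms.dfr !E ST -C /FrameForms.dfr.
move: (L i (fun y => L j h y) x) (L j (fun y => L i h y) x) (structure alpha i j lam x) => a b c.
move: (L i (lam j) x) (L j (lam i) x) (L i f0 x) (L j f0 x) (L i g1 x) (L j g1 x) => d e f g k l.
ring.
Qed.

Variable G : R6 R -> set (R6 R).
Hypothesis hG : smooth_complement (Y alpha) G.

(** X1 and [frame 4] are commuting linear fields, so leafwise closedness is the equality of two
    cross derivatives; [rho_pullback] carries it to [dom]. *)
Lemma closed_on_torus (Gamma1 : R6 R -> R6 R) : infinitesimal_deformation (Y alpha) Gamma1 ->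
  let f x := ev Gamma1 (rho alpha x) (X1 (rho alpha x)) in
  let g x := ev Gamma1 (rho alpha x) (frame 4 (rho alpha x)) in
  [/\ smooth_on dom f, smooth_on dom g & forall x, dom x -> lie X1 g x = L 4 f x].
Proof.
move=> [[U [oU YU sG]] cl] f g.
have evs (Z : R6 R -> R6 R) : linear Z -> smooth_on U (fun y => ev Gamma1 y (Z y)).
  move=> lZ; apply: smooth_on_sum => // l _; apply: smooth_on_sum => // k _.
  apply: smooth_onM => //; first exact: smooth_on_entry.
  by apply: smooth_on_entry => //; exact: lin_field_smooth.
have lX := @X1_lin _ alpha; have l4 := @frame_lin _ alpha 4.
have [sf lf] := rho_pullback oU YU (evs _ lX); have [sg lg] := rho_pullback oU YU (evs _ l4).
split => // x dx; have Yr := rho_Y dx; have Ur := YU _ Yr.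
have sec (Z : R6 R -> R6 R) : linear Z -> (forall y, exists a b : R, Z y = a *: X1 y + b *: frame 4 y) ->
    section_of (Y alpha) (null_tangent (Y alpha)) Z.
  move=> lZ hZ; split; first by exists setT; split => //; [exact: openT|apply: lin_field_smooth => //; exact: openT].
  by move=> y Yy; apply/(null_tangentP alpha_gt0 _ Yy).
have sX : section_of (Y alpha) (null_tangent (Y alpha)) X1.
  by apply: sec => // y; exists 1, 0; rewrite scale1r scale0r addr0.
have s4 : section_of (Y alpha) (null_tangent (Y alpha)) (frame 4).
  by apply: sec => // y; exists 0, 1; rewrite scale1r scale0r add0r.
have := cl _ _ sX s4 _ Yr; rewrite /dF /bracket.
have -> : 'D_(X1 (rho alpha x)) (frame 4) (rho alpha x) - 'D_(frame 4 (rho alpha x)) X1 (rho alpha x) = 0.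
  rewrite !derive_lin_field//; apply: R6P; apply: I3P;
    rewrite /Coframes.X1 /LieDerivatives.frame /torus_gen !(mxE, pair_mx0, pair_mx1, threeE) /=; ring.
have -> : ev Gamma1 (rho alpha x) 0 = 0 by rewrite evE /pairing !sum3 !sum2 !mxE; ring.
rewrite subr0 => /eqP; rewrite subr_eq0 => /eqP e.
have eX : lie X1 g x = lie X1 (fun y => ev Gamma1 y (frame 4 y)) (rho alpha x) by exact: lg.
have e4 : L 4 f x = L 4 (fun y => ev Gamma1 y (X1 y)) (rho alpha x) by exact: lf.
by rewrite eX e4 /lie e.
Qed.

Theorem unobstructed_diophantine : diophantine alpha -> unobstructed (Y alpha) G.
Proof.
move=> dio Gamma1 inf; have od : open dom by exact: dom_open.
have [sf sg cl] := closed_on_torus inf.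
set f := (fun x => ev Gamma1 (rho alpha x) (X1 (rho alpha x))) in sf cl.
set g := (fun x => ev Gamma1 (rho alpha x) (frame 4 (rho alpha x))) in sg cl.
have [h [f0 [sh sf0 Xh R1f R2f]]] := cohomological_equation alpha_gt0 dio sf.
have l4 := @frame_lin _ alpha 4; have lX := @X1_lin _ alpha.
have sl k (u : R6 R -> R) : smooth_on dom u -> smooth_on dom (fun y => L k u y).
  by move=> su; apply: lie_smooth => //; exact: frame_lin.
have df (u : R6 R -> R) x : smooth_on dom u -> dom x -> differentiable u x by exact: smooth_on_diff.
pose g1 x := g x - L 4 h x.
have s4h := sl 4%N h sh; have sg1 : smooth_on dom g1 by exact: smooth_onB.
have com k (u : R6 R -> R) x : smooth_on dom u -> dom x -> lie (torus_gen k) (fun y => L 4 u y) x = L 4 (lie (torus_gen k) u) x.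
  move=> su dx; apply/eqP; rewrite -subr_eq0.
  have -> := lie_comm od dx (@torus_gen_lin _ k) l4 su.
  rewrite (_ : frame 4 (torus_gen k x) - torus_gen k (frame 4 x) = 0) ?dir0//; first exact: df.
  by apply: R6P; apply: I3P; rewrite /LieDerivatives.frame /torus_gen !(mxE, pair_mx0, pair_mx1, threeE) /=; ring.
have Xg1 x : dom x -> lie X1 g1 x = L 4 f0 x.
  move=> dx; have c := com (three 1 alpha 0) h x sh dx.
  rewrite /g1 (lieB _ (df _ _ sg dx) (df _ _ s4h dx)) (cl x dx).
  have -> : lie X1 (fun y => L 4 h y) x = L 4 (fun y => f y - f0 y) x.
    rewrite [LHS]c; apply: (lie_near_eq _ od dx) => y dy; exact: Xh.
  by rewrite (lieB _ (df _ _ sf dx) (df _ _ sf0 dx)) opprB addrC subrK.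
have lie_cst0 k (u : R6 R -> R) x : dom x -> (forall y, dom y -> u y = 0) -> L k u x = 0.
  by move=> dx u0; rewrite (lie_near_eq (frame k) od dx u0) /lie derive_cst.
(* By [Xg1] this torus-invariant function is a derivative along X1, so [flow_growth] makes it
   vanish. Then g1 is constant along X1, hence torus-invariant as well. *)
have L4f0 x : dom x -> L 4 f0 x = 0.
  move=> dx; apply: (@flow_growth _ alpha g1 (fun y => L 4 f0 y) x sg1 (sl 4%N f0 sf0) Xg1 _ _ dx) => y dy.
    by rewrite (com _ _ _ sf0 dy) (lie_cst0 _ _ _ dy R1f).
  by rewrite (com _ _ _ sf0 dy) (lie_cst0 _ _ _ dy R2f).
have fi x : dom x -> lie R1 g1 x = 0 /\ lie R2 g1 x = 0.
  move=> dx; apply: (flow_invariant alpha_gt0 dio sg1 _ dx) => y dy.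
  exact: etrans (Xg1 y dy) (L4f0 y dy).
have R1g x dx := (fi x dx).1; have R2g x dx := (fi x dx).2.
pose mu := solved_form f0 g1 h.
have L1 (u : R6 R -> R) x : smooth_on dom u -> (forall y, dom y -> lie R1 u y = 0) -> (forall y, dom y -> lie R2 u y = 0) -> 
    dom x -> L 1 u x = 0 /\ xi 2 x * L 2 u x + xi 3 x * L 3 u x = 0.
  move=> su u1 u2 dx; have du := df _ _ su dx.
  have h1 : L 1 u x = 0 by rewrite (lie_frame1 alpha du) (u1 x dx) (u2 x dx) addr0.
  split => //; have := lie_X1 alpha_gt1 dx du; rewrite h1 mulr0 add0r => <-.
  by rewrite [LHS](lieX_split alpha du) (u1 x dx) (u2 x dx) mulr0 addr0.
apply: (extends alpha_gt0 hG (mu0 := mu)).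
- by case: inf.
- move=> i; apply: smooth_onD => //; last exact: sl.
  apply: smooth_onD => //; apply: smooth_onM => //; try exact: smooth_on_cst.
    by apply: smooth_onM => //; exact: smooth_on_cst.
  exact: lam_smooth.
- move=> x v Yx nv; have [c [d ->]] := (null_tangentP alpha_gt0 _ Yx).1 nv.
  have dx := Y_dom Yx; have dh := df _ _ sh dx.
  rewrite ev_form !comp_lin2 comp4_X1 !comp_frame//= -/(xi 1 x) -/(xi 2 x) -/(xi 3 x).
  have -> : ev Gamma1 x (c *: X1 x + d *: frame 4 x) = c * f x + d * g x.
    rewrite /f /g rho_id// !evE pairing_linr -[d *: _]addr0 pairing_linr; congr (_ + _).
    by rewrite (_ : pairing _ 0 = 0) ?addr0// /pairing !sum3 !sum2 !mxE; ring.
  have ef : f x = f0 x + lie X1 h x by have e : lie X1 h x = f x - f0 x := Xh x dx; rewrite e addrC subrK.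
  have eg : g x = g1 x + L 4 h x by rewrite /g1 subrK.
  rewrite ef eg (lie_X1 alpha_gt1 dx dh) /mu /solved_form lam4 /=.
  (* On Y, lambda takes the value Nf/2 = 1/4 on X1; this explains the factor 4 in [solved_form]. *)
  have Nx : Nf alpha x = 2^-1 by have /YE[] := Yx.
  have := lam_xi dx; rewrite Nx.
  move: (lam 1%N x) (lam 2%N x) (lam 3%N x) (xi 1 x) (xi 2 x) (xi 3 x) (L 1 h x) (L 2 h x) (L 3 h x) (L 4 h x).
  move=> l1 l2 l3 a1 a2 a3 b1 b2 b3 b4 e.
  transitivity (c * (4 * f0 x * (a1 * l1 + a2 * l2 + a3 * l3) + (a1 * b1 + a2 * b2 + a3 * b3)) + d * (g1 x + b4)).
    ring.
  by rewrite e; field.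
- move=> x Yx; have dx := Y_dom Yx; have [t [e12 e13 e23 _ e4]] := dlam_eq alpha_gt0 dx.
  rewrite /pfd /pf /dfr_at !e4// e12 e13 e23 /mu !(dfr_solved sf0 sg1 sh dx)// !e4// lam4 (L4f0 x dx) /=.
  have [g0 g23] := L1 g1 x sg1 R1g R2g dx; rewrite g0; move: g23.
  move: (xi 1 x) (xi 2 x) (xi 3 x) (L 1 f0 x) (L 2 f0 x) (L 3 f0 x) (L 2 g1 x) (L 3 g1 x) (L 4 g1 x).
  move: (lam 1%N x) (lam 2%N x) (lam 3%N x) (f0 x) => l1 l2 l3 f' a1 a2 a3 p1 p2 p3 q2 q3 q4 e.
  transitivity (t * (a2 * q2 + a3 * q3)); first by ring.
  by rewrite e mulr0.
(* Up to a multiple of X1 g1 = 0, the square of d mu is the minor of the derivatives of f0 and g1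
   along [frame 2] and [frame 3]. *)
- move=> x Yx; have dx := Y_dom Yx; have [t [e12 e13 e23 _ e4]] := dlam_eq alpha_gt0 dx.
  rewrite /pfd /pf /dfr_at /mu !(dfr_solved sf0 sg1 sh dx)// !e4// e12 e13 e23 lam4 (L4f0 x dx) /=.
  have [g0 g23] := L1 g1 x sg1 R1g R2g dx; have [f00 f23] := L1 f0 x sf0 R1f R2f dx; rewrite g0 f00.
  have mi := invariant_minor alpha_gt1 sf0 sg1 dx R1f R2f R1g R2g; move: g23 mi.
  move: (xi 1 x) (xi 2 x) (xi 3 x) (L 2 f0 x) (L 3 f0 x) (L 2 g1 x) (L 3 g1 x) (L 4 g1 x).
  move: (lam 1%N x) (lam 2%N x) (lam 3%N x) (f0 x) => l1 l2 l3 f' a1 a2 a3 p2 p3 q2 q3 q4 e mi.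
  transitivity (- 8 * l1 * (p2 * q3 - p3 * q2) + 8 * f' * t * (a2 * q2 + a3 * q3)); first by ring.
  by rewrite e mi !mulr0 addr0.
Qed.

End Diophantine.
End DiophantineCase.
Import DiophantineCase.

(** * First-order deformations that test the obstruction *)

Module FirstOrderTerms.
Section ObstructionEquation.
Context {R : realType}.
Variable alpha : R.
Hypothesis alpha_gt1 : 1 < alpha.
Let alpha_gt0 : 0 < alpha := lt_trans ltr01 alpha_gt1.
Implicit Types (x y u v w : R6 R).

Local Notation frame := (frame alpha).
Local Notation dom := (dom alpha).
Local Notation X1 := (X1 alpha).
Local Notation xi := (xi alpha).
Local Notation fcomp := (fcomp alpha).
Local Notation dfr := (dfr alpha).
Local Notation form := (form alpha).
Local Notation lam := (coef alpha lamf).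
Local Notation ww := (ww alpha).
Local Notation pfd := (pfd alpha).
Local Notation L i f x := (lie (frame i) f x).
Local Notation R1 := (torus_gen (three (1 : R) 0 0)).
Local Notation R2 := (torus_gen (three (0 : R) 1 0)).

Lemma lie_vanish (U : set (R6 R)) (q : R6 R -> R) i x : Y alpha `<=` U -> smooth_on U q ->
  (forall y, Y alpha y -> q y = 0) -> Y alpha x -> L i q x = 0.
Proof.
move=> YU sq q0 Yx; apply: (@tangent_derive0 _ alpha _ x (frame i x)) => //.
  by apply/tangentP => //; exact: frame_tangential.
by apply: (smooth_on_diff sq); exact: YU.
Qed.

(** The frame is tangent to Y, so the derivative of a form there depends only on its components on
    Y. *)
Lemma dfr_eq_on (U : set (R6 R)) (b c : nat -> R6 R -> R) i j x : open U -> Y alpha `<=` U ->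
  smooth_coef U b -> smooth_coef U c ->
  (forall k y, (0 < k <= 4)%N -> Y alpha y -> b k y = c k y) -> Y alpha x ->
  (0 < i <= 4)%N -> (0 < j <= 4)%N -> dfr b i j x = dfr c i j x.
Proof.
move=> oU YU sb sc bc Yx hi hj.
have l k m : (0 < m <= 4)%N -> L k (b m) x = L k (c m) x.
  move=> hm; apply/eqP; rewrite -subr_eq0.
  have db : differentiable (b m) x by apply: (smooth_on_diff (sb m)); exact: YU.
  have dc : differentiable (c m) x by apply: (smooth_on_diff (sc m)); exact: YU.
  rewrite -(lieB _ db dc); apply/eqP; apply: (lie_vanish k YU) => //; first exact: smooth_onB.
  by move=> y Yy; rewrite bc// subrr.
rewrite /FrameForms.dfr (l i j hj) (l j i hi); congr (_ - _ - _).
by move: hi hj; case: i => [|[|[|[|[|//]]]]] // _; case: j => [|[|[|[|[|//]]]]] // _; rewrite /structure ?bc.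
Qed.

Lemma xi_frame4 i x (s : R) : (0 < i <= 3)%N -> dom x -> xi i (torus (fun l => s * three 0 0 1 l) x) = xi i x.
Proof.
move=> hi dx; have N0 : 0 < Nf alpha x by case: dx.
have NE : Nf alpha (torus (fun l => s * three 0 0 1 l) x) = Nf alpha x by rewrite /Nf !sq_torus.
case: i hi => [|[|[|[|i]]]] // _; rewrite /Coframes.xi ?comp1E ?comp2E ?NE// ?comp3E ?NE// /cr /Coframes.X1 /torus_gen /torus;
  by rewrite !(pair_mx0, pair_mx1, threeE) ?mulr0 ?cos0 ?sin0 ?mulr0 ?mulr1 ?addr0 ?subr0 ?add0r.
Qed.

Lemma lie4_xi i x : (0 < i <= 3)%N -> dom x -> L 4 (xi i) x = 0.
Proof.
move=> hi dx; apply: (invariant_lie0 _ dx) => [|s]; last exact: xi_frame4.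
by apply: xi_smooth => //; exact: dom_open.
Qed.

(** The kernel of d lambda is spanned by X1 and [frame 4], so d lambda /\ d c reads the single
    component d c (X1, frame 4). This is the leafwise differential of c, which is the linear part of
    the deformation equation. *)
Lemma pfd_lam (U : set (R6 R)) (c : nat -> R6 R -> R) x : open U -> U `<=` dom -> smooth_coef U c -> U x ->
  pfd lam c x = Nf alpha x * (lie X1 (c 4%N) x -
    L 4 (fun y => xi 1 y * c 1%N y + xi 2 y * c 2%N y + xi 3 y * c 3%N y) x).
Proof.
move=> oU Ud sc Ux; have dx := Ud _ Ux; have [t [e12 e13 e23 et e4]] := dlam_eq alpha_gt0 dx.
have N0 : 0 < Nf alpha x by case: dx.
have tN : t = Nf alpha x.
  have w0 := ww_gt0 alpha_gt0 dx; move: et; rewrite xi1E => et.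
  apply: (mulfI (lt0r_neq0 w0)); rewrite -{2}et.
  by move: (ww x) (Nf alpha x) N0 => a b b0; field; rewrite gt_eqF.
have dc k : differentiable (c k) x by exact: smooth_on_diff (sc k) Ux.
have dxi k : (0 < k <= 3)%N -> differentiable (xi k) x.
  by move=> hk; apply: (@smooth_on_diff _ _ _ dom) => //; apply: xi_smooth => //; exact: dom_open.
have dm k : (0 < k <= 3)%N -> differentiable (fun y => xi k y * c k y) x.
  by move=> hk; apply: differentiableM; [exact: dxi|exact: dc].
rewrite (lie_X1 alpha_gt1 dx (dc 4%N)).
rewrite (lieD _ (differentiableD (dm 1%N isT) (dm 2%N isT)) (dm 3%N isT)) (lieD _ (dm 1%N isT) (dm 2%N isT)).
rewrite (lieM _ (dxi 1%N isT) (dc 1%N)) (lieM _ (dxi 2%N isT) (dc 2%N)) (lieM _ (dxi 3%N isT) (dc 3%N)).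
rewrite !lie4_xi// /GaugeRecursion.pfd /pf /dfr_at !e4// e12 e13 e23 -tN /FrameForms.dfr /structure.
move: (L 1 (c 4%N) x) (L 2 (c 4%N) x) (L 3 (c 4%N) x) (L 4 (c 1%N) x) (L 4 (c 2%N) x) (L 4 (c 3%N) x) => a1 a2 a3 b1 b2 b3.
by rewrite !mul0r !mulr0 !subr0 !addr0; ring.
Qed.

Definition half_sq x : R := 2^-1 * sq x 0.

Lemma half_sq_smooth (U : set (R6 R)) : open U -> smooth_on U half_sq.
Proof. by move=> oU; apply: smooth_onM => //; [exact: smooth_on_cst|exact: sq_smooth]. Qed.

Lemma lie_half_sq (F : R6 R -> R6 R) x : lie F half_sq x = dt x (F x) 0.
Proof.
have [d e] := sq_derive x (F x) 0.
by rewrite /half_sq (lieZ _ _ d) /lie e mulrA mulVf ?mul1r.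
Qed.

(** The form 4 f lambda + (r_1^2 / 2) d theta_3. For f independent of theta_3 it is leafwise closed,
    and the square of its differential is a multiple of df /\ lambda /\ d (r_1^2) /\ d theta_3. *)
Definition first_order (f : R6 R -> R) : nat -> R6 R -> R := solved_form alpha f half_sq (fun=> 0).

Lemma first_order_smooth f : smooth_on dom f -> smooth_coef dom (first_order f).
Proof.
move=> sf i; have od : open dom by exact: dom_open.
apply: smooth_onD => //; last by apply: lie_smooth => //; [exact: frame_lin|exact: smooth_on_cst].
apply: smooth_onD => //; apply: smooth_onM => //; try exact: smooth_on_cst; try exact: half_sq_smooth.
  by apply: smooth_onM => //; exact: smooth_on_cst.
exact: lam_smooth.
Qed.

Section FirstOrder.
Variable f : R6 R -> R.
Hypothesis sf : smooth_on dom f.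
Hypothesis f4 : forall x, dom x -> L 4 f x = 0.
Local Notation beta := (first_order f).

Lemma dfr_first_order i j x : dom x -> (0 < i <= 4)%N -> (0 < j <= 4)%N -> dfr beta i j x =
  4 * (L i f x * lam j x - L j f x * lam i x + f x * dfr lam i j x)
  + ((j == 4%N)%:R * dt x (frame i x) 0 - (i == 4%N)%:R * dt x (frame j x) 0).
Proof.
move=> dx hi hj; have od : open dom by exact: dom_open.
have s0 : smooth_on dom (fun _ : R6 R => 0 : R) := smooth_on_cst _ _.
have h := dfr_solved sf (half_sq_smooth od) s0 dx hi hj.
by rewrite [LHS]h !lie_half_sq.
Qed.

Lemma first_order_null x : dom x ->
  xi 1 x * dfr beta 1 4 x + xi 2 x * dfr beta 2 4 x + xi 3 x * dfr beta 3 4 x = 0.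
Proof.
move=> dx; have [t [_ _ _ _ e4]] := dlam_eq alpha_gt0 dx.
rewrite !dfr_first_order// !e4// lam4 (f4 dx) /=.
have -> : dt x (frame 1 x) 0 = 0.
  by rewrite /dt /LieDerivatives.frame /torus_gen !(pair_mx0, pair_mx1, threeE); ring.
have [N0 _] := dx; rewrite /Coframes.xi comp2E// comp3E// /Coframes.X1 /LieDerivatives.frame /torus_gen /dt !(pair_mx0, pair_mx1, threeE).
by move: (fcomp 1 x _) (L 1 f x) (L 2 f x) (L 3 f x) => *; field; rewrite gt_eqF.
Qed.

Lemma first_order_pfd_lam x : dom x -> pfd lam beta x = 0.
Proof.
move=> dx; have [t [e12 e13 e23 et e4]] := dlam_eq alpha_gt0 dx.
have := first_order_null dx; rewrite /GaugeRecursion.pfd /pf /dfr_at !e4// e12 e13 e23.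
move: (dfr beta) => B h; transitivity (t * (xi 1 x * B 1%N 4%N x + xi 2 x * B 2%N 4%N x + xi 3 x * B 3%N 4%N x)).
  by ring.
by rewrite h mulr0.
Qed.

(** In df /\ lambda /\ d (r_1^2) /\ d theta_3 only the derivatives of f in theta_1 and theta_2
    survive, and lambda = (r_1^2 d theta_1 + r_2^2 d theta_2) / 2 combines them with the weights
    r_2^2 and - r_1^2. *)
Lemma first_order_pfd x : dom x ->
  pfd beta beta x = 4 * alpha * Nf alpha x * (sq x 1 * lie R1 f x - sq x 0 * lie R2 f x).
Proof.
move=> dx; have df : differentiable f x by exact: smooth_on_diff sf dx.
have [t [_ _ _ _ e4]] := dlam_eq alpha_gt0 dx.
have h1 := lie_frame1 alpha df.
(* The field on the left is orthogonal to [frame 1] for the metric behind [weight], hence a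
   combination of [frame 2] and [frame 3]. *)
have h2 : alpha * sq x 1 * lie R1 f x - sq x 0 * lie R2 f x =
   (x 0 0 * x 1 1 + x 0 1 * x 1 0) * L 2 f x - (x 0 0 * x 1 0 - x 0 1 * x 1 1) * L 3 f x.
  have dB (k l : R) u v : k * 'D_u f x - l * 'D_v f x = 'D_(k *: u + ((- l) *: v + 0)) f x.
    by rewrite !(dirlin _ _ _ df) (dir0 df) addr0 mulNr.
  rewrite /lie !dB.
  congr ('D_ _ f x); apply: R6P; apply: I3P;
    rewrite /LieDerivatives.frame /torus_gen !(mxE, pair_mx0, pair_mx1, threeE) /= /sq; ring.
rewrite /GaugeRecursion.pfd /pf /dfr_at !dfr_first_order// !e4// !lam4 (f4 dx) h1 !dlamf//.
rewrite !omega0E /coef /ev !sum3 !sum2 /lamf /cr /dt /LieDerivatives.frame /torus_gen !(pair_mx0, pair_mx1, threeE) /=.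
move: h2; rewrite /Nf /sq.
move: (L 2 f x) (L 3 f x) (lie R1 f x) (lie R2 f x) (f x) => p2 p3 q1 q2 f0.
move: (x 0 0) (x 0 1) (x 1 0) (x 1 1) => a b c d h2.
transitivity (8 * ((q1 + q2) * (- (alpha * (alpha - 1) / 2) * (a ^+ 2 + b ^+ 2) * (c ^+ 2 + d ^+ 2)) +
  (a ^+ 2 + b ^+ 2 + (c ^+ 2 + d ^+ 2)) / 2 * alpha * ((a * d + b * c) * p2 - (a * c - b * d) * p3))).
  by field.
by rewrite -h2; field.
Qed.

End FirstOrder.

End ObstructionEquation.
End FirstOrderTerms.
Import FirstOrderTerms.

(** * The second-order equation *)

Module SecondOrder.
Section Obstruction.
Context {R : realType}.
Variable alpha : R.
Hypothesis alpha_gt1 : 1 < alpha.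
Let alpha_gt0 : 0 < alpha := lt_trans ltr01 alpha_gt1.
Implicit Types (x y u v w : R6 R).

Local Notation frame := (frame alpha).
Local Notation dom := (dom alpha).
Local Notation X1 := (X1 alpha).
Local Notation xi := (xi alpha).
Local Notation fcomp := (fcomp alpha).
Local Notation dfr := (dfr alpha).
Local Notation form := (form alpha).
Local Notation coef := (coef alpha).
Local Notation lam := (coef lamf).
Local Notation ww := (ww alpha).
Local Notation pfd := (pfd alpha).
Local Notation L i f x := (lie (frame i) f x).
Local Notation R1 := (torus_gen (three (1 : R) 0 0)).
Local Notation R2 := (torus_gen (three (0 : R) 1 0)).

Variable G : R6 R -> set (R6 R).
Variable f : R6 R -> R.
Hypothesis sf : smooth_on dom f.
Hypothesis f4 : forall x, dom x -> L 4 f x = 0.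
Local Notation beta := (first_order alpha f).

Lemma first_order_infinitesimal : infinitesimal_deformation (Y alpha) (form beta).
Proof.
have od : open dom by exact: dom_open.
have sb := first_order_smooth sf.
have sF : smooth_on dom (form beta) by exact: form_smooth.
split; first by exists dom; split => // x /Y_dom.
move=> X Z [[U [oU YU sX]] X0] [[V [oV YV sZ]] Z0] x Yx; have dx := Y_dom Yx.
have dF : differentiable (form beta) x by exact: smooth_on_diff sF dx.
rewrite dF_dext//; [|exact: smooth_on_diff sX (YU _ Yx)|exact: smooth_on_diff sZ (YV _ Yx)].
have [a [b ->]] := (null_tangentP alpha_gt0 _ Yx).1 (X0 _ Yx).
have [c [d ->]] := (null_tangentP alpha_gt0 _ Yx).1 (Z0 _ Yx).
have [B1 B2] := dext_bialt dF; have BE := @bialt_expand _ alpha _ x (frame 4 x) _ _ _ _ (dext_bialt dF).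
have fr k : (0 < k <= 4)%N -> dext (form beta) x (frame k x) (frame 4 x) = dfr beta k 4 x.
  move=> hk; rewrite dext_frame//.
  rewrite (@dfr_near_eq _ alpha (coef (form beta)) beta dom k 4 x od dx)//.
  by move=> m y hm dy; exact: coef_form.
have BX : dext (form beta) x (X1 x) (frame 4 x) = 0.
  rewrite (X1_decomp alpha_gt0 dx) -[X in dext _ x X]addr0 -[X in _ + X](scale0r (frame 4 x)) BE !fr// mul0r addr0.
  exact: (first_order_null alpha_gt1 sf f4 dx).
move: (dext (form beta) x) B1 B2 BX => B B1 B2 BX.
have B0 u : B 0 u = 0 by have := B1 (-1) 0 0 u; rewrite scaler0 addr0; lra.
have Bs k u u' : B (k *: u) u' = k * B u u' by rewrite -[k *: u]addr0 B1 B0 addr0.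
have Bd u : B u u = 0 by have := B2 u u; lra.
rewrite B1 Bs (B2 (X1 x) (_ + _)) (B2 (frame 4 x) (_ + _)) !B1 !Bs !Bd (B2 (frame 4 x) (X1 x)) BX; ring.
Qed.

(** At order 2, d e1 /\ d e1 = 2 d lambda /\ d e2, where e1 extends the leafwise form by zero on G.
    As e1 = beta - i_W d lambda on Y for some W, [pf_lie] transforms this into d beta /\ d beta = 2
    d lambda /\ d zeta, without G, and [pfd_lam] evaluates the right side. *)
Lemma obstruction_equation : unobstructed (Y alpha) G ->
  exists z y : R6 R -> R, [/\ smooth_on dom z, smooth_on dom y &
    forall x, Y alpha x -> lie X1 z x - L 4 y x =
      2 * alpha * (sq x 1 * lie R1 f x - sq x 0 * lie R2 f x)].
Proof.
move=> unob; have od : open dom by exact: dom_open.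
have [Gamma [G1 _ [eta [ext eqn]]]] := unob _ first_order_infinitesimal.
have [[U1 [oU1 YU1 s1]] e1P] := ext 1%N isT; have [[U2 [oU2 YU2 s2]] _] := ext 2%N isT.
pose U := U1 `&` U2 `&` dom.
have oU : open U by apply: openI => //; exact: openI.
have YU : Y alpha `<=` U by move=> x Yx; split; [split; [exact: YU1|exact: YU2]|exact: Y_dom].
have Ud : U `<=` dom by move=> x [].
have sU (V W : normedModType R) (A : set V) (B : set V) (g : V -> W) : (A `<=` B) -> smooth_on B g -> smooth_on A g.
  by move=> AB; exact: smooth_onW.
have sb i : smooth_on U (beta i) by apply: smooth_onW Ud _; exact: first_order_smooth.
have slam : smooth_coef U lam by exact: lam_smooth.
have se1 : smooth_coef U (coef (eta 1%N)) by apply: coef_smooth => //; apply: smooth_onW s1 => x [[]].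
have se2 : smooth_coef U (coef (eta 2%N)) by apply: coef_smooth => //; apply: smooth_onW s2 => x [[]].
pose e1 := coef (eta 1%N); pose e2 := coef (eta 2%N).
have quad x : Y alpha x -> pfd e1 e1 x = 2 * pfd lam e2 x.
  move=> Yx; have tf i : tangent (Y alpha) x (frame i x) by apply/tangentP => //; exact: frame_tangential.
  have := eqn 2%N x Yx _ _ _ _ (tf 1%N) (tf 2%N) (tf 3%N) (tf 4%N).
  have d1 : differentiable (eta 1%N) x by apply: (smooth_on_diff s1); exact: YU1.
  have d2 : differentiable (eta 2%N) x by apply: (smooth_on_diff s2); exact: YU2.
  have D1 k l : (0 < k <= 4)%N -> (0 < l <= 4)%N -> dext (eta 1%N) x (frame k x) (frame l x) = dfr e1 k l x.
    by move=> hk hl; exact: dext_frame.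
  have D2 k l : (0 < k <= 4)%N -> (0 < l <= 4)%N -> dext (eta 2%N) x (frame k x) (frame l x) = dfr e2 k l x.
    by move=> hk hl; exact: dext_frame.
  have DL k l : (0 < k <= 4)%N -> (0 < l <= 4)%N -> omega0 (frame k x) (frame l x) = dfr lam k l x.
    by move=> hk hl; rewrite dlamf.
  pose n1 u v := - dext (eta 1%N) x u v; pose n2 u v := - dext (eta 2%N) x u v.
  have -> : \sum_(i < 3) wedge22 (deformed_coef eta i x) (deformed_coef eta (2 - i) x)
       (frame 1 x) (frame 2 x) (frame 3 x) (frame 4 x) =
     wedge22 (@omega0 R) n2 (frame 1 x) (frame 2 x) (frame 3 x) (frame 4 x) +
     wedge22 n1 n1 (frame 1 x) (frame 2 x) (frame 3 x) (frame 4 x) +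
     wedge22 n2 (@omega0 R) (frame 1 x) (frame 2 x) (frame 3 x) (frame 4 x) by rewrite sum3.
  rewrite /wedge22 /n1 /n2 !D1// !D2// !DL//.
  rewrite /GaugeRecursion.pfd /pf /dfr_at -/e1 -/e2.
  move: (dfr e1) (dfr e2) (dfr lam) => B C D; lra.
have agree x : Y alpha x -> e1 4%N x = beta 4%N x /\
    xi 1 x * e1 1%N x + xi 2 x * e1 2%N x + xi 3 x * e1 3%N x =
    xi 1 x * beta 1%N x + xi 2 x * beta 2%N x + xi 3 x * beta 3%N x.
  move=> Yx; have dx := Y_dom Yx; have [h _] := e1P x Yx.
  have n4 : null_tangent (Y alpha) x (frame 4 x).
    by apply/(null_tangentP alpha_gt0 _ Yx); exists 0, 1; rewrite scale0r scale1r add0r.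
  have nX : null_tangent (Y alpha) x (X1 x).
    by apply/(null_tangentP alpha_gt0 _ Yx); exists 1, 0; rewrite scale0r scale1r addr0.
  have evX a : ev a x (X1 x) = xi 1 x * coef a 1 x + xi 2 x * coef a 2 x + xi 3 x * coef a 3 x.
    rewrite {1}evE (X1_decomp alpha_gt0 dx) -[xi 3 x *: _]addr0 -!addrA !pairing_linr.
    by rewrite (_ : pairing _ 0 = 0) ?addr0// /pairing !sum3 !sum2 !mxE; ring.
  have h4 := h _ n4; have hX := h _ nX; rewrite G1 in h4 hX; split.
    have c4 : coef (form beta) 4 x = beta 4%N x by exact: coef_form.
    by rewrite -c4; exact: h4.
  by rewrite -evX hX evX !coef_form.
pose del i x := beta i x - e1 i x.
have sdel i : smooth_on U (del i) by apply: smooth_onB => //; exact: se1.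
(* The solution of i_W omega = beta - e1 in the span of [frame 2] and [frame 3]; it exists because
   the right side vanishes on null vectors. *)
pose W i x : R := match i with 2%N => del 3%N x / ww x | 3%N => - (del 2%N x / ww x) | _ => 0 end.
have sV : smooth_on U (fun x => (ww x)^-1).
  by apply: smooth_onV => //; [move=> x /Ud dx; rewrite gt_eqF// ww_gt0|exact: ww_smooth].
have sW : smooth_coef U W.
  case=> [|[|[|[|i]]]]; try exact: smooth_on_cst; first exact: smooth_onM.
  by apply: smooth_onN => //; exact: smooth_onM.
pose iW := iprod W (dfr lam); pose iB := iprod W (dfr beta); pose iI := iprod W (dfr iW).
have si b : smooth_coef U b -> smooth_coef U (iprod W (dfr b)).
  by move=> sb' i; apply: iprod_smooth => // l; exact: dfr_smooth.
have siW := si _ slam; have siB := si _ sb; have siI := si _ siW.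
pose fam (l : bool) := if l then beta else iW.
pose e' i x := \sum_(l <- [:: true; false]) (if l then 1 else -1) * fam l i x.
have e'E i x : e' i x = beta i x - iW i x by rewrite /e' !big_cons big_nil /=; ring.
have se' : smooth_coef U e'.
  by move=> i; rewrite (funext (e'E i)); apply: smooth_onB => //; exact: siW.
have dU (g : R6 R -> R) x : smooth_on U g -> U x -> differentiable g x by exact: smooth_on_diff.
have ee i j x : Y alpha x -> (0 < i <= 4)%N -> (0 < j <= 4)%N -> dfr e1 i j x = dfr beta i j x - dfr iW i j x.
  move=> Yx hi hj; have Ux := YU x Yx.
  rewrite (dfr_eq_on oU YU se1 se' _ Yx hi hj).
    rewrite (@dfr_lincomb _ alpha bool); first by rewrite !big_cons big_nil /=; ring.
    by move=> l m; apply: dU => //; case: l; [exact: sb|exact: siW].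
  move=> k y hk Yy; have dy := Y_dom Yy; rewrite e'E.
  have [t [e12 e13 e23 et e4]] := dlam_eq alpha_gt0 dy; have [a4 aX] := agree y Yy.
  have an a b : (0 < a <= 4)%N -> (0 < b <= 4)%N -> dfr lam a b y = - dfr lam b a y by exact: dfr_anti.
  have d0 a : (0 < a <= 4)%N -> dfr lam a a y = 0 by move=> ha; have := an _ _ ha ha; lra.
  have w0 := lt0r_neq0 (ww_gt0 alpha_gt0 dy).
  suff : iW k y = del k y by rewrite /del => ->; rewrite opprB addrC subrK.
  have D : xi 1 y * del 1%N y = - (xi 2 y * del 2%N y + xi 3 y * del 3%N y).
    by move: aX; rewrite /del !mulrBr; lra.
  have D4 : del 4%N y = 0 by rewrite /del a4 subrr.
  rewrite -et in w0; have [x10 t0] : xi 1 y != 0 /\ t != 0.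
    by move: w0; rewrite mulf_eq0 negb_or => /andP[].
  have D1 : del 1%N y = - (xi 2 y * del 2%N y + xi 3 y * del 3%N y) / xi 1 y by rewrite -D mulrC mulKf.
  rewrite /iW /iprod /W -et; move: hk D1; case: k => [|[|[|[|[|k]]]]] // _ D1.
  - rewrite (an 2 1)%N// (an 3 1)%N// e12 e13 D1; move: (del _ _) (del _ _) => p q; field; exact/andP.
  - by rewrite (an 3 2)%N// d0// e23; move: (del _ _) (del _ _) => p q; field; exact/andP.
  - by rewrite d0// e23; move: (del _ _) (del _ _) => p q; field; exact/andP.
  - by rewrite !e4// D4; ring.
have div0 q x : smooth_on U q -> (forall y, Y alpha y -> q y = 0) -> Y alpha x -> divergence alpha W q x = 0.
  move=> sq0 q0 Yx.
  have l i : L i (fun y => W i y * q y) x = 0.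
    apply: (lie_vanish i YU _ _ Yx); first by apply: smooth_onM => //; exact: sW.
    by move=> y Yy; rewrite q0// mulr0.
  by rewrite /divergence !l !addr0.
have plam x : U x -> pfd lam lam x = 0.
  move=> /Ud dx; have [t [_ _ _ _ e4]] := dlam_eq alpha_gt0 dx.
  by rewrite /GaugeRecursion.pfd /pf /dfr_at !e4//; ring.
have spf b c : smooth_coef U b -> smooth_coef U c -> smooth_on U (pfd b c) by move=> *; exact: pf_smooth.
have LL x : Y alpha x -> pfd lam iW x = 0.
  move=> Yx; have := pf_lie alpha oU slam slam sW (YU _ Yx).
  have := @div0 (pfd lam lam) x (spf _ _ slam slam) (fun y Yy => plam y (YU _ Yy)) Yx.
  rewrite /divergence => -> h; have : pfd iW lam x + pfd lam iW x = 0 by exact: h.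
  by rewrite pfdC; lra.
have LB x : Y alpha x -> pfd iW beta x = - pfd lam iB x.
  move=> Yx; have := pf_lie alpha oU slam sb sW (YU _ Yx).
  have := @div0 (pfd lam beta) x (spf _ _ slam sb) (fun y Yy => first_order_pfd_lam alpha_gt1 sf f4 (Y_dom Yy)) Yx.
  rewrite /divergence => -> h; have : pfd iW beta x + pfd lam iB x = 0 by exact: h.
  by lra.
have LI x : Y alpha x -> pfd iW iW x = - pfd lam iI x.
  move=> Yx; have := pf_lie alpha oU slam siW sW (YU _ Yx).
  have := @div0 (pfd lam iW) x (spf _ _ slam siW) LL Yx.
  rewrite /divergence => -> h; have : pfd iW iW x + pfd lam iI x = 0 by exact: h.
  by lra.
pose s' : seq (option bool) := [:: None; Some true; Some false].
pose fam' (l : option bool) := if l is Some b then (if b then iB else iI) else e2.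
pose wt (l : option bool) : R := if l is Some b then (if b then -1 else 2^-1) else 1.
(* zeta = e2 - i_W d beta + (1/2) i_W d (i_W d lambda), which collects the terms that [LB] and [LI]
   turn into products with d lambda. *)
pose zeta i x := \sum_(l <- s') wt l * fam' l i x.
have zE i x : zeta i x = e2 i x - iB i x + 2^-1 * iI i x by rewrite /zeta /s' !big_cons big_nil /=; ring.
have sz : smooth_coef U zeta.
  move=> i; rewrite (funext (zE i)); apply: smooth_onD => //; first by exact: smooth_onB (se2 i) (siB i).
  by apply: (smooth_onM oU (smooth_on_cst _ _) (siI i)).
have main x : Y alpha x -> pfd beta beta x = 2 * pfd lam zeta x.
  move=> Yx; have Ux := YU x Yx.
  have q1 := quad x Yx; have q2 := LB x Yx; have q3 := LI x Yx.
  have -> : pfd lam zeta x = pfd lam e2 x - pfd lam iB x + 2^-1 * pfd lam iI x.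
    rewrite pfdC (@pfd_linl _ alpha _ s' wt zeta fam' lam x).
      rewrite /s' !big_cons big_nil /= !(pfdC _ _ lam); ring.
    move=> i j hi hj; apply: (@dfr_lincomb _ alpha _ s' wt fam') => l m.
    by apply: dU => //; case: l => [[]|]; [exact: siB|exact: siI|exact: se2].
  have q4 : pfd e1 e1 x = pfd beta beta x - 2 * pfd iW beta x + pfd iW iW x.
    rewrite /GaugeRecursion.pfd /pf /dfr_at !ee//; move: (dfr beta) (dfr iW) => B C; ring.
  lra.
pose y0 x := xi 1 x * zeta 1%N x + xi 2 x * zeta 2%N x + xi 3 x * zeta 3%N x.
have sy0 : smooth_on U y0.
  have sm k : (0 < k <= 3)%N -> smooth_on U (fun y => xi k y * zeta k y).
    move=> hk; have sx : smooth_on U (xi k) by exact: xi_smooth.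
    by apply: smooth_onM; [exact: oU|exact: sx|exact: (sz k)].
  apply: smooth_onD; [exact: oU| |exact: (sm 3%N isT)].
  by apply: smooth_onD; [exact: oU|exact: (sm 1%N isT)|exact: (sm 2%N isT)].
have [sz4 lz4] := rho_pullback oU YU (sz 4%N); have [sy ly] := rho_pullback oU YU sy0.
exists (fun x => zeta 4%N (rho alpha x)), (fun x => y0 (rho alpha x)); split => // x Yx.
have dx := Y_dom Yx; have Ux := YU x Yx.
have h1 : lie X1 (fun x => zeta 4%N (rho alpha x)) x = lie X1 (zeta 4%N) (rho alpha x) by exact: lz4.
have h2 : L 4 (fun x => y0 (rho alpha x)) x = L 4 y0 (rho alpha x) by exact: ly.
have [Nx _] := proj1 (YE alpha x) Yx.
have := main x Yx; rewrite (first_order_pfd alpha_gt1 sf f4 dx) (pfd_lam alpha_gt1 oU Ud sz Ux) Nx.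
rewrite h1 h2 rho_id// -/y0.
move: (lie X1 _ x) (L 4 y0 x) (lie R1 f x) (lie R2 f x) (sq x 0) (sq x 1) => a b c d e g h.
by lra.
Qed.

End Obstruction.
End SecondOrder.
Import SecondOrder.

(** * Bounded primitives along the flow of X1 *)

Module BoundedPrimitives.
Section BoundedPrimitive.
Context {R : realType}.
Variable alpha : R.
Hypothesis alpha_gt1 : 1 < alpha.
Let alpha_gt0 : 0 < alpha := lt_trans ltr01 alpha_gt1.
Implicit Types (x y u v w : R6 R).

Local Notation frame := (frame alpha).
Local Notation dom := (dom alpha).
Local Notation X1 := (X1 alpha).
Local Notation L i f x := (lie (frame i) f x).
Local Notation orb k s x := (torus (fun i => s * k i) x).
Local Notation e1 := (three (1 : R) 0 0).
Local Notation e2 := (three (0 : R) 1 0).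
Local Notation e3 := (three (0 : R) 0 1).
Local Notation k1 := (three 1 alpha 0).
Local Notation R1 := (torus_gen e1).
Local Notation R2 := (torus_gen e2).

Lemma periodic_reduce (T : Type) (p : R -> T) : (forall s, p (s + 2 * pi) = p s) ->
  forall s, exists2 s', 0 <= s' <= 2 * pi & p s = p s'.
Proof.
move=> per s; have pi2 : 0 < 2 * pi :> R by rewrite mulr_gt0// pi_gt0.
have pn (n : nat) t : p (t + n%:R * (2 * pi)) = p t.
  elim: n t => [|n IH] t; first by rewrite mul0r addr0.
  by rewrite -natr1 mulrDl mul1r addrA per IH.
have pz (z : int) t : p (t + z%:~R * (2 * pi)) = p t.
  case: z => n; first exact: pn.
  by rewrite -(pn n.+1) NegzE intrN mulNr subrK.
pose z := Num.floor (s / (2 * pi)).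
have f1 : z%:~R <= s / (2 * pi) by exact: floor_le_tmp.
have f2 : s / (2 * pi) < z%:~R + 1 by have := floorD1_gt (s / (2 * pi)); rewrite intrD.
rewrite ler_pdivlMr// in f1; rewrite ltr_pdivrMr// mulrDl mul1r in f2.
exists (s - z%:~R * (2 * pi)); last by rewrite -(pz z (s - z%:~R * (2 * pi))) subrK.
by apply/andP; split; lra.
Qed.

Lemma torus2_bounded (F : R6 R -> R) x : smooth_on dom F -> dom x ->
  exists C : R, forall s t : R, `|F (orb e1 s (orb e2 t x))| <= C.
Proof.
move=> sF dx; pose A := `[0 : R, 2 * pi]%classic `*` `[0 : R, 2 * pi]%classic.
pose h (p : R * R) := `|F (orb e1 p.1 (orb e2 p.2 x))|.
have pi2 : 0 <= 2 * pi :> R by rewrite mulr_ge0// pi_ge0.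
have cA : compact A by apply: compact_setX; exact: segment_compact.
have ch : continuous h.
  move=> [s t]; apply: cvg_norm; apply: continuous_cvg.
    apply: (smooth_on_cts sF); apply: dom_orb; exact: dom_orb.
  have ca i : (fun p : R * R => p.1 * e1 i + p.2 * e2 i) @ nbhs (s, t) --> s * e1 i + t * e2 i.
    by apply: cvgD; apply: cvgMl; [exact: cvg_fst|exact: cvg_snd].
  have cs i : (fun p : R * R => sin (p.1 * e1 i + p.2 * e2 i)) @ nbhs (s, t) --> sin (s * e1 i + t * e2 i).
    by apply: (cvg_comp _ _ (ca i)); exact: continuous_sin.
  have cc i : (fun p : R * R => cos (p.1 * e1 i + p.2 * e2 i)) @ nbhs (s, t) --> cos (s * e1 i + t * e2 i).
    by apply: (cvg_comp _ _ (ca i)); exact: continuous_cos.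
  rewrite /= (_ : (fun p : R * R => _) = (fun p : R * R => torus (fun i => p.1 * e1 i + p.2 * e2 i) x)).
    rewrite torusD; apply: cvg_pair_mx => i.
      under eq_cvg => p do rewrite pair_mx0.
      by rewrite pair_mx0; apply: cvgB; apply: cvgMr; [exact: cc|exact: cs].
    under eq_cvg => p do rewrite pair_mx1.
    by rewrite pair_mx1; apply: cvgD; apply: cvgMr; [exact: cs|exact: cc].
  by apply/funext => p; rewrite torusD.
have A0 : A !=set0 by exists (0, 0); split; rewrite /= in_itv/= lexx.
have [c _ hc] := compact_EVT_max A0 cA (continuous_subspaceT ch).
exists (h c) => s t.
have [s' hs ->] := @periodic_reduce _ (fun s => F (orb e1 s (orb e2 t x))) (fun s => congr1 F (e1_period s _)) s.
have [t' ht ->] := @periodic_reduce _ (fun t => F (orb e1 s' (orb e2 t x))) (fun t => congr1 (fun y => F (orb e1 s' y)) (e2_period t _)) t.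
by apply: (hc (s', t')); rewrite inE; split; rewrite /= in_itv.
Qed.

Variable G : R6 R -> set (R6 R).

(** The integral of z over the theta_3 circle is the primitive: the term in y integrates to zero,
    the right side does not depend on theta_3, and the orbit of X1 stays in a 2-torus, where a
    continuous function is bounded. *)
Lemma bounded_primitive (f : R6 R -> R) x : smooth_on dom f -> (forall x, dom x -> L 4 f x = 0) ->
  unobstructed (Y alpha) G -> Y alpha x ->
  exists (V : R -> R) (C : R), (forall s, `|V s| <= C) /\
    forall s : R, is_derive s 1 V (sq x 1 * lie R1 f (orb k1 s x) - sq x 0 * lie R2 f (orb k1 s x)).
Proof.
move=> sf f4 unob Yx; have dx := Y_dom Yx; have od : open dom by exact: dom_open.
have [z [y [sz sy E]]] := obstruction_equation alpha_gt1 sf f4 unob.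
have cc : continuous (fun _ : R => 1 : R) by exact: cst_continuous.
pose A3 := avg e3 (fun=> 1) z.
have sA : smooth_on dom A3 by exact: avg_smooth.
have [C hC] := torus2_bounded sA dx.
(* 2 alpha comes from [obstruction_equation], 2 pi from [avg], which is not normalized. *)
pose c : R := (2 * alpha * (2 * pi))^-1.
exists (fun s => c * A3 (orb k1 s x)), (`|c| * C); split.
  move=> s; rewrite normrM ler_wpM2l//; have := hC s (s * alpha).
  by congr (`|A3 _| <= _); rewrite torusD; congr torus; apply/funext; apply: I3P; rewrite !threeE; ring.
move=> s; set p := orb k1 s x.
have YO k t q : Y alpha q -> Y alpha (orb k t q) by move=> /YE[a b]; apply/YE; rewrite /Nf !sq_torus.
have Yp : Y alpha p by exact: YO.
have dp := Y_dom Yp.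
have D := @is_deriveZ _ _ _ _ c s 1 _ (orbit_lie_derive k1 s sA dx).
apply: is_derive_eq D _; rewrite /GRing.scale/= -/p.
have -> : lie (torus_gen k1) A3 p = avg e3 (fun=> 1) (lie (torus_gen k1) z) p.
  by apply: (avg_lie _ sz dp) => // t q; exact: orb_gen.
have inv k t : lie (torus_gen k) f (orb e3 t p) = lie (torus_gen k) f p.
  apply: (lie0_invariant t (F := fun q => lie (torus_gen k) f q) _ dp).
    by apply: lie_smooth => //; exact: torus_gen_lin.
  move=> q dq; have e := lie_comm od dq (@torus_gen_lin _ e3) (@torus_gen_lin _ k) sf.
  have z0 : lie (torus_gen k) (lie (torus_gen e3) f) q = 0.
    by rewrite (lie_near_eq (torus_gen k) od dq f4) /lie derive_cst.
  have dfq : differentiable f q by exact: smooth_on_diff sf dq.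
  move: e; rewrite z0 subr0 => ->.
  rewrite (_ : torus_gen k (torus_gen e3 q) - torus_gen e3 (torus_gen k q) = 0) ?dir0//.
  by apply: R6P; apply: I3P; rewrite /torus_gen !(mxE, pair_mx0, pair_mx1, threeE) /=; ring.
have syc : continuous (fun t : R => lie (torus_gen e3) y (orb e3 t p)).
  by apply: (orbit_cont _ dp); apply: lie_smooth => //; exact: torus_gen_lin.
pose K := 2 * alpha * (sq x 1 * lie R1 f p - sq x 0 * lie R2 f p).
have -> : avg e3 (fun=> 1) (lie (torus_gen k1) z) p =
    1 * cint (fun t : R => lie (torus_gen e3) y (orb e3 t p)) + cint (fun=> K).
  rewrite -cint_lin//; last exact: cst_continuous.
  congr cint; apply/funext => t; have Yq := YO e3 t p Yp.
  have := E _ Yq; rewrite !sq_torus !inv -/K => <-; rewrite mul1r mul1r.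
  have -> : lie X1 z (orb e3 t p) = lie (torus_gen k1) z (orb e3 t p) by [].
  by have -> : L 4 y (orb e3 t p) = lie (torus_gen e3) y (orb e3 t p) by []; rewrite addrC subrK.
have -> : cint (fun t : R => lie (torus_gen e3) y (orb e3 t p)) = 0.
  have := avg_cint_lie e3 sy dp; rewrite /avg.
  have -> : orb e3 (2 * pi) p = p.
    rewrite -[RHS](orb_period (fun i => i == ord_max)); congr torus.
    by apply/funext; apply: I3P.
  rewrite subrr => h; apply: etrans h; congr cint; apply/funext => t; by rewrite mul1r.
rewrite mulr0 add0r cint_cst /K /c; have p0 : (pi : R) != 0 by rewrite gt_eqF// pi_gt0.
have a0 : alpha != 0 by rewrite gt_eqF.
move: (lie R1 f p) (lie R2 f p) (pi : R) p0 => a b q q0; field; exact/andP.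
Qed.

End BoundedPrimitive.
End BoundedPrimitives.
Import BoundedPrimitives.

(** * The flat function exp(-1/t) *)

Module Flat.
Section FlatFunction.
Context {R : realType}.
Implicit Types (s t : R).

(** The powers of 1/t make the family closed under derivation, so that smoothness is an induction
    over all k at once. *)
Definition flat k t : R := if 0 < t then t ^- k * expR (- t^-1) else 0.

Lemma flat_le k : exists C, 0 <= C /\ forall t, `|flat k t| <= C * t ^+ 2.
Proof.
(* From exp(1/t) >= (1/(m t))^m; with m = k + 2, a factor t^2 remains, which makes the derivative at
   0 vanish. *)
pose m := k.+2; exists (m%:R ^+ m); split; first by rewrite exprn_ge0.
move=> t; rewrite /flat; case: ifPn => [t0|_]; last first.
  by rewrite normr0; apply: mulr_ge0; [exact: exprn_ge0|exact: sqr_ge0].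
have h0 := expR_gt0 (t^-1).
have h : (t * m%:R) ^- m <= expR (t^-1).
  have -> : expR (t^-1) = expR (t^-1 / m%:R) ^+ m.
    by rewrite -expRM_natl -mulr_natl mulrCA mulfV ?mulr1// pnatr_eq0.
  rewrite -exprVn lerXn2r ?nnegrE ?expR_ge0 ?invr_ge0 ?mulr_ge0 ?(ltW t0)//.
  by rewrite invfM; apply: le_trans (expR_ge1Dx _); rewrite lerDr.
rewrite ger0_norm; last by rewrite mulr_ge0 ?expR_ge0// invr_ge0 exprn_ge0// ltW.
rewrite expRN; apply: (@le_trans _ _ (t ^- k * (t * m%:R) ^+ m)).
  rewrite ler_wpM2l ?invr_ge0 ?exprn_ge0 ?(ltW t0)//.
  by rewrite -[leRHS]invrK lef_pV2 ?posrE ?invr_gt0 ?exprn_gt0 ?mulr_gt0.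
rewrite exprMn /m (_ : t ^+ k.+2 = t ^+ k * t ^+ 2); last by rewrite -exprD addn2.
have tk : t ^+ k != 0 by rewrite expf_neq0// gt_eqF.
by rewrite -(mulrA (t ^+ k)) mulKf// mulrC.
Qed.

Lemma is_derive_powV k t : t != 0 ->
  is_derive t 1 (fun y : R => y^-1 ^+ k) (- (k%:R * t^-1 ^+ k.+1)).
Proof.
move=> tn; elim: k => [|k IH].
  rewrite mul0r oppr0 (_ : (fun y : R => _) = cst 1); first exact: is_derive_cst.
  by apply/funext => y; rewrite expr0.
have D1 : is_derive t 1 (fun y : R => y^-1) (- t ^- 2).
  apply: is_derive_eq (is_deriveV tn (is_derive_id t 1)) _.
  by rewrite /GRing.scale /= mulr1.
have D := is_deriveM D1 IH.
rewrite (_ : (fun y : R => y^-1 ^+ k.+1) = (fun y : R => y^-1) * (fun y : R => y^-1 ^+ k)).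
  apply: is_derive_eq D _; rewrite /GRing.scale /= -exprVn -natr1 !exprS; ring.
by apply/funext => y; rewrite exprS.
Qed.

Lemma flat_derive k t : is_derive t 1 (flat k) (- (k%:R * flat k.+1 t) + flat k.+2 t).
Proof.
have [t0|t0|t0] := ltgtP 0 t.
- have tn := lt0r_neq0 t0.
  have E : \forall y \near t, y^-1 ^+ k * expR (- y^-1) = flat k y.
    have : \forall y \near t, 0 < y by apply: (open_nbhs_nbhs); split => //; exact: open_gt.
    by apply: filterS => y y0; rewrite /flat y0 exprVn.
  apply: (near_eq_is_derive E).
  have D3 : is_derive t 1 (fun y : R => - y^-1) (t ^- 2).
    apply: is_derive_eq (is_deriveN (is_deriveV tn (is_derive_id t 1))) _.
    by rewrite /GRing.scale /= mulr1 opprK.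
  have D4 := @is_derive1_comp _ expR (fun y : R => - y^-1) t _ _ (is_derive_expR _) D3.
  have D := is_deriveM (is_derive_powV k tn) D4.
  rewrite (_ : (fun y : R => _) = ((fun y : R => y^-1 ^+ k) * (expR \o (fun y : R => - y^-1))))//.
  apply: is_derive_eq D _; rewrite /GRing.scale /= /flat t0 -!exprVn !exprS; ring.
- have E : \forall y \near t, cst 0 y = flat k y.
    have : \forall y \near t, y < 0 by apply: (open_nbhs_nbhs); split => //; exact: open_lt.
    by apply: filterS => y y0; rewrite /flat ltNge (ltW y0).
  apply: (near_eq_is_derive E); rewrite /flat ltNge (ltW t0) /= mulr0 oppr0 addr0.
  exact: is_derive_cst.
- rewrite -t0 /flat ltxx mulr0 oppr0 addr0 -/(flat k).
  have [C [C0 hC]] := flat_le k.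
  pose z : {linear R^o -> R^o} := [the {linear R^o -> R^o} of \0].
  have [||d e] := @is_diff_eps R R^o R^o (flat k) 0 z.
  - by move=> x; exact: cst_continuous.
  - move=> e e0; exists (e / (C + 1)); first by rewrite divr_gt0// ltr_wpDl.
    move=> h; rewrite ltr_pdivlMr ?ltr_wpDl// => hh.
    have f0 : flat k 0 = 0 by rewrite /flat ltxx.
    have -> : flat k (0 + h) - flat k 0 - z h = flat k h by rewrite f0 add0r !subr0.
    apply: (le_trans (hC h)).
    rewrite -real_normK ?num_real// expr2 mulrA ler_wpM2r//.
    by move: (normr_ge0 h) => h0; nra.
  have dd : derivable (flat k : R^o -> R^o) 0 1 by exact: diff_derivable.
  by apply: DeriveDef => //; rewrite deriveE// e.
Qed.

Lemma flat_smooth (U : set R) k : open U -> smooth_on U (flat k).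
Proof.
move=> oU j; elim: j k => [|j IH] k /=.
  by move=> t _; have [d _] := flat_derive k t; exact/differentiable_continuous/derivable1_diffP.
split; first by move=> t _; have [d _] := flat_derive k t; exact/derivable1_diffP.
move=> v; have -> : (fun x => 'D_v (flat k) x) = (fun x => v *: (- k%:R *: flat k.+1 x + flat k.+2 x)).
  apply/funext => t; have d := flat_derive k t; have [dd _] := d.
  rewrite -[v in LHS]mulr1 -[v * 1]/(v *: 1) -[v *: 1 in LHS]addr0.
  rewrite derive_lin; last exact/derivable1_diffP.
  rewrite (@derive_val _ _ _ _ _ _ _ d) (_ : 'D_0 (flat k) t = 0).
    by rewrite addr0 /GRing.scale /= mulNr.
  have df : differentiable (flat k) t by exact/derivable1_diffP.
  by have := derive_lin 0 0 (-1) df; rewrite scaler0 addr0 scaleN1r addNr.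
by apply: Ck_onZ => //; apply: Ck_onD => //; apply: Ck_onZ.
Qed.

End FlatFunction.
End Flat.
Import Flat.

(** * Superpositions of Fourier modes in theta_1 and theta_2 *)

Module ModeSums.
Section Modes.
Context {R : realType}.
Implicit Types (x y v : R6 R) (i : 'I_3) (e : bool).

Definition regular : set (R6 R) := [set y | 0 < sq y 0 /\ 0 < sq y 1].

Lemma regular_open : open regular.
Proof.
have -> : regular = (sq^~ 0) @^-1` [set t : R | 0 < t] `&` (sq^~ 1) @^-1` [set t : R | 0 < t] by [].
by apply: openI; apply: open_comp => [y _|]; [exact: sq_cont|exact: open_gt|exact: sq_cont|exact: open_gt].
Qed.

Definition inv_radius i y : R := (Num.sqrt (sq y i))^-1.
(** The value of d theta_i on v. *)
Definition ang i v y : R := cr y v i / sq y i.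

Section Direction.
Variable i : 'I_3.
Hypothesis hi : forall y, regular y -> 0 < sq y i.

Lemma inv_radius_smooth : smooth_on regular (inv_radius i).
Proof.
by apply: smooth_on_sqrtV => //; [exact: regular_open|apply: sq_smooth; exact: regular_open].
Qed.

Lemma ang_smooth v : smooth_on regular (ang i v).
Proof.
have oO := regular_open; apply: smooth_onM => //; last first.
  by apply: smooth_onV => //; [move=> y /hi y0; rewrite gt_eqF|exact: sq_smooth].
by apply: smooth_onB => //; apply: smooth_onM => //; try exact: smooth_on_coord; exact: smooth_on_cst.
Qed.

(** Obtained by differentiating the identity r^-2 r^2 = 1. *)
Lemma inv_radius_derive x v : regular x -> 'D_v (inv_radius i) x = - inv_radius i x * (dt x v i / sq x i).
Proof.
move=> rx; have oO := regular_open; have x0 := lt0r_neq0 (hi rx).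
have ds : differentiable (inv_radius i) x by exact: smooth_on_diff inv_radius_smooth rx.
have [dq Dq] := sq_derive x v i.
have s0 y : regular y -> inv_radius i y != 0.
  by move=> /hi y0; rewrite invr_eq0 sqrtr_eq0 -ltNge.
have e y : regular y -> inv_radius i y * inv_radius i y * sq y i = 1.
  move=> ry; have y0 := hi ry; rewrite -invfM -expr2 sqr_sqrtr ?(ltW y0)//.
  by rewrite mulVf// gt_eqF.
have := derive_near_eq v oO rx e; rewrite derive_cst.
rewrite (deriveMf _ (differentiableM ds ds) dq) (deriveMf _ ds ds) Dq.
move=> h; have {}h : inv_radius i x * inv_radius i x * (2 * dt x v i) +
    sq x i * (inv_radius i x * 'D_v (inv_radius i) x + inv_radius i x * 'D_v (inv_radius i) x) = 0 by exact: h.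
move: (s0 x rx) h; move: (inv_radius i x) ('D_v _ x) (dt x v i) => a b c a0 h.
have a1 : 2 * a * sq x i != 0 by rewrite !mulf_neq0.
move: x0 h a1; move: (sq x i) => q q0 h a1; apply: (mulfI a1).
transitivity (- (a * a * (2 * c))); last by field.
transitivity (q * (a * b + a * b)); first by ring.
by apply/eqP; rewrite -subr_eq0 opprK addrC h.
Qed.

Definition uc y := y i 0 * inv_radius i y.
Definition us y := y i 1 * inv_radius i y.

Lemma uc_smooth : smooth_on regular uc.
Proof.
have oO := regular_open.
by apply: smooth_onM => //; [exact: smooth_on_coord|exact: inv_radius_smooth].
Qed.

Lemma us_smooth : smooth_on regular us.
Proof.
have oO := regular_open.
by apply: smooth_onM => //; [exact: smooth_on_coord|exact: inv_radius_smooth].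
Qed.

Lemma u_norm y : regular y -> uc y ^+ 2 + us y ^+ 2 = 1.
Proof.
move=> ry; have y0 := hi ry; rewrite /uc /us !exprMn -mulrDl -/(sq y i) /inv_radius exprVn sqr_sqrtr ?(ltW y0)//.
by rewrite mulfV// gt_eqF.
Qed.

Lemma u_derive x v : regular x -> 'D_v uc x = - us x * ang i v x /\ 'D_v us x = uc x * ang i v x.
Proof.
move=> rx; have ds : differentiable (inv_radius i) x by exact: smooth_on_diff inv_radius_smooth rx.
have dco (j : 'I_2) : differentiable (fun y : R6 R => y i j) x.
  by apply: (@smooth_on_diff _ _ _ setT) => //; exact: smooth_on_coord.
have x0 := lt0r_neq0 (hi rx); have D := inv_radius_derive v rx.
rewrite /uc /us (deriveMf _ (dco 0) ds) (deriveMf _ (dco 1) ds) !derive_coord D /ang /cr /dt.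
have q : sq x i = x i 0 ^+ 2 + x i 1 ^+ 2 by [].
move: x0; rewrite q; move: (inv_radius i x) (x i 0) (x i 1) (v i 0) (v i 1) => r a b c d x0.
by split; field.
Qed.

End Direction.

Lemma derive_prodD (f1 g1 f2 g2 : R6 R -> R) x v : differentiable f1 x -> differentiable g1 x ->
  differentiable f2 x -> differentiable g2 x ->
  'D_v (fun y => f1 y * g1 y + f2 y * g2 y) x =
  f1 x * 'D_v g1 x + g1 x * 'D_v f1 x + (f2 x * 'D_v g2 x + g2 x * 'D_v f2 x).
Proof.
move=> a b c d; have := deriveD (diff_derivable (v := v) (differentiableM a b)) (diff_derivable (v := v) (differentiableM c d)).
by move=> h; rewrite [LHS]h; congr (_ + _); exact: deriveMf.
Qed.

Lemma derive_prodB (f1 g1 f2 g2 : R6 R -> R) x v : differentiable f1 x -> differentiable g1 x ->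
  differentiable f2 x -> differentiable g2 x ->
  'D_v (fun y => f1 y * g1 y - f2 y * g2 y) x =
  f1 x * 'D_v g1 x + g1 x * 'D_v f1 x - (f2 x * 'D_v g2 x + g2 x * 'D_v f2 x).
Proof.
move=> a b c d; have := deriveB (diff_derivable (v := v) (differentiableM a b)) (diff_derivable (v := v) (differentiableM c d)).
by move=> h; rewrite [LHS]h; congr (_ - _); exact: deriveMf.
Qed.

(** The real and imaginary parts of (a + i b)^n. They give cos(n theta) and sin(n theta) as smooth
    functions, without choosing a branch of the angle. *)
Fixpoint cpow n (a b : R) : R * R :=
  if n is m.+1 then let p := cpow m a b in (a * p.1 - b * p.2, a * p.2 + b * p.1) else (1, 0).

Lemma cpow_norm n a b : a ^+ 2 + b ^+ 2 = 1 -> (cpow n a b).1 ^+ 2 + (cpow n a b).2 ^+ 2 = 1.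
Proof.
move=> ab; elim: n => [|n IH] /=; first by rewrite expr1n expr0n addr0.
rewrite -[RHS](mulr1 1) -{1}ab -IH; move: (cpow n a b) => [c d] /=; ring.
Qed.

Lemma cpow_smooth n i : (forall y, regular y -> 0 < sq y i) ->
  smooth_on regular (fun y => (cpow n (uc i y) (us i y)).1) /\
  smooth_on regular (fun y => (cpow n (uc i y) (us i y)).2).
Proof.
move=> hi; have oO := regular_open; have su := uc_smooth hi; have sv := us_smooth hi.
elim: n => [|n [IH1 IH2]] /=; first by split; exact: smooth_on_cst.
by split; [apply: smooth_onB => //|apply: smooth_onD => //]; exact: smooth_onM.
Qed.

Lemma cpow_derive n i x v : (forall y, regular y -> 0 < sq y i) -> regular x ->
  'D_v (fun y => (cpow n (uc i y) (us i y)).1) x = - (n%:R * ang i v x) * (cpow n (uc i x) (us i x)).2 /\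
  'D_v (fun y => (cpow n (uc i y) (us i y)).2) x = n%:R * ang i v x * (cpow n (uc i x) (us i x)).1.
Proof.
move=> hi rx; have [Du Dv] := u_derive hi v rx.
have du : differentiable (uc i) x by exact: smooth_on_diff (uc_smooth hi) rx.
have dv : differentiable (us i) x by exact: smooth_on_diff (us_smooth hi) rx.
elim: n => [|n [IH1 IH2]] /=; first by rewrite !derive_cst; split; ring.
have [s1 s2] := cpow_smooth n hi; have d1 := smooth_on_diff s1 rx; have d2 := smooth_on_diff s2 rx.
rewrite (derive_prodB v du d1 dv d2) (derive_prodD v du d2 dv d1) Du Dv IH1 IH2 -natr1.
move: (uc i x) (us i x) (ang i v x) (cpow n _ _) => a b c [p q] /=; split; ring.
Qed.

Definition mode e P Q y : R :=
  let p := cpow P (uc 0 y) (us 0 y) in let q := cpow Q (uc 1 y) (us 1 y) in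
  if e then p.1 * q.1 + p.2 * q.2 else p.2 * q.1 - p.1 * q.2.

Let h0 y : regular y -> 0 < sq y 0. Proof. by case. Qed.
Let h1 y : regular y -> 0 < sq y 1. Proof. by case. Qed.

Lemma mode_smooth e P Q : smooth_on regular (mode e P Q).
Proof.
have oO := regular_open; have [p1 p2] := cpow_smooth P h0; have [q1 q2] := cpow_smooth Q h1.
by case: e; [apply: smooth_onD => //|apply: smooth_onB => //]; exact: smooth_onM.
Qed.

Lemma mode_le1 e P Q y : regular y -> `|mode e P Q y| <= 1.
Proof.
move=> ry; have := cpow_norm P (u_norm h0 ry); have := cpow_norm Q (u_norm h1 ry).
rewrite /mode; move: (cpow P _ _) (cpow Q _ _) => [a b] [c d] /= hc ha.
have h : (a * c + b * d) ^+ 2 + (b * c - a * d) ^+ 2 = 1.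
  transitivity ((a ^+ 2 + b ^+ 2) * (c ^+ 2 + d ^+ 2)); first by ring.
  by rewrite hc ha mulr1.
have := sqr_ge0 (a * c + b * d); have := sqr_ge0 (b * c - a * d) => p q.
have le1 (X : R) : X ^+ 2 <= 1 -> `|X| <= 1.
  by move=> hX; rewrite ler_norml; apply/andP; split; nra.
by case: e; apply: le1; lra.
Qed.

Lemma mode_derive e P Q x v : regular x -> 'D_v (mode e P Q) x =
  (if e then -1 else 1) * mode (~~ e) P Q x * (P%:R * ang 0 v x - Q%:R * ang 1 v x).
Proof.
move=> rx; have [p1 p2] := cpow_smooth P h0; have [q1 q2] := cpow_smooth Q h1.
have dp1 := smooth_on_diff p1 rx; have dp2 := smooth_on_diff p2 rx.
have dq1 := smooth_on_diff q1 rx; have dq2 := smooth_on_diff q2 rx.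
have [Dp1 Dp2] := cpow_derive P v h0 rx; have [Dq1 Dq2] := cpow_derive Q v h1 rx.
case: e; [rewrite [LHS](derive_prodD v dp1 dq1 dp2 dq2)|rewrite [LHS](derive_prodB v dp2 dq1 dp1 dq2)];
  rewrite Dp1 Dp2 Dq1 Dq2 /mode /=;
  move: (cpow P _ _) (cpow Q _ _) (ang 0 v x) (ang 1 v x) => [p p'] [q q'] /= a b; ring.
Qed.

End Modes.

Section ModeSeries.
Context {R : realType}.
Implicit Types (x y v : R6 R) (c : nat -> R).
Variables P Q : nat -> nat.
Local Notation E := (@mode R).
Local Notation regular := (@regular R).

Definition weight_n (n : nat) : R := (n.+1%:R * n.+2%:R)^-1.

(** Decay faster than any power of the frequencies. It survives multiplication by P n or Q n, which
    is what a derivative does to coefficients. *)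
Definition rapid c := forall j, exists2 B, 0 <= B &
  forall n, `|c n| * (P n + Q n).+1%:R ^+ j <= B * weight_n n.

Lemma rapidM c (K : nat -> nat) : (forall n, (K n <= P n + Q n)%N) -> rapid c -> rapid (fun n => c n * (K n)%:R).
Proof.
move=> hK hc j; have [B B0 hB] := hc j.+1; exists B => // n; apply: le_trans (hB n).
rewrite normrM exprS mulrA ler_wpM2r ?exprn_ge0// ler_wpM2l// normr_nat ler_nat.
by apply: leqW; exact: hK.
Qed.

Definition summable : set (nat -> R) := [set p | exists2 c, 0 <= c & forall n, `|p n| <= c * weight_n n].

Definition sumf (p : nat -> R) : R := xget 0 [set l | approx l (fun n => \sum_(k < n) p k)].

Lemma sumfE (p : nat -> R) l : approx l (fun n => \sum_(k < n) p k) -> sumf p = l.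
Proof. by move=> h; rewrite /sumf; case: xgetP => [y _ /= hy|/(_ l)//]; exact: approx_uniq hy h. Qed.

Lemma sumf_bound (p : nat -> R) (c : R) : (forall n, `|p n| <= c * weight_n n) ->
  forall n, `|sumf p - \sum_(k < n) p k| <= c / n.+1%:R.
Proof.
move=> h; have [|k s|U [_ hU]] := @unif_series R (fun k _ => p k) c; first by move=> k; exact: cst_continuous.
  exact: h.
have -> : sumf p = U 0 by apply: sumfE; exists c => n; exact: hU.
by move=> n; exact: hU.
Qed.

Lemma sumf_approx (p : nat -> R) : summable p -> approx (sumf p) (fun n => \sum_(k < n) p k).
Proof. by move=> [c _ h]; exists c => n; exact: sumf_bound. Qed.

Lemma weight_ge0 n : 0 <= weight_n n.
Proof. by rewrite invr_ge0 mulr_ge0. Qed.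

Lemma sumf_functional : bounded_functional [set: nat] weight_n summable sumf 1.
Proof.
split.
- exact: weight_ge0.
- move=> k f g [a a0 ha] [b b0 hb]; exists (`|k| * a + b); first by rewrite addr_ge0// mulr_ge0.
  move=> n; apply: (le_trans (ler_normD _ _)); rewrite mulrDl lerD// normrM -mulrA ler_wpM2l//.
- move=> k f g sf sg; apply: sumfE.
  apply: approx_eq (approx_lin k (sumf_approx sf) (sumf_approx sg)) => n.
  by rewrite mulr_sumr -big_split.
- move=> f c c0 _ h; have := sumf_bound (fun n => h n I) 0%N.
  by rewrite big_ord0 subr0 divr1 mulr1.
Qed.

(** Closed under derivation: a derivative acts on the smooth factor phi, or exchanges cosine and
    sine at the price of a factor P n or Q n. *)
Inductive mode_family : (R6 R -> nat -> R) -> Prop :=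
| mode_family0 : mode_family (fun _ _ => 0)
| mode_familyD c (phi : R6 R -> R) e H : rapid c -> smooth_on regular phi -> mode_family H ->
    mode_family (fun x n => c n * (phi x * E e (P n) (Q n) x) + H x n).

Definition mode_class : set (R6 R -> nat -> R) :=
  [set H | exists2 H', mode_family H' & forall x n, regular x -> H x n = H' x n].

Lemma mode_family_smooth H : mode_family H -> forall n, smooth_on regular (H^~ n).
Proof.
have oO := @regular_open R; elim=> [|c phi e {}H hc sp _ IH] n; first exact: smooth_on_cst.
apply: smooth_onD => //; apply: smooth_onM => //; first exact: smooth_on_cst.
by apply: smooth_onM => //; exact: mode_smooth.
Qed.

Lemma mode_family_bounded H x : mode_family H -> regular x -> exists2 C : R, 0 <= C &
  \forall y \near x, forall n, `|H y n| <= C * weight_n n.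
Proof.
move=> hH rx; elim: hH => [|c phi e {}H hc sp _ [C C0 IH]].
  by exists 0 => //; near=> y => n; rewrite normr0 mul0r.
have [B B0 hB] := hc 0%N; exists (B * (`|phi x| + 1) + C); first by rewrite addr_ge0// mulr_ge0// addr_ge0.
have np : \forall y \near x, `|phi y| <= `|phi x| + 1.
  have cp := smooth_on_cts sp rx.
  have /cvgrPdist_lt/(_ 1 ltr01) := cp; apply: filterS => y hy.
  rewrite -lerBlDl; apply: le_trans (ltW hy); rewrite distrC; exact: lerB_dist.
have nr : \forall y \near x, regular y by apply: open_nbhs_nbhs; split => //; exact: regular_open.
near=> y => n.
have hphi : `|phi y| <= `|phi x| + 1 by near: y.
have ry : regular y by near: y.
have hH : `|H y n| <= C * weight_n n by move: n; near: y.
apply: (le_trans (ler_normD _ _)); rewrite [leRHS]mulrDl lerD//.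
have cn := hB n; rewrite expr0 mulr1 in cn.
rewrite normrM mulrAC ler_pM// normrM -[leRHS]mulr1 ler_pM//; exact: mode_le1.
Unshelve. all: by end_near.
Qed.

Let h0 y : regular y -> 0 < sq y 0. Proof. by case. Qed.
Let h1 y : regular y -> 0 < sq y 1. Proof. by case. Qed.

Lemma mode_term_derive e (phi : R6 R -> R) x v (c : R) n : smooth_on regular phi -> regular x ->
  'D_v (fun y => c * (phi y * E e (P n) (Q n) y)) x =
  c * ('D_v phi x * E e (P n) (Q n) x) +
  c * (P n)%:R * ((if e then -1 else 1) * phi x * ang 0 v x * E (~~ e) (P n) (Q n) x) +
  c * (Q n)%:R * (- (if e then -1 else 1) * phi x * ang 1 v x * E (~~ e) (P n) (Q n) x).
Proof.
move=> sp rx; have dp := smooth_on_diff sp rx; have dE := smooth_on_diff (mode_smooth e (P n) (Q n)) rx.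
rewrite (deriveMf _ (differentiable_cst c x) (differentiableM dp dE)) derive_cst mulr0 addr0.
rewrite (deriveMf _ dp dE) mode_derive//.
rewrite [cst c x]/=; move: (E e _ _ x) (E (~~ e) _ _ x) (phi x) ('D_v phi x) (ang 0 v x) (ang 1 v x) => A B C D F H.
by case: e dE => _; ring.
Qed.

Lemma mode_family_D v H : mode_family H -> mode_class (fun x n => 'D_v (H^~ n) x).
Proof.
have oO := @regular_open R.
elim=> [|c phi e {}H hc sp hH [H' hH' E']].
  by exists (fun _ _ => 0); [exact: mode_family0|move=> x n rx; rewrite derive_cst].
pose s : R := if e then -1 else 1.
have rP := rapidM (fun n => leq_addr (Q n) (P n)) hc; have rQ := rapidM (fun n => leq_addl (P n) (Q n)) hc.
have ss i w : (forall y, regular y -> 0 < sq y i) -> smooth_on regular (fun y => w * phi y * ang i v y).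
  move=> hi; apply: smooth_onM => //; last exact: ang_smooth.
  by apply: smooth_onM => //; exact: smooth_on_cst.
exists (fun x n => c n * ('D_v phi x * E e (P n) (Q n) x) +
  (c n * (P n)%:R * (s * phi x * ang 0 v x * E (~~ e) (P n) (Q n) x) +
  (c n * (Q n)%:R * (- s * phi x * ang 1 v x * E (~~ e) (P n) (Q n) x) + H' x n))).
  apply: mode_familyD => //; first exact: smooth_on_D.
  apply: (mode_familyD (c := fun n => c n * (P n)%:R) (phi := fun x => s * phi x * ang 0 v x) _ rP) => //; first exact: ss.
  by apply: (mode_familyD (c := fun n => c n * (Q n)%:R) (phi := fun x => - s * phi x * ang 1 v x) _ rQ) => //; exact: ss.
move=> x n rx; rewrite -E'// /s.
have dH := smooth_on_diff (mode_family_smooth hH n) rx.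
have sT : smooth_on regular (fun y => c n * (phi y * E e (P n) (Q n) y)).
  by apply: smooth_onM => //; [exact: smooth_on_cst|apply: smooth_onM => //; exact: mode_smooth].
have dT := smooth_on_diff sT rx.
have hD := deriveD (diff_derivable (v := v) dT) (diff_derivable (v := v) dH).
by rewrite [LHS]hD mode_term_derive// !addrA.
Qed.

Variables a b : nat -> R.
Hypotheses (ra : rapid a) (rb : rapid b).

Definition mode_terms x n : R := a n * E true (P n) (Q n) x + b n * E false (P n) (Q n) x.

Let terms_class : mode_class mode_terms.
Proof.
exists (fun x n => a n * (1 * E true (P n) (Q n) x) + (b n * (1 * E false (P n) (Q n) x) + 0)).
  by do 2![apply: mode_familyD => //; first exact: smooth_on_cst]; exact: mode_family0.
by move=> x n _; rewrite /mode_terms; ring.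
Qed.

Definition mode_sum x : R := sumf (mode_terms x).

Lemma mode_sum_spec : smooth_on regular mode_sum /\
  (forall x v, regular x -> 'D_v mode_sum x = sumf (fun n => 'D_v (mode_terms^~ n) x)).
Proof.
have oO := @regular_open R.
have Ks F : mode_class F -> forall t, smooth_on regular (F^~ t).
  move=> [H hH e] n; apply: (smooth_on_near_eq oO (f := H^~ n)); first by move=> y ry; rewrite e.
  exact: mode_family_smooth.
have Kb F x : mode_class F -> regular x -> exists c : R,
    \forall y \near x, forall t, [set: nat] t -> `|F y t| <= c * weight_n t.
  move=> [H hH e] rx; have [C _ h] := mode_family_bounded hH rx; exists C.
  have nr : \forall y \near x, regular y by apply: open_nbhs_nbhs; split.
  by apply: filterS2 h nr => y hy ry n _; rewrite e.
have KP F x : mode_class F -> regular x -> summable (F x).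
  move=> [H hH e] rx; have [C C0 h] := mode_family_bounded hH rx; exists C => // n.
  by rewrite e//; exact: (nbhs_singleton h).
have KD F v : mode_class F -> mode_class (fun x t => 'D_v (F^~ t) x).
  move=> [H hH e]; have [H' hH' e'] := mode_family_D v hH; exists H' => // x n rx.
  by rewrite -e'//; apply: (derive_near_eq _ oO rx) => y ry; exact: e.
split; first exact: (superposition_smooth sumf_functional oO Ks KP Kb KD terms_class).
by move=> x v rx; exact: (superposition_derive sumf_functional oO Ks KP Kb KD v terms_class rx).
Qed.

End ModeSeries.
End ModeSums.
Import ModeSums.

(** * Rational approximations of alpha *)

Module RationalApproximation.
Section Arithmetic.
Context {R : realType}.
Variable alpha : R.
Hypothesis alpha_gt1 : 1 < alpha.
Let alpha_gt0 : 0 < alpha := lt_trans ltr01 alpha_gt1.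

Lemma rational_div (p q : int) : rational (p%:~R / q%:~R : R).
Proof. by exists (p%:~R / q%:~R) => //; rewrite fmorph_div /= !ratr_int. Qed.

Lemma rational_fraction : rational alpha -> exists P Q : nat, (0 < Q)%N /\ P%:R - Q%:R * alpha = 0.
Proof.
move=> [r _ e]; exists `|numq r|%N, `|denq r|%N.
have q0 : (denq r)%:~R != 0 :> R by rewrite intr_eq0 denq_eq0.
have ae : alpha = (numq r)%:~R / (denq r)%:~R by rewrite -e.
have n0 : (0 <= numq r)%R.
  by rewrite numq_ge0 -(ler0q R) e ltW.
have P0 : (`|numq r|%N)%:R = (numq r)%:~R :> R by rewrite natr_absz ger0_norm.
have Q0 : (`|denq r|%N)%:R = (denq r)%:~R :> R by rewrite natr_absz ger0_norm// denq_ge0.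
split; first by rewrite absz_gt0 denq_eq0.
by rewrite P0 Q0 ae mulrC divfK// subrr.
Qed.

Lemma irrational_delta (P Q : nat) : irrational alpha -> (0 < Q)%N -> P%:R - Q%:R * alpha != 0.
Proof.
move=> irr Q0; apply/eqP => /eqP; rewrite subr_eq0 => /eqP e; apply: irr.
have q0 : Q%:R != 0 :> R by rewrite pnatr_eq0 -lt0n.
have -> : alpha = (P : int)%:~R / (Q : int)%:~R by rewrite -!pmulrn e mulrAC mulfV// mul1r.
exact: rational_div.
Qed.

(* the denominators are unbounded since the multiples of 1 / N! stay away from alpha *)
Lemma denominators_unbounded (p : nat -> int) (q : nat -> nat) : irrational alpha ->
  (forall n, (1 <= q n)%N) -> (fun n => (p n)%:~R / (q n)%:R : R) @ \oo --> alpha ->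
  forall N : nat, exists n, (N <= q n)%N.
Proof.
move=> irr q1 cv N; apply: contrapT => h.
have qN n : (q n <= N)%N by rewrite leqNgt; apply/negP => hn; apply: h; exists n; exact: ltnW.
pose M : R := (N`!)%:R; have M0 : 0 < M by rewrite /M ltr0n fact_gt0.
pose z := Num.floor (M * alpha).
have f1 : z%:~R <= M * alpha by exact: floor_le_tmp.
have f2 : M * alpha < z%:~R + 1 by have := floorD1_gt (M * alpha); rewrite intrD.
have f3 : z%:~R != M * alpha.
  apply/eqP => e; apply: irr; have -> : alpha = z%:~R / (N`! : int)%:~R.
    by rewrite e -pmulrn mulrC mulKf// gt_eqF.
  exact: rational_div.
have {}f1 : z%:~R < M * alpha by rewrite lt_neqAle f3.
pose d := Num.min (M * alpha - z%:~R) (z%:~R + 1 - M * alpha).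
have d0 : 0 < d by rewrite lt_min !subr_gt0 f1.
have far (w : int) : d <= `|w%:~R - M * alpha|.
  have [wz|wz] := leP w z.
    have : w%:~R <= z%:~R :> R by rewrite ler_int.
    by move=> hw; rewrite ler0_norm; [rewrite ge_min; apply/orP; left; lra|lra].
  have : (z + 1)%:~R <= w%:~R :> R by rewrite ler_int lezD1.
  by rewrite intrD => hw; rewrite ger0_norm; [rewrite ge_min; apply/orP; right; lra|lra].
have dM : 0 < d / M by rewrite divr_gt0.
have /cvgrPdist_lt/(_ _ dM) [n _ /(_ n (leqnn n))] := cv.
apply/negP; rewrite -leNgt.
have [c hc] : exists c : nat, N`! = (c * q n)%N.
  have /dvdnP[c hc] : (q n %| N`!)%N by apply: dvdn_fact; rewrite q1 qN.
  by exists c.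
have q0 : (q n)%:R != 0 :> R by rewrite pnatr_eq0 -lt0n q1.
have e : alpha - (p n)%:~R / (q n)%:R = - ((p n * c)%:~R - M * alpha) / M.
  have c0 : c%:R != 0 :> R.
    by rewrite pnatr_eq0; apply/eqP => c0; move: (fact_gt0 N); rewrite hc c0 mul0n.
  by rewrite /M hc natrM intrM -[c%:~R]pmulrn; field; exact/andP.
by rewrite e normrM normrN normfV (gtr0_norm M0) ler_wpM2r ?invr_ge0 ?(ltW M0)//; exact: far.
Qed.

(** The power grows with n, so that the sequence of P n - Q n alpha is itself [rapid]; the bound n <
    Q n makes the growth at the end unbounded. *)
Lemma liouville_sequence : liouville alpha -> exists P Q : nat -> nat,
  (forall n, (n < Q n)%N) /\
  forall n, `|(P n)%:R - (Q n)%:R * alpha| * (P n + Q n).+1%:R ^+ n <= weight_n n :> R.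
Proof.
move=> [irr [p [q [q1 cv lio]]]].
suff /choice[f hf] : forall n, exists PQ : nat * nat, (n < PQ.2)%N /\
    `|PQ.1%:R - PQ.2%:R * alpha| * (PQ.1 + PQ.2).+1%:R ^+ n <= weight_n n :> R.
  by exists (fun n => (f n).1), (fun n => (f n).2); split => n; have [] := hf n.
(* In the exponent N + 2, one power of q pays for multiplying p/q - alpha by q, N powers for (P + Q
   + 1)^N, and the last one beats the constants. *)
move=> N; have [lam hl] := lio N.+2 isT.
(* P is at most Q alpha + 1, so P + Q + 1 is at most (alpha + 3) Q. *)
pose D : R := alpha + 3; have D0 : 0 < D by rewrite addr_gt0.
have w0 : 0 < weight_n N :> R by rewrite /weight_n invr_gt0 mulr_gt0.
have [B1 hB1] := nat_above (lam * D ^+ N / weight_n N); have [B2 hB2] := nat_above lam.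
have [n hn] := denominators_unbounded irr q1 cv (maxn N.+1 (maxn B1 B2)).
have [n0 n1 n2] : [/\ (N < q n)%N, (B1 <= q n)%N & (B2 <= q n)%N].
  by move: hn; rewrite !geq_max => /andP[-> /andP[-> ->]].
have Q0 : 0 < (q n)%:R :> R by rewrite ltr0n q1.
have Q1 : 1 <= (q n)%:R :> R by rewrite ler1n q1.
set Qn : R := (q n)%:R in Q0 Q1.
have lamQ : lam <= Qn by apply: (le_trans (ltW hB2)); rewrite ler_nat.
have lamD : lam * D ^+ N / weight_n N <= Qn by apply: (le_trans (ltW hB1)); rewrite ler_nat.
have del : `|(p n)%:~R - Qn * alpha| < lam / Qn ^+ N.+1.
  have -> : (p n)%:~R - Qn * alpha = Qn * ((p n)%:~R / Qn - alpha) by field; rewrite gt_eqF.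
  rewrite normrM (gtr0_norm Q0) -ltr_pdivlMl//; apply: lt_le_trans (hl n) _.
  by rewrite le_eqVlt; apply/orP; left; apply/eqP; rewrite (exprS Qn N.+1) invfM mulrCA.
have le1 : `|(p n)%:~R - Qn * alpha| <= 1.
  apply: (le_trans (ltW del)); rewrite ler_pdivrMr ?exprn_gt0// mul1r exprS.
  by apply: (le_trans lamQ); rewrite ler_peMr ?(ltW Q0)// exprn_ege1.
have Qa : 1 <= Qn * alpha by rewrite mulr_ege1// ltW.
have p0 : 0 <= (p n)%:~R :> R.
  by move: le1 Qa; rewrite ler_norml; move: (p n)%:~R (Qn * alpha) => x y /andP[]; lra.
have pe : (`|p n|%N)%:R = (p n)%:~R :> R by rewrite natr_absz ger0_norm// -(ler0z R).
exists (`|p n|%N, q n) => /=; split; first exact: n0.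
rewrite pe -/Qn.
have wD : (`|p n| + q n).+1%:R <= D * Qn :> R.
  rewrite -natr1 natrD pe -/Qn /D; move: le1; rewrite ler_norml mulrDl [alpha * Qn]mulrC => /andP[_].
  by move: (p n)%:~R (Qn * alpha) Q1 => x y; move: (Qn) => z; lra.
apply: (@le_trans _ _ (lam / Qn ^+ N.+1 * (D * Qn) ^+ N)).
  by rewrite ler_pM ?exprn_ge0 ?(ltW del)// lerXn2r ?nnegrE ?mulr_ge0 ?(ltW D0) ?(ltW Q0).
have -> : lam / Qn ^+ N.+1 * (D * Qn) ^+ N = lam * D ^+ N / Qn.
  rewrite exprMn exprS; have : Qn ^+ N != 0 by rewrite expf_neq0// gt_eqF.
  by move: (Qn ^+ N) (D ^+ N) (gt_eqF Q0) => a b /negbT q0 a0; field; apply/andP.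
by rewrite (ler_pdivrMr _ _ Q0) [leRHS]mulrC; move: lamD; rewrite (ler_pdivrMr _ _ w0).
Qed.

End Arithmetic.
End RationalApproximation.
Import RationalApproximation.

(** * Modes along an orbit of X1 *)

Module ModeFlows.
Section ModeFlow.
Context {R : realType}.
Variable alpha : R.
Hypothesis alpha_gt1 : 1 < alpha.
Let alpha_gt0 : 0 < alpha := lt_trans ltr01 alpha_gt1.
Implicit Types (x y v : R6 R).

Local Notation dom := (dom alpha).
Local Notation regular := (@regular R).
Local Notation orb k s x := (torus (fun i => s * k i) x).
Local Notation e1 := (three (1 : R) 0 0).
Local Notation e2 := (three (0 : R) 1 0).
Local Notation e3 := (three (0 : R) 0 1).
Local Notation k1 := (three 1 alpha 0).

Lemma inv_radius_torus i (th : 'I_3 -> R) y : inv_radius i (torus th y) = inv_radius i y.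
Proof. by rewrite /inv_radius sq_torus. Qed.

Lemma uc_torus i (th : 'I_3 -> R) y : uc i (torus th y) = uc i y * cos (th i) - us i y * sin (th i).
Proof. by rewrite /uc /us inv_radius_torus pair_mx0; ring. Qed.

Lemma us_torus i (th : 'I_3 -> R) y : us i (torus th y) = uc i y * sin (th i) + us i y * cos (th i).
Proof. by rewrite /uc /us inv_radius_torus pair_mx1; ring. Qed.

Lemma cpow_cos_sin n (t : R) : cpow n (cos t) (sin t) = (cos (n%:R * t), sin (n%:R * t)).
Proof.
elim: n => [|n IH]; first by rewrite mul0r cos0 sin0.
rewrite /= IH -natr1 mulrDl mul1r [_ + t]addrC cosD sinD /=; congr pair; ring.
Qed.

Lemma ang_torus_gen i (k : 'I_3 -> R) y : 0 < sq y i -> ang i (torus_gen k y) y = k i.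
Proof.
move=> y0; rewrite /ang (_ : cr y (torus_gen k y) i = k i * sq y i).
  by rewrite mulfK// gt_eqF.
by rewrite /cr pair_mx0 pair_mx1 /sq; ring.
Qed.

(** A point of Y with all angles 0 and r_1^2 = alpha r_2^2 = 1/4, so that every mode is a pure
    cosine or sine along its orbit. *)
Definition base_point : R6 R := pair_mx (three 2^-1 (2 * Num.sqrt alpha)^-1 1) (three 0 0 0).

Lemma base_sq i : sq base_point i = three 2^-1 (2 * Num.sqrt alpha)^-1 1 i ^+ 2.
Proof. by move: i; apply: I3P; rewrite /sq pair_mx0 pair_mx1 !threeE expr0n addr0. Qed.

Lemma base_sq0 : sq base_point 0 = 4^-1.
Proof. by rewrite base_sq threeE; field. Qed.

Lemma base_sq1 : sq base_point 1 = (4 * alpha)^-1.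
Proof. by rewrite base_sq threeE exprVn exprMn sqr_sqrtr ?(ltW alpha_gt0)// -natrX. Qed.

Lemma base_Y : Y alpha base_point.
Proof.
apply/YE; rewrite /Nf base_sq0 base_sq1 base_sq threeE expr1n; split => //.
by field; rewrite gt_eqF.
Qed.

Lemma base_regular : regular base_point.
Proof. by split; rewrite ?base_sq0 ?base_sq1 invr_gt0// mulr_gt0. Qed.

Lemma base_u i : i != ord_max -> uc i base_point = 1 /\ us i base_point = 0.
Proof.
have s0 : 0 < Num.sqrt alpha by rewrite sqrtr_gt0.
have h (r : R) : 0 < r -> r * (Num.sqrt (r ^+ 2))^-1 = 1.
  by move=> r0; rewrite sqrtr_sqr gtr0_norm// mulfV// gt_eqF.
by move: i; apply: I3P => // _; rewrite /uc /us /inv_radius base_sq pair_mx0 pair_mx1 !threeE mul0r h// invr_gt0// mulr_gt0.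
Qed.

Lemma mode_flow e (P Q : nat) (s : R) : mode e P Q (orb k1 s base_point) =
  if e then cos ((P%:R - Q%:R * alpha) * s) else sin ((P%:R - Q%:R * alpha) * s).
Proof.
have [c0 s0] := @base_u 0 isT; have [c1 s1] := @base_u 1 isT.
rewrite /mode !uc_torus !us_torus c0 c1 s0 s1 !threeE !mul0r !mul1r !subr0 !addr0 !cpow_cos_sin /=.
have -> : (P%:R - Q%:R * alpha) * s = P%:R * (s * 1) - Q%:R * (s * alpha) by ring.
by case: e; rewrite ?cosB ?sinB.
Qed.

(** It vanishes where r_1^2 or r_2^2 is at most half its value at [base_point], in particular near
    the axes, where the modes are not defined. *)
Definition cutoff y : R := flat 0 (sq y 0 - 8^-1) * flat 0 (sq y 1 - (8 * alpha)^-1).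

Lemma cutoff_smooth (U : set (R6 R)) : open U -> smooth_on U cutoff.
Proof.
move=> oU.
have h i (c : R) : smooth_on U (fun y => flat 0 (sq y i - c)).
  apply: (smooth_on_compR (O := setT) oU _ _ (flat_smooth 0 openT)) => //.
  by apply: smooth_onB => //; [exact: sq_smooth|exact: smooth_on_cst].
by apply: smooth_onM => //; exact: h.
Qed.

Lemma cutoff_torus (th : 'I_3 -> R) y : cutoff (torus th y) = cutoff y.
Proof. by rewrite /cutoff !sq_torus. Qed.

Lemma flat_gt0 (t : R) : 0 < t -> 0 < flat 0 t.
Proof. by move=> t0; rewrite /flat t0 expr0 invr1 mul1r expR_gt0. Qed.

Lemma flat_le0 (t : R) : t <= 0 -> flat 0 t = 0.
Proof. by move=> t0; rewrite /flat ltNge t0. Qed.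

Lemma cutoff_base : 0 < cutoff base_point.
Proof.
rewrite /cutoff base_sq0 base_sq1 mulr_gt0// flat_gt0//; first by lra.
by rewrite subr_gt0 ltf_pV2 ?posrE ?mulr_gt0//; have := alpha_gt0; lra.
Qed.

Section Perturbation.
Variables (P Q : nat -> nat) (a b : nat -> R).
Hypotheses (ra : rapid P Q a) (rb : rapid P Q b).

Lemma sumfN (p : nat -> R) : summable p -> sumf (fun n => - p n) = - sumf p.
Proof.
move=> [c _ h]; apply: sumfE; exists c => n.
by rewrite sumrN -opprD normrN; exact: sumf_bound.
Qed.

Definition perturbation y : R := cutoff y * mode_sum P Q a b y.

Lemma perturbation_smooth : smooth_on dom perturbation.
Proof.
have [sm _] := mode_sum_spec ra rb.
apply: smooth_on_local => x _.
have osq i (c : R) : open [set y : R6 R | c < sq y i].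
  rewrite (_ : [set y | _] = (sq^~ i) @^-1` [set t : R | c < t])//.
  by apply: open_comp => [y _|]; [exact: sq_cont|exact: open_gt].
have osq' i (c : R) : open [set y : R6 R | sq y i < c].
  rewrite (_ : [set y | _] = (sq^~ i) @^-1` [set t : R | t < c])//.
  by apply: open_comp => [y _|]; [exact: sq_cont|exact: open_lt].
have a8 : 0 < (16 * alpha)^-1 by rewrite invr_gt0 mulr_gt0.
have a16 : (16 * alpha)^-1 < (8 * alpha)^-1.
  by rewrite ltf_pV2 ?posrE ?mulr_gt0//; have := alpha_gt0; lra.
(* The thresholds 1/16 and 1/8 leave room: a point with sq x 0 at most 1/16 has an open
   neighbourhood on which the cutoff vanishes. *)
have [h0|h0] := ltP (16^-1) (sq x 0); last first.
  exists [set y | sq y 0 < 8^-1]; split; [exact: osq'|rewrite /=; lra|].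
  exists (fun=> 0); last exact: smooth_on_cst.
  by move=> y /= hy; rewrite /perturbation /cutoff flat_le0 ?mul0r//; lra.
have [h1|h1] := ltP (16 * alpha)^-1 (sq x 1); last first.
  exists [set y | sq y 1 < (8 * alpha)^-1]; split; [exact: osq'|rewrite /=; lra|].
  exists (fun=> 0); last exact: smooth_on_cst.
  by move=> y /= hy; rewrite /perturbation /cutoff (@flat_le0 (sq y 1 - _)) ?mulr0 ?mul0r//; lra.
pose O := [set y : R6 R | 16^-1 < sq y 0] `&` [set y | (16 * alpha)^-1 < sq y 1].
have oO : open O by exact: openI.
exists O; split => //; exists perturbation => //.
apply: smooth_onM => //; first exact: cutoff_smooth.
by apply: (smooth_onW _ sm) => y [/= y0 y1]; split; lra.
Qed.

Lemma perturbation_e3 (s : R) y : perturbation (orb e3 s y) = perturbation y.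
Proof.
rewrite /perturbation cutoff_torus /mode_sum; congr (_ * sumf _); apply/funext => n.
rewrite /mode_terms /mode !uc_torus !us_torus !threeE mulr0 cos0 sin0.
by rewrite !mulr0 !mulr1 !subr0 !add0r.
Qed.

Lemma perturbation_derive (k : 'I_3 -> R) y : dom y -> regular y ->
  lie (torus_gen k) perturbation y = cutoff y *
    sumf (fun n => (b n * mode true (P n) (Q n) y - a n * mode false (P n) (Q n) y) *
      ((P n)%:R * k 0 - (Q n)%:R * k 1)).
Proof.
move=> dy ry; have [sm Dm] := mode_sum_spec ra rb; have [y0 y1] := ry.
have dc : differentiable cutoff y by exact: smooth_on_diff (cutoff_smooth openT) I.
have dm : differentiable (mode_sum P Q a b) y by exact: smooth_on_diff sm ry.
rewrite /lie [LHS](deriveMf _ dc dm) Dm//.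
have -> : 'D_(torus_gen k y) cutoff y = 0.
  have h := invariant_lie0 (k := k) (cutoff_smooth (@dom_open _ alpha)) dy.
  by apply: h => s; exact: cutoff_torus.
rewrite mulr0 addr0; congr (_ * sumf _); apply/funext => n.
have dM e := smooth_on_diff (mode_smooth e (P n) (Q n)) ry.
rewrite [LHS](derive_prodD _ (differentiable_cst (a n) y) (dM true) (differentiable_cst (b n) y) (dM false)).
rewrite !derive_cst !mulr0 !addr0 !mode_derive//= !ang_torus_gen//=.
by ring.
Qed.

Variable G : R6 R -> set (R6 R).

Let delta n : R := (P n)%:R - (Q n)%:R * alpha.
(** The factor r_2^2 P + r_1^2 Q at [base_point], with which the n-th mode enters the equation. *)
Let m n : R := ((P n)%:R / alpha + (Q n)%:R) / 4.

(** Along the orbit of [base_point] the bounded primitive is, up to the constant factor chi, the sum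
    of the primitives m n g n. Truncating at M changes the derivative by O(1/M), hence the increment
    over [0, T] by O(T/M). *)
Lemma mode_growth (g : nat -> R -> R) : unobstructed (Y alpha) G ->
  (forall n (s : R), is_derive s 1 (g n) (b n * cos (delta n * s) - a n * sin (delta n * s))) ->
  exists C c : R, forall M T, 0 <= T ->
    \sum_(n < M) m n * (g n T - g n 0) <= C + c * T / M.+1%:R.
Proof.
move=> uG hg.
have [|V [C [hC hV]]] := bounded_primitive alpha_gt1 perturbation_smooth _ uG base_Y.
  by move=> y dy; apply: (invariant_lie0 (k := e3) perturbation_smooth dy) => s; exact: perturbation_e3.
pose chi := cutoff base_point; have chi0 : 0 < chi := cutoff_base.
pose t n s := b n * cos (delta n * s) - a n * sin (delta n * s).
pose sP s := sumf (fun n => t n s * (P n)%:R); pose sQ s := sumf (fun n => t n s * (Q n)%:R).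
have [B B0 hB] : exists2 B, 0 <= B & forall s n, `|t n s * (P n)%:R| <= B * weight_n n /\
    `|t n s * (Q n)%:R| <= B * weight_n n.
  have [Ba Ba0 ha] := ra 1%N; have [Bb Bb0 hb] := rb 1%N.
  exists (Ba + Bb); first exact: addr_ge0.
  move=> s n.
  have tn : `|t n s| <= `|a n| + `|b n|.
    rewrite addrC (le_trans (ler_normB _ _))// !normrM lerD// ler_piMr// ler_norml.
      by rewrite cos_geN1 cos_le1.
    by rewrite sin_geN1 sin_le1.
  suff key (K : nat) : (K <= P n + Q n)%N -> `|t n s * K%:R| <= (Ba + Bb) * weight_n n.
    by split; apply: key; [exact: leq_addr|exact: leq_addl].
  move=> hK; have := ha n; have := hb n; rewrite !expr1 => h2 h1.
  rewrite [leRHS]mulrDl; apply: le_trans (lerD h1 h2); rewrite -mulrDl normrM ler_pM// normr_nat ler_nat.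
  exact: leqW.
have {}hV (s : R) : is_derive s 1 V (chi * ((4 * alpha)^-1 * sP s + 4^-1 * sQ s)).
  have := hV s; rewrite base_sq0 base_sq1.
  have dp : dom (orb k1 s base_point) by apply/dom_torus; apply: Y_dom; exact: base_Y.
  have rp : regular (orb k1 s base_point) by rewrite /regular /= !sq_torus; exact: base_regular.
  rewrite !perturbation_derive// cutoff_torus -/chi !threeE.
  have -> : (fun n => (b n * mode true (P n) (Q n) (orb k1 s base_point) -
      a n * mode false (P n) (Q n) (orb k1 s base_point)) * ((P n)%:R * 1 - (Q n)%:R * 0)) =
      fun n => t n s * (P n)%:R.
    by apply/funext => n; rewrite !mode_flow mulr1 mulr0 subr0.
  have -> : (fun n => (b n * mode true (P n) (Q n) (orb k1 s base_point) -
      a n * mode false (P n) (Q n) (orb k1 s base_point)) * ((P n)%:R * 0 - (Q n)%:R * 1)) =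
      fun n => - (t n s * (Q n)%:R).
    by apply/funext => n; rewrite !mode_flow mulr1 mulr0 sub0r mulrN.
  rewrite sumfN; last by exists B => // n; have [] := hB s n.
  by rewrite -/(sP s) -/(sQ s) => d; apply: is_derive_eq; ring.
exists (2 * C / chi), (((4 * alpha)^-1 + 4^-1) * B) => M T T0.
have hS (s : R) : is_derive s 1 (fun s : R => \sum_(n < M) m n * g n s) (\sum_(n < M) m n * t n s).
  apply: (CosineSums.is_derive_sum M (f := fun n s => m n * g n s) (df := fun n s => m n * t n s)).
have hD (s : R) : is_derive s 1 (fun s : R => V s - chi * (\sum_(n < M) m n * g n s))
    (chi * ((4 * alpha)^-1 * sP s + 4^-1 * sQ s) - chi * (\sum_(n < M) m n * t n s)).
  exact: (is_deriveB (hV s) (is_deriveZ chi (hS s))).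
have a0 : 0 <= (4 * alpha)^-1 by rewrite invr_ge0 mulr_ge0// ltW.
have hb s : `|chi * ((4 * alpha)^-1 * sP s + 4^-1 * sQ s) - chi * (\sum_(n < M) m n * t n s)| <=
    chi * (((4 * alpha)^-1 + 4^-1) * B / M.+1%:R).
  have h1 := sumf_bound (fun n => (hB s n).1) M; have h2 := sumf_bound (fun n => (hB s n).2) M.
  rewrite -mulrBr normrM (gtr0_norm chi0) ler_wpM2l ?(ltW chi0)//.
  have -> : \sum_(n < M) m n * t n s = (4 * alpha)^-1 * (\sum_(n < M) t n s * (P n)%:R) +
      4^-1 * (\sum_(n < M) t n s * (Q n)%:R).
    rewrite !mulr_sumr -big_split; apply: eq_bigr => n _ /=; rewrite /m invfM.
    by move: alpha^-1 => c; field.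
  rewrite (_ : _ - _ = (4 * alpha)^-1 * (sP s - \sum_(n < M) t n s * (P n)%:R) +
    4^-1 * (sQ s - \sum_(n < M) t n s * (Q n)%:R)); last by ring.
  rewrite -[leRHS]mulrA [leRHS]mulrDl; move: h1 h2; rewrite -/(sP s) -/(sQ s).
  move: (sP s - _) (sQ s - _) (B / _) (4 * alpha)^-1 a0 => x y K u u0 hx hy.
  by rewrite (le_trans (ler_normD _ _))// !normrM (ger0_norm u0) (ger0_norm (_ : 0 <= 4^-1))// lerD// ler_wpM2l.
have := MVT_bound T0 (fun s _ => hD s) (fun s _ => hb s).
rewrite subr0 => h; rewrite -(ler_pM2l chi0).
have hs : \sum_(n < M) m n * (g n T - g n 0) = \sum_(n < M) m n * g n T - \sum_(n < M) m n * g n 0.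
  by rewrite -sumrB; apply: eq_bigr => n _; rewrite mulrBr.
have e : chi * (2 * C / chi + ((4 * alpha)^-1 + 4^-1) * B * T / M.+1%:R) =
    2 * C + chi * (((4 * alpha)^-1 + 4^-1) * B / M.+1%:R) * T.
  by rewrite mulrDr [chi * (2 * C / chi)]mulrC divfK ?gt_eqF//; congr (_ + _); ring.
rewrite e hs; move: h; move: (chi * (_ / _) * T) => K h.
have := hC T; have := hC 0; rewrite !ler_norml => /andP[v1 v2] /andP[v3 v4].
move: h; rewrite ler_norml => /andP[h _]; lra.
Qed.

End Perturbation.

End ModeFlow.
End ModeFlows.
Import ModeFlows.

(** * The rational and Liouville cases *)

Module ObstructedCases.
Section Obstructed.
Context {R : realType}.
Variable alpha : R.
Hypothesis alpha_gt1 : 1 < alpha.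
Let alpha_gt0 : 0 < alpha := lt_trans ltr01 alpha_gt1.
Variable G : R6 R -> set (R6 R).

Lemma rapid0 (P Q : nat -> nat) : rapid P Q (fun _ => 0 : R).
Proof. by move=> j; exists 0 => // n; rewrite normr0 !mul0r. Qed.

Lemma obstructed_rational : rational alpha -> obstructed (Y alpha) G.
Proof.
move=> /(rational_fraction alpha_gt1)[P [Q [Q0 d0]]] uG.
(* A single mode, of frequency 0 along the flow. *)
pose b n : R := if n is 0 then 1 else 0.
have rb : rapid (fun=> P) (fun=> Q) b.
  move=> j; exists (2 * (P + Q).+1%:R ^+ j); first by rewrite mulr_ge0// exprn_ge0.
  case=> [|n]; last by rewrite normr0 mul0r mulr_ge0 ?mulr_ge0 ?exprn_ge0 ?weight_ge0.
  by rewrite normr1 mul1r /weight_n mul1r mulrAC mulfV// mul1r.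
pose g n (s : R) : R := b n * s.
have hg n (s : R) : is_derive s 1 (g n) (b n * cos ((P%:R - Q%:R * alpha) * s) - 0 * sin ((P%:R - Q%:R * alpha) * s)).
  rewrite d0 !mul0r subr0 cos0.
  exact: (is_deriveZ (b n) (is_derive_id s 1)).
have [C [c h]] := mode_growth alpha_gt1 (@rapid0 _ _) rb uG hg.
pose m : R := (P%:R / alpha + Q%:R) / 4.
have m0 : 0 < m.
  by rewrite divr_gt0// ltr_wpDl ?ltr0n// divr_ge0// ltW.
have {}h M T : 0 <= T -> m * T <= C + c * T / M.+2%:R.
  move=> T0; have := h M.+1 T T0.
  rewrite big_ord_recl big1 ?addr0 /g /b /= => [|i _]; last by rewrite !mul0r subrr mulr0.
  by rewrite !mul1r subr0.
(* M makes the truncation error at most m T / 2; the time T chosen below then makes the other half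
   exceed C. *)
clearbody m; have [M hM] := nat_above (2 * c / m).
have M0 : 0 < M.+2%:R :> R by [].
have hc : c / M.+2%:R <= m / 2.
  have : M%:R <= M.+2%:R :> R by rewrite ler_nat leqW.
  move: hM; rewrite ltr_pdivrMr// => h1 h2.
  rewrite ler_pdivrMr//; nra.
pose T := 2 * (`|C| + 1) / m.
have T0 : 0 <= T by rewrite divr_ge0 ?(ltW m0)// mulr_ge0// addr_ge0.
have hT := h M T T0; rewrite (mulrAC c T) in hT.
have mT : m * T = 2 * (`|C| + 1) by rewrite mulrC divfK// gt_eqF.
have : c / M.+2%:R * T <= m / 2 * T by rewrite ler_wpM2r.
move: hT; rewrite [m / 2 * T]mulrAC mT; have := ler_norm C.
by move: (c / _ * T) `|C| => X K; lra.
Qed.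

Lemma obstructed_liouville : liouville alpha -> obstructed (Y alpha) G.
Proof.
move=> lio uG; have irr : irrational alpha by have [] := lio.
have [P [Q [nQ hd]]] := liouville_sequence alpha_gt1 lio.
pose delta n : R := (P n)%:R - (Q n)%:R * alpha.
have d0 n : delta n != 0 by apply: irrational_delta irr _; exact: leq_ltn_trans (nQ n).
have w0 n : 0 < weight_n n :> R by rewrite invr_gt0 mulr_gt0.
have ra : rapid P Q (fun n => - delta n).
  (* [hd] controls the power n, hence the power j for n >= j; the finitely many smaller n are
     absorbed in the constant. *)
  move=> j; pose D k : R := `|delta k| * (P k + Q k).+1%:R ^+ j / weight_n k.
  have D0 k : 0 <= D k by rewrite divr_ge0 ?(ltW (w0 k))// mulr_ge0// exprn_ge0.
  exists (1 + \sum_(k < j) D k); first by rewrite addr_ge0// sumr_ge0.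
  move=> n; rewrite normrN mulrDl mul1r; have [nj|jn] := ltnP n j.
    rewrite (bigD1 (Ordinal nj))//= mulrDl divfK ?gt_eqF//.
    by rewrite addrCA lerDl addr_ge0 ?(ltW (w0 n))// mulr_ge0 ?(ltW (w0 n))// sumr_ge0.
  apply: (@le_trans _ _ (weight_n n)); last first.
    by rewrite lerDl mulr_ge0 ?(ltW (w0 n))// sumr_ge0.
  apply: le_trans (hd n); rewrite ler_wpM2l//.
  by apply: ler_weXn2l => //; rewrite ler1n.
pose g n (s : R) : R := - cos (delta n * s).
have hg n (s : R) : is_derive s 1 (g n) (0 * cos (delta n * s) - (- delta n) * sin (delta n * s)).
  have h := is_deriveN (is_derive_cos_arg (delta n) s).
  by apply: is_derive_eq; ring.
have [C [c h]] := mode_growth alpha_gt1 ra (@rapid0 _ _) uG hg.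
pose m n : R := ((P n)%:R / alpha + (Q n)%:R) / 4.
have m0 n : 0 <= m n by rewrite divr_ge0// addr_ge0// divr_ge0// ltW.
have [N hN] := nat_above (2 * (`|C| + 1)).
(* Half a period of mode N, where 1 - cos equals 2. This mode alone contributes 2 m N >= N/2, more
   than |C| + 1, and the others contribute nonnegative amounts. *)
pose T := pi / `|delta N|.
have T0 : 0 <= T by rewrite divr_ge0 ?pi_ge0.
have [M hM] := nat_above (`|c| * T).
have := h (M + N).+1 T T0.
have cT : c * T / (M + N).+2%:R <= 1.
  rewrite ler_pdivrMr// mul1r; apply: (@le_trans _ _ (`|c| * T)); first by rewrite ler_wpM2r// ler_norm.
  by apply: (le_trans (ltW hM)); rewrite ler_nat -addSn -addnS; apply: leq_trans (leq_addr _ _) => //; exact: leqnSn.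
have term n : 0 <= m n * (g n T - g n 0).
  by rewrite mulr_ge0// /g mulr0 cos0 opprK addrC subr_ge0 cos_le1.
have lt : (N < (M + N).+1)%N by rewrite ltnS leq_addl.
rewrite (bigD1 (Ordinal lt))//=.
have -> : g N T - g N 0 = 2.
  have -> : g N T = 1; last by rewrite /g mulr0 cos0 opprK.
  rewrite /g /T; have [dN|dN] := ltrP 0 (delta N).
    by rewrite gtr0_norm// mulrC divfK ?gt_eqF// cospi opprK.
  have dN' : `|delta N| = - delta N by rewrite ler0_norm.
  by rewrite dN' invrN mulrN mulrN mulrCA mulfV// mulr1 cosN cospi opprK.
have s0 : 0 <= \sum_(i < (M + N).+1 | i != Ordinal lt) m i * (g i T - g i 0) by rewrite sumr_ge0.
have mN : N%:R / 4 <= m N.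
  rewrite ler_pM2r// -[leLHS]add0r lerD ?divr_ge0 ?(ltW alpha_gt0)// ler_nat ltnW//.
move: s0; rewrite -/(m N); move: (\sum_(i < _ | _) _) => S s0 hS.
move: (ler_norm C) mN hS cT hN.
by move: (m N) (c * T / _) `|C| (N%:R : R) => mu X K z; lra.
Qed.

End Obstructed.
End ObstructedCases.
Import ObstructedCases.

Unset Implicit Arguments.

Theorem theorem1p2 (R : realType) (alpha : R) (alpha_gt1 : 1 < alpha)
    (G : R6 R -> set (R6 R)) (hG : smooth_complement (Y alpha) G) :
  [/\ rational alpha -> obstructed (Y alpha) G,
      irrational alpha -> liouville alpha -> obstructed (Y alpha) G
    & irrational alpha -> diophantine alpha -> unobstructed (Y alpha) G].
Proof.
split.
- exact: obstructed_rational.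
- by move=> _; exact: obstructed_liouville.
- by move=> _; exact: unobstructed_diophantine.
Qed.
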